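(* Let $\mathbb G$ be a locally compact quantum group. There is a unital embedded $C^*$-Eberlein algebra $(A,\Phi_A,U_A,H_A)$ of $\mathbb G$ such that for any other unital embedded $C^*$-Eberlein algebra $(B,\Phi,U,H)$ of $\mathbb G$ we have $B\subseteq A$ (as subalgebras of $M(C_0^u(\mathbb G))$) with the inclusion $B\to A$ being a morphism. It is essentially unique, in that $A$ and $\Phi_A$ are uniquely determined (the choice of $U_A,H_A$ need not be).
   Context: $\mathbb G$ is a locally compact quantum group in the sense of Kustermans–Vaes, with universal $C^*$-algebra $C_0^u(\mathbb G)$ and coproduct $\Delta_u:C_0^u(\mathbb G)\to M(C_0^u(\mathbb G)\otimes C_0^u(\mathbb G))$; $C_0^u(\mathbb G)^*$ is a Banach algebra with product $\langle\mu\star\lambda,a\rangle=(\mu\otimes\lambda)\Delta_u(a)$. A unitary corepresentation of $C_0^u(\mathbb G)$ on $H$ is a unitary $U\in M(C_0^u(\mathbb G)\otimes\mathcal B_0(H))$ with $(\Delta_u\otimes\mathrm{id})(U)=U_{13}U_{23}$. A $C^*$-Eberlein algebra is a quadruple $(A,\Phi,V,H)$ where: (1) $A$ is a $C^*$-algebra, $\Phi:A\to A^{**}\overline\otimes A^{**}$ is a unital $*$-homomorphism (if $A$ is non-unital, this means the normal extension $A^{**}\to A^{**}\overline\otimes A^{**}$ is unital), $H$ is a Hilbert space and $V\in A^{**}\overline\otimes\mathcal B(H)$ is a contraction; (2) $A_V:=\{(\mathrm{id}\otimes\omega)(V):\omega\in\mathcal B(H)_*\}$ is a subset of $A\subseteq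 A^{**}$ and is norm dense in $A$; (3) the bilinear product on $A^*$ given by $\langle\mu\star\nu,a\rangle=\langle\Phi(a),\mu\otimes\nu\rangle$ is associative; (4) the map $A^*\to\mathcal B(H)$, $\mu\mapsto(\mu\otimes\mathrm{id})(V)$ is a homomorphism for $\star$. It is unital if $A$ is unital. The inclusion $B\to A$ (or more generally a non-degenerate $*$-homomorphism $\theta:B\to M(A)$) is a morphism (of $C^*$-Eberlein algebras) if the induced map $\theta^*:A^*\to B^*$ is a homomorphism for the products $\star$. Embedded $C^*$-Eberlein algebras of $\mathbb G$: let $U\in M(C_0^u(\mathbb G)\otimes\mathcal B_0(K))$ be a unitary corepresentation such that the norm closure $B$ of $\{(\mathrm{id}\otimes\omega)(U):\omega\in\mathcal B(K)_*\}$ is a $C^*$-subalgebra of $M(C_0^u(\mathbb G))$. Let $U'\in B^{**}\overline\otimes\mathcal B(K)$ be the element determined by $(\mathrm{id}\otimes\omega)(U')=(\mathrm{id}\otimes\omega)(U)\in B\subseteq B^{**}$ for all $\omega\in\mathcal B(K)_*$. There is a unique $\Phi_B$ such that $(B,\Phi_B,U',K)$ is a $C^*$-Eberlein algebra for which the restriction map $C_0^u(\mathbb G)^*\to B^*$ (functionals being extended strictly to $M(C_0^u(\mathbb G))$) is a homomorphism. The $C^*$-Eberlein algebras $(B,\Phi_B,U',K)$ arising in this way are the embedded ones. *)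

(* Defs.v *)
From HB Require Import structures.
From mathcomp Require Import all_boot all_order all_algebra.
From mathcomp Require Import complex.
From mathcomp Require Import all_classical all_reals all_analysis.

Set Implicit Arguments.
Unset Strict Implicit.
Unset Printing Implicit Defensive.

Import Order.TTheory GRing.Theory Num.Theory numFieldNormedType.Exports.
Local Open Scope classical_set_scope.
Local Open Scope ring_scope.

Notation cplx R := (complex (Real.sort R)).

(* [0 <= z] and [0 < z] in [cplx R] entail that [z] is real, so that a bound
   [0 < e] on a complex number [e] is the usual condition on a positive real. *)

(** * Hilbert spaces and bounded operators *)

Record hilbert (R : realType) := Hilbert {
  hspace :> completeNormedModType (cplx R);
  ip : hspace -> hspace -> cplx R;
  ip_linear : forall a x y z, ip (a *: x + y) z = a * ip x z + ip y z;
  ip_conj : forall x y, ip y x = (ip x y)^*;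
  ip_norm : forall x, `|x| ^+ 2 = ip x x }.
Arguments ip {R h}.

(* Operators are bare functions; [bop] is the algebra of bounded ones. *)
Notation op H := (hspace H -> hspace H).

Section Operators.
Context {R : realType}.
Local Notation C := (cplx R).

Definition lspan (V : lmodType C) (S : set V) : set V :=
  [set v | exists (n : nat) (a : 'I_n -> C) (s : 'I_n -> V),
     (forall i, S (s i)) /\ v = \sum_(i < n) a i *: s i].

Variable H : hilbert R.

Definition opbound (c : C) (T : op H) := forall x, `|T x| <= c * `|x|.

Definition bop : set (op H) := [set T |
  (forall (a : C) x y, T (a *: x + y) = a *: T x + T y) /\
  exists c : C, opbound c T].

(* The bounded operator with a given bounded sesquilinear form. *)
Definition op_of_form (q : H -> H -> C) : op H :=
  xget (fun=> 0) [set T | bop T /\ forall x y, ip (T x) y = q x y].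

Definition adj (T : op H) : op H := op_of_form (fun x y => ip x (T y)).

Definition unitary (T : op H) :=
  [/\ bop T, adj T \o T = id & T \o adj T = id].

Definition pos_op (T : op H) := bop T /\ forall x, 0 <= ip (T x) x.

Definition op_le (S T : op H) := pos_op (T \- S).

Definition norm_closure (S : set (op H)) : set (op H) :=
  [set T | bop T /\ forall e : C, 0 < e -> exists s, S s /\ opbound e (T \- s)].

Definition rank_one (x y : H) : op H := fun z => ip z y *: x.

Definition compact_ops : set (op H) :=
  norm_closure (lspan [set T | exists x y, T = rank_one x y]).

(** * Normal functionals and von Neumann algebras *)

(* The values of a functional outside [bop] are irrelevant throughout. *)
Definition vfun (x y : H) : op H -> C := fun T => ip (T x) y.

Definition square_summable (x : nat -> H) :=
  exists c : C, forall N, \sum_(n < N) `|x n| ^+ 2 <= c.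

Definition normal_fun : set (op H -> C) := [set f |
  exists x y : nat -> H,
  [/\ square_summable x, square_summable y &
      forall T, bop T ->
        series (fun n => ip (T (x n)) (y n) : C^o) @ \oo --> (f T : C^o)]].

Definition sigma_weak_closure (S : set (op H)) : set (op H) :=
  [set T | bop T /\ forall (n : nat) (f : 'I_n -> op H -> C) (e : C),
     (forall i, normal_fun (f i)) -> 0 < e ->
     exists s, S s /\ forall i, `|f i T - f i s| < e].

Definition commutant (S : set (op H)) : set (op H) :=
  [set T | bop T /\ forall s, S s -> s \o T = T \o s].

Definition von_neumann (M : set (op H)) :=
  [/\ M `<=` bop, (forall x, M x -> M (adj x)) &
      commutant (commutant M) = M].

(** * Concrete C*-algebras *)

Record cstar_algebra (A : set (op H)) : Prop := CstarAlgebra {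
  cstar_bop : A `<=` bop;
  cstar0 : A (fun=> 0);
  cstar_linear : forall (a : C) x y, A x -> A y -> A (a *: x + y);
  cstar_mul : forall x y, A x -> A y -> A (x \o y);
  cstar_adj : forall x, A x -> A (adj x);
  cstar_closed : norm_closure A `<=` A }.

Definition unital_algebra (A : set (op H)) :=
  exists e, A e /\ forall a, A a -> e \o a = a /\ a \o e = a.

(* For [A] acting non-degenerately, this is the usual concrete description of
   the multiplier algebra. *)
Definition multipliers (A : set (op H)) : set (op H) :=
  [set x | bop x /\ forall a, A a -> A (x \o a) /\ A (a \o x)].

(* Bounded linear functionals on [A]. *)
Definition dual (A : set (op H)) : set (op H -> C) := [set f |
  (forall (a : C) x y, A x -> A y -> f (a *: x + y) = a * f x + f y) /\
  exists c : C, forall x m, A x -> 0 <= m -> opbound m x -> `|f x| <= c * m].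

End Operators.
Arguments bop {R} H.
Arguments compact_ops {R} H.
Arguments normal_fun {R} H.

(** * Representations and biduals *)

Section Representations.
Context {R : realType} {H K : hilbert R}.
Local Notation C := (cplx R).

Record star_hom (A : set (op H)) (p : op H -> op K) : Prop := StarHom {
  star_hom_bop : forall x, A x -> bop K (p x);
  star_hom_linear : forall (a : C) x y, A x -> A y ->
    p (a *: x + y) = a *: p x + p y;
  star_hom_mul : forall x y, A x -> A y -> p (x \o y) = p x \o p y;
  star_hom_adj : forall x, A x -> p (adj x) = adj (p x) }.

Definition normal_map (M : set (op H)) (p : op H -> op K) :=
  forall f, normal_fun K f ->
  exists2 g, normal_fun H g & forall x, M x -> f (p x) = g x.

Definition nondegenerate (A : set (op H)) (p : op H -> op K) :=
  closure (lspan [set z | exists x y, A x /\ z = p x y]) = setT.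

(* A non-degenerate representation in which every bounded functional is a
   vector functional.  The weak closure of its image is a copy of A** with
   predual A*: by Kaplansky's density theorem every such representation extends
   to an isomorphism of A** onto the bicommutant of the image. *)
Definition universal_rep (A : set (op H)) (p : op H -> op K) :=
  [/\ star_hom A p, nondegenerate A p &
      forall f, dual A f ->
        exists x y, forall a, A a -> f a = vfun x y (p a)].

Definition bidual (A : set (op H)) (p : op H -> op K) : set (op K) :=
  commutant (commutant (p @` A)).

(* The normal extension to A** of a functional on A; the result is meaningful
   on [bidual A p] only. *)
Definition normal_ext (A : set (op H)) (p : op H -> op K) (f : op H -> C)
    : op K -> C :=
  xget (fun=> 0) [set g |
    exists x y, g = vfun x y /\ forall a, A a -> f a = g (p a)].

End Representations.

(** * Tensor products *)

Record hilbert_tensor (R : realType) (H K : hilbert R) := HilbertTensor {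
  tspace :> hilbert R;
  tens : H -> K -> tspace;
  tens_linear_l : forall a x x' y,
    tens (a *: x + x') y = a *: tens x y + tens x' y;
  tens_linear_r : forall a x y y',
    tens x (a *: y + y') = a *: tens x y + tens x y';
  tens_ip : forall x y x' y',
    ip (tens x y) (tens x' y') = ip x x' * ip y y';
  tens_total : closure (lspan [set z | exists x y, z = tens x y]) = setT }.
Arguments tens {R H K}.

(* A choice of Hilbert space tensor product (which is determined up to a unique
   unitary) for each pair of Hilbert spaces. *)
Definition tensor_choice (R : realType) :=
  forall H K : hilbert R, hilbert_tensor H K.

Section Tensor.
Context {R : realType} {T : tensor_choice R}.
Local Notation C := (cplx R).
Local Notation "H ** K" := (tspace (T H K)) (at level 40).

Section TwoLegs.
Context {H K : hilbert R}.

Definition otens (x : op H) (y : op K) : op (H ** K) :=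
  xget (fun=> 0) [set z | bop _ z /\
    forall a b, z (tens (T H K) a b) = tens (T H K) (x a) (y b)].

(* (id (x) f)(X) and (f (x) id)(X) *)
Definition slice_r (f : op K -> C) (X : op (H ** K)) : op H :=
  op_of_form (fun a b => f (op_of_form (fun k l =>
    ip (X (tens (T H K) a k)) (tens (T H K) b l)))).

Definition slice_l (f : op H -> C) (X : op (H ** K)) : op K :=
  op_of_form (fun k l => f (op_of_form (fun a b =>
    ip (X (tens (T H K) a k)) (tens (T H K) b l)))).

(* <X, f (x) g> *)
Definition ftens (f : op H -> C) (g : op K -> C) (X : op (H ** K)) : C :=
  f (slice_r g X).

Definition elementary (A : set (op H)) (B : set (op K)) : set (op (H ** K)) :=
  [set z | exists x y, [/\ A x, B y & z = otens x y]].

Definition min_tensor (A : set (op H)) (B : set (op K)) : set (op (H ** K)) :=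
  norm_closure (lspan (elementary A B)).

Definition vn_tensor (M : set (op H)) (N : set (op K)) : set (op (H ** K)) :=
  commutant (commutant (elementary M N)).

(* U_13 and U_23 on (H (x) H) (x) K *)
Definition leg13 (U : op (H ** K)) : op ((H ** H) ** K) :=
  let t := tens (T H H) in let t' := tens (T (H ** H) K) in
  xget (fun=> 0) [set Z | bop _ Z /\ forall a b k a' b' k',
    ip (Z (t' (t a b) k)) (t' (t a' b') k') =
    ip b b' * ip (U (tens (T H K) a k)) (tens (T H K) a' k')].

Definition leg23 (U : op (H ** K)) : op ((H ** H) ** K) :=
  let t := tens (T H H) in let t' := tens (T (H ** H) K) in
  xget (fun=> 0) [set Z | bop _ Z /\ forall a b k a' b' k',
    ip (Z (t' (t a b) k)) (t' (t a' b') k') =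
    ip a a' * ip (U (tens (T H K) b k)) (tens (T H K) b' k')].

(* (D (x) id)(U), determined by
   (id (x) id (x) w)((D (x) id)(U)) = D((id (x) w)(U)). *)
Definition amplify (D : op H -> op (H ** H)) (U : op (H ** K))
    : op ((H ** H) ** K) :=
  let t' := tens (T (H ** H) K) in
  xget (fun=> 0) [set Z | bop _ Z /\ forall x k y l,
    ip (Z (t' x k)) (t' y l) = ip (D (slice_r (vfun k l) U) x) y].

Definition corepresentation (D : op H -> op (H ** H)) (U : op (H ** K)) :=
  unitary U /\ amplify D U = leg13 U \o leg23 U.

End TwoLegs.

Definition flip (H : hilbert R) : op (H ** H) :=
  xget (fun=> 0) [set z | bop _ z /\
    forall a b, z (tens (T H H) a b) = tens (T H H) b a].
Arguments flip H _ : clear implicits.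

(** * Locally compact quantum groups (von Neumann algebraic setting) *)

Section Weights.
Context {H : hilbert R}.
Implicit Types (M : set (op H)) (phi : op H -> \bar R).

Definition pos_part M : set (op H) := [set x | M x /\ pos_op x].

(* n_phi *)
Definition square_integrable M phi : set (op H) :=
  [set x | M x /\ (phi (adj x \o x) < +oo)%E].

Record nsf_weight M phi : Prop := NsfWeight {
  weight_ge0 : forall x, pos_part M x -> (0 <= phi x)%E;
  weightD : forall x y, pos_part M x -> pos_part M y ->
    phi (x \+ y) = (phi x + phi y)%E;
  weightZ : forall (r : R) x, 0 <= r -> pos_part M x ->
    phi (r%:C%C *: x) = (r%:E * phi x)%E;
  weight_normal : forall (D : set (op H)) x,
    D !=set0 -> D `<=` pos_part M ->
    (forall y z, D y -> D z -> exists w, [/\ D w, op_le y w & op_le z w]) ->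
    pos_part M x -> (forall y, D y -> op_le y x) ->
    (forall z, pos_part M z -> (forall y, D y -> op_le y z) -> op_le x z) ->
    phi x = ereal_sup (phi @` D);
  weight_semifinite :
    M `<=` sigma_weak_closure
      (lspan [set x | pos_part M x /\ (phi x < +oo)%E]);
  weight_faithful : forall x, pos_part M x -> phi x = 0%E -> x = fun=> 0 }.

Definition pos_normal M : set (op H -> C) :=
  [set f | normal_fun H f /\ forall x, pos_part M x -> 0 <= f x].

Definition left_invariant M (D : op H -> op (H ** H)) phi :=
  forall f x, pos_normal M f -> pos_part M x -> (phi x < +oo)%E ->
  phi (slice_l f (D x)) = (phi x * (complex.Re (f id))%:E)%E.

Definition right_invariant M (D : op H -> op (H ** H)) phi :=
  forall f x, pos_normal M f -> pos_part M x -> (phi x < +oo)%E ->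
  phi (slice_r f (D x)) = (phi x * (complex.Re (f id))%:E)%E.

(* [M] acts on the GNS space of [phi], with GNS map [L]. *)
Record gns_map M phi (L : op H -> H) : Prop := GnsMap {
  gns_linear : forall (a : C) x y,
    square_integrable M phi x -> square_integrable M phi y ->
    L (a *: x + y) = a *: L x + L y;
  gns_norm : forall x, square_integrable M phi x ->
    (complex.Re (`|L x| ^+ 2))%:E = phi (adj x \o x);
  gns_dense : closure (L @` square_integrable M phi) = setT;
  gns_mul : forall x y, M x -> square_integrable M phi y ->
    L (x \o y) = x (L y) }.

End Weights.

Record lcqg := LCQG {
  L2 : hilbert R;
  Linfty : set (op L2);
  comult : op L2 -> op (L2 ** L2);
  left_haar : op L2 -> \bar R;
  right_haar : op L2 -> \bar R;
  gns : op L2 -> L2;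
  Linfty_vn : von_neumann Linfty;
  comult_hom : star_hom Linfty comult;
  comult_into : comult @` Linfty `<=` vn_tensor Linfty Linfty;
  comult_normal : normal_map Linfty comult;
  comult_unital : comult id = id;
  (* (D (x) id) D = (id (x) D) D, tested on product functionals *)
  comult_coassoc : forall f g h x,
    normal_fun L2 f -> normal_fun L2 g -> normal_fun L2 h -> Linfty x ->
    ftens f g (comult (slice_r h (comult x))) =
    ftens g h (comult (slice_l f (comult x)));
  left_haar_nsf : nsf_weight Linfty left_haar;
  left_haar_inv : left_invariant Linfty comult left_haar;
  right_haar_nsf : nsf_weight Linfty right_haar;
  right_haar_inv : right_invariant Linfty comult right_haar;
  gnsP : gns_map Linfty left_haar gns }.
Arguments Linfty G _ : clear implicits, rename.
Arguments comult G _ : clear implicits, rename.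
Arguments left_haar G _ : clear implicits, rename.
Arguments gns G _ : clear implicits, rename.

Section Dual.
Variable G : lcqg.

(* The Kustermans-Vaes multiplicative unitary, determined by
   (f (x) id)(W^* ) gns(x) = gns((f (x) id) D(x)); equivalently
   W^* (gns a (x) gns b) = (gns (x) gns)(D(b)(a (x) 1)). *)
Definition mult_unitary : op (L2 G ** L2 G) :=
  xget (fun=> 0) [set W | unitary W /\
    forall f x, normal_fun (L2 G) f ->
      square_integrable (Linfty G) (left_haar G) x ->
      slice_l f (adj W) (gns G x) = gns G (slice_l f (comult G x))].

Local Notation W := mult_unitary.

Definition dual_coeffs : set (op (L2 G)) :=
  [set slice_l f W | f in normal_fun (L2 G)].

Definition dual_C0 : set (op (L2 G)) := norm_closure dual_coeffs.

Definition dual_Linfty : set (op (L2 G)) := sigma_weak_closure dual_coeffs.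

Definition dual_comult (x : op (L2 G)) : op (L2 G ** L2 G) :=
  flip (L2 G) \o W \o otens x id \o adj W \o flip (L2 G).

(* The product of L^1 of the dual; elements of that L^1 are represented by
   normal functionals on all bounded operators, identified when they agree on
   [dual_Linfty]. *)
Definition dual_conv (f g : op (L2 G) -> C) : op (L2 G) -> C :=
  fun x => ftens f g (dual_comult x).

(* The regular representation of L^1 of the dual. *)
Definition dual_lambda (f : op (L2 G) -> C) : op (L2 G) :=
  slice_r f (adj W).

(* [dual_sharp f g]: f belongs to the dense *-algebra L^1_sharp of the dual,
   and g is its adjoint there. *)
Definition dual_sharp (f g : op (L2 G) -> C) :=
  [/\ normal_fun (L2 G) f, normal_fun (L2 G) g &
      dual_lambda g = adj (dual_lambda f)].

Definition dual_L1sharp : set (op (L2 G) -> C) :=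
  [set f | exists g, dual_sharp f g].

(* *-representations of L^1_sharp of the dual *)
Record sharp_rep (K : hilbert R) (p : (op (L2 G) -> C) -> op K) : Prop :=
  SharpRep {
    sharp_rep_bop : forall f, dual_L1sharp f -> bop K (p f);
    sharp_rep_ext : forall f g, dual_L1sharp f -> dual_L1sharp g ->
      (forall x, dual_Linfty x -> f x = g x) -> p f = p g;
    sharp_rep_linear : forall (a : C) f g, dual_L1sharp f -> dual_L1sharp g ->
      p (fun x => a * f x + g x) = a *: p f + p g;
    sharp_rep_mul : forall f g, dual_L1sharp f -> dual_L1sharp g ->
      p (dual_conv f g) = p f \o p g;
    sharp_rep_adj : forall f g, dual_sharp f g -> p g = adj (p f) }.

End Dual.
Arguments dual_C0 G _ : clear implicits.
Arguments dual_L1sharp G _ : clear implicits.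

(* The pair (C_0^u(G), Delta_u): C_0^u(G) is the enveloping C*-algebra of
   L^1_sharp of the dual, through f |-> (id (x) f)(WW^* ), and Delta_u is the
   non-degenerate *-homomorphism with (Delta_u (x) id)(WW) = WW_13 WW_23.
   C_0^u(G) is taken in a universal representation, so that multipliers lie in
   its bidual; [univ_comult] is the strict extension of Delta_u to M(C_0^u(G)).
   This data is unique up to isomorphism. *)
Record universal_lcqg (G : lcqg) := UniversalLCQG {
  univ_space : hilbert R;
  C0u : set (op univ_space);
  univ_comult : op univ_space -> op (univ_space ** univ_space);
  univ_W : op (univ_space ** L2 G);
  C0u_cstar : cstar_algebra C0u;
  C0u_universal : universal_rep C0u id;
  univ_W_mult : multipliers (min_tensor C0u (dual_C0 G)) univ_W;
  univ_lambda_rep : sharp_rep (fun f => slice_r f (adj univ_W));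
  C0u_generated :
    C0u = norm_closure [set slice_r f (adj univ_W) | f in dual_L1sharp G];
  univ_lambda_universal : forall (K : hilbert R)
      (p : (op (L2 G) -> C) -> op K), sharp_rep p ->
    exists2 q : op univ_space -> op K, star_hom C0u q &
      forall f, dual_L1sharp G f -> q (slice_r f (adj univ_W)) = p f;
  univ_comult_hom : star_hom (multipliers C0u) univ_comult;
  univ_comult_into :
    univ_comult @` multipliers C0u `<=` multipliers (min_tensor C0u C0u);
  univ_comult_nondeg :
    norm_closure (lspan [set z | exists a x,
      [/\ C0u a, min_tensor C0u C0u x & z = univ_comult a \o x]]) =
    min_tensor C0u C0u;
  univ_W_corep : corepresentation univ_comult univ_W }.
Arguments C0u {G} Cu _ : rename.
Arguments univ_comult {G} Cu _ : rename.

(** * C*-Eberlein algebras *)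

Section Eberlein.
(* A C*-algebra [A] on [H0], with the universal representation [p] realising
   A** on [E]. *)
Context {H0 E : hilbert R}.
Variables (A : set (op H0)) (p : op H0 -> op E).
Variable Phi : op H0 -> op (E ** E).

Definition conv (f g : op H0 -> C) : op H0 -> C :=
  fun a => ftens (normal_ext A p f) (normal_ext A p g) (Phi a).

Definition eberlein_comult :=
  [/\ star_hom A Phi,
      Phi @` A `<=` vn_tensor (bidual A p) (bidual A p) &
      exists Phi'' : op E -> op (E ** E),
        [/\ star_hom (bidual A p) Phi'',
            Phi'' @` bidual A p `<=` vn_tensor (bidual A p) (bidual A p),
            normal_map (bidual A p) Phi'', Phi'' id = id &
            forall a, A a -> Phi'' (p a) = Phi a]].

Record eberlein (K : hilbert R) (V : op (E ** K)) : Prop := Eberlein {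
  eberlein_cstar : cstar_algebra A;
  eberlein_bidual : universal_rep A p;
  eberlein_Phi : eberlein_comult;
  eberlein_V : vn_tensor (bidual A p) (bop K) V /\ opbound 1 V;
  eberlein_coeff : forall w, normal_fun K w ->
    exists2 a, A a & slice_r w V = p a;
  eberlein_dense : p @` A `<=` norm_closure [set slice_r w V | w in normal_fun K];
  eberlein_assoc : forall f g h, dual A f -> dual A g -> dual A h ->
    forall a, A a -> conv (conv f g) h a = conv f (conv g h) a;
  eberlein_hom : forall f g, dual A f -> dual A g ->
    slice_l (normal_ext A p (conv f g)) V =
    slice_l (normal_ext A p f) V \o slice_l (normal_ext A p g) V }.

End Eberlein.

Section Embedded.
Context {G : lcqg}.
Variable Cu : universal_lcqg G.
Local Notation Hu := (univ_space Cu).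

(* The strict extension to M(C_0^u(G)) of a functional on C_0^u(G), and the
   product of two such functionals. *)
Definition strict_ext : (op Hu -> C) -> op Hu -> C := normal_ext (C0u Cu) id.

Definition univ_conv : (op Hu -> C) -> (op Hu -> C) -> op Hu -> C :=
  conv (C0u Cu) id (univ_comult Cu).

(* [em_U'] is U viewed over B**; (B, Phi_B, U', K) is
   ([em_alg], [em_Phi], [em_U'], [em_K]). *)
Record embedded := Embedded {
  em_K : hilbert R;
  em_U : op (Hu ** em_K);
  em_alg : set (op Hu);
  em_bispace : hilbert R;
  em_rep : op Hu -> op em_bispace;
  em_Phi : op Hu -> op (em_bispace ** em_bispace);
  em_U' : op (em_bispace ** em_K);
  em_U_mult : multipliers (min_tensor (C0u Cu) (compact_ops em_K)) em_U;
  em_U_corep : corepresentation (univ_comult Cu) em_U;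
  em_algE : em_alg = norm_closure [set slice_r w em_U | w in normal_fun em_K];
  em_U'E : forall w, normal_fun em_K w ->
    slice_r w em_U' = em_rep (slice_r w em_U);
  em_eberlein : eberlein em_alg em_rep em_Phi em_U';
  em_restriction : forall f g, dual (C0u Cu) f -> dual (C0u Cu) g ->
    forall b, em_alg b ->
      strict_ext (univ_conv f g) b =
      conv em_alg em_rep em_Phi (strict_ext f) (strict_ext g) b }.
Arguments em_alg B _ : clear implicits, rename.
Arguments em_rep B _ : clear implicits, rename.
Arguments em_Phi B _ : clear implicits, rename.

Definition em_dual (B : embedded) : set (op Hu -> C) := dual (em_alg B).

(* The product of B*. *)
Definition em_conv (B : embedded) : (op Hu -> C) -> (op Hu -> C) -> op Hu -> C :=
  conv (em_alg B) (em_rep B) (em_Phi B).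

Definition unital (B : embedded) := unital_algebra (em_alg B).

(* For B included in A, the map induced by the inclusion is the restriction
   A* -> B*. *)
Definition inclusion_morphism (B A : embedded) :=
  forall f g, em_dual A f -> em_dual A g ->
  forall b, em_alg B b -> em_conv A f g b = em_conv B f g b.

Definition greatest_unital (A : embedded) :=
  unital A /\
  forall B : embedded, unital B ->
    em_alg B `<=` em_alg A /\ inclusion_morphism B A.

(* Equality of the coproducts of two embedded algebras with the same underlying
   algebra: as elements of A** (x) A** (von Neumann tensor product) are
   separated by A* (x) A*, they are compared through the pairings
   <Phi(a), f (x) g>, which do not depend on the representations realising
   A**. *)
Definition same_coproduct (A A' : embedded) :=
  forall a f g, em_alg A a -> em_dual A f -> em_dual A g ->
  em_conv A f g a = em_conv A' f g a.

End Embedded.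

End Tensor.
Arguments lcqg {R} T.

(* Main.v *)
Require Import Defs.
From HB Require Import structures.
From mathcomp Require Import all_boot all_order all_algebra.
From mathcomp Require Import complex.
From mathcomp Require Import all_classical all_reals all_analysis.
From mathcomp Require Import ring lra.

(* Let [gen_alg] be the smallest norm-closed algebra of operators that contains the
   identity and all unital embedded algebras; it is a C*-algebra of multipliers
   of C_0^u(G).  Coefficients of corepresentations with coefficients in [gen_alg] are
   closed under products (tensor products of corepresentations), and only a set
   of spaces of coefficients occurs, so a direct sum over that set of one
   corepresentation for each space is a corepresentation [U] whose coefficients
   are dense in [gen_alg].

   The coproduct of [gen_alg] is [(p (x) p) Delta_u], where [p] is the direct sum of
   the GNS representations of all positive functionals on [bop Hu].  As [p] need
   not be normal, [p (x) p] is built from amplifications and is not obviously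
   multiplicative; but on coefficients it is given by
     Phi(U_kl) = (id (x) w_kl)(P_13 P_23),   P = (p (x) id)(U),
   and this formula, applied to the tensor square of [U], yields
   multiplicativity.  Every vector functional of [Phi] is one of [p], and a
   bicommutant argument extends [Phi] normally to the bidual.

   Condition (4) gives the value of [f * g] at the coefficient [U_kl] of any
   unital embedded algebra as [<F(f) F(g) k, l>], where [F(f)] is determined by
   the values of [f] on coefficients.  Hence restriction to a smaller algebra is
   multiplicative.  The restriction map from C_0^u(G)^* is multiplicative because
   a single element of C_0^u(G) can approximately fix a vector and, through
   Delta_u, another vector at the same time. *)

Set Implicit Arguments.
Unset Strict Implicit.
Unset Printing Implicit Defensive.

Import Order.TTheory GRing.Theory Num.Theory numFieldNormedType.Exports.
Local Open Scope classical_set_scope.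
Local Open Scope ring_scope.
(* [all_analysis] shadows [normal_fun]. *)
Import Defs.

(** Coefficient spaces are closed under products by tensoring, but the adjoint of a coefficient need
    not be a coefficient of any corepresentation at hand. This is why [gen_alg] is generated without
    adjoints: as a least closed algebra it can be compared with the coefficients of [U], and it is
    self-adjoint because the embedded algebras that generate it are. The identity is adjoined since
    contractivity of star-homomorphisms is proved with square roots of [e - x], and since it makes
    [p] non-degenerate on the algebra at once.

    The representation [p] lives on all of [bop Hu], not just on the algebra. By Hahn-Banach a
    bounded functional on any subspace is dominated by a positive functional on [bop Hu], so [p] is
    chosen before the algebra, and it has amplifications to every [K]. Its complete boundedness is a
    positivity statement about kernels, and positive kernels are also the source of every new
    Hilbert space: GNS spaces, direct sums, finite-dimensional spaces. *)

(** * Real parts, conjugation and real-valued norms *)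

Section ComplexNorm.
Variable R : realType.
Local Notation C := (cplx R).
Local Notation Re := (@complex.Re R).
Implicit Types (z w : C) (r : R).

Lemma ReD z w : Re (z + w) = Re z + Re w.
Proof. by case: z w => [a b] [c d]. Qed.

Lemma ReN z : Re (- z) = - Re z.
Proof. by case: z => [a b]. Qed.

Lemma ReB z w : Re (z - w) = Re z - Re w.
Proof. by rewrite ReD ReN. Qed.

Lemma ReZ r z : Re (r%:C%C * z) = r * Re z.
Proof. by case: z => [a b] /=; rewrite mul0r subr0. Qed.

Lemma Re_conj z : Re z^* = Re z.
Proof. by rewrite -[z^*]/(z^*)%C; case: z. Qed.

Lemma rcD r s : (r + s)%:C%C = r%:C%C + s%:C%C :> C.
Proof. exact: rmorphD. Qed.

Lemma rcB r s : (r - s)%:C%C = r%:C%C - s%:C%C :> C.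
Proof. exact: rmorphB. Qed.

Lemma rcM r s : (r * s)%:C%C = r%:C%C * s%:C%C :> C.
Proof. exact: rmorphM. Qed.

Lemma rcX r n : (r ^+ n)%:C%C = r%:C%C ^+ n :> C.
Proof. exact: rmorphXn. Qed.

Lemma cjD z w : (z + w)^* = z^* + w^*.
Proof. exact: rmorphD. Qed.

Lemma cjE z : z^* = (z^*)%C.
Proof. by []. Qed.

Lemma cj1 : (1 : C)^* = 1.
Proof. exact: rmorph1. Qed.

Lemma cjN z : (- z)^* = - z^*.
Proof. exact: rmorphN. Qed.

Lemma cjM z w : (z * w)^* = z^* * w^*.
Proof. exact: rmorphM. Qed.

Lemma cj_real r : (r%:C%C : C)^* = r%:C%C.
Proof. exact: conjc_real. Qed.

Lemma cj_sum (I : Type) (s : seq I) (P : pred I) (F : I -> C) :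
  (\sum_(i <- s | P i) F i)^* = \sum_(i <- s | P i) (F i)^*.
Proof. exact: rmorph_sum. Qed.

Lemma Re_le z w : z <= w -> Re z <= Re w.
Proof. by rewrite lecE => /andP[]. Qed.

Lemma ge0_Re z : 0 <= z -> z = (Re z)%:C%C.
Proof. by case: z => [a b]; rewrite lecE /= => /andP[/eqP -> _]. Qed.

Lemma Re_ge0 z : 0 <= z -> 0 <= Re z.
Proof. by move/Re_le. Qed.

Lemma Re_gt0 z : 0 < z -> 0 < Re z.
Proof. by rewrite ltcE => /andP[]. Qed.

(** Norms in the definitions take complex values. Estimates are made with this real version, for
    which infima and ordered-field arithmetic are available. *)
Definition nr (V : normedZmodType C) (x : V) : R := Re `|x|.

Section Norm.
Variable V : normedZmodType C.
Implicit Types x y : V.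

Lemma nrE x : `|x| = (nr x)%:C%C.
Proof. exact: ge0_Re. Qed.

Lemma nr_ge0 x : 0 <= nr x.
Proof. exact: Re_ge0. Qed.

Lemma nrD x y : nr (x + y) <= nr x + nr y.
Proof. by rewrite -lecR rcD -!nrE; exact: ler_normD. Qed.

Lemma nrN x : nr (- x) = nr x.
Proof. by rewrite /nr normrN. Qed.

Lemma nrB x y : nr (x - y) = nr (y - x).
Proof. by rewrite /nr distrC. Qed.

Lemma nr0 : nr (0 : V) = 0.
Proof. by rewrite /nr normr0. Qed.

Lemma nr0_eq0 x : nr x = 0 -> x = 0.
Proof. by move=> h; apply/normr0_eq0; rewrite nrE h. Qed.

Lemma nr_le x r : (nr x <= r) = (`|x| <= r%:C%C).
Proof. by rewrite nrE lecR. Qed.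

Lemma nr_small x : (forall e : R, 0 < e -> nr x <= e) -> x = 0.
Proof.
move=> h; apply: nr0_eq0; apply/eqP; rewrite eq_le nr_ge0 andbT.
by apply/ler_addgt0Pr => e e0; rewrite add0r; exact: h.
Qed.

End Norm.

Lemma nrM z w : nr (z * w) = nr z * nr w.
Proof. by apply: complexI; rewrite rcM -!nrE normrM. Qed.

Lemma nrZ (V : normedModType C) z (x : V) : nr (z *: x) = nr z * nr x.
Proof. by apply: complexI; rewrite rcM -!nrE normrZ. Qed.

Lemma nr_conj z : nr z^* = nr z.
Proof. by rewrite /nr norm_conjC. Qed.

Lemma nr_real r : 0 <= r -> nr (r%:C%C) = r.
Proof. by move=> r0; rewrite /nr ger0_norm // ler0c. Qed.

Lemma Re_le_nr z : Re z <= nr z.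
Proof. by rewrite -lecR -nrE; apply: le_trans (normc_ge_Re z); rewrite lecR ler_norm. Qed.

Lemma nr_sqr z : nr z ^+ 2 = Re (z * z^*).
Proof. by apply: complexI; rewrite rcX -nrE normCK -ge0_Re // mul_conjC_ge0. Qed.

Lemma nr_phase z : exists u : C, nr u = 1 /\ u * z = (nr z)%:C%C.
Proof.
have [->|z0] := eqVneq z 0.
  by exists 1; rewrite nr0 mulr0 /nr normr1.
have n0 : `|z| != 0 by rewrite normr_eq0.
exists (z^* / `|z|); split.
  by apply: complexI; rewrite -nrE normrM norm_conjC normfV normr_id divff.
by rewrite mulrAC [_ * z]mulrC -normCK expr2 mulfK // nrE.
Qed.

(* Optimising the scalar in [2 Re (t z) <= |t|^2 a^2 + b^2]. *)
Lemma nr_le_polar z (a b : R) : 0 <= a -> 0 <= b ->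
  (forall t : C, 2 * Re (t * z) <= nr t ^+ 2 * a ^+ 2 + b ^+ 2) ->
  nr z <= a * b.
Proof.
move=> a0 b0 h; have [u [u1 uz]] := nr_phase z.
have k s : 0 <= s -> 2 * s * nr z <= s ^+ 2 * a ^+ 2 + b ^+ 2.
  move=> s0; have := h (s%:C%C * u).
  by rewrite -mulrA uz -rcM /= nrM nr_real // u1 mulr1 mulrA.
have [b1|b1] := eqVneq b 0.
  subst b; rewrite mulr0; rewrite leNgt; apply/negP => z0.
  have a1 : 0 < a ^+ 2 + 1 by have := sqr_ge0 a; lra.
  (* With [q = nr z ^+ 2 / (a ^+ 2 + 1) > 0] this scalar yields [2 * q <= q * (a ^+ 2 / (a ^+ 2 +
     1)) <= q], a contradiction. *)
  have := k (nr z / (a ^+ 2 + 1)) (divr_ge0 (ltW z0) (ltW a1)).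
  have -> : 2 * (nr z / (a ^+ 2 + 1)) * nr z = 2 * (nr z ^+ 2 / (a ^+ 2 + 1)).
    by rewrite expr2 -!mulrA; congr (_ * (_ * _)); rewrite mulrC.
  have -> : (nr z / (a ^+ 2 + 1)) ^+ 2 * a ^+ 2 + 0 ^+ 2 =
     (nr z ^+ 2 / (a ^+ 2 + 1)) * (a ^+ 2 / (a ^+ 2 + 1)).
    by field; rewrite gt_eqF.
  have q0 : 0 < nr z ^+ 2 / (a ^+ 2 + 1) by rewrite divr_gt0 // exprn_gt0.
  have q1 : a ^+ 2 / (a ^+ 2 + 1) <= 1 by rewrite ler_pdivrMr // mul1r lerDl.
  nra.
have bp : 0 < b by rewrite lt_neqAle eq_sym b1 b0.
have [a1|a1] := eqVneq a 0.
  subst a; rewrite mul0r leNgt; apply/negP => z0.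
  (* At [a = 0] the right side does not depend on the scalar, which is chosen to make the left side
     [2 * b ^+ 2]. *)
  have := k (b ^+ 2 / nr z) (divr_ge0 (sqr_ge0 _) (ltW z0)).
  rewrite expr0n mulr0 add0r -mulrA divfK ?gt_eqF //.
  have : 0 < b ^+ 2 by rewrite exprn_gt0.
  lra.
have ap : 0 < a by rewrite lt_neqAle eq_sym a1 a0.
(* In the generic case this is the optimal scalar: both terms on the right become [b ^+ 2]. *)
have := k (b / a) (divr_ge0 b0 a0).
have -> : 2 * (b / a) * nr z = 2 * b * (nr z / a) by field.
have -> : (b / a) ^+ 2 * a ^+ 2 + b ^+ 2 = 2 * b * b by field.
by rewrite ler_pM2l ?mulr_gt0 // ler_pdivrMr // mulrC.
Qed.

End ComplexNorm.

(** * Inner products, completeness and the Riesz representation theorem *)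

Section Hilbert.
Variable R : realType.
Local Notation C := (cplx R).
Local Notation Re := (@complex.Re R).

Section Basics.
Variable H : hilbert R.
Implicit Types (x y z : H) (a b : C).

Lemma ipDl x y z : ip (x + y) z = ip x z + ip y z.
Proof. by rewrite -{1}[x]scale1r ip_linear mul1r. Qed.

Lemma ip0l z : ip (0 : H) z = 0.
Proof. by apply: (addrI (ip (0 : H) z)); rewrite -ipDl !addr0. Qed.

Lemma ipZl a x z : ip (a *: x) z = a * ip x z.
Proof. by rewrite -[a *: x]addr0 ip_linear ip0l addr0. Qed.

Lemma ipNl x z : ip (- x) z = - ip x z.
Proof. by rewrite -scaleN1r ipZl mulN1r. Qed.

Lemma ipBl x y z : ip (x - y) z = ip x z - ip y z.
Proof. by rewrite ipDl ipNl. Qed.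

Lemma ipC x y : ip x y = (ip y x)^*.
Proof. exact: ip_conj. Qed.

Lemma ipDr x y z : ip x (y + z) = ip x y + ip x z.
Proof. by rewrite ipC ipDl cjD -!ipC. Qed.

Lemma ip0r x : ip x (0 : H) = 0.
Proof. by rewrite ipC ip0l rmorph0. Qed.

Lemma ipZr a x y : ip x (a *: y) = a^* * ip x y.
Proof. by rewrite ipC ipZl cjM -ipC. Qed.

Lemma ipNr x y : ip x (- y) = - ip x y.
Proof. by rewrite ipC ipNl cjN -ipC. Qed.

Lemma ipBr x y z : ip x (y - z) = ip x y - ip x z.
Proof. by rewrite ipDr ipNr. Qed.

Lemma ip_suml (I : Type) (s : seq I) (P : pred I) (F : I -> H) y :
  ip (\sum_(i <- s | P i) F i) y = \sum_(i <- s | P i) ip (F i) y.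
Proof. by apply: (big_morph (ip^~ y)) => [u v|]; rewrite ?ipDl ?ip0l. Qed.

Lemma ip_sumr (I : Type) (s : seq I) (P : pred I) (F : I -> H) x :
  ip x (\sum_(i <- s | P i) F i) = \sum_(i <- s | P i) ip x (F i).
Proof. by apply: (big_morph (ip x)) => [u v|]; rewrite ?ipDr ?ip0r. Qed.

Lemma ip_nr x : ip x x = (nr x ^+ 2)%:C%C.
Proof. by rewrite -ip_norm rcX -nrE. Qed.

Lemma nr_ip x : nr x ^+ 2 = Re (ip x x).
Proof. by rewrite ip_nr. Qed.

Lemma ip_ge0 x : 0 <= ip x x.
Proof. by rewrite ip_nr ler0c sqr_ge0. Qed.

Lemma ip_eq0 x : ip x x = 0 -> x = 0.
Proof.
rewrite ip_nr => /complexI /eqP; rewrite sqrf_eq0 => /eqP; exact: nr0_eq0.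
Qed.

Lemma ip_extr x y : (forall z, ip x z = ip y z) -> x = y.
Proof.
by move=> h; apply/eqP; rewrite -subr_eq0; apply/eqP/ip_eq0; rewrite ipBl h subrr.
Qed.

Lemma nr_sqrD x y : nr (x + y) ^+ 2 = nr x ^+ 2 + nr y ^+ 2 + 2 * Re (ip x y).
Proof.
rewrite !nr_ip ipDl !ipDr !ReD (ipC y x) Re_conj; ring.
Qed.

Lemma nr_sqrB x y : nr (x - y) ^+ 2 = nr x ^+ 2 + nr y ^+ 2 - 2 * Re (ip x y).
Proof. by rewrite nr_sqrD nrN ipNr ReN mulrN. Qed.

Lemma cauchy_schwarz x y : nr (ip x y) <= nr x * nr y.
Proof.
apply: nr_le_polar => // [||t]; rewrite ?nr_ge0 //.
have := sqr_ge0 (nr (t *: x - y)).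
by rewrite nr_sqrB nrZ ipZl exprMn subr_ge0.
Qed.

Lemma parallelogram x y :
  nr (x + y) ^+ 2 + nr (x - y) ^+ 2 = 2 * nr x ^+ 2 + 2 * nr y ^+ 2.
Proof. rewrite nr_sqrB nr_sqrD; ring. Qed.

Lemma nr_le_ip x (c : R) : 0 <= c -> (forall y, nr (ip x y) <= c * nr y) -> nr x <= c.
Proof.
move=> c0 /(_ x); rewrite ip_nr nr_real ?sqr_ge0 // expr2.
have [->|xn] := eqVneq (nr x) 0; first by [].
by rewrite ler_pM2r // lt_neqAle eq_sym xn nr_ge0.
Qed.

Lemma hilbert_complete (u : nat -> H) :
  (forall e : R, 0 < e -> exists N, forall m n, (N <= m)%N -> (N <= n)%N ->
     nr (u m - u n) <= e) ->
  exists z, forall e : R, 0 < e -> exists N, forall n, (N <= n)%N -> nr (u n - z) <= e.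
Proof.
move=> hu.
have : cvg (u @ \oo).
  apply: cauchy_cvg; apply/cauchy_ballP => e e0.
  have e1 : 0 < Re e / 2 by rewrite divr_gt0 // Re_gt0.
  have [N hN] := hu _ e1.
  exists (u @` [set n | (N <= n)%N], u @` [set n | (N <= n)%N]).
    by split; exists N => // n hn; exists n.
  case=> _ _ [/= [m hm <-] [n hn <-]].
  rewrite -ball_normE /= nrE (ge0_Re (ltW e0)) ltcR.
  by apply: le_lt_trans (hN _ _ hm hn) _; have := Re_gt0 e0; lra.
move=> /cvg_ex[z /cvgrPdist_le hz]; exists z => e e0.
have e1 : 0 < e%:C%C :> C by rewrite ltcR.
have [N _ hN] := hz _ e1; exists N => n hn.
by have := hN _ hn; rewrite /= nrE lecR nrB.
Qed.

Lemma closureE (A : set H) z :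
  closure A z <-> forall e : R, 0 < e -> exists2 y, A y & nr (z - y) <= e.
Proof.
split=> [cA e e0|h B].
  have e1 : 0 < e%:C%C :> C by rewrite ltcR.
  have [y [Ay]] := cA _ (nbhsx_ballx z _ e1).
  rewrite -ball_normE /= nrE ltcR => /ltW zy; by exists y.
case/nbhs_ballP => e /= e0 hB.
have e1 : 0 < Re e / 2 by rewrite divr_gt0 // Re_gt0.
have [y Ay zy] := h _ e1; exists y; split=> //; apply: hB.
rewrite -ball_normE /= nrE (ge0_Re (ltW e0)) ltcR.
by apply: le_lt_trans zy _; have := Re_gt0 e0; lra.
Qed.

End Basics.

Lemma invS_small (e : R) : 0 < e -> exists N, forall n, (N <= n)%N -> (n.+1%:R)^-1 <= e.
Proof.
move=> e0; have [N hN] : exists N, e^-1 < N%:R.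
  by exists (Num.bound e^-1); apply: archi_boundP; rewrite invr_ge0 ltW.
exists N => n Nn; rewrite -[e]invrK lef_pV2 ?posrE ?invr_gt0 ?ltr0n //.
by apply: (le_trans (ltW hN)); rewrite ler_nat (leq_trans Nn).
Qed.

(* The minimiser of [|L a|^2 - 2 Re (f a)] over [S]. *)
Lemma riesz_on (V : lmodType C) (H : hilbert R) (S : set V) (L : V -> H)
    (f : V -> C) (c : R) :
  S 0 -> (forall a x y, S x -> S y -> S (a *: x + y)) ->
  (forall a x y, S x -> S y -> L (a *: x + y) = a *: L x + L y) ->
  (forall a x y, S x -> S y -> f (a *: x + y) = a * f x + f y) ->
  (forall x, S x -> nr (f x) <= c * nr (L x)) ->
  exists2 z, nr z <= Num.max c 0 /\
    (forall e : R, 0 < e -> exists2 x, S x & nr (z - L x) <= e) &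
    forall x, S x -> f x = ip (L x) z.
Proof.
move=> S0 Slin Llin flin fle.
pose J x := nr (L x) ^+ 2 - 2 * Re (f x).
have f0 : f 0 = 0 by have := fle _ S0; have := flin 1 0 0 S0 S0;
  rewrite scaler0 addr0 mul1r -[X in X = _]addr0 => /addrI.
have L0 : L 0 = 0.
  by have := Llin 1 0 0 S0 S0; rewrite scaler0 addr0 scale1r -[X in X = _]addr0 => /addrI.
(* Completing the square in [nr (L x)] bounds the functional below. Its infimum need not be attained
   in [S]: the minimiser is only a limit [z] of vectors [L (a n)]. *)
have Jge x : S x -> - c ^+ 2 <= J x.
  move=> Sx; have := le_trans (Re_le_nr (f x)) (fle _ Sx) => h.
  have := sqr_ge0 (nr (L x) - c); rewrite /J; nra.
have hI : has_inf [set J x | x in S].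
  split; first by exists (J 0), 0.
  by exists (- c ^+ 2) => _ [x Sx <-]; apply: Jge.
pose m := inf [set J x | x in S].
have mle x : S x -> m <= J x by move=> Sx; apply: ge_inf; [case: hI|exists x].
have ex n : exists x, S x /\ J x <= m + (n.+1%:R)^-1.
  have e0 : 0 < (n.+1%:R)^-1 :> R by rewrite invr_gt0.
  by have [_ [x Sx <-] hx] := inf_adherent e0 hI; exists x; split=> //; apply: ltW.
have {ex}[a ha] := choice ex.
have Sa n : S (a n) by case: (ha n).
have Ja n : J (a n) <= m + (n.+1%:R)^-1 by case: (ha n).
have Szl t x : S x -> S (t *: x) by move=> Sx; rewrite -[t *: x]addr0; apply: Slin.
have LZ t x : S x -> L (t *: x) = t *: L x.
  by move=> Sx; rewrite -[t *: x]addr0 Llin // L0 addr0.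
have fZ t x : S x -> f (t *: x) = t * f x.
  by move=> Sx; rewrite -[t *: x]addr0 flin // f0 addr0.
have SD x y : S x -> S y -> S (x + y) by move=> ? ?; rewrite -[x]scale1r; apply: Slin.
have LD x y : S x -> S y -> L (x + y) = L x + L y.
  by move=> ? ?; rewrite -{1}[x]scale1r Llin // scale1r.
have fD x y : S x -> S y -> f (x + y) = f x + f y.
  by move=> ? ?; rewrite -{1}[x]scale1r flin // mul1r.
(* The midpoint of [x] and [y] is admissible, so the parallelogram law makes near-minimisers close
   to each other and minimising sequences Cauchy. *)
have near x y : S x -> S y -> nr (L x - L y) ^+ 2 <= 2 * (J x - m) + 2 * (J y - m).
  move=> Sx Sy; have := mle _ (Szl (2^-1)%:C%C _ (SD _ _ Sx Sy)).
  rewrite /J LZ ?fZ ?LD ?fD //; try exact: SD.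
  rewrite nrZ nr_real ?invr_ge0 // ReZ ReD exprMn.
  have := parallelogram (L x) (L y); nra.
have [|z hz] := @hilbert_complete H (fun n => L (a n)).
  move=> e e0; have e1 : 0 < e ^+ 2 / 4 by rewrite divr_gt0 // exprn_gt0.
  have [N hN] := invS_small e1; exists N => i j hi hj.
  have := near _ _ (Sa i) (Sa j).
  have := Ja i; have := Ja j; have := hN _ hi; have := hN _ hj => h1 h2 h3 h4 h5.
  rewrite -(@ler_pXn2r _ 2) ?nnegrE ?nr_ge0 ?(ltW e0) //.
  move: h1 h2 h3 h4 h5; move: (j.+1%:R^-1) (i.+1%:R^-1) => ? ? *; lra.
have zapp (e : R) : 0 < e -> exists2 x, S x & nr (z - L x) <= e /\ J x <= m + e.
  move=> e0; have [N1 h1] := hz _ e0; have [N2 h2] := invS_small e0.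
  exists (a (maxn N1 N2)) => //; split.
    by rewrite nrB h1 ?leq_maxl.
  by apply: le_trans (Ja _) _; rewrite lerD2l h2 ?leq_maxr.
have key y : S y -> f y = ip (L y) z.
  move=> Sy; apply/eqP; rewrite -subr_eq0; apply/eqP.
  set d := f y - _.
  suff hd : nr d ^+ 2 <= 0.
    by apply: nr0_eq0; apply/eqP; rewrite -sqrf_eq0 eq_le hd sqr_ge0.
  (* First variation in the direction [t *: y], where [t] is [s] times the conjugate of [d], so that
     the linear part is [2 s |d|^2]. It is taken at an approximate minimiser [x], whence the error
     term in [e]. *)
  have step (s e : R) : 0 < s -> 0 < e ->
      2 * s * nr d ^+ 2 <= s ^+ 2 * nr d ^+ 2 * nr (L y) ^+ 2 + e * (1 + 2 * s * nr d * nr (L y)).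
    move=> s0 e0; have [x Sx [xz xJ]] := zapp _ e0.
    pose t := s%:C%C * d^*.
    have := mle _ (SD _ _ Sx (Szl t _ Sy)).
    rewrite /J fD ?fZ ?LD ?LZ //; try exact: Szl.
    rewrite nr_sqrD ReD.
    have nt : nr t = s * nr d by rewrite nrM nr_conj nr_real // ltW.
    have -> : ip (L x) (t *: L y) = (t * ip (L y) (L x))^* by rewrite ipZr cjM -ipC.
    rewrite Re_conj nrZ nt.
    have -> : ip (L y) (L x) = f y - d - ip (L y) (z - L x).
      by rewrite /d ipBr !opprB; ring.
    rewrite (mulrBr t (f y - d)) (mulrBr t (f y) d) ReB (ReB (t * f y)).
    have -> : Re (t * d) = s * nr d ^+ 2.
      by rewrite /t -mulrA ReZ nr_sqr [d^* * _]mulrC.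
    have h : - Re (t * ip (L y) (z - L x)) <= s * nr d * (nr (L y) * e).
      rewrite -ReN; apply: le_trans (Re_le_nr _) _; rewrite nrN nrM nt.
      rewrite ler_wpM2l ?mulr_ge0 ?nr_ge0 ?(ltW s0) //.
      by apply: le_trans (cauchy_schwarz _ _) _; rewrite ler_wpM2l ?nr_ge0.
    move: xJ; rewrite /J; rewrite exprMn exprMn; nra.
  have step2 (s : R) : 0 < s -> 2 * s * nr d ^+ 2 <= s ^+ 2 * nr d ^+ 2 * nr (L y) ^+ 2.
    move=> s0; apply/ler_addgt0Pr => e e0.
    have q : 0 < 1 + 2 * s * nr d * nr (L y).
      by have := nr_ge0 d; have := nr_ge0 (L y) => ? ?; rewrite ltr_wpDr // !mulr_ge0 // ltW.
    have := step s (e / (1 + 2 * s * nr d * nr (L y))) s0 (divr_gt0 e0 q).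
    by rewrite divfK ?gt_eqF.
  pose w := nr (L y) ^+ 2 + 1.
  have w0 : 0 < w by rewrite /w; have := sqr_ge0 (nr (L y)); lra.
  (* The value [1 / w] makes the quadratic term at most half of the linear one, which forces
     [d = 0]. *)
  have := step2 w^-1; rewrite invr_gt0 => /(_ w0).
  rewrite -(ler_pM2l w0).
  have -> : w * (2 * w^-1 * nr d ^+ 2) = 2 * nr d ^+ 2 by field; rewrite gt_eqF.
  have -> : w * (w^-1 ^+ 2 * nr d ^+ 2 * nr (L y) ^+ 2) = nr d ^+ 2 * (nr (L y) ^+ 2 / w).
    by field; rewrite gt_eqF.
  have : nr (L y) ^+ 2 / w <= 1 by rewrite ler_pdivrMr // mul1r /w lerDl.
  have := sqr_ge0 (nr d); nra.
exists z => //; split; last first.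
  by move=> e /zapp[x Sx [h _]]; exists x.
set c' := Num.max c 0.
have c0 : 0 <= c' by rewrite /c' le_max lexx orbT.
rewrite -(@ler_pXn2r _ 2) ?nnegrE ?nr_ge0 //.
suff h : nr z ^+ 2 <= c' * nr z.
  have [->|zn] := eqVneq (nr z) 0; first by rewrite expr0n sqr_ge0.
  move: h; rewrite expr2 ler_pM2r; last by rewrite lt_neqAle eq_sym zn nr_ge0.
  by move=> h; rewrite expr2; apply: ler_pM; rewrite ?nr_ge0.
apply/ler_addgt0Pr => e e0.
have q : 0 < c' + nr z + 1 by have := nr_ge0 z; lra.
have [x Sx [h _]] := zapp _ (divr_gt0 e0 q).
have e1 := h; set e' := e / _ in h e1.
have -> : nr z ^+ 2 = Re (ip (L x) z) + Re (ip (z - L x) z).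
  by rewrite nr_ip ipBl ReB addrC subrK.
rewrite -key //.
have h1 := le_trans (Re_le_nr (f x)) (fle _ Sx).
have h2 : nr (L x) <= nr z + e'.
  by have := nrD (L x - z) z; rewrite subrK nrB; lra.
have h3 : Re (ip (z - L x) z) <= e' * nr z.
  apply: le_trans (Re_le_nr _) _; apply: le_trans (cauchy_schwarz _ _) _.
  by rewrite ler_wpM2r ?nr_ge0.
have h4 : c * nr (L x) <= c' * nr (L x) by rewrite ler_wpM2r ?nr_ge0 // /c' le_max lexx.
have h5 : e = e' * (c' + nr z + 1) by rewrite /e' divfK // gt_eqF.
have e'0 : 0 < e' by rewrite /e' divr_gt0.
have := nr_ge0 z; nra.
Qed.

End Hilbert.

(** * Bounded linear maps, adjoints and operators given by forms *)

Section BoundedMaps.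
Variable R : realType.
Local Notation C := (cplx R).
Local Notation Re := (@complex.Re R).

(** Isometries, contractions of a tensor leg and columns go between different spaces, so boundedness
    is needed beyond [bop]. Bounds are carried as a relation; no operator norm is formed. *)
Definition lin (H K : hilbert R) (F : H -> K) :=
  forall (a : C) x y, F (a *: x + y) = a *: F x + F y.
Definition bd (H K : hilbert R) (r : R) (F : H -> K) := forall x, nr (F x) <= r * nr x.
Definition blin (H K : hilbert R) (F : H -> K) := lin F /\ exists2 r, 0 <= r & bd r F.

Section Lin.
Variables (H K : hilbert R) (F : H -> K).
Hypothesis linF : lin F.

Lemma lin0 : F 0 = 0.
Proof. by have := linF 1 0 0; rewrite scaler0 addr0 scale1r -[X in X = _]addr0 => /addrI. Qed.

Lemma linD x y : F (x + y) = F x + F y.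
Proof. by rewrite -{1}[x]scale1r linF scale1r. Qed.

Lemma linZ a x : F (a *: x) = a *: F x.
Proof. by rewrite -[a *: x]addr0 linF lin0 addr0. Qed.

Lemma linN x : F (- x) = - F x.
Proof. by rewrite -scaleN1r linZ scaleN1r. Qed.

Lemma linB x y : F (x - y) = F x - F y.
Proof. by rewrite linD linN. Qed.

Lemma lin_sum (I : Type) (s : seq I) (P : pred I) (G : I -> H) :
  F (\sum_(i <- s | P i) G i) = \sum_(i <- s | P i) F (G i).
Proof. by apply: (big_morph F); [exact: linD | exact: lin0]. Qed.

End Lin.

Lemma blin_comp (H K L : hilbert R) (G : K -> L) (F : H -> K) :
  blin G -> blin F -> blin (G \o F).
Proof.
move=> [lG [s s0 bG]] [lF [r r0 bF]]; split.
  by move=> a x y /=; rewrite lF lG.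
exists (s * r); first exact: mulr_ge0.
move=> x /=; apply: le_trans (bG _) _; rewrite -mulrA; exact: ler_wpM2l.
Qed.

Lemma opbound_bd (H : hilbert R) (c : C) (T : op H) : opbound c T -> bd (Re c) T.
Proof.
move=> h x; have := Re_le (h x); rewrite -/(nr (T x)) => /le_trans; apply.
by rewrite nrE mulrC ReZ mulrC.
Qed.

Lemma bd_opbound (H : hilbert R) (r : R) (T : op H) : bd r T -> opbound r%:C%C T.
Proof. by move=> h x; rewrite !nrE -rcM lecR. Qed.

Lemma bd_le (H K : hilbert R) (r s : R) (F : H -> K) : r <= s -> bd r F -> bd s F.
Proof. by move=> rs h x; apply: le_trans (h x) _; rewrite ler_wpM2r ?nr_ge0. Qed.

Lemma bopE (H : hilbert R) (T : op H) : bop H T <-> blin T.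
Proof.
split=> [[l [c /opbound_bd b]]|[l [r r0 b]]]; split=> //.
  exists (Num.max (Re c) 0); first by rewrite le_max lexx orbT.
  by apply: bd_le b; rewrite le_max lexx.
by exists r%:C%C; exact: bd_opbound.
Qed.

Lemma form_rep (H K : hilbert R) (q : H -> K -> C) (r : R) : 0 <= r ->
  (forall a x y k, q (a *: x + y) k = a * q x k + q y k) ->
  (forall a x k l, q x (a *: k + l) = a^* * q x k + q x l) ->
  (forall x k, nr (q x k) <= r * nr x * nr k) ->
  exists F : H -> K, [/\ lin F, bd r F & forall x k, ip (F x) k = q x k].
Proof.
move=> r0 ql qr qb.
have ex x : exists z : K, nr z <= r * nr x /\ forall k, ip z k = q x k.
  have [//|||||z [nz _] hz] := @riesz_on R K K setT id (fun k => (q x k)^*) (r * nr x).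
  - by [].
  - by [].
  - by move=> a k l _ _; rewrite qr cjD cjM conjCK.
  - by move=> k _; rewrite nr_conj.
  exists z; split; last by move=> k; rewrite ipC -hz // conjCK.
  by apply: le_trans nz _; rewrite ge_max lexx mulr_ge0 ?nr_ge0.
have [F hF] := choice ex; exists F; split.
- move=> a x y; apply: ip_extr => k.
  by rewrite ipDl ipZl !(hF _).2 ql.
- by move=> x; case: (hF x).
- by move=> x k; case: (hF x).
Qed.

Lemma madj_ex (H K : hilbert R) (F : H -> K) r : 0 <= r -> lin F -> bd r F ->
  exists G : K -> H, [/\ lin G, bd r G & forall k x, ip (G k) x = ip k (F x)].
Proof.
move=> r0 lF bF; apply: form_rep => //.
- by move=> a x y k; rewrite ipDl ipZl.
- by move=> a x k l; rewrite lF ipDr ipZr.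
move=> k x; apply: le_trans (cauchy_schwarz _ _) _.
by rewrite -mulrA [r * _]mulrC -mulrA ler_wpM2l ?nr_ge0 // mulrC.
Qed.

Lemma bd_ip (H K : hilbert R) (F : H -> K) r : bd r F ->
  forall x k, nr (ip (F x) k) <= r * nr x * nr k.
Proof.
by move=> h x k; apply: le_trans (cauchy_schwarz _ _) _; rewrite ler_wpM2r ?nr_ge0.
Qed.

Lemma ip_bd (H K : hilbert R) (F : H -> K) r : 0 <= r ->
  (forall x k, nr (ip (F x) k) <= r * nr x * nr k) -> bd r F.
Proof. by move=> r0 h x; apply: nr_le_ip => //; rewrite mulr_ge0 ?nr_ge0. Qed.

Section Op.
Variable H : hilbert R.
Implicit Types S T : op H.

Lemma bop_lin T : bop H T -> lin T. Proof. by case. Qed.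

Lemma op_of_formE (q : H -> H -> C) T : bop H T -> (forall x y, ip (T x) y = q x y) ->
  op_of_form q = T.
Proof.
move=> bT hT; apply: xget_unique => // S [bS hS].
by apply/funext => x; apply: ip_extr => y; rewrite hS hT.
Qed.

Lemma op_of_form_rep (q : H -> H -> C) (r : R) : 0 <= r ->
  (forall a x y k, q (a *: x + y) k = a * q x k + q y k) ->
  (forall a x k l, q x (a *: k + l) = a^* * q x k + q x l) ->
  (forall x k, nr (q x k) <= r * nr x * nr k) ->
  [/\ bop H (op_of_form q), bd r (op_of_form q) & forall x y, ip (op_of_form q x) y = q x y].
Proof.
move=> r0 ql qr qb; have [F [lF bF hF]] := form_rep r0 ql qr qb.
have bopF : bop H F by apply/bopE; split=> //; exists r.
by rewrite (op_of_formE bopF hF).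
Qed.

Lemma bop_id : bop H id.
Proof. by apply/bopE; split=> //; exists 1 => // x; rewrite mul1r. Qed.

Lemma bop0 : bop H (fun=> 0).
Proof.
apply/bopE; split=> [a x y|]; first by rewrite scaler0 addr0.
by exists 0 => // x; rewrite nr0 mul0r.
Qed.

Lemma bop_comp S T : bop H S -> bop H T -> bop H (S \o T).
Proof. by move=> /bopE bS /bopE bT; apply/bopE/blin_comp. Qed.

Lemma bd_comp S T (r s : R) : 0 <= r -> bd r S -> bd s T -> bd (r * s) (S \o T).
Proof. by move=> r0 bS bT x /=; apply: le_trans (bS _) _; rewrite -mulrA ler_wpM2l. Qed.

Lemma bd_lin a S T (r s : R) : bd r S -> bd s T -> bd (nr a * r + s) (a *: S + T).
Proof.
move=> bS bT x; rewrite -[(_ + _) x]/(a *: S x + T x).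
apply: le_trans (nrD _ _) _; rewrite mulrDl nrZ lerD //.
by rewrite -mulrA ler_wpM2l ?nr_ge0.
Qed.

Lemma bop_lcomb a S T : bop H S -> bop H T -> bop H (a *: S + T).
Proof.
move=> /bopE[lS [r r0 bS]] /bopE[lT [s s0 bT]]; apply/bopE; split.
  move=> b x y; rewrite -[LHS]/(a *: S _ + T _) lS lT.
  rewrite -[in RHS]/(b *: (a *: S x + T x) + (a *: S y + T y)).
  by rewrite !scalerDr !scalerA [a * b]mulrC addrACA.
exists (nr a * r + s); last exact: bd_lin.
by rewrite addr_ge0 ?mulr_ge0 ?nr_ge0.
Qed.

Lemma bopZ a T : bop H T -> bop H (a *: T).
Proof. by move=> bT; rewrite -[a *: T]addr0; apply: bop_lcomb => //; exact: bop0. Qed.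

Lemma bopD S T : bop H S -> bop H T -> bop H (S + T).
Proof. by move=> *; rewrite -[S]scale1r; apply: bop_lcomb. Qed.

Lemma bopB S T : bop H S -> bop H T -> bop H (S - T).
Proof. by move=> bS bT; rewrite addrC -scaleN1r; apply: bop_lcomb. Qed.

Lemma adj_rep T : bop H T ->
  [/\ bop H (adj T), forall x y, ip (adj T x) y = ip x (T y) &
      forall r, 0 <= r -> bd r T -> bd r (adj T)].
Proof.
move=> /bopE[lT [r r0 bT]].
have [G [lG bG hG]] := madj_ex r0 lT bT.
have bopG : bop H G by apply/bopE; split=> //; exists r.
rewrite /adj (op_of_formE bopG hG); split=> // s s0 bs.
have [G' [_ bG' hG']] := madj_ex s0 lT bs.
suff -> : G = G' by [].
by apply/funext => x; apply: ip_extr => y; rewrite hG hG'.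
Qed.

Lemma bop_adj T : bop H T -> bop H (adj T). Proof. by case/adj_rep. Qed.

Lemma adjE T : bop H T -> forall x y, ip (adj T x) y = ip x (T y).
Proof. by case/adj_rep. Qed.

Lemma adjEr T : bop H T -> forall x y, ip x (adj T y) = ip (T x) y.
Proof. by move=> bT x y; rewrite ipC adjE // -ipC. Qed.

Lemma bd_adj T r : bop H T -> 0 <= r -> bd r T -> bd r (adj T).
Proof. by move/adj_rep => [_ _]; apply. Qed.

Lemma adj_uniq S T : bop H S -> (forall x y, ip (S x) y = ip x (T y)) -> adj T = S.
Proof. exact: op_of_formE. Qed.

Lemma adjK T : bop H T -> adj (adj T) = T.
Proof. by move=> bT; apply: adj_uniq => // x y; rewrite adjEr. Qed.

Lemma adj_comp S T : bop H S -> bop H T -> adj (S \o T) = adj T \o adj S.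
Proof.
move=> bS bT; apply: adj_uniq; first by apply: bop_comp; apply: bop_adj.
by move=> x y /=; rewrite !adjE.
Qed.

Lemma adj_lcomb a S T : bop H S -> bop H T -> adj (a *: S + T) = a^* *: adj S + adj T.
Proof.
move=> bS bT; apply: adj_uniq; first by apply: bop_lcomb; apply: bop_adj.
move=> x y; rewrite -[(a *: S + T) y]/(a *: S y + T y).
by rewrite -[(_ + _) x]/(a^* *: adj S x + adj T x) ipDl ipZl ipDr ipZr !adjE.
Qed.

Lemma adj_id : adj (id : op H) = id.
Proof. by apply: adj_uniq => //; exact: bop_id. Qed.

Lemma adj0 : adj ((fun=> 0) : op H) = fun=> 0.
Proof. by apply: adj_uniq => [|x y]; [exact: bop0 | rewrite ip0l ip0r]. Qed.

Lemma bop_ext S T : (forall x y, ip (S x) y = ip (T x) y) -> S = T.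
Proof. by move=> h; apply/funext => x; apply: ip_extr. Qed.

End Op.

(** * Total families *)

Section Lc.
Variables (V : lmodType C) (X : Type) (v : X -> V).

(** Combinations are lists whose indices may repeat: concatenation is addition, and the index type
    may be arbitrary. *)
Definition lc (s : seq (C * X)) : V := \sum_(p <- s) p.1 *: v p.2.

Lemma lc_cat s t : lc (s ++ t) = lc s + lc t.
Proof. exact: big_cat. Qed.

Lemma lc_scale a s : lc [seq (a * p.1, p.2) | p <- s] = a *: lc s.
Proof. by rewrite /lc big_map scaler_sumr; apply: eq_bigr => p _; rewrite scalerA. Qed.

Lemma lc1 x : lc [:: (1, x)] = v x.
Proof. by rewrite /lc big_seq1 scale1r. Qed.

End Lc.

(** Totality is phrased by orthogonality, since it mostly serves to prove equalities of vectors and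
    operators; [total_dense] recovers density. *)
Definition total (H : hilbert R) (X : Type) (v : X -> H) :=
  forall z, (forall x, ip (v x) z = 0) -> z = 0.

Lemma total_ext (H : hilbert R) (X : Type) (v : X -> H) : total v ->
  forall z z', (forall x, ip (v x) z = ip (v x) z') -> z = z'.
Proof.
move=> tv z z' h; apply/eqP; rewrite -subr_eq0; apply/eqP/tv => x.
by rewrite ipBr h subrr.
Qed.

Lemma total_extl (H : hilbert R) (X : Type) (v : X -> H) : total v ->
  forall z z', (forall x, ip z (v x) = ip z' (v x)) -> z = z'.
Proof. by move=> tv z z' h; apply: (total_ext tv) => x; rewrite ipC h -ipC. Qed.

(** The adjoints of [F] and [G] agree because their values are determined by the pairings with [v];
    no approximation is made. *)
Lemma lin_total_ext (H K : hilbert R) (X : Type) (v : X -> H) (F G : H -> K) :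
  total v -> blin F -> blin G -> (forall x, F (v x) = G (v x)) -> F = G.
Proof.
move=> tv [lF [r r0 bF]] [lG [s s0 bG]] h; apply/funext => x; apply: ip_extr => k.
have [F' [_ _ hF']] := madj_ex r0 lF bF; have [G' [_ _ hG']] := madj_ex s0 lG bG.
suff E : F' k = G' k by rewrite ipC -hF' E hG' -ipC.
by apply: (total_ext tv) => y; rewrite ipC hF' h -hG' -ipC.
Qed.

Lemma rep_total (H : hilbert R) (X : Type) (v : X -> H) (g : X -> C) (r : R) :
  0 <= r ->
  (forall s, nr (lc (g : X -> C^o) s) <= r * nr (lc v s)) ->
  exists2 z, nr z <= r & forall x, ip (v x) z = g x.
Proof.
move=> r0 h.
(* The graph of the map from [lc v s] to [lc g s]. As [riesz_on] accepts a map [L] that is not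
   injective, here the first projection, the graph takes the place of a proof that this map is well
   defined. *)
pose S : set (H * C^o) := [set p | exists s, p = (lc v s, lc (g : X -> C^o) s)].
have Slin (a : C) (x y : (H * C^o)%type) : S x -> S y -> S (a *: x + y).
  case=> s -> [t ->]; exists ([seq (a * p.1, p.2) | p <- s] ++ t).
  by rewrite !lc_cat !lc_scale.
have [|||||z [nz _] hz] := @riesz_on R (H * C^o)%type H S fst (fun p => p.2 : C) r.
- by exists [::]; rewrite /lc !big_nil.
- exact: Slin.
- by [].
- by [].
- by move=> _ [s ->]; exact: h.
exists z; first by apply: le_trans nz _; rewrite ge_max lexx.
move=> x; have := hz (v x, g x); rewrite /= => <- //.
by exists [:: (1, x)]; rewrite !lc1.
Qed.

Lemma lcE (X : Type) (g : X -> C) s : lc (g : X -> C^o) s = \sum_(p <- s) p.1 * g p.2.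
Proof. by []. Qed.

Lemma ip_lcl (H : hilbert R) (X : Type) (v : X -> H) s z :
  ip (lc v s) z = \sum_(p <- s) p.1 * ip (v p.2) z.
Proof. by rewrite ip_suml; apply: eq_bigr => p _; rewrite ipZl. Qed.

Lemma ip_lcr (H : hilbert R) (X : Type) (v : X -> H) s z :
  ip z (lc v s) = \sum_(p <- s) p.1^* * ip z (v p.2).
Proof. by rewrite ip_sumr; apply: eq_bigr => p _; rewrite ipZr. Qed.

Lemma lin_lc (H K : hilbert R) (F : H -> K) (X : Type) (v : X -> H) s :
  lin F -> F (lc v s) = lc (F \o v) s.
Proof. by move=> lF; rewrite lin_sum //; apply: eq_bigr => p _; rewrite linZ. Qed.

(** The adjoint is found first: [rep_total] solves [ip (v x) z = ip (w x) k] for each [k]. This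
    gives a map on all of [H] without extending by continuity. *)
Lemma ext_total (H K : hilbert R) (X : Type) (v : X -> H) (w : X -> K) (r : R) :
  total v -> 0 <= r -> (forall s, nr (lc w s) <= r * nr (lc v s)) ->
  exists F : H -> K, [/\ lin F, bd r F & forall x, F (v x) = w x].
Proof.
move=> tv r0 h.
have ex k : exists z : H, nr z <= r * nr k /\ forall x, ip (v x) z = ip (w x) k.
  have [||z nz hz] := @rep_total H X v (fun x => ip (w x) k) (r * nr k).
  - by rewrite mulr_ge0 ?nr_ge0.
  - move=> s; rewrite lcE -ip_lcl; apply: le_trans (cauchy_schwarz _ _) _.
    by rewrite mulrAC ler_wpM2r ?nr_ge0.
  by exists z.
have [G hG] := choice ex.
have [|||F [lF bF hF]] := @form_rep H K (fun x k => ip x (G k)) r r0.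
- by move=> a x y k; rewrite ipDl ipZl.
- move=> a x k l; suff -> : G (a *: k + l) = a *: G k + G l by rewrite ipDr ipZr.
  by apply: (total_ext tv) => y; rewrite ipDr ipZr !(hG _).2 ipDr ipZr.
- move=> x k; apply: le_trans (cauchy_schwarz _ _) _.
  by rewrite -mulrA mulrCA ler_wpM2l ?nr_ge0 // (hG k).1.
exists F; split=> // x; apply: ip_extr => k; by rewrite hF (hG k).2.
Qed.

Lemma ext_form (H K : hilbert R) (X Y : Type) (v : X -> H) (w : Y -> K)
    (q : X -> Y -> C) (r : R) :
  total v -> total w -> 0 <= r ->
  (forall s t, nr (\sum_(p <- s) \sum_(p' <- t) p.1 * p'.1^* * q p.2 p'.2) <=
     r * nr (lc v s) * nr (lc w t)) ->
  exists F : H -> K, [/\ lin F, bd r F & forall x y, ip (F (v x)) (w y) = q x y].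
Proof.
move=> tv tw r0 h.
have ex x : exists z : K, forall y, ip z (w y) = q x y.
  have [||z _ hz] := @rep_total K Y w (fun y => (q x y)^*) (r * nr (v x)).
  - by rewrite mulr_ge0 ?nr_ge0.
  - move=> t; have := h [:: (1, x)] t; rewrite lc1 big_seq1 -nr_conj cj_sum lcE.
    by under eq_bigr do rewrite mul1r cjM conjCK.
  by exists z => y; rewrite ipC hz conjCK.
have [z hz] := choice ex.
have [//||F [lF bF hF]] := @ext_total H K X v z r tv; last first.
  by exists F; split=> // x y; rewrite hF.
move=> s.
(* The vector [w'] has the same pairings with the total family [w] as [lc z s] and satisfies the
   required bound, so the bound passes to [lc z s]. *)
have [||w' nw' hw'] := @rep_total K Y w (fun y => ip (w y) (lc z s)) (r * nr (lc v s)).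
- by rewrite mulr_ge0 ?nr_ge0.
- move=> t; have := h s t; rewrite lcE -ip_lcl ipC nr_conj ip_lcl.
  congr (nr _ <= _); apply: eq_bigr => p _; rewrite ip_lcr mulr_sumr.
  by apply: eq_bigr => p' _; rewrite hz mulrA.
by rewrite (total_ext tw (z := lc z s) (z' := w')).
Qed.

Lemma ext_gram (H K : hilbert R) (X : Type) (v : X -> H) (w : X -> K) :
  total v -> (forall x y, ip (w x) (w y) = ip (v x) (v y)) ->
  exists F : H -> K, [/\ lin F, bd 1 F, forall x, F (v x) = w x &
     forall x y, ip (F x) (F y) = ip x y].
Proof.
move=> tv h.
have hs s : nr (lc w s) ^+ 2 = nr (lc v s) ^+ 2.
  rewrite !nr_ip !ip_lcl; congr (Re _); apply: eq_bigr => p _; rewrite !ip_lcr.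
  by congr (_ * _); apply: eq_bigr => p' _; rewrite h.
have [//||F [lF bF hF]] := @ext_total H K X v w 1 tv.
  by move=> s; rewrite mul1r -(@ler_pXn2r _ 2) ?nnegrE ?nr_ge0 ?hs.
exists F; split=> //.
have [G [lG bG hG]] := madj_ex ler01 lF bF.
suff GF : G \o F = id by move=> x y; rewrite -hG -[G (F x)]/((G \o F) x) GF.
apply: (lin_total_ext tv).
- by apply: blin_comp; split=> //; exists 1.
- by split=> //; exists 1 => // x; rewrite mul1r.
- by move=> x /=; apply: (total_extl tv) => y; rewrite hG !hF h.
Qed.

End BoundedMaps.

(** * The Hilbert space of a positive semidefinite kernel *)

Section Complete.
Variable R : realType.
Local Notation C := (cplx R).

Lemma real_complete (u : nat -> R) :
  (forall e : R, 0 < e -> exists N, forall m n, (N <= m)%N -> (N <= n)%N ->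
     `|u m - u n| <= e) ->
  exists z, forall e : R, 0 < e -> exists N, forall n, (N <= n)%N -> `|u n - z| <= e.
Proof.
move=> hu.
have : cvg (u @ \oo).
  apply: (@cauchy_cvg R); apply/cauchy_ballP => e e0.
  have e1 : 0 < e / 2 by rewrite divr_gt0.
  have [N hN] := hu _ e1.
  exists (u @` [set n | (N <= n)%N], u @` [set n | (N <= n)%N]).
    by split; exists N => // n hn; exists n.
  case=> _ _ [/= [m hm <-] [n hn <-]].
  rewrite /ball /=; apply: le_lt_trans (hN _ _ hm hn) _; lra.
move=> /cvg_ex[z /cvgrPdist_le hz]; exists z => e e0.
have [N _ hN] := hz _ e0; exists N => n hn.
by have := hN _ hn; rewrite /= distrC.
Qed.

Lemma Re_nr_le (z : C) : `|complex.Re z| <= nr z.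
Proof. by rewrite -lecR -nrE normc_ge_Re. Qed.

Lemma Im_nr_le (z : C) : `|complex.Im z| <= nr z.
Proof.
have -> : complex.Im z = complex.Re (- 'i%C * z).
  by case: z => a b /=; rewrite oppr0 mul0r sub0r mulN1r opprK.
apply: le_trans (Re_nr_le _) _; rewrite nrM nrN.
suff -> : nr 'i%C = 1 :> R by rewrite mul1r.
by rewrite /nr normc_def /= expr0n add0r expr1n sqrtr1.
Qed.

Lemma nr_ReIm (z : C) : nr z <= `|complex.Re z| + `|complex.Im z|.
Proof.
have -> : nr z = Num.sqrt (complex.Re z ^+ 2 + complex.Im z ^+ 2).
  by rewrite /nr normc_def.
rewrite -[leRHS]ger0_norm ?addr_ge0 // -sqrtr_sqr ler_wsqrtr // sqrrD !real_normK ?num_real //.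
by rewrite addrAC lerDl mulrn_wge0 // mulr_ge0.
Qed.

Lemma complex_complete (u : nat -> C) :
  (forall e : R, 0 < e -> exists N, forall m n, (N <= m)%N -> (N <= n)%N ->
     nr (u m - u n) <= e) ->
  exists z, forall e : R, 0 < e -> exists N, forall n, (N <= n)%N -> nr (u n - z) <= e.
Proof.
move=> hu.
have [|a ha] := @real_complete (fun n => complex.Re (u n)).
  move=> e /hu[N hN]; exists N => m n hm hn; rewrite -ReB.
  by apply: le_trans (Re_nr_le _) _; exact: hN.
have [|b hb] := @real_complete (fun n => complex.Im (u n)).
  move=> e /hu[N hN]; exists N => m n hm hn.
  have -> : complex.Im (u m) - complex.Im (u n) = complex.Im (u m - u n).
    by case: (u m) (u n) => ? ? [].
  by apply: le_trans (Im_nr_le _) _; exact: hN.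
exists (a +i* b)%C => e e0.
have e1 : 0 < e / 2 by rewrite divr_gt0.
have [N1 h1] := ha _ e1; have [N2 h2] := hb _ e1.
exists (maxn N1 N2) => n hn; apply: le_trans (nr_ReIm _) _.
have := h1 n (leq_trans (leq_maxl _ _) hn); have := h2 n (leq_trans (leq_maxr _ _) hn).
by case: (u n) => c d /= *; lra.
Qed.

End Complete.

Section Kernel.
Variables (R : realType) (X : Type).
Local Notation C := (cplx R).
Local Notation Re := (@complex.Re R).

Definition psd (k : X -> X -> C) := forall s : seq (C * X),
  0 <= \sum_(p <- s) \sum_(p' <- s) p.1 * p'.1^* * k p.2 p'.2.

Record pskernel := PSKernel { kfun :> X -> X -> C; kfun_psd : psd kfun }.

Variable k : pskernel.
Local Notation combo := (seq (C * X)).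
Implicit Types (s t : combo) (f g : X -> C^o).

Definition kform s t : C := \sum_(p <- s) \sum_(p' <- t) p.1 * p'.1^* * k p.2 p'.2.
Definition kscale (a : C) s : combo := [seq (a * p.1, p.2) | p <- s].
Definition kpair f t : C := \sum_(p <- t) p.1^* * f p.2.
Definition ksec s : X -> C^o := fun y => \sum_(p <- s) p.1 * k p.2 y.
Definition kn s : R := Num.sqrt (Re (kform s s)).

Lemma kform_catl s s' t : kform (s ++ s') t = kform s t + kform s' t.
Proof. exact: big_cat. Qed.

Lemma kform_catr s t t' : kform s (t ++ t') = kform s t + kform s t'.
Proof. by rewrite /kform -big_split; apply: eq_bigr => p _; rewrite big_cat. Qed.

Lemma kform_scalel a s t : kform (kscale a s) t = a * kform s t.
Proof.
rewrite /kform big_map mulr_sumr; apply: eq_bigr => p _.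
by rewrite mulr_sumr; apply: eq_bigr => p' _; rewrite !mulrA.
Qed.

Lemma kform_scaler a s t : kform s (kscale a t) = a^* * kform s t.
Proof.
rewrite /kform mulr_sumr; apply: eq_bigr => p _; rewrite big_map mulr_sumr.
by apply: eq_bigr => p' _ /=; rewrite cjM; ring.
Qed.

Lemma kpair_sec s t : kpair (ksec s) t = kform s t.
Proof.
rewrite /kpair /ksec /kform exchange_big /=; apply: eq_bigr => p _.
by rewrite mulr_sumr; apply: eq_bigr => p' _; ring.
Qed.

Lemma kform_ge0 s : 0 <= kform s s. Proof. exact: kfun_psd. Qed.

Lemma kn_ge0 s : 0 <= kn s. Proof. exact: sqrtr_ge0. Qed.

Lemma kform_kn s : kform s s = (kn s ^+ 2)%:C%C.
Proof. by rewrite sqr_sqrtr ?Re_ge0 ?kform_ge0 // -ge0_Re ?kform_ge0. Qed.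

(** Symmetry is not part of [psd]. It follows because the form at [s] plus [a] times [t] is real for
    [a = 1] and for [a = i]. *)
Lemma kform_conj s t : kform t s = (kform s t)^*.
Proof.
have h (a : C) : complex.Im (a^* * kform s t + a * kform t s + a * a^* * kform t t) = 0.
  have : complex.Im (kform (s ++ kscale a t) (s ++ kscale a t)) = 0 by rewrite kform_kn.
  rewrite kform_catl !kform_catr !kform_scalel !kform_scaler (kform_kn s) => <-.
  rewrite !addrA mulrA; set u := _ * kform s t; set v := a * kform t s; set w := _ * kform t t.
  by case: u v w => ? ? [? ?] [? ?] /=; rewrite add0r.
move: (h 1) (h 'i%C); rewrite (kform_kn t) !cjE.
case: (kform s t) (kform t s) => a b [c d] /=.
rewrite oppr0 => h1 h2; congr Complex; move: h1 h2; lra.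
Qed.

Lemma kform_cs s t : nr (kform s t) <= kn s * kn t.
Proof.
apply: nr_le_polar; rewrite ?kn_ge0 // => a.
have := Re_ge0 (kform_ge0 (kscale a s ++ kscale (-1) t)).
rewrite kform_catl !kform_catr !kform_scalel !kform_scaler !ReD.
rewrite (kform_kn s) (kform_kn t) (kform_conj s t).
rewrite cjN cj1 !mulN1r opprK mulrN !ReN.
have -> : Re (a * (a^* * (kn s ^+ 2)%:C%C)) = nr a ^+ 2 * kn s ^+ 2.
  by rewrite mulrA mulrC ReZ -nr_sqr mulrC.
have -> : Re (a^* * (kform s t)^*) = Re (a * kform s t) by rewrite -cjM Re_conj.
by rewrite /=; lra.
Qed.

Definition kbound f (M : R) := forall t, nr (kpair f t) <= M * kn t.
Definition kN f : R := inf [set M | 0 <= M /\ kbound f M].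
(** The reproducing kernel space: a vector is the function of its pairings with the generators, and
    [kN] is its norm as a functional on combinations. Combinations of seminorm zero have zero
    section, so neither a quotient nor a completion by Cauchy sequences is formed. *)
Definition kH : set (X -> C^o) :=
  [set f | forall e : R, 0 < e -> exists s, kbound (f - ksec s) e].

Lemma kpair_lin a f g t : kpair (a *: f + g) t = a * kpair f t + kpair g t.
Proof.
rewrite /kpair mulr_sumr -big_split; apply: eq_bigr => p _ /=.
rewrite -[(a *: f + g) _]/(a * f p.2 + g p.2); ring.
Qed.

Lemma kpairD f g t : kpair (f + g) t = kpair f t + kpair g t.
Proof. by rewrite -{1}[f]scale1r kpair_lin mul1r. Qed.

Lemma kpairZ a f t : kpair (a *: f) t = a * kpair f t.
Proof.
rewrite /kpair mulr_sumr; apply: eq_bigr => p _ /=.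
rewrite -[(a *: f) _]/(a * f p.2); ring.
Qed.

Lemma kboundD f g M N : kbound f M -> kbound g N -> kbound (f + g) (M + N).
Proof.
by move=> hf hg t; rewrite kpairD mulrDl; apply: le_trans (nrD _ _) _; apply: lerD.
Qed.

Lemma kboundZ a f M : kbound f M -> kbound (a *: f) (nr a * M).
Proof. by move=> hf t; rewrite kpairZ nrM -mulrA ler_wpM2l ?nr_ge0. Qed.

Lemma kbound_sec s : kbound (ksec s) (kn s).
Proof. by move=> t; rewrite kpair_sec kform_cs. Qed.

Lemma kbound_le f M N : M <= N -> kbound f M -> kbound f N.
Proof. by move=> MN h t; apply: le_trans (h t) _; rewrite ler_wpM2r ?kn_ge0. Qed.

Lemma kN_le f M : 0 <= M -> kbound f M -> kN f <= M.
Proof. by move=> M0 h; apply: ge_inf; [exists 0 => ? []|]. Qed.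

Lemma kN_ge0 f : 0 <= kN f.
Proof.
rewrite /kN; have [[M hM]|h] := pselect (exists M, [set M | 0 <= M /\ kbound f M] M).
  by apply: lb_le_inf; [exists M | move=> ? []].
rewrite (_ : [set _ | _] = set0) ?inf0 //.
by rewrite -subset0 => M hM; case: h; exists M.
Qed.

Lemma kN_bound f M : kbound f M -> kbound f (kN f).
Proof.
move=> h t.
have hb : kbound f (Num.max M 0) by apply: kbound_le h; rewrite le_max lexx.
have M0 : 0 <= Num.max M 0 by rewrite le_max lexx orbT.
have [t0|t0] := eqVneq (kn t) 0; first by have := h t; rewrite t0 !mulr0.
have tp : 0 < kn t by rewrite lt_neqAle eq_sym t0 kn_ge0.
rewrite -ler_pdivrMr //; apply: lb_le_inf; first by exists (Num.max M 0).
by move=> N [_ hN]; rewrite ler_pdivrMr.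
Qed.

Lemma kN_sec s : kN (ksec s) = kn s.
Proof.
apply/eqP; rewrite eq_le kN_le ?kn_ge0 //=; last exact: kbound_sec.
have := kN_bound (@kbound_sec s) s; rewrite kpair_sec kform_kn nr_real ?sqr_ge0 // expr2.
have [->|s0] := eqVneq (kn s) 0; first by rewrite kN_ge0.
by rewrite ler_pM2r // lt_neqAle eq_sym s0 kn_ge0.
Qed.

Lemma kH_bound f : kH f -> kbound f (kN f).
Proof.
move=> /(_ 1 ltr01)[s hs]; apply: (@kN_bound _ (1 + kn s)).
by rewrite -[f](subrK (ksec s)); apply: kboundD hs _; exact: kbound_sec.
Qed.

Lemma ksec_cat s t : ksec (s ++ t) = ksec s + ksec t.
Proof. by apply/funext => x; rewrite /ksec big_cat. Qed.

Lemma ksec_scale a s : ksec (kscale a s) = a *: ksec s.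
Proof.
apply/funext => x; rewrite -[RHS]/(a * ksec s x) /ksec big_map mulr_sumr.
by apply: eq_bigr => p _; rewrite mulrA.
Qed.

Lemma kH_sec s : kH (ksec s).
Proof.
move=> e e0; exists s => t; rewrite subrr /kpair big1 ?nr0 ?mulr_ge0 ?kn_ge0 ?ltW //.
by move=> p _; rewrite mulr0.
Qed.

Lemma kH_lin a f g : kH f -> kH g -> kH (a *: f + g).
Proof.
move=> hf hg e e0.
have q : 0 < nr a + 1 by have := nr_ge0 a; lra.
have e1 : 0 < e / (nr a + 1) by rewrite divr_gt0.
have [s hs] := hf _ e1; have [t ht] := hg _ e1.
exists (kscale a s ++ t); rewrite ksec_cat ksec_scale.
have -> : a *: f + g - (a *: ksec s + ksec t) = a *: (f - ksec s) + (g - ksec t).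
  by rewrite scalerBr opprD addrACA.
apply: kbound_le (kboundD (kboundZ a hs) ht).
by rewrite -{2}[_ / _]mul1r -mulrDl mulrCA divff ?mulr1 // gt_eqF.
Qed.

Lemma kN_triangle f g : kH f -> kH g -> kN (f + g) <= kN f + kN g.
Proof.
move=> hf hg; apply: kN_le; first by rewrite addr_ge0 ?kN_ge0.
by apply: kboundD; exact: kH_bound.
Qed.

Lemma kH0 : kH 0.
Proof.
suff -> : (0 : X -> C^o) = ksec [::] by exact: kH_sec.
by apply/funext => x; rewrite /ksec big_nil.
Qed.

Lemma kHD f g : kH f -> kH g -> kH (f + g).
Proof. by move=> *; rewrite -[f]scale1r; apply: kH_lin. Qed.

Lemma kHZ a f : kH f -> kH (a *: f).
Proof. by move=> ?; rewrite -[_ *: _]addr0; apply: kH_lin => //; exact: kH0. Qed.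

Lemma kN_scale a f : kH f -> kN (a *: f) = nr a * kN f.
Proof.
have le b g : kH g -> kN (b *: g) <= nr b * kN g.
  move=> hg; apply: kN_le; first by rewrite mulr_ge0 ?nr_ge0 ?kN_ge0.
  by apply: kboundZ; exact: kH_bound.
move=> hf; apply/eqP; rewrite eq_le le //=.
have [->|a0] := eqVneq a 0; first by rewrite nr0 mul0r kN_ge0.
have na : 0 < nr a by rewrite lt_neqAle nr_ge0 eq_sym andbT; apply: contra a0 => /eqP/nr0_eq0->.
have := le a^-1 (a *: f) (kHZ a hf); rewrite scalerA mulVf // scale1r.
have -> : nr a^-1 = (nr a)^-1.
  by apply: (mulfI (lt0r_neq0 na)); rewrite -nrM divff // divff ?gt_eqF // nr_real.
by rewrite mulrC ler_pdivlMr // mulrC.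
Qed.

Lemma kpair1 f x : kpair f [:: (1, x)] = f x.
Proof. by rewrite /kpair big_seq1 /= rmorph1 mul1r. Qed.

Lemma kH_eval f x : kH f -> nr (f x) <= kN f * kn [:: (1, x)].
Proof. by move=> /kH_bound/(_ [:: (1, x)]); rewrite kpair1. Qed.

Lemma kN_eq0 f : kH f -> kN f = 0 -> f = 0.
Proof.
move=> hf f0; apply/funext => x; apply/nr0_eq0/eqP.
by rewrite eq_le nr_ge0 andbT; have := kH_eval x hf; rewrite f0 mul0r.
Qed.

Definition kHb : {pred X -> C^o} := fun f => `[< kH f >].

Record ksp := Ksp { kval : X -> C^o; kvalP : kval \in kHb }.

HB.instance Definition _ := [isSub for kval].
HB.instance Definition _ := gen_eqMixin ksp.
HB.instance Definition _ := gen_choiceMixin ksp.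

Lemma kHbP f : reflect (kH f) (f \in kHb).
Proof. exact: asboolP. Qed.

Lemma kHb_closed : subsemimod_closed kHb.
Proof.
split; first by split=> [|f g /kHbP hf /kHbP hg]; apply/kHbP; [exact: kH0|exact: kHD].
by move=> a f /kHbP hf; apply/kHbP/kHZ.
Qed.

HB.instance Definition _ := GRing.SubChoice_isSubLmodule.Build C (X -> C^o) kHb ksp kHb_closed.

Lemma kH_val (f : ksp) : kH (kval f).
Proof. by apply/kHbP/kvalP. Qed.

Definition knorm (f : ksp) : C := (kN (kval f))%:C%C.

Lemma knormD (f g : ksp) : knorm (f + g) <= knorm f + knorm g.
Proof. by rewrite -rcD lecR; apply: kN_triangle; exact: kH_val. Qed.

Lemma knormZ (a : C) (f : ksp) : knorm (a *: f) = `|a| * knorm f.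
Proof. by rewrite nrE -rcM -kN_scale //; exact: kH_val. Qed.

Lemma knorm_eq0 (f : ksp) : knorm f = 0 -> f = 0.
Proof. by move/complexI => h; apply: val_inj; apply: kN_eq0 => //; exact: kH_val. Qed.

HB.instance Definition _ := Lmodule_isNormed.Build C ksp knormD knormZ knorm_eq0.

Lemma kH_pt (f : ksp) x : nr (kval f x) <= nr f * kn [:: (1, x)].
Proof. exact/kH_eval/kH_val. Qed.

Lemma ksp_complete (F : set_system ksp) : ProperFilter F -> cauchy F -> cvg F.
Proof.
move=> FF /cauchyP hF.
have inv0 n : 0 < (n.+1%:R)^-1 :> R by rewrite invr_gt0.
have ex n : exists x : ksp, F (ball x ((n.+1%:R)^-1)%:C%C).
  by apply: hF; rewrite ltcR.
have {ex hF}[a ha] := choice ex.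
have ballE (x y : ksp) (e : R) : ball x e%:C%C y <-> nr (x - y) < e.
  by rewrite -ball_normE /= nrE ltcR.
have aa m n : nr (a m - a n) <= (m.+1%:R)^-1 + (n.+1%:R)^-1.
  have [f [/ballE h1 /ballE h2]] := filter_ex (filterI (ha m) (ha n)).
  rewrite -[a m](subrK f) -addrA; apply: le_trans (nrD _ _) _.
  by rewrite (nrB f) lerD ?ltW.
(* Evaluation at a point is bounded, so the centres [a n] converge pointwise; [g] is the candidate
   limit. *)
have [g hg] : exists g : X -> C, forall x (e : R), 0 < e ->
    exists N, forall n, (N <= n)%N -> nr (kval (a n) x - g x) <= e.
  suff ex x : exists z : C, forall e : R, 0 < e ->
      exists N, forall n, (N <= n)%N -> nr (kval (a n) x - z) <= e.
    by have [g hg] := choice ex; exists g.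
  apply: complex_complete => e e0.
  set c := kn [:: (1, x)].
  have c0 : 0 <= c by exact: kn_ge0.
  have e1 : 0 < e / (2 * (c + 1)) by rewrite divr_gt0 // mulr_gt0 // ltr_wpDl.
  have [N hN] := invS_small e1; exists N => m n hm hn.
  have := kH_pt (a m - a n) x; rewrite -[kval _ x]/(kval (a m) x - kval (a n) x) -/c.
  move=> /le_trans; apply.
  apply: (@le_trans _ _ ((e / (2 * (c + 1)) + e / (2 * (c + 1))) * c)).
    by rewrite ler_wpM2r //; apply: le_trans (aa m n) _; rewrite lerD ?hN.
  have -> : e / (2 * (c + 1)) + e / (2 * (c + 1)) = e / (c + 1).
    by field; rewrite gt_eqF // ltr_wpDl.
  by rewrite mulrAC ler_pdivrMr ?ltr_wpDl // ler_pM2l // lerDl.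
have hgt t (e : R) : 0 < e -> exists N, forall n, (N <= n)%N ->
    nr (kpair (kval (a n) - g) t) <= e.
  elim: t e => [|p t IH] e e0.
    by exists 0%N => n _; rewrite /kpair big_nil nr0 ltW.
  have e1 : 0 < e / 2 by rewrite divr_gt0.
  have e2 : 0 < e / 2 / (nr p.1 + 1) by rewrite divr_gt0 // ltr_wpDl ?nr_ge0.
  have [N1 h1] := IH _ e1; have [N2 h2] := hg p.2 _ e2.
  exists (maxn N1 N2) => n hn.
  have := h1 n (leq_trans (leq_maxl _ _) hn); have := h2 n (leq_trans (leq_maxr _ _) hn).
  rewrite /kpair big_cons => k2 k1; apply: le_trans (nrD _ _) _.
  rewrite [leRHS](splitr e) lerD // nrM nr_conj.
  apply: le_trans (ler_wpM2l (nr_ge0 _) k2) _.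
  rewrite mulrCA -[leRHS]mulr1 ler_pM2l //.
  by rewrite ler_pdivrMr ?ltr_wpDl ?nr_ge0 // mul1r lerDl.
(* In [aa] the second index is sent to infinity for one fixed combination [t] at a time; the
   resulting constant is the same for all [t]. *)
have bnd n : kbound (kval (a n) - g) (n.+1%:R)^-1.
  move=> t; apply/ler_addgt0Pr => e e0.
  have e1 : 0 < e / 2 by rewrite divr_gt0.
  have e2 : 0 < e / 2 / (kn t + 1) by rewrite divr_gt0 // ltr_wpDl ?kn_ge0.
  have [N1 h1] := hgt t _ e1; have [N2 h2] := invS_small e2.
  pose m := maxn N1 N2.
  have := h1 m (leq_maxl _ _); have := h2 m (leq_maxr _ _) => k2 k1.
  have -> : kpair (kval (a n) - g) t = kpair (kval (a n - a m)) t + kpair (kval (a m) - g) t.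
    by rewrite -kpairD; congr kpair; rewrite -[kval (_ - _)]/(kval (a n) - kval (a m)) addrA subrK.
  apply: le_trans (nrD _ _) _; rewrite [in leRHS](splitr e) addrA lerD //.
  apply: le_trans (kH_bound (kH_val _) t) _.
  apply: le_trans (ler_wpM2r (kn_ge0 _) (aa n m)) _.
  rewrite mulrDl lerD2l; apply: le_trans (ler_wpM2r (kn_ge0 _) k2) _.
  by rewrite mulrAC ler_pdivrMr ?ltr_wpDl ?kn_ge0 // ler_pM2l // lerDl.
have Hg : kH g.
  move=> e e0; have e1 : 0 < e / 2 by rewrite divr_gt0.
  have [N hN] := invS_small e1; have [s hs] := kH_val (a N) e1; exists s.
  have -> : (g : X -> C^o) - ksec s = (-1) *: (kval (a N) - g) + (kval (a N) - ksec s).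
    by rewrite scaleN1r opprB addrA subrK.
  rewrite (splitr e); apply: kboundD hs.
  have := kboundZ (-1) (bnd N); rewrite nrN /nr normr1 mul1r.
  by apply: kbound_le; exact: hN.
apply/cvg_ex; exists (Ksp (introT (kHbP _) Hg)); apply/cvg_ballP => e e0.
have e1 : 0 < Re e / 2 by rewrite divr_gt0 // Re_gt0.
have [N hN] := invS_small e1.
apply: filterS (ha N) => f /ballE hf; rewrite (ge0_Re (ltW e0)); apply/ballE.
rewrite -[X in nr (X - _)](subrK (a N)) -addrA.
apply: le_lt_trans (nrD _ _) _; rewrite [ltRHS](splitr (Re e)); apply: ler_ltD.
  rewrite nrB; apply: le_trans (hN N (leqnn N)).
  apply: kN_le; [exact: ltW | exact: bnd].
exact: lt_le_trans hf (hN N (leqnn N)).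
Qed.

HB.instance Definition _ := Uniform_isComplete.Build ksp ksp_complete.

Definition kS s : ksp := Ksp (introT (kHbP _) (@kH_sec s)).

Lemma nr_kS s : nr (kS s) = kn s. Proof. exact: kN_sec. Qed.

Lemma kS_cat s t : kS (s ++ t) = kS s + kS t.
Proof. by apply: val_inj; exact: ksec_cat. Qed.

Lemma kS_scale a s : kS (kscale a s) = a *: kS s.
Proof. by apply: val_inj; exact: ksec_scale. Qed.

Lemma kS_dense (f : ksp) (e : R) : 0 < e -> exists s, nr (f - kS s) <= e.
Proof.
move=> e0; have [s hs] := kH_val f e0; exists s.
by apply: kN_le => //; exact: ltW.
Qed.

(** Polarisation: on the completed space only the norm is at hand. *)
Definition kip (f g : ksp) : C := 4^-1 *
  ((nr (f + g) ^+ 2 - nr (f - g) ^+ 2)%:C%C +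
   'i%C * (nr (f + 'i%C *: g) ^+ 2 - nr (f - 'i%C *: g) ^+ 2)%:C%C).

Lemma nr_i : nr ('i%C : C) = 1.
Proof. by rewrite /nr normc_def /= expr0n add0r expr1n sqrtr1. Qed.

Lemma mulii : 'i%C * 'i%C = -1 :> C.
Proof. by rewrite -expr2 sqr_i. Qed.

Lemma kip_kS s t : kip (kS s) (kS t) = kform s t.
Proof.
have hq c : (nr (kS s + c *: kS t) ^+ 2)%:C%C =
   kform s s + c^* * kform s t + c * kform t s + c * c^* * kform t t.
  by rewrite -kS_scale -kS_cat nr_kS -kform_kn kform_catl !kform_catr
     !kform_scalel !kform_scaler !addrA mulrA.
have h1 := hq 1; have h2 := hq (-1); have h3 := hq 'i%C; have h4 := hq (- 'i%C).
move: h1 h2 h3 h4; rewrite scale1r scaleN1r scaleNr !cjN cj1.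
have -> : ('i%C : C)^* = - 'i%C by rewrite cjE /= ; congr Complex; rewrite oppr0.
rewrite /kip !rcB => -> -> -> ->.
have := mulii; move: 'i%C => i ii.
have := ii; rewrite -expr2 => ii2.
transitivity (4^-1 * (2 * kform s t + 2 * kform t s + (2 * kform t s - 2 * kform s t) * i ^+ 2)).
  by congr (_ * _); ring.
by rewrite ii2; field.
Qed.

Lemma nr_sqr_close (V : normedZmodType C) (u w : V) (d : R) : 0 <= d -> nr (u - w) <= d ->
  `|nr u ^+ 2 - nr w ^+ 2| <= d * (2 * nr u + d).
Proof.
move=> d0 h.
have h1 : nr u <= nr w + d by have := nrD (u - w) w; rewrite subrK; lra.
have h2 : nr w <= nr u + d by have := nrD (w - u) u; rewrite subrK nrB; lra.
have := nr_ge0 u; have := nr_ge0 w => ? ?.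
by rewrite ler_norml; apply/andP; split; nra.
Qed.

(** Linearity of the polarisation formula is not visible from the norm alone, so it is carried over
    from [kform] by approximating with combinations. *)
Lemma kip_approx (f g : ksp) (e : R) : 0 < e -> exists2 d : R, 0 < d & forall s t,
  nr (f - kS s) <= d -> nr (g - kS t) <= d -> nr (kip f g - kform s t) <= e.
Proof.
move=> e0; pose M := nr f + nr g.
have M0 : 0 <= M by rewrite addr_ge0 ?nr_ge0.
(* Each of the four squares moves by at most [4 * d * (M + 1)], and the factor [1/4] of the formula
   leaves [4 * d * (M + 1) <= e]. *)
pose d := Num.min 1 (e / (4 * (M + 1))).
have q0 : 0 < 4 * (M + 1) by rewrite mulr_gt0 // ltr_wpDl.
have d0 : 0 < d by rewrite lt_min ltr01 divr_gt0.
have d1 : d <= 1 by rewrite ge_min lexx.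
have d2 : d * (4 * (M + 1)) <= e by rewrite -ler_pdivlMr // ge_min lexx orbT.
exists d => // s t hs ht.
have T (c : C) : nr c = 1 ->
    `|nr (f + c *: g) ^+ 2 - nr (kS s + c *: kS t) ^+ 2| <= 4 * d * (M + 1).
  move=> c1; apply: le_trans (@nr_sqr_close _ _ _ (2 * d) _ _) _.
  - by rewrite mulr_ge0 // ltW.
  - rewrite opprD addrACA -scalerBr; apply: le_trans (nrD _ _) _.
    by rewrite nrZ c1 mul1r; lra.
  have : nr (f + c *: g) <= M by apply: le_trans (nrD _ _) _; rewrite nrZ c1 mul1r.
  move=> h; have := nr_ge0 (f + c *: g); nra.
have n1 : nr (1 : C) = 1 by rewrite /nr normr1.
have := T 1 n1; have := T (-1); rewrite nrN => /(_ n1).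
have := T 'i%C nr_i; have := T (- 'i%C); rewrite nrN => /(_ nr_i).
rewrite -kip_kS /kip !scaleN1r !scale1r !scaleNr => k4 k3 k2 k1.
rewrite -mulrBr.
set a1 := nr (f + g) ^+ 2 in k1 *; set a2 := nr (f - g) ^+ 2 in k2 *.
set a3 := nr (f + _) ^+ 2 in k3 *; set a4 := nr (f - _) ^+ 2 in k4 *.
set b1 := nr (kS s + kS t) ^+ 2 in k1 *; set b2 := nr (kS s - kS t) ^+ 2 in k2 *.
set b3 := nr (kS s + _) ^+ 2 in k3 *; set b4 := nr (kS s - _) ^+ 2 in k4 *.
have -> : (a1 - a2)%:C%C + 'i%C * (a3 - a4)%:C%C - ((b1 - b2)%:C%C + 'i%C * (b3 - b4)%:C%C)
   = ((a1 - b1) - (a2 - b2))%:C%C + 'i%C * ((a3 - b3) - (a4 - b4))%:C%C :> C.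
  by rewrite !rcB; ring.
rewrite nrM.
have -> : nr (4^-1 : C) = 4^-1.
  have -> : 4^-1 = (4^-1)%:C%C :> C by rewrite fmorphV rmorph_nat.
  by rewrite nr_real ?invr_ge0.
have nrabs (x : R) : nr x%:C%C = `|x|.
  by rewrite /nr normc_def /= expr0n addr0 sqrtr_sqr.
have h1 : nr (((a1 - b1) - (a2 - b2))%:C%C + 'i%C * ((a3 - b3) - (a4 - b4))%:C%C)
    <= 16 * d * (M + 1).
  apply: le_trans (nrD _ _) _; rewrite nrM nr_i mul1r !nrabs.
  have := ler_normB (a1 - b1) (a2 - b2); have := ler_normB (a3 - b3) (a4 - b4).
  lra.
lra.
Qed.

Lemma nr_lin_close (a u v w v' w' : C) (e : R) :
  nr (u - (a * v' + w')) <= e -> nr (v - v') <= e -> nr (w - w') <= e ->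
  nr (u - (a * v + w)) <= (nr a + 2) * e.
Proof.
move=> h1 h2 h3.
have -> : u - (a * v + w) = (u - (a * v' + w')) - (a * (v - v') + (w - w')) by ring.
apply: le_trans (nrD _ _) _; rewrite nrN.
have := nrD (a * (v - v')) (w - w'); rewrite nrM => h4.
have := ler_wpM2l (nr_ge0 a) h2; lra.
Qed.

Lemma kip_linear (a : C) (f f' g : ksp) : kip (a *: f + f') g = a * kip f g + kip f' g.
Proof.
apply/eqP; rewrite -subr_eq0; apply/eqP/nr_small => e e0.
have na := nr_ge0 a.
have q0 : 0 < nr a + 2 by lra.
have e1 : 0 < e / (nr a + 2) by rewrite divr_gt0.
have [d1 d10 h1] := kip_approx (a *: f + f') g e1.
have [d2 d20 h2] := kip_approx f g e1; have [d3 d30 h3] := kip_approx f' g e1.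
have qa : 0 < nr a + 1 by lra.
have p1 : 0 < Num.min d2 (d1 / (nr a + 1)) by rewrite lt_min d20 divr_gt0.
have p2 : 0 < Num.min d3 (d1 / (nr a + 1)) by rewrite lt_min d30 divr_gt0.
have p3 : 0 < Num.min d1 (Num.min d2 d3) by rewrite !lt_min d10 d20 d30.
have [s hs] := kS_dense f p1; have [s' hs'] := kS_dense f' p2; have [t ht] := kS_dense g p3.
move: hs hs' ht; rewrite !le_min => /andP[s1 s2] /andP[s1' s2'] /and3P[t1 t2 t3].
have k1 : nr (kip (a *: f + f') g - kform (kscale a s ++ s') t) <= e / (nr a + 2).
  apply: h1 => //; rewrite kS_cat kS_scale opprD addrACA -scalerBr.
  apply: le_trans (nrD _ _) _; rewrite nrZ.
  apply: le_trans (lerD (ler_wpM2l na s2) s2') _.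
  by rewrite -{2}[_ / _]mul1r -mulrDl mulrCA divff ?mulr1 // gt_eqF.
have k2 := h2 _ _ s1 t2; have k3 := h3 _ _ s1' t3.
rewrite kform_catl kform_scalel in k1.
apply: le_trans (nr_lin_close k1 k2 k3) _.
by rewrite mulrCA divff ?mulr1 // gt_eqF.
Qed.

Lemma kip_conj (f g : ksp) : kip g f = (kip f g)^*.
Proof.
have E1 : nr (g + 'i%C *: f) = nr (f - 'i%C *: g).
  have -> : f - 'i%C *: g = (- 'i%C : C) *: (g + 'i%C *: f).
    by rewrite scalerDr scalerA mulNr mulii opprK scale1r scaleNr addrC.
  by rewrite nrZ nrN nr_i mul1r.
have E2 : nr (g - 'i%C *: f) = nr (f + 'i%C *: g).
  have -> : f + 'i%C *: g = ('i%C : C) *: (g - 'i%C *: f).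
    by rewrite scalerBr scalerA mulii scaleN1r opprK addrC.
  by rewrite nrZ nr_i mul1r.
rewrite /kip (addrC g f) (nrB g f) E1 E2 cjM cjD cjM !cj_real.
have -> : ('i%C : C)^* = - 'i%C by rewrite cjE /= ; congr Complex; rewrite oppr0.
have -> : (4^-1 : C)^* = 4^-1 by rewrite fmorphV rmorph_nat.
by congr (_ * (_ + _)); rewrite !rcB; ring.
Qed.

Lemma kip_norm (f : ksp) : `|f| ^+ 2 = kip f f.
Proof.
rewrite nrE /kip subrr nr0.
have -> : f + f = (2 : C) *: f by rewrite scaler_nat mulr2n.
have -> : f + 'i%C *: f = (1 + 'i%C : C) *: f by rewrite scalerDl scale1r.
have -> : f - 'i%C *: f = (1 - 'i%C : C) *: f by rewrite scalerBl scale1r.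
rewrite !nrZ.
have -> : nr (1 - 'i%C : C) = nr (1 + 'i%C : C).
  rewrite -nr_conj; congr nr; rewrite cjE /=; congr Complex; ring.
rewrite subrr mulr0 addr0.
have -> : nr (2 : C) = 2 by rewrite /nr normr_nat.
rewrite expr0n subr0 exprMn rcM !rcX.
have -> : 2%:C%C = 2 :> C by rewrite rmorph_nat.
by field.
Qed.

Definition kernel_space : hilbert R := Hilbert kip_linear kip_conj kip_norm.
Definition kernel_vec (x : X) : kernel_space := kS [:: (1, x)].

Lemma kernel_vec_ip x y : ip (kernel_vec x) (kernel_vec y) = k x y.
Proof.
by rewrite -[ip _ _]/(kip _ _) kip_kS /kform !big_seq1 /= cj1 !mul1r.
Qed.

Lemma kS_lc s : kS s = lc kernel_vec s :> kernel_space.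
Proof.
elim: s => [|p s IH]; last first.
  rewrite -cat1s kS_cat IH lc_cat /lc big_seq1 -kS_scale /kscale /= mulr1.
  by case: p.
rewrite /lc big_nil; apply: val_inj; apply/funext => x.
by rewrite /= /ksec big_nil.
Qed.

Lemma kernel_vec_total : total kernel_vec.
Proof.
move=> f hf; apply: nr_small => e e0; have [s hs] := kS_dense (f : ksp) e0.
have h : ip (lc kernel_vec s) f = 0.
  by rewrite ip_lcl big1 // => p _; rewrite hf mulr0.
have := cauchy_schwarz ((f : kernel_space) - lc kernel_vec s) f.
rewrite ipBl h subr0 ip_nr nr_real ?sqr_ge0 // expr2 -kS_lc => k1.
have [->|fn] := eqVneq (nr f) 0; first exact: ltW.
apply: le_trans hs; move: k1; rewrite ler_pM2r //.
by rewrite lt_neqAle eq_sym fn nr_ge0.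
Qed.

End Kernel.

(** The only source of new Hilbert spaces below: the GNS space, direct sums, spaces with a finite
    orthonormal basis, and the auxiliary space of [tmap_l]. *)
Lemma kolmogorov (R : realType) (X : Type) (k : X -> X -> cplx R) : psd k ->
  exists (H : hilbert R) (v : X -> H), (forall x y, ip (v x) (v y) = k x y) /\ total v.
Proof.
move=> kp; exists (kernel_space (PSKernel kp)), (@kernel_vec _ _ (PSKernel kp)).
by split; [exact: kernel_vec_ip | exact: kernel_vec_total].
Qed.

(** * Tensor products *)

Section LinearMaps.
Variable R : realType.
Local Notation C := (cplx R).

Lemma closure_total (H : hilbert R) (S : set H) z : closure (lspan S) = setT ->
  (forall s, S s -> ip s z = 0) -> z = 0.
Proof.
move=> cS hz; have : closure (lspan S) z by rewrite cS.
move=> /closureE h; apply: nr_small => e e0; have [w [n [a [s [hs ->]]]] zy] := h _ e0.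
set y := \sum_(i < n) _ in zy.
have yz : ip y z = 0 by rewrite ip_suml big1 // => i _; rewrite ipZl hz // mulr0.
have := cauchy_schwarz (z - y) z.
rewrite ipBl yz subr0 ip_nr nr_real ?sqr_ge0 // expr2.
have [->|zn] := eqVneq (nr z) 0; first by move=> _; exact: ltW.
rewrite ler_pM2r; last by rewrite lt_neqAle eq_sym zn nr_ge0.
by move/le_trans; apply.
Qed.

Definition madj (H K : hilbert R) (F : H -> K) : K -> H :=
  xget (fun=> 0) [set G | blin G /\ forall k x, ip (G k) x = ip k (F x)].

Lemma madjP (H K : hilbert R) (F : H -> K) : blin F ->
  [/\ blin (madj F), forall k x, ip (madj F k) x = ip k (F x) &
      forall k x, ip x (madj F k) = ip (F x) k].
Proof.
move=> [lF [r r0 bF]].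
have [|b e] := @xgetPex _ (fun=> 0) [set G | blin G /\ forall k x, ip (G k) x = ip k (F x)].
  by have [G [? ? ?]] := madj_ex r0 lF bF; exists G; split=> //; split=> //; exists r.
by split=> // k x; rewrite ipC e -ipC.
Qed.

Lemma blin_id (H : hilbert R) : blin (id : H -> H).
Proof. by split=> //; exists 1 => // x; rewrite mul1r. Qed.

Lemma bilin_total (H K : hilbert R) (X Y : Type) (v : X -> H) (w : Y -> K) (F G : H -> K) :
  total v -> total w -> blin F -> blin G ->
  (forall x y, ip (F (v x)) (w y) = ip (G (v x)) (w y)) -> F = G.
Proof.
move=> tv tw bF bG h; apply: (lin_total_ext tv) => // x.
exact: (total_extl tw).
Qed.

Definition isometric (H K : hilbert R) (F : H -> K) :=
  lin F /\ forall x y, ip (F x) (F y) = ip x y.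

Lemma isometric_bd (H K : hilbert R) (F : H -> K) : isometric F -> bd 1 F.
Proof.
move=> [_ h] x; rewrite mul1r -(@ler_pXn2r _ 2) ?nnegrE ?nr_ge0 //.
by rewrite !nr_ip h.
Qed.

Lemma isometric_blin (H K : hilbert R) (F : H -> K) : isometric F -> blin F.
Proof. by move=> h; split; [case: h | exists 1 => //; exact: isometric_bd]. Qed.

Lemma gram_isometric (H K : hilbert R) (X : Type) (v : X -> H) (w : X -> K) :
  total v -> (forall x y, ip (w x) (w y) = ip (v x) (v y)) ->
  exists2 F : H -> K, isometric F & forall x, F (v x) = w x.
Proof. by move=> tv h; have [F [? _ ? ?]] := ext_gram tv h; exists F. Qed.

Lemma gram_unitary (H K : hilbert R) (X : Type) (v : X -> H) (w : X -> K) :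
  total v -> total w -> (forall x y, ip (w x) (w y) = ip (v x) (v y)) ->
  exists F : H -> K, exists G : K -> H,
   [/\ isometric F, isometric G, cancel F G, cancel G F & forall x, F (v x) = w x].
Proof.
move=> tv tw h; have [F iF hF] := gram_isometric tv h.
have [//|G iG hG] := @gram_isometric _ _ _ _ v tw _.
exists F, G; split=> // x.
  suff E : G \o F = id by rewrite -[LHS]/((G \o F) x) E.
  apply: (lin_total_ext tv) => [||y /=]; last by rewrite hF hG.
    by apply: blin_comp; apply: isometric_blin.
  exact: blin_id.
suff E : F \o G = id by rewrite -[LHS]/((F \o G) x) E.
apply: (lin_total_ext tw) => [||y /=]; last by rewrite hG hF.
  by apply: blin_comp; apply: isometric_blin.
exact: blin_id.
Qed.

End LinearMaps.

Section Tensors.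
Context {R : realType} {T : tensor_choice R}.
Local Notation C := (cplx R).
Local Notation "H ** K" := (tspace (T H K)) (at level 40).
Local Notation tn := (tens (T _ _)).
Local Notation ot := (@otens R T _ _).

Section Two.
Variables (H K : hilbert R).
Implicit Types (x y : H) (k l : K).

Lemma tnDl x y k : tens (T H K) (x + y) k = tn x k + tn y k.
Proof. by rewrite -{1}[x]scale1r tens_linear_l scale1r. Qed.

Lemma tn0l k : tens (T H K) 0 k = 0.
Proof. by apply: (addrI (tn (0 : H) k)); rewrite -tnDl !addr0. Qed.

Lemma tnZl a x k : tens (T H K) (a *: x) k = a *: tn x k.
Proof. by rewrite -[a *: x]addr0 tens_linear_l tn0l addr0. Qed.

Lemma tnDr x k l : tens (T H K) x (k + l) = tn x k + tn x l.
Proof. by rewrite -{1}[k]scale1r tens_linear_r scale1r. Qed.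

Lemma tn0r x : tens (T H K) x 0 = 0.
Proof. by apply: (addrI (tn x (0 : K))); rewrite -tnDr !addr0. Qed.

Lemma tnZr a x k : tens (T H K) x (a *: k) = a *: tn x k.
Proof. by rewrite -[a *: k]addr0 tens_linear_r tn0r addr0. Qed.

Lemma tn_nr x k : nr (tens (T H K) x k) = nr x * nr k.
Proof.
apply/eqP; rewrite -(@eqrXn2 _ 2) ?mulr_ge0 ?nr_ge0 //; apply/eqP.
by apply: complexI; rewrite -ip_nr tens_ip !ip_nr -rcM exprMn.
Qed.

Lemma tn_total : total (fun p : H * K => tens (T H K) p.1 p.2).
Proof.
move=> z hz; apply: (closure_total (tens_total (T H K))) => _ [x [k ->]].
exact: (hz (x, k)).
Qed.

Lemma blin_tnl k : blin (fun x => tens (T H K) x k).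
Proof.
split; first by move=> a x y; rewrite tens_linear_l.
by exists (nr k); rewrite ?nr_ge0 // => x; rewrite tn_nr mulrC.
Qed.

Lemma blin_tnr x : blin (fun k => tens (T H K) x k).
Proof.
split; first by move=> a k l; rewrite tens_linear_r.
by exists (nr x); rewrite ?nr_ge0 // => k; rewrite tn_nr.
Qed.

(** The contraction of the second leg with [k], in bra-ket notation [1 (x) <k|]; [slice_r] by a
    vector functional factors through it. *)
Definition contr_r k : H ** K -> H := madj (fun x => tens (T H K) x k).
Definition contr_l x : H ** K -> K := madj (fun k => tens (T H K) x k).

Lemma contr_rE k z x : ip (contr_r k z) x = ip z (tn x k).
Proof. by have [_ h _] := madjP (blin_tnl k); exact: h. Qed.

Lemma contr_lE x z k : ip (contr_l x z) k = ip z (tn x k).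
Proof. by have [_ h _] := madjP (blin_tnr x); exact: h. Qed.

Lemma contr_rEr k z x : ip x (contr_r k z) = ip (tn x k) z.
Proof. by rewrite ipC contr_rE -ipC. Qed.

Lemma contr_lEr x z k : ip k (contr_l x z) = ip (tn x k) z.
Proof. by rewrite ipC contr_lE -ipC. Qed.

Lemma tn_ext (z z' : H ** K) : (forall x k, ip z (tn x k) = ip z' (tn x k)) -> z = z'.
Proof. by move=> h; apply: (total_extl tn_total) => -[x k]; exact: h. Qed.

Lemma blin_contr_r k : blin (contr_r k). Proof. by case: (madjP (blin_tnl k)). Qed.
Lemma blin_contr_l x : blin (contr_l x). Proof. by case: (madjP (blin_tnr x)). Qed.

Lemma contr_r_bd k z : nr (contr_r k z) <= nr k * nr z.
Proof.
apply: nr_le_ip => [|x]; first by rewrite mulr_ge0 ?nr_ge0.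
rewrite contr_rE; apply: le_trans (cauchy_schwarz _ _) _; rewrite tn_nr; nra.
Qed.

Lemma contr_l_tn x y k : contr_l x (tn y k) = ip y x *: k.
Proof. by apply: ip_extr => l; rewrite contr_lE tens_ip ipZl. Qed.

Lemma contr_r_tn k x l : contr_r k (tn x l) = ip l k *: x.
Proof. by apply: ip_extr => y; rewrite contr_rE tens_ip ipZl mulrC. Qed.

Lemma total_tn (X Y : Type) (v : X -> H) (w : Y -> K) : total v -> total w ->
  total (fun p : X * Y => tens (T H K) (v p.1) (w p.2)).
Proof.
move=> tv tw z hz; apply: tn_total => -[x k] /=.
rewrite ipC -contr_lE; suff -> : contr_l x z = 0 by rewrite ip0l rmorph0.
apply: tw => j; rewrite ipC contr_lE.
rewrite -contr_rE; suff -> : contr_r (w j) z = 0 by rewrite ip0l rmorph0.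
by apply: tv => i; rewrite ipC contr_rE ipC (hz (i, j)) !rmorph0.
Qed.

End Two.

Lemma tflip_ex (H K : hilbert R) : exists F : H ** K -> K ** H, exists G : K ** H -> H ** K,
  [/\ isometric F, isometric G, cancel F G, cancel G F &
      forall x k, F (tn x k) = tn k x].
Proof.
have t2 : total (fun p : H * K => tens (T K H) p.2 p.1).
  by move=> z hz; apply: tn_total => -[k x]; exact: (hz (x, k)).
have [F [G [iF iG FG GF hF]]] := gram_unitary (@tn_total H K) t2
  (fun x y => etrans (tens_ip _ _ _ _ _) (etrans (mulrC _ _) (esym (tens_ip _ _ _ _ _)))).
by exists F, G; split=> // x k; rewrite (hF (x, k)).
Qed.

(* The Schur product of the positive kernel [r^2 <x, y> - <F x, F y>] with a
   Gram kernel is positive, as seen by realising the former as a Gram kernel. *)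
Lemma tmap_l (H H' K : hilbert R) (F : H -> H') (r : R) : 0 <= r -> lin F -> bd r F ->
  exists M : H ** K -> H' ** K,
    [/\ lin M, bd r M & forall x k, M (tn x k) = tn (F x) k].
Proof.
move=> r0 lF bF.
pose D (x y : H) : C := (r ^+ 2)%:C%C * ip x y - ip (F x) (F y).
have pD : psd D.
  move=> s; set z := lc id s.
  have -> : \sum_(p <- s) \sum_(p' <- s) p.1 * p'.1^* * D p.2 p'.2 =
      (r ^+ 2)%:C%C * ip z z - ip (F z) (F z).
    rewrite (lin_lc _ _ lF) !ip_lcl mulr_sumr -sumrB; apply: eq_bigr => p _.
    rewrite !ip_lcr !mulr_sumr -sumrB; apply: eq_bigr => p' _; rewrite /D /=; ring.
  rewrite !ip_nr -rcM -rcB ler0c subr_ge0 -exprMn.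
  by rewrite ler_pXn2r ?nnegrE ?mulr_ge0 ?nr_ge0.
have [Hd [d [hd _]]] := kolmogorov pD.
have [//||M [lM bM hM]] := @ext_total R (H ** K) (H' ** K) (H * K)
  (fun p => tn p.1 p.2) (fun p => tn (F p.1) p.2) r (@tn_total H K); last first.
  by exists M; split=> // x k; rewrite (hM (x, k)).
move=> s; rewrite -(@ler_pXn2r _ 2) ?nnegrE ?mulr_ge0 ?nr_ge0 // exprMn -subr_ge0.
rewrite -ler0c rcB rcM -!ip_nr.
have -> : (r ^+ 2)%:C%C * ip (lc (fun p : H * K => tens (T H K) p.1 p.2) s) (lc (fun p => tn p.1 p.2) s) -
    ip (lc (fun p : H * K => tens (T H' K) (F p.1) p.2) s) (lc (fun p => tn (F p.1) p.2) s) =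
    ip (lc (fun p : H * K => tens (T Hd K) (d p.1) p.2) s) (lc (fun p => tn (d p.1) p.2) s).
  rewrite !ip_lcl mulr_sumr -sumrB; apply: eq_bigr => p _.
  rewrite !ip_lcr !mulr_sumr -sumrB; apply: eq_bigr => p' _.
  rewrite !tens_ip hd /D; ring.
exact: ip_ge0.
Qed.

(** The map [F (x) 1] is [tmap_l], and [1 (x) G] is [tmap_l] conjugated with flips. *)
Lemma tmap_ex (H H' K K' : hilbert R) (F : H -> H') (G : K -> K') (r s : R) :
  0 <= r -> 0 <= s -> lin F -> lin G -> bd r F -> bd s G ->
  exists M : H ** K -> H' ** K',
    [/\ lin M, bd (r * s) M & forall x k, M (tn x k) = tn (F x) (G k)].
Proof.
move=> r0 s0 lF lG bF bG.
have [M [lM bM hM]] := tmap_l K' r0 lF bF.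
have [N [lN bN hN]] := tmap_l H s0 lG bG.
have [f [g [if_ ig _ _ hf]]] := tflip_ex H K.
have [f' [g' [if' ig' fg' gf' hf']]] := tflip_ex H K'.
exists (M \o g' \o N \o f); split.
- by move=> a x y /=; rewrite if_.1 lN ig'.1 lM.
- move=> x /=; rewrite -mulrA; apply: le_trans (bM _) _; rewrite ler_wpM2l //.
  have := isometric_bd ig' (N (f x)); rewrite mul1r => /le_trans; apply.
  apply: le_trans (bN _) _; rewrite ler_wpM2l //.
  by have := isometric_bd if_ x; rewrite mul1r.
by move=> x k /=; rewrite hf hN -hf' fg' hM.
Qed.

Lemma tmap_blin (H H' K K' : hilbert R) (F : H -> H') (G : K -> K') : blin F -> blin G ->
  exists2 M : H ** K -> H' ** K', blin M & forall x k, M (tn x k) = tn (F x) (G k).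
Proof.
move=> [lF [r r0 bF]] [lG [s s0 bG]].
have [M [lM bM hM]] := tmap_ex r0 s0 lF lG bF bG.
by exists M => //; split=> //; exists (r * s) => //; rewrite mulr_ge0.
Qed.

Section Otens.
Variables (H K : hilbert R).
Implicit Types (x y : op H) (u w : op K).

Lemma otensP x u : bop H x -> bop K u ->
  bop (H ** K) (ot x u) /\ forall a b, ot x u (tn a b) = tn (x a) (u b).
Proof.
move=> /bopE bx /bopE bu; have [M bM hM] := tmap_blin bx bu.
apply: (@xgetPex _ (fun=> 0) [set z | bop _ z /\
    forall a b, z (tens (T H K) a b) = tens (T H K) (x a) (u b)]).
by exists M; split=> //; apply/bopE.
Qed.

Lemma bop_otens x u : bop H x -> bop K u -> bop (H ** K) (ot x u).
Proof. by move=> bx bu; case: (otensP bx bu). Qed.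

Lemma otensE x u : bop H x -> bop K u -> forall a b, ot x u (tn a b) = tn (x a) (u b).
Proof. by move=> bx bu; case: (otensP bx bu). Qed.

Lemma op_tn_ext (z z' : op (H ** K)) : bop _ z -> bop _ z' ->
  (forall a b, z (tn a b) = z' (tn a b)) -> z = z'.
Proof.
move=> /bopE bz /bopE bz' h; by apply: (lin_total_ext (@tn_total H K)) => // -[a b]; exact: h.
Qed.

Lemma op_tn_ext2 (z z' : op (H ** K)) : bop _ z -> bop _ z' ->
  (forall a k b l, ip (z (tn a k)) (tn b l) = ip (z' (tn a k)) (tn b l)) -> z = z'.
Proof.
move=> /bopE bz /bopE bz' h.
by apply: (bilin_total (@tn_total H K) (@tn_total H K)) => // -[a k] [b l]; exact: h.
Qed.

Lemma otens_bd x u (r s : R) : bop H x -> bop K u -> 0 <= r -> 0 <= s ->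
  bd r x -> bd s u -> bd (r * s) (ot x u).
Proof.
move=> bx bu r0 s0 hx hu; have [M [lM bM hM]] := tmap_ex r0 s0 (bop_lin bx) (bop_lin bu) hx hu.
suff -> : ot x u = M by [].
apply: op_tn_ext => [||a b]; [exact: bop_otens | | by rewrite otensE // hM].
by apply/bopE; split=> //; exists (r * s) => //; rewrite mulr_ge0.
Qed.

Lemma otens_id : ot (id : op H) (id : op K) = id.
Proof.
apply: op_tn_ext; rewrite ?otensE; try by [exact: bop_id | apply: bop_otens; exact: bop_id].
by move=> a b; rewrite otensE //; exact: bop_id.
Qed.

Lemma otens_comp x y u w : bop H x -> bop H y -> bop K u -> bop K w ->
  ot (x \o y) (u \o w) = ot x u \o ot y w.
Proof.
move=> bx by_ bu bw; apply: op_tn_ext.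
- by apply: bop_otens; apply: bop_comp.
- by apply: bop_comp; apply: bop_otens.
- by move=> a b; rewrite /= !otensE //; apply: bop_comp.
Qed.

Lemma otens_adj x u : bop H x -> bop K u -> adj (ot x u) = ot (adj x) (adj u).
Proof.
move=> bx bu; apply: op_tn_ext2.
- by apply: bop_adj; apply: bop_otens.
- by apply: bop_otens; apply: bop_adj.
move=> a k b l; rewrite adjE; last exact: bop_otens.
by rewrite !otensE //; [rewrite !tens_ip !adjE | apply: bop_adj | apply: bop_adj].
Qed.

Lemma otens_lcomb_l a x y u : bop H x -> bop H y -> bop K u ->
  ot (a *: x + y) u = a *: ot x u + ot y u.
Proof.
move=> bx by_ bu; apply: op_tn_ext.
- by apply: bop_otens => //; apply: bop_lcomb.
- by apply: bop_lcomb; apply: bop_otens.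
move=> b k; rewrite otensE //; last exact: bop_lcomb.
rewrite -[RHS]/(a *: ot x u (tn b k) + ot y u (tn b k)) !otensE //.
by rewrite -tens_linear_l.
Qed.

End Otens.

(** * Slices by vector functionals *)

Section Slices.
Variables (H K : hilbert R) (X : op (H ** K)).
Hypothesis bX : bop _ X.

Lemma slice_form_ex (r : R) : 0 <= r -> bd r X -> forall k l : K,
  [/\ bop H (op_of_form (fun a b => ip (X (tn a k)) (tn b l))),
      bd (r * nr k * nr l) (op_of_form (fun a b => ip (X (tn a k)) (tn b l))) &
      forall a b : H, ip (op_of_form (fun a b => ip (X (tn a k)) (tn b l)) a) b =
        ip (X (tn a k)) (tn b l)].
Proof.
move=> r0 br k l; apply: op_of_form_rep.
- by rewrite !mulr_ge0 ?nr_ge0.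
- by move=> a x y z; rewrite tens_linear_l (bop_lin bX) ipDl ipZl.
- by move=> a x y z; rewrite tens_linear_l ipDr ipZr.
move=> x y; apply: le_trans (bd_ip br _ _) _; rewrite !tn_nr.
have -> : r * (nr x * nr k) * (nr y * nr l) = r * nr k * nr l * nr x * nr y by ring.
by [].
Qed.

Lemma slice_form_ex' (r : R) : 0 <= r -> bd r X -> forall a b : H,
  [/\ bop K (op_of_form (fun k l => ip (X (tn a k)) (tn b l))),
      bd (r * nr a * nr b) (op_of_form (fun k l => ip (X (tn a k)) (tn b l))) &
      forall k l : K, ip (op_of_form (fun k l => ip (X (tn a k)) (tn b l)) k) l =
        ip (X (tn a k)) (tn b l)].
Proof.
move=> r0 br a b; apply: op_of_form_rep.
- by rewrite !mulr_ge0 ?nr_ge0.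
- by move=> c x y z; rewrite tens_linear_r (bop_lin bX) ipDl ipZl.
- by move=> c x y z; rewrite tens_linear_r ipDr ipZr.
move=> x y; apply: le_trans (bd_ip br _ _) _; rewrite !tn_nr.
have -> : r * (nr a * nr x) * (nr b * nr y) = r * nr a * nr b * nr x * nr y by ring.
by [].
Qed.

Lemma slice_r_vfun k l :
  slice_r (vfun k l) X = op_of_form (fun a b => ip (X (tn a k)) (tn b l)).
Proof.
have /bopE[_ [r r0 br]] := bX.
rewrite /slice_r; congr op_of_form; apply/funext => a; apply/funext => b.
by rewrite /vfun; have [_ _ ->] := slice_form_ex' r0 br a b.
Qed.

Lemma slice_l_vfun a b :
  slice_l (vfun a b) X = op_of_form (fun k l => ip (X (tn a k)) (tn b l)).
Proof.
have /bopE[_ [r r0 br]] := bX.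
rewrite /slice_l; congr op_of_form; apply/funext => k; apply/funext => l.
by rewrite /vfun; have [_ _ ->] := slice_form_ex r0 br k l.
Qed.

Lemma bop_slice_r k l : bop H (slice_r (vfun k l) X).
Proof.
have /bopE[_ [r r0 br]] := bX.
by rewrite slice_r_vfun; case: (slice_form_ex r0 br k l).
Qed.

Lemma bop_slice_l a b : bop K (slice_l (vfun a b) X).
Proof.
have /bopE[_ [r r0 br]] := bX.
by rewrite slice_l_vfun; case: (slice_form_ex' r0 br a b).
Qed.

Lemma slice_rE k l a b : ip (slice_r (vfun k l) X a) b = ip (X (tn a k)) (tn b l).
Proof.
have /bopE[_ [r r0 br]] := bX.
by rewrite slice_r_vfun; case: (slice_form_ex r0 br k l).
Qed.

Lemma slice_lE a b k l : ip (slice_l (vfun a b) X k) l = ip (X (tn a k)) (tn b l).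
Proof.
have /bopE[_ [r r0 br]] := bX.
by rewrite slice_l_vfun; case: (slice_form_ex' r0 br a b).
Qed.

Lemma slice_r_bd (r : R) k l : 0 <= r -> bd r X -> bd (r * nr k * nr l) (slice_r (vfun k l) X).
Proof. by move=> r0 br; rewrite slice_r_vfun; case: (slice_form_ex r0 br k l). Qed.

Lemma slice_l_bd (r : R) a b : 0 <= r -> bd r X -> bd (r * nr a * nr b) (slice_l (vfun a b) X).
Proof. by move=> r0 br; rewrite slice_l_vfun; case: (slice_form_ex' r0 br a b). Qed.

Lemma ip_slice k l a b :
  ip (slice_r (vfun k l) X a) b = ip (slice_l (vfun a b) X k) l.
Proof. by rewrite slice_rE slice_lE. Qed.

End Slices.

(* [P (x) 1] on a space [Z] presented as a tensor product of [H], [K] and [L]. *)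
Section Amp.
Variables (H K L Z : hilbert R) (j : H -> K -> L -> Z).
Hypothesis gram_j : forall a k l a' k' l',
  ip (j a k l) (j a' k' l') = ip a a' * ip k k' * ip l l'.
Hypothesis total_j : total (fun p : H * K * L => j p.1.1 p.1.2 p.2).

Lemma tn3_total : total (fun p : H * K * L => tens (T _ L) (tens (T H K) p.1.1 p.1.2) p.2).
Proof.
move=> z hz; apply: (total_tn (@tn_total H K) (w := @id L)).
  by move=> y hy; apply: ip_eq0; exact: hy.
by move=> p; exact: (hz p).
Qed.

Lemma amp_ex : exists (A : op (H ** K) -> op Z) (J : L -> H ** K -> Z),
  [/\ forall l, blin (J l),
      (forall l a k, J l (tn a k) = j a k l) /\
      (forall l l' s t, ip (J l s) (J l' t) = ip s t * ip l l'),
      forall P, bop _ P -> bop _ (A P) /\ (forall r, 0 <= r -> bd r P -> bd r (A P)),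
      forall P l s, bop _ P -> A P (J l s) = J l (P s) &
      A id = id /\ (forall P Q, bop _ P -> bop _ Q -> A (P \o Q) = A P \o A Q) /\
      (forall P, bop _ P -> adj (A P) = A (adj P))].
Proof.
have [F [G [iF iG FG GF hF]]] := gram_unitary total_j tn3_total
  (fun x y => etrans (tens_ip _ _ _ _ _) (etrans (congr1 ( *%R^~ _) (tens_ip _ _ _ _ _)) (esym (gram_j _ _ _ _ _ _)))).
have lG := isometric_blin iG; have lF := isometric_blin iF.
have FGip x y : ip (F x) y = ip x (G y) by rewrite -[y in LHS]GF iF.2.
exists (fun P => G \o ot P (id : op L) \o F), (fun l s => G (tn s l)); split.
- by move=> l; apply: (blin_comp lG); exact: blin_tnl.
- split=> [l a k|l l' s t]; first by rewrite -(hF (a, k, l)) FG.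
  by rewrite iG.2 tens_ip.
- move=> P bP; have bid := @bop_id _ L; split.
    apply/bopE; apply: blin_comp => //; apply: blin_comp => //.
    by apply/bopE; apply: bop_otens.
  move=> r r0 br x /=; have := isometric_bd iG (ot P id (F x)); rewrite mul1r.
  move=> /le_trans; apply.
  have b1 : bd 1 (id : op L) by move=> y; rewrite mul1r.
  have := otens_bd bP bid r0 ler01 br b1 (F x); rewrite mulr1.
  move=> /le_trans; apply.
  by rewrite ler_wpM2l //; have := isometric_bd iF x; rewrite mul1r.
- by move=> P l s bP /=; rewrite GF otensE //; exact: bop_id.
split; first by apply/funext => x /=; rewrite otens_id FG.
have bid := @bop_id _ L.
split=> [P Q bP bQ|P bP].
  by apply/funext => x /=; rewrite GF (otens_comp bP bQ bid bid).
apply: adj_uniq.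
  apply/bopE; apply: blin_comp => //; apply: blin_comp => //.
  by apply/bopE; apply: bop_otens => //; exact: bop_adj.
move=> x y /=; have GFip u : ip (G u) y = ip u (F y) by rewrite ipC -FGip -ipC.
rewrite GFip -FGip -[X in ot _ X]adj_id -otens_adj // adjE //.
exact: bop_otens.
Qed.

End Amp.

(** Lets an identity checked on elementary tensors be used at vectors such as [U (tn a k)], which
    are not elementary. *)
Lemma ip_tn_ext (H K H' K' L L' : hilbert R) (F : H ** K -> L) (G : H' ** K' -> L)
    (F' : H ** K -> L') (G' : H' ** K' -> L') : blin F -> blin G -> blin F' -> blin G' ->
  (forall a k a' k', ip (F (tn a k)) (G (tn a' k')) = ip (F' (tn a k)) (G' (tn a' k'))) ->
  forall s t, ip (F s) (G t) = ip (F' s) (G' t).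
Proof.
move=> bF bG bF' bG' h s t.
have [bg gE _] := madjP bG; have [bg' gE' _] := madjP bG'.
rewrite -gE -gE'; congr (ip _ t); rewrite -[LHS]/((madj G \o F) s) -[RHS]/((madj G' \o F') s).
suff -> : madj G \o F = madj G' \o F' by [].
apply: (bilin_total (@tn_total H K) (@tn_total H' K')); try exact: blin_comp.
by case=> a k [a' k'] /=; rewrite gE gE'.
Qed.

Lemma ip_tn_ext1 (H K L L' : hilbert R) (F : H ** K -> L) (F' : H ** K -> L') y y' :
  blin F -> blin F' ->
  (forall a k, ip (F (tn a k)) y = ip (F' (tn a k)) y') ->
  forall s, ip (F s) y = ip (F' s) y'.
Proof.
move=> bF bF' h s.
have [_ gE gEr] := madjP bF; have [_ gE' gEr'] := madjP bF'.
rewrite -gEr -gEr'; congr (ip s _); apply: tn_ext => a k.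
by rewrite ipC gEr h -gEr' -ipC.
Qed.

(** * Leg notation on triple tensor products *)

Section Legs.
Variables (H K : hilbert R).
Local Notation Z := ((H ** H) ** K).
Implicit Types (U V : op (H ** K)).

(** [J b] inserts [b] in the middle leg and intertwines [U] with [leg13 U], so computations with
    [leg13] stay on [H (x) K], even at vectors that are not elementary. *)
Lemma leg13_ex : exists (J : H -> H ** K -> Z),
  [/\ forall b, blin (J b), forall b a k, J b (tn a k) = tn (tn a b) k &
      forall U, bop _ U ->
      [/\ bop _ (leg13 U), forall b s, leg13 U (J b s) = J b (U s),
          adj (leg13 U) = leg13 (adj U) &
          forall r, 0 <= r -> bd r U -> bd r (leg13 U)]].
Proof.
have [||A [J [bJ [hJ iJ] bA AJ [Aid [Ac Aadj]]]]] :=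
  @amp_ex H K H Z (fun a k b => tn (tn a b) k).
- by move=> *; rewrite !tens_ip mulrAC.
- by move=> z hz; apply: tn3_total => -[[a b] k]; exact: (hz (a, k, b)).
have LA U : bop _ U -> leg13 U = A U.
  move=> bU; rewrite /leg13; apply: xget_unique.
    split; first by case: (bA U bU).
    by move=> a b k a' b' k'; rewrite -!hJ AJ // iJ mulrC.
  move=> Y [bY hY]; have [/bopE bAU _] := bA U bU; move/bopE: bY => bY.
  apply: (bilin_total (@tn3_total H H K) (@tn3_total H H K)) => // -[[a b] k] [[a' b'] k'] /=.
  by rewrite hY -!hJ AJ // iJ mulrC.
exists J; split=> // U bU; rewrite !LA //; last exact: bop_adj.
by have [? h] := bA U bU; split=> // *; rewrite ?AJ ?Aadj //; apply: h.
Qed.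

Lemma leg23_ex : exists (J : H -> H ** K -> Z),
  [/\ forall a, blin (J a), forall a b k, J a (tn b k) = tn (tn a b) k &
      forall U, bop _ U ->
      [/\ bop _ (leg23 U), forall a s, leg23 U (J a s) = J a (U s),
          adj (leg23 U) = leg23 (adj U) &
          forall r, 0 <= r -> bd r U -> bd r (leg23 U)]].
Proof.
have [||A [J [bJ [hJ iJ] bA AJ [Aid [Ac Aadj]]]]] :=
  @amp_ex H K H Z (fun b k a => tn (tn a b) k).
- by move=> a k l a' k' l'; rewrite !tens_ip; ring.
- by move=> z hz; apply: tn3_total => -[[a b] k]; exact: (hz (b, k, a)).
have LA U : bop _ U -> leg23 U = A U.
  move=> bU; rewrite /leg23; apply: xget_unique.
    split; first by case: (bA U bU).
    by move=> a b k a' b' k'; rewrite -!hJ AJ // iJ mulrC.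
  move=> Y [bY hY]; have [/bopE bAU _] := bA U bU; move/bopE: bY => bY.
  apply: (bilin_total (@tn3_total H H K) (@tn3_total H H K)) => // -[[a b] k] [[a' b'] k'] /=.
  by rewrite hY -!hJ AJ // iJ mulrC.
exists J; split=> // U bU; rewrite !LA //; last exact: bop_adj.
by have [? h] := bA U bU; split=> // *; rewrite ?AJ ?Aadj //; apply: h.
Qed.

Lemma bop_leg13 U : bop _ U -> bop _ (leg13 U).
Proof. by have [J [_ _ h]] := leg13_ex; case/h. Qed.

Lemma bop_leg23 U : bop _ U -> bop _ (leg23 U).
Proof. by have [J [_ _ h]] := leg23_ex; case/h. Qed.

Lemma contr_l_slice U b b' k : bop _ U ->
  contr_l b' (U (tn b k)) = slice_l (vfun b b') U k.
Proof. by move=> bU; apply: ip_extr => l; rewrite contr_lE slice_lE. Qed.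

Lemma contr_l_adj_slice U a a' k : bop _ U ->
  contr_l a (adj U (tn a' k)) = adj (slice_l (vfun a a') U) k.
Proof.
move=> bU; apply: ip_extr => l; rewrite contr_lE adjE // adjE; last exact: bop_slice_l.
by rewrite ipC [RHS]ipC slice_lE.
Qed.

Lemma contr_r_slice U a k l : bop _ U ->
  contr_r l (U (tn a k)) = slice_r (vfun k l) U a.
Proof. by move=> bU; apply: ip_extr => b; rewrite contr_rE slice_rE. Qed.

Lemma contr_r_adj_slice U a k l : bop _ U ->
  contr_r k (adj U (tn a l)) = adj (slice_r (vfun k l) U) a.
Proof.
move=> bU; apply: ip_extr => b; rewrite contr_rE adjE // adjE; last exact: bop_slice_r.
by rewrite ipC [RHS]ipC slice_rE.
Qed.

Lemma slice_adj U k l : bop _ U ->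
  slice_r (vfun k l) (adj U) = adj (slice_r (vfun l k) U).
Proof.
move=> bU; apply: bop_ext => x y; rewrite slice_rE; last exact: bop_adj.
rewrite adjE // adjE; last exact: bop_slice_r.
by rewrite ipC [RHS]ipC slice_rE.
Qed.

(** Moving the first factor to the other side leaves one vector with [a] in leg one and one with
    [b'] in leg two; contracting these legs gives two slices acting on [K]. This is the bridge
    between products of slices and [U_13 V_23]. *)
Lemma leg_formula U V a b k a' b' k' : bop _ U -> bop _ V ->
  ip (leg13 U (leg23 V (tn (tn a b) k))) (tn (tn a' b') k') =
  ip (slice_l (vfun a a') U (slice_l (vfun b b') V k)) k'.
Proof.
move=> bU bV.
have [J [bJ hJ LJ]] := leg13_ex; have [I [bI hI LI]] := leg23_ex.
have [bL1 L1 L1a _] := LJ U bU; have [bL2 L2 _ _] := LI V bV.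
have [_ L3 _ _] := LJ _ (bop_adj bU).
rewrite -hI L2 -hJ -[LHS]adjEr // L1a L3.
have cross := @ip_tn_ext H K H K _ _ (I a) (J b') (contr_l b') (contr_l a).
rewrite cross //; try exact: blin_contr_l.
  by rewrite contr_l_slice // contr_l_adj_slice // adjEr //; exact: bop_slice_l.
by move=> b1 k1 a1 k1'; rewrite hI hJ !contr_l_tn !tens_ip ipZl ipZr -ipC; ring.
Qed.

(** Reduces commutation with [leg13 U] to commutation with the elementary tensors [U_kl (x) 1]. *)
Lemma leg13_slice U (z z' : H ** H) k l : bop _ U ->
  ip (leg13 U (tn z k)) (tn z' l) = ip (ot (slice_r (vfun k l) U) id z) z'.
Proof.
move=> bU; have bid := @bop_id _ H.
have [J [bJ hJ LJ]] := leg13_ex; have [bL L _ _] := LJ U bU.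
have bs := bop_slice_r bU k l.
apply: (@ip_tn_ext H H H H _ _ (fun z => leg13 U (tn z k)) (fun z => tn z l)).
- by apply: (@blin_comp _ _ _ _ (leg13 U)); [exact/bopE | exact: blin_tnl].
- exact: blin_tnl.
- by apply/bopE; exact: bop_otens.
- exact: blin_id.
move=> a b a' b'; rewrite otensE // tens_ip slice_rE // -hJ L -contr_rE.
have [bm mE _] := madjP (bJ b); rewrite contr_rE.
have := @ip_tn_ext H K H K _ _ (J b) (J b') (fun s => (ip b b') *: s) id.
rewrite -hJ => ->; rewrite ?ipZl //; first by rewrite mulrC.
- split; first by move=> c x y; rewrite scalerDr !scalerA mulrC.
  by exists (nr (ip b b')); rewrite ?nr_ge0 // => x; rewrite nrZ.
- exact: blin_id.
by move=> a1 k1 a2 k2; rewrite !hJ ipZl !tens_ip; ring.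
Qed.

Lemma leg23_slice U (z z' : H ** H) k l : bop _ U ->
  ip (leg23 U (tn z k)) (tn z' l) = ip (ot id (slice_r (vfun k l) U) z) z'.
Proof.
move=> bU; have bid := @bop_id _ H.
have [J [bJ hJ LJ]] := leg23_ex; have [bL L _ _] := LJ U bU.
have bs := bop_slice_r bU k l.
apply: (@ip_tn_ext H H H H _ _ (fun z => leg23 U (tn z k)) (fun z => tn z l)).
- by apply: (@blin_comp _ _ _ _ (leg23 U)); [exact/bopE | exact: blin_tnl].
- exact: blin_tnl.
- by apply/bopE; exact: bop_otens.
- exact: blin_id.
move=> a b a' b'; rewrite otensE // tens_ip slice_rE // -hJ L.
have := @ip_tn_ext H K H K _ _ (J a) (J a') (fun s => (ip a a') *: s) id.
rewrite -hJ => ->; rewrite ?ipZl //.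
- split; first by move=> c x y; rewrite scalerDr !scalerA mulrC.
  by exists (nr (ip a a')); rewrite ?nr_ge0 // => x; rewrite nrZ.
- exact: blin_id.
by move=> a1 k1 a2 k2; rewrite !hJ ipZl !tens_ip; ring.
Qed.

End Legs.

(* [P_12 Q_13] on [H (x) (K (x) K')] *)
Section Pair.
Variables (H K K' : hilbert R).
Local Notation Z := (H ** (K ** K')).

Lemma tn3r_total : total (fun p : H * K * K' => tens (T H _) p.1.1 (tens (T K K') p.1.2 p.2)).
Proof.
move=> z hz; apply: (total_tn (v := @id H) (w := fun p : K * K' => tn p.1 p.2)).
- by move=> y hy; apply: ip_eq0; exact: hy.
- exact: tn_total.
by case=> a [k k'] /=; exact: (hz (a, k, k')).
Qed.

Lemma leg12_ex : exists (A : op (H ** K) -> op Z) (J : K' -> H ** K -> Z),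
  [/\ forall l, blin (J l), forall l a k, J l (tn a k) = tn a (tn k l),
      forall P, bop _ P -> bop _ (A P),
      forall P l s, bop _ P -> A P (J l s) = J l (P s) &
      A id = id /\ (forall P Q, bop _ P -> bop _ Q -> A (P \o Q) = A P \o A Q) /\
      (forall P, bop _ P -> adj (A P) = A (adj P))].
Proof.
have [||A [J [bJ [hJ iJ] bA AJ hA]]] := @amp_ex H K K' Z (fun a k l => tn a (tn k l)).
- by move=> *; rewrite !tens_ip mulrA.
- exact: tn3r_total.
by exists A, J; split=> // P bP; case: (bA P bP).
Qed.

Lemma leg13r_ex : exists (A : op (H ** K') -> op Z) (J : K -> H ** K' -> Z),
  [/\ forall l, blin (J l), forall l a k, J l (tn a k) = tn a (tn l k),
      forall P, bop _ P -> bop _ (A P),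
      forall P l s, bop _ P -> A P (J l s) = J l (P s) &
      A id = id /\ (forall P Q, bop _ P -> bop _ Q -> A (P \o Q) = A P \o A Q) /\
      (forall P, bop _ P -> adj (A P) = A (adj P))].
Proof.
have [||A [J [bJ [hJ iJ] bA AJ hA]]] := @amp_ex H K' K Z (fun a k l => tn a (tn l k)).
- by move=> *; rewrite !tens_ip; ring.
- by move=> z hz; apply: tn3r_total => -[[a k] k']; exact: (hz (a, k', k)).
by exists A, J; split=> // P bP; case: (bA P bP).
Qed.

End Pair.

Section Multiplicativity.
Variables (H K K' : hilbert R) (P : op (H ** K)) (Q : op (H ** K')) (S : op (H ** (K ** K'))).
Hypotheses (bP : bop _ P) (bQ : bop _ Q) (bS : bop _ S).
Hypothesis S_slice : forall k k' l l',
  slice_r (vfun (tn k k') (tn l l')) S = slice_r (vfun k l) P \o slice_r (vfun k' l') Q.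

(* [S_13 S_23 = P_13 P_23 Q_14 Q_24], which holds as [Q_14] and [P_23] commute. *)
Lemma leg_slice_mul k k' l l' :
  slice_r (vfun (tn k k') (tn l l')) (leg13 S \o leg23 S) =
  slice_r (vfun k l) (leg13 P \o leg23 P) \o slice_r (vfun k' l') (leg13 Q \o leg23 Q).
Proof.
have bcP := bop_comp (bop_leg13 bP) (bop_leg23 bP).
have bcQ := bop_comp (bop_leg13 bQ) (bop_leg23 bQ).
have bcS := bop_comp (bop_leg13 bS) (bop_leg23 bS).
apply: op_tn_ext2; try (by apply: bop_slice_r); first by apply: bop_comp; apply: bop_slice_r.
move=> xi eta xi' eta'; rewrite slice_rE //= leg_formula //.
rewrite -[RHS]adjEr; last exact: bop_slice_r.
have bSl a a' := bop_slice_l bS a a'.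
rewrite -[LHS]adjEr //.
(* [t] and [s] are the innermost vectors on both sides. The facts [E1] to [E4] write the rest as
   maps of [t] and of [s], so the identity can be checked for elementary [t] and [s], where it is
   commutativity of scalars. *)
set t := Q (tn eta k'); set s := adj P (tn xi' l).
have /bopE lP := bP; have /bopE lQ := bQ.
have /bopE lP' := bop_adj bP; have /bopE lQ' := bop_adj bQ.
have [|A bA hA] := @tmap_blin H K K' K' (fun e => contr_l eta' (P (tn e k))) id _ (@blin_id _ K').
  exact: (blin_comp (@blin_contr_l H K eta') (blin_comp lP (@blin_tnl H K k))).
have [|A' bA' hA'] := @tmap_blin H K' K K (fun e => contr_l xi (adj Q (tn e l'))) id _ (@blin_id _ K).
  exact: (blin_comp (@blin_contr_l H K' xi) (blin_comp lQ' (@blin_tnl H K' l'))).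
have [fl [_ [/isometric_blin bfl _ _ _ hfl]]] := tflip_ex K' K.
have [|B bB hB] := @tmap_blin H H K' H id (fun m => contr_r l' (Q (tn xi m))) (@blin_id _ H) _.
  exact: (blin_comp (@blin_contr_r H K' l') (blin_comp lQ (@blin_tnr H K' xi))).
have [fl' [_ [/isometric_blin bfl' _ _ _ hfl']]] := tflip_ex H H.
have [|B' bB' hB'] := @tmap_blin H H K H id (fun m => contr_r k (adj P (tn eta' m))) (@blin_id _ H) _.
  exact: (blin_comp (@blin_contr_r H K k) (blin_comp lP' (@blin_tnr H K eta'))).
have E1 : slice_l (vfun eta eta') S (tn k k') = A t.
  apply: tn_ext => m m'; rewrite -ip_slice // S_slice /=.
  rewrite (@ip_tn_ext1 _ _ _ _ A (@contr_r H K' m') (tn m m')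
    (adj (slice_r (vfun k m) P) eta') bA (@blin_contr_r H K' m')).
    by rewrite contr_r_slice // adjEr //; exact: bop_slice_r.
  move=> e n; rewrite hA tens_ip contr_lE contr_r_tn ipZl adjEr; last exact: bop_slice_r.
  by rewrite slice_rE // mulrC.
have E2 : adj (slice_l (vfun xi xi') S) (tn l l') = fl (A' s).
  apply: tn_ext => m m'; rewrite adjE // ipC -ip_slice // S_slice /= -ipC.
  rewrite (@ip_tn_ext1 _ _ _ _ (fl \o A') (@contr_r H K m) (tn m m')
    (slice_r (vfun m' l') Q xi) (blin_comp bfl bA') (@blin_contr_r H K m)).
    by rewrite contr_r_adj_slice // adjE //; exact: bop_slice_r.
  move=> e n /=; rewrite hA' hfl tens_ip contr_lE contr_r_tn ipZl adjE //.
  by rewrite [ip e _]ipC slice_rE // -ipC.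
have E3 : slice_r (vfun k' l') (leg13 Q \o leg23 Q) (tn xi eta) = fl' (B t).
  apply: tn_ext => z z'; rewrite slice_rE //= leg_formula //.
  rewrite (@ip_tn_ext1 _ _ _ _ (fl' \o B) (@contr_l H K' z') (tn z z')
    (adj (slice_l (vfun xi z) Q) l') (blin_comp bfl' bB) (@blin_contr_l H K' z')).
    by rewrite contr_l_slice // adjEr //; exact: bop_slice_l.
  move=> e n /=; rewrite hB hfl' tens_ip contr_rE contr_l_tn ipZl adjEr; last exact: bop_slice_l.
  by rewrite slice_lE // mulrC.
have E4 : adj (slice_r (vfun k l) (leg13 P \o leg23 P)) (tn xi' eta') = B' s.
  apply: tn_ext => z z'; rewrite adjE; last exact: bop_slice_r.
  rewrite ipC slice_rE //= leg_formula // -ipC.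
  rewrite (@ip_tn_ext1 _ _ _ _ B' (@contr_l H K z) (tn z z')
    (slice_l (vfun z' eta') P k) bB' (@blin_contr_l H K z)).
    by rewrite contr_l_adj_slice // adjE //; exact: bop_slice_l.
  move=> e n /=; rewrite hB' tens_ip contr_rE contr_l_tn ipZl adjE //.
  by rewrite [ip n _]ipC slice_lE // -ipC.
rewrite E1 E2 E3 E4.
apply: (@ip_tn_ext _ _ _ _ _ _ A (fl \o A') (fl' \o B) B') => //.
- exact: blin_comp.
- exact: blin_comp.
move=> a m' a' m /=; rewrite hA hA' hB hB' /= hfl hfl' !tens_ip.
rewrite contr_lE contr_lEr adjEr // contr_rE contr_rEr adjEr //.
exact: mulrC.
Qed.

End Multiplicativity.

End Tensors.

(** * Norm closures and star-homomorphisms *)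

Section Closures.
Variable R : realType.
Local Notation C := (cplx R).
Local Notation Re := (@complex.Re R).

Section Span.
Variables (V : lmodType C) (S : set V).

Definition lclosed (A : set V) := forall (a : C) x y, A x -> A y -> A (a *: x + y).

Lemma lspan_ind (P : set V) : P 0 -> lclosed P -> S `<=` P -> lspan S `<=` P.
Proof.
move=> P0 Pl SP _ [n [a [s [hs ->]]]].
by apply: big_ind => // [x y Px Py|i _]; [rewrite -[x]scale1r; apply: Pl |
  rewrite -[_ *: _]addr0; apply: Pl => //; exact: SP].
Qed.

Lemma lspan_in : S `<=` lspan S.
Proof.
move=> s Ss; exists 1%N, (fun=> 1), (fun=> s); split=> //.
by rewrite big_ord_recl big_ord0 addr0 scale1r.
Qed.

Lemma lspan0 : lspan S 0.
Proof. by exists 0%N, (fun=> 0), (fun=> 0); split=> [[]//|]; rewrite big_ord0. Qed.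

Lemma lspan_lin : lclosed (lspan S).
Proof.
move=> c _ _ [n [a [s [hs ->]]]] [m [b [t [ht ->]]]].
exists (n + m)%N, (fun i : 'I_(n + m) => match fintype.split i with inl i => c * a i | inr j => b j end),
  (fun i : 'I_(n + m) => match fintype.split i with inl i => s i | inr j => t j end); split.
  by move=> i; case: fintype.split.
rewrite big_split_ord scaler_sumr; congr (_ + _); apply: eq_bigr => i _.
  by rewrite (unsplitK (inl i)) scalerA.
by rewrite (unsplitK (inr i)).
Qed.

End Span.

Section OpClosure.
Variable H : hilbert R.
Implicit Types (A S : set (op H)) (x y : op H).

Lemma ncP S x : norm_closure S x <->
  bop H x /\ forall e : R, 0 < e -> exists2 s, S s & bd e (x - s).
Proof.
split=> -[bx h]; split=> // e e0.
  have e1 : 0 < e%:C%C :> C by rewrite ltcR.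
  have [s [Ss /opbound_bd hs]] := h _ e1; by exists s.
have [s Ss /bd_opbound hs] := h _ (Re_gt0 e0); exists s; split=> //.
by rewrite (ge0_Re (ltW e0)).
Qed.

Lemma nc_bop S x : norm_closure S x -> bop H x. Proof. by case. Qed.

Lemma bd0 r : 0 <= r -> bd r ((fun=> 0) : op H).
Proof. by move=> r0 x; rewrite nr0 mulr_ge0 ?nr_ge0. Qed.

Lemma bdB r x y : bd r (x - y) -> bd r (y - x).
Proof.
move=> h z; have := h z.
by rewrite -[(x - y) z]/(x z - y z) -[(y - x) z]/(y z - x z) nrB.
Qed.

Lemma bdD r s x y : bd r x -> bd s y -> bd (r + s) (x + y).
Proof.
move=> hx hy z; rewrite -[(x + y) z]/(x z + y z) mulrDl.
by apply: le_trans (nrD _ _) _; exact: lerD.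
Qed.

Lemma bdZ (a : C) r x : bd r x -> bd (nr a * r) (a *: x).
Proof.
move=> hx z; rewrite -[(a *: x) z]/(a *: x z) nrZ -mulrA.
by rewrite ler_wpM2l ?nr_ge0.
Qed.

Lemma nc_sub S : S `<=` bop H -> S `<=` norm_closure S.
Proof.
move=> Sb x Sx; apply/ncP; split; first exact: Sb.
by move=> e e0; exists x => //; rewrite subrr; exact: bd0 (ltW e0).
Qed.

Lemma nc_mono S S' : S `<=` S' -> norm_closure S `<=` norm_closure S'.
Proof. by move=> h x [bx hx]; split=> // e /hx[s [Ss ?]]; exists s; split=> //; exact: h. Qed.

Lemma nc_idem S : norm_closure (norm_closure S) `<=` norm_closure S.
Proof.
move=> x /ncP[bx hx]; apply/ncP; split=> // e e0.
have e1 : 0 < e / 2 by rewrite divr_gt0.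
have [y /ncP[by_ hy] xy] := hx _ e1; have [s Ss ys] := hy _ e1; exists s => //.
by rewrite -[x](subrK y) -addrA (splitr e); exact: bdD.
Qed.

Lemma nc_close S x : (bop H x) -> (forall e : R, 0 < e -> exists2 y, norm_closure S y & bd e (x - y)) ->
  norm_closure S x.
Proof. by move=> bx h; apply: nc_idem; apply/ncP. Qed.

Lemma nc_lin S : lclosed S -> lclosed (norm_closure S).
Proof.
move=> Sl a x y /ncP[bx hx] /ncP[by_ hy]; apply/ncP; split; first exact: bop_lcomb.
move=> e e0; have q : 0 < nr a + 1 by rewrite ltr_wpDl ?nr_ge0.
have e1 : 0 < e / (nr a + 1) by rewrite divr_gt0.
have [s Ss xs] := hx _ e1; have [t St yt] := hy _ e1.
exists (a *: s + t); first exact: Sl.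
have -> : a *: x + y - (a *: s + t) = a *: (x - s) + (y - t).
  by rewrite scalerBr opprD addrACA.
suff -> : e = nr a * (e / (nr a + 1)) + e / (nr a + 1) by apply: bdD => //; exact: bdZ.
by rewrite -{2}[_ / _]mul1r -mulrDl mulrCA divff ?mulr1 // gt_eqF.
Qed.

Lemma nc_mul S S' S'' : S `<=` bop H -> S' `<=` bop H -> lclosed S' ->
  (forall x y, S x -> S' y -> norm_closure S'' (x \o y)) ->
  forall x y, norm_closure S x -> norm_closure S' y -> norm_closure S'' (x \o y).
Proof.
move=> Sb Sb' _ h x y /ncP[bx hx] /ncP[by_ hy].
have /bopE[lx [r r0 br]] := bx; have /bopE[ly [s s0 bs]] := by_.
apply: nc_close; first exact: bop_comp.
(* The cap at 1 keeps [y'] bounded by [s + 1], whence the total error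
   [r * d + d * (s + d) <= d * (r + s + 1)]. *)
move=> e e0; pose d := Num.min 1 (e / (r + s + 1)).
have q : 0 < r + s + 1 by lra.
have d0 : 0 < d by rewrite lt_min ltr01 divr_gt0.
have d1 : d <= 1 by rewrite ge_min lexx.
have d2 : d * (r + s + 1) <= e by rewrite -ler_pdivlMr // ge_min lexx orbT.
have [x' Sx' hx'] := hx _ d0; have [y' Sy' hy'] := hy _ d0.
exists (x' \o y'); first exact: h.
have -> : (x \o y) - (x' \o y') = (x \o (y - y')) + ((x - x') \o y').
  apply/funext => z; rewrite -[LHS]/(x (y z) - x' (y' z)).
  rewrite -[RHS]/(x (y z - y' z) + (x (y' z) - x' (y' z))) (linB lx).
  by rewrite addrA subrK.
have by' : bd (s + d) y'.
  by rewrite -[y'](subrK y) addrC; apply: bdD => //; exact: bdB.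
apply: (@bd_le _ _ _ (r * d + d * (s + d))); first nra.
by apply: bdD; apply: bd_comp => //; exact: ltW.
Qed.

Lemma nc_adj S S' : S `<=` bop H -> (forall x, S x -> norm_closure S' (adj x)) ->
  forall x, norm_closure S x -> norm_closure S' (adj x).
Proof.
move=> Sb h x /ncP[bx hx]; apply: nc_close; first exact: bop_adj.
move=> e e0; have [s Ss xs] := hx _ e0; exists (adj s); first exact: h.
have bs := Sb _ Ss.
have -> : adj x - adj s = adj (x - s).
  have -> : x - s = (-1) *: s + x by rewrite scaleN1r addrC.
  by rewrite (adj_lcomb _ bs bx) cjN cj1 scaleN1r addrC.
by apply: bd_adj => //; [exact: bopB | exact: ltW].
Qed.

Lemma op_complete (u : nat -> op H) : (forall n, bop H (u n)) ->
  (forall e : R, 0 < e -> exists N, forall m n, (N <= m)%N -> (N <= n)%N -> bd e (u m - u n)) ->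
  exists2 y, bop H y & forall e : R, 0 < e -> exists N, forall n, (N <= n)%N -> bd e (u n - y).
Proof.
move=> bu cu.
have ex (x : H) : exists z, forall e : R, 0 < e -> exists N, forall n, (N <= n)%N -> nr (u n x - z) <= e.
  apply: hilbert_complete => e e0.
  have q : 0 < nr x + 1 by rewrite ltr_wpDl ?nr_ge0.
  have [N hN] := cu _ (divr_gt0 e0 q); exists N => m n hm hn.
  have := hN m n hm hn x; rewrite -[(u m - u n) x]/(u m x - u n x).
  move=> /le_trans; apply; rewrite mulrAC ler_pdivrMr // ler_pM2l // lerDl.
  by [].
have [y hy] := choice ex.
have lim e : 0 < e -> exists N, forall n, (N <= n)%N -> bd e (u n - y).
  move=> e0; have [N hN] := cu _ e0; exists N => n hn x.
  rewrite -[(u n - y) x]/(u n x - y x); apply/ler_addgt0Pr => d d0.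
  have [M hM] := hy x _ d0; pose m := maxn N M.
  rewrite -[u n x](subrK (u m x)) -addrA; apply: le_trans (nrD _ _) _.
  rewrite lerD ?hM ?leq_maxr //.
  exact: (hN n m hn (leq_maxl _ _) x).
have ly : lin y.
  move=> a x z; apply/eqP; rewrite -subr_eq0; apply/eqP/nr_small => e e0.
  pose M := nr (a *: x + z) + nr a * nr x + nr z + 1.
  have := nr_ge0 (a *: x + z); have := nr_ge0 z.
  have := mulr_ge0 (nr_ge0 a) (nr_ge0 x) => h1 h2 h3.
  have M0 : 0 < M by rewrite /M; lra.
  have d0 : 0 < e / M by rewrite divr_gt0.
  have [N hN] := lim _ d0; have h := hN N (leqnn N).
  have /bopE[lu _] := bu N.
  have -> : y (a *: x + z) - (a *: y x + y z) =
     a *: (u N - y) x + (u N - y) z - (u N - y) (a *: x + z).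
    rewrite -[(u N - y) x]/(u N x - y x) -[(u N - y) z]/(u N z - y z).
    rewrite -[(u N - y) (_ + _)]/(u N _ - y _) lu.
    by rewrite scalerBr [(a *: u N x - _) + _]addrACA -opprD opprB [RHS]addrC addrA subrK.
  have k1 := h x; have k2 := h z; have k3 := h (a *: x + z).
  apply: le_trans (nrD _ _) _; rewrite nrN.
  have k4 := nrD (a *: (u N - y) x) ((u N - y) z); rewrite nrZ in k4.
  have k5 := ler_wpM2l (nr_ge0 a) k1.
  have : e = e / M * M by rewrite divfK // gt_eqF.
  move: k2 k3 k4 k5 d0; rewrite /M; set q := e / _ => k2 k3 k4 k5 d0 ->.
  nra.
exists y => //; apply/bopE; split=> //.
have [N hN] := lim _ ltr01; have /bopE[_ [r r0 br]] := bu N.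
exists (r + 1); first by lra.
have := hN N (leqnn N); move=> /bdB h.
by rewrite -[y](subrK (u N)) addrC; exact: bdD.
Qed.

End OpClosure.

Section Contractive.
Variables (H K : hilbert R) (A : set (op H)) (p : op H -> op K) (e : op H).
Hypotheses (cA : cstar_algebra A) (hp : star_hom A p).
Hypotheses (Ae : A e) (unit_e : forall a, A a -> e \o a = a /\ a \o e = a).

Lemma unit_selfadj : adj e = e.
Proof.
have be := cstar_bop cA Ae; have [h _] := unit_e (cstar_adj cA Ae).
by rewrite -[RHS](adjK be) -[in RHS]h adj_comp ?adjK // ?h //; exact: bop_adj.
Qed.

(* The square root of [e - x], obtained by iterating [y |-> (x + y^2) / 2]. *)
Lemma sqrt_sub x (r : R) : A x -> adj x = x -> 0 <= r < 1 -> bd r x ->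
  exists z, [/\ A z, adj z = z & z \o z = e - x].
Proof.
move=> Ax sx /andP[r0 r1] bx.
pose h : C := (2^-1)%:C%C.
have nh : nr h = 2^-1 by rewrite nr_real // invr_ge0.
have ch : h^* = h by exact: cj_real.
have h2 (w : op H) : h *: (w + w) = w.
  by rewrite -mulr2n -scaler_nat scalerA /h fmorphV rmorph_nat mulVf ?scale1r // pnatr_eq0.
pose f (y : op H) := h *: (x + (y \o y)).
pose u n := iter n f (fun=> 0).
have A0 := cstar0 cA.
have AD a b : A a -> A b -> A (a + b) by move=> ? ?; rewrite -[a]scale1r; apply: (cstar_linear cA).
have AZ c a : A a -> A (c *: a).
  by move=> ?; rewrite -[_ *: _]addr0; apply: (cstar_linear cA).
have AB a b : A a -> A b -> A (a - b) by move=> ? ?; rewrite -scaleN1r; apply: AD => //; exact: AZ.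
have bA := cstar_bop cA.
have Af y : A y -> A (f y).
  by move=> Ay; apply/AZ/AD => //; exact: (cstar_mul cA).
have Au n : A (u n) by elim: n => //= n; exact: Af.
have bf y : bop H y -> bd r y -> bd r (f y).
  move=> by_ hy; have -> : r = 2^-1 * (r + r) by field.
  rewrite -nh; apply/bdZ/bdD => //; apply: (@bd_le _ _ _ (r * r)); first nra.
  exact: bd_comp.
have bu n : bd r (u n).
  by elim: n => [|n IH] /=; [exact: bd0 | apply: bf => //; exact/bA/Au].
have adjD a b : A a -> A b -> adj (a + b) = adj a + adj b.
  by move=> /bA ba /bA bb; rewrite -[a]scale1r adj_lcomb // cj1 !scale1r.
have adjZ c a : A a -> adj (c *: a) = c^* *: adj a.
  move=> /bA ba; rewrite -[c *: a]addr0 (adj_lcomb _ ba (@bop0 _ H)).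
  by rewrite adj0 addr0.
have sf y : A y -> adj y = y -> adj (f y) = f y.
  move=> Ay sy; have Ayy := cstar_mul cA Ay Ay.
  have b1 := bA _ Ay; have e1 : adj (y \o y) = y \o y by rewrite (adj_comp b1 b1) sy.
  by rewrite /f (adjZ _ _ (AD _ _ Ax Ayy)) (adjD _ _ Ax Ayy) ch sx e1.
have su n : adj (u n) = u n by elim: n => [|n IH] /=; [exact: adj0 | exact: sf].
(* From [a^2 - b^2 = a (a - b) + (a - b) b], valid without commutation, the iteration contracts by
   the factor [r] on the ball of radius [r]. *)
have step a b d : A a -> A b -> bd r a -> bd r b -> 0 <= d -> bd d (a - b) -> bd (r * d) (f a - f b).
  move=> Aa Ab ra rb d0 hd.
  have -> : f a - f b = h *: ((a \o (a - b)) + ((a - b) \o b)).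
    rewrite /f -scalerBr opprD addrACA subrr add0r; congr (_ *: _).
    apply/funext => z; rewrite -[LHS]/(a (a z) - b (b z)).
    rewrite -[RHS]/(a (a z - b z) + (a (b z) - b (b z))) (linB (bop_lin (bA _ Aa))).
    by rewrite addrA subrK.
  have -> : r * d = 2^-1 * (r * d + d * r) by field.
  by rewrite -nh; apply/bdZ/bdD; exact: bd_comp.
have du n : bd (r ^+ n * r) (u n.+1 - u n).
  elim: n => [|n IH]; last by rewrite exprS -mulrA; apply: (step _ _ _ (Au n.+1) (Au n) (bu n.+1) (bu n) _ IH); rewrite mulr_ge0 // exprn_ge0.
  rewrite expr0 mul1r /= [X in _ - X](_ : _ = 0) // subr0; exact: (bu 1%N).
have q : 0 < 1 - r by lra.
have dmn m n : (m <= n)%N -> bd (r ^+ m / (1 - r)) (u n - u m).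
  move=> mn; apply: (@bd_le _ _ _ ((r ^+ m - r ^+ n) / (1 - r))).
    by rewrite ler_pM2r ?invr_gt0 // lerBlDr lerDl exprn_ge0.
  elim: n mn => [|n IH]; first by rewrite leqn0 => /eqP ->; rewrite !subrr mul0r; exact: bd0.
  rewrite leq_eqVlt => /predU1P[->|mn]; first by rewrite !subrr mul0r; exact: bd0.
  rewrite -[u n.+1](subrK (u n)) -addrA.
  apply: (@bd_le _ _ _ (r ^+ n * r + (r ^+ m - r ^+ n) / (1 - r))); last exact: bdD (du n) (IH mn).
  rewrite exprSr; set w := r ^+ n; have w0 : 0 <= w by rewrite exprn_ge0.
  rewrite -(ler_pM2r q) mulrDl !divfK ?gt_eqF //.
  by have := mulr_ge0 w0 (sqr_ge0 (1 - r)); move: (r ^+ m) => v; nra.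
have rlim (d : R) : 0 < d -> exists N, forall n, (N <= n)%N -> r ^+ n / (1 - r) <= d.
  move=> d0; have dq : 0 < d * (1 - r) by rewrite mulr_gt0.
  have := @cvg_expr R r; rewrite ger0_norm // => /(_ r1) /cvgrPdist_le /(_ _ dq)[N _ hN].
  exists N => n /hN /=; rewrite sub0r normrN ger0_norm ?exprn_ge0 // => ?.
  by rewrite ler_pdivrMr.
have [|y by_ hy] := @op_complete H u (fun n => bA _ (Au n)).
  move=> d d0; have [N hN] := rlim _ d0; exists N => m n hm hn.
  case/orP: (leq_total m n) => mn.
    by apply: bdB; apply: bd_le (dmn _ _ mn); exact: hN.
  by apply: bd_le (dmn _ _ mn); exact: hN.
have Ay : A y.
  apply: (cstar_closed cA); apply/ncP; split=> // d d0; have [N hN] := hy _ d0.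
  by exists (u N) => //; apply: bdB; exact: hN.
have small (w : op H) : (forall d : R, 0 < d -> bd d w) -> w = 0.
  move=> hw; apply/funext => z; apply: nr_small => d d0.
  have q' : 0 < nr z + 1 by rewrite ltr_wpDl ?nr_ge0.
  have := hw _ (divr_gt0 d0 q') z => /le_trans; apply.
  by rewrite mulrAC ler_pdivrMr // ler_pM2l // lerDl.
have ry : bd r y.
  move=> z; apply/ler_addgt0Pr => d d0.
  have q' : 0 < nr z + 1 by rewrite ltr_wpDl ?nr_ge0.
  have [N hN] := hy _ (divr_gt0 d0 q').
  have := hN N (leqnn N) z; rewrite -[(u N - y) z]/(u N z - y z) nrB => k.
  rewrite -[y z](subrK (u N z)) addrC; apply: le_trans (nrD _ _) _.
  rewrite lerD ?bu //; apply: le_trans k _.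
  by rewrite mulrAC ler_pdivrMr // ler_pM2l // lerDl.
have fy : f y = y.
  apply/eqP; rewrite -subr_eq0; apply/eqP/small => d d0.
  have d2 : 0 < d / 2 by rewrite divr_gt0.
  have [N hN] := hy _ d2.
  rewrite -[f y](subrK (u N.+1)) -addrA (splitr d); apply: bdD; last exact: hN.
  have k := hN N (leqnn N).
  apply: (@bd_le _ _ _ (r * (d / 2))); first by rewrite ger_pMl ?ltW.
  apply: step => //; first exact: ltW.
  exact: bdB.
have sy : adj y = y.
  apply/eqP; rewrite -subr_eq0; apply/eqP/small => d d0.
  have d2 : 0 < d / 2 by rewrite divr_gt0.
  have [N hN] := hy _ d2; have k := hN N (leqnn N).
  rewrite -[adj y](subrK (u N)) -addrA (splitr d); apply: bdD => //.
  have -> : adj y - u N = adj (y - u N).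
    have -> : y - u N = (-1) *: u N + y by rewrite scaleN1r addrC.
    by rewrite adj_lcomb ?su ?cjN ?cj1 ?scaleN1r 1?addrC //; exact: bA.
  apply: bd_adj; [exact: bopB (by_) (bA _ (Au N)) | exact: ltW |].
  exact: bdB.
(* The fixed point satisfies [2 y = x + y^2], so [(e - y)^2 = e - 2 y + y^2 = e - x]. *)
exists (e - y); split; first exact: AB.
  rewrite -scaleN1r adjD //; last exact: AZ.
  by rewrite adjZ // cjN cj1 sy unit_selfadj.
have yy : y + y = x + (y \o y).
  by rewrite -{1 2}fy /f; move: (x + _) => w; rewrite -scalerDr h2.
have [ey ye] := unit_e Ay; have [ee _] := unit_e Ae.
apply/funext => z; rewrite -[LHS]/(e (e z - y z) - y (e z - y z)).
rewrite (linB (bop_lin (bA _ Ae))) (linB (bop_lin by_)).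
rewrite -[e (e z)]/((e \o e) z) ee -[e (y z)]/((e \o y) z) ey -[y (e z)]/((y \o e) z) ye.
rewrite -[RHS]/(e z - x z).
have k : y z + y z = x z + y (y z) := congr1 (fun w : op H => w z) yy.
have -> : x z = y z + y z - y (y z) by rewrite k addrK.
by rewrite -(addrA (y z)) [in RHS]opprD addrA.
Qed.

(** For [c' > c] the operator [e - a^* a / c'^2] is the square of a self-adjoint element [z] of [A].
    Applying [p] shows that [p(e) - p(a)^* p(a) / c'^2] is positive. This takes the place of a
    spectral argument and allows a unit [e] other than the identity operator. *)
Lemma star_hom_contractive a (c : R) : A a -> 0 <= c -> bd c a -> bd c (p a).
Proof.
move=> Aa c0 bc.
have bA := cstar_bop cA; have bP := star_hom_bop hp.
have pe_e : p e \o p e = p e by rewrite -(star_hom_mul hp) //; case: (unit_e Ae) => ->.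
have pe_s : adj (p e) = p e by rewrite -(star_hom_adj hp) // unit_selfadj.
have pe1 x : nr (p e x) <= nr x.
  have h : nr (p e x) ^+ 2 = Re (ip (p e x) x).
    by rewrite nr_ip -{1}pe_s adjE; [rewrite -[p e (p e x)]/((p e \o p e) x) pe_e ipC Re_conj | exact: bP].
  have := le_trans (Re_le_nr _) (cauchy_schwarz (p e x) x); rewrite -h expr2.
  have [->|n0] := eqVneq (nr (p e x)) 0; first by rewrite nr_ge0.
  by rewrite ler_pM2l // lt_neqAle eq_sym n0 nr_ge0.
have key (c' : R) x : c < c' -> nr (p a x) <= c' * nr x.
  move=> cc; have c'0 : 0 < c' by exact: le_lt_trans cc.
  pose s : R := (c' ^+ 2)^-1; pose y := s%:C%C *: (adj a \o a).
  have s0 : 0 < s by rewrite invr_gt0 exprn_gt0.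
  have Aaa : A (adj a \o a) by apply: (cstar_mul cA) => //; exact: (cstar_adj cA).
  have Ay : A y by rewrite /y -[_ *: _]addr0; apply: (cstar_linear cA) => //; exact: (cstar0 cA).
  have sy : adj y = y.
    rewrite /y -[_ *: _]addr0 (adj_lcomb _ (bA _ Aaa) (@bop0 _ H)) adj0 cj_real.
    by rewrite (adj_comp (bop_adj (bA _ Aa)) (bA _ Aa)) adjK //; exact: bA.
  have byr : bd (s * (c * c)) y.
    rewrite -{1}[s](@nr_real R) ?ltW //; apply/bdZ/bd_comp => //.
    by apply: bd_adj => //; exact: bA.
  have [|z [Az sz zz]] := @sqrt_sub y (s * (c * c)) Ay sy _ byr.
    rewrite mulr_ge0 ?(ltW s0) ?mulr_ge0 //= /s mulrC ltr_pdivrMr ?exprn_gt0 // mul1r expr2.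
    nra.
  have py : p y = s%:C%C *: (adj (p a) \o p a).
    have -> : y = s%:C%C *: (adj a \o a) + 0 by rewrite addr0.
    have p0 : p 0 = 0.
      have := star_hom_linear hp 1 (cstar0 cA) (cstar0 cA).
      rewrite -[(fun=> 0) : op H]/(0 : op H) scaler0 addr0 scale1r -[X in X = _]addr0.
      by move/addrI.
    rewrite (star_hom_linear hp) //; last exact: (cstar0 cA).
    by rewrite p0 addr0 (star_hom_mul hp) ?(star_hom_adj hp) //; exact: (cstar_adj cA).
  have pz : p e = (p z \o p z) + p y.
    have -> : e = 1 *: (z \o z) + y by rewrite scale1r zz subrK.
    rewrite (star_hom_linear hp) //; last exact: (cstar_mul cA).
    by rewrite scale1r (star_hom_mul hp).
  have pzs : adj (p z) = p z by rewrite -(star_hom_adj hp) // sz.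
  have h1 : Re (ip (p e x) x) <= nr x ^+ 2.
    apply: le_trans (Re_le_nr _) _; apply: le_trans (cauchy_schwarz _ _) _.
    by rewrite expr2 ler_wpM2r ?nr_ge0.
  have h2 : Re (ip (p e x) x) = nr (p z x) ^+ 2 + s * nr (p a x) ^+ 2.
    rewrite pz py -[(_ + _) x]/(p z (p z x) + s%:C%C *: adj (p a) (p a x)).
    rewrite ipDl ReD ipZl ReZ adjE; last exact: bP.
    by rewrite -nr_ip -{1}pzs adjE ?nr_ip //; exact: bP.
  have h3 : nr (p a x) ^+ 2 <= (c' * nr x) ^+ 2.
    have sc : s * c' ^+ 2 = 1 by rewrite mulVf // gt_eqF // exprn_gt0.
    rewrite exprMn.
    have -> : nr (p a x) ^+ 2 = c' ^+ 2 * (s * nr (p a x) ^+ 2).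
      by rewrite mulrA [c' ^+ 2 * s]mulrC sc mul1r.
    rewrite ler_wpM2l ?sqr_ge0 //.
    by have := sqr_ge0 (nr (p z x)); lra.
  by move: h3; rewrite ler_pXn2r ?nnegrE ?mulr_ge0 ?nr_ge0 ?(ltW c'0).
move=> x; apply/ler_addgt0Pr => d d0.
have q : 0 < nr x + 1 by rewrite ltr_wpDl ?nr_ge0.
have := key (c + d / (nr x + 1)) x; rewrite ltrDl divr_gt0 // => /(_ isT) /le_trans; apply.
rewrite mulrDl lerD2l mulrAC ler_pdivrMr // ler_pM2l // lerDl.
by [].
Qed.

End Contractive.

End Closures.

(** * Normal functionals *)

Section Normal.
Variable R : realType.
Local Notation C := (cplx R).
Local Notation Re := (@complex.Re R).

Lemma sum_tail (a : nat -> R) (B : R) : (forall n, 0 <= a n) ->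
  (forall n, \sum_(i < n) a i <= B) ->
  forall e, 0 < e -> exists N, forall n, \sum_(i < n) a i <= \sum_(i < N) a i + e.
Proof.
move=> a0 aB e e0; pose S : set R := [set \sum_(i < n) a i | n in setT].
have hS : has_sup S by split; [exists (\sum_(i < 0) a i), 0%N | exists B => _ [n _ <-]].
have [_ [N _ <-] hN] := sup_adherent e0 hS; exists N => n.
have : \sum_(i < n) a i <= sup S by apply: sup_upper_bound => //; exists n.
by move: hN; set x := sup S; lra.
Qed.

Section OneSpace.
Variable H : hilbert R.
Implicit Types (x y : nat -> H) (S U : op H) (f : op H -> C).

Definition fsum n x y : op H -> C := fun U => \sum_(i < n) ip (U (x i)) (y i).
Definition sqsum x := exists c : R, forall N, \sum_(n < N) nr (x n) ^+ 2 <= c.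

Lemma sqsumP x : square_summable x <-> sqsum x.
Proof.
have E N : \sum_(n < N) `|x n| ^+ 2 = (\sum_(n < N) nr (x n) ^+ 2)%:C%C.
  rewrite (big_morph (fun r : R => r%:C%C : C) (@rcD R) (erefl _)).
  by apply: eq_bigr => i _; rewrite nrE rcX.
split=> -[c hc].
  by exists (Re c) => N; have := Re_le (hc N); rewrite E.
by exists c%:C%C => N; rewrite E lecR.
Qed.

Definition represents x y f := forall U, bop H U -> forall e : R, 0 < e ->
  exists N, forall n, (N <= n)%N -> nr (fsum n x y U - f U) <= e.

Lemma normalP f : normal_fun H f <-> exists x y, [/\ sqsum x, sqsum y & represents x y f].
Proof.
have E x y U n : series (fun n => ip (U (x n)) (y n) : C^o) n = fsum n x y U.
  by rewrite /series /= big_mkord.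
split=> -[x [y [hx hy h]]]; exists x, y; split; try exact/sqsumP.
  move=> U bU e e0; have e1 : 0 < e%:C%C :> C by rewrite ltcR.
  have /cvgrPdist_le /(_ _ e1) [N _ hN] := h U bU; exists N => n /hN /=.
  by rewrite nrE lecR nrB E.
move=> U bU; apply/cvgrPdist_le => e e0.
have [N hN] := h U bU _ (Re_gt0 e0); exists N => // n /hN /=.
by rewrite E nrE (ge0_Re (ltW e0)) lecR nrB.
Qed.

Lemma fsum_split x y U m n : (m <= n)%N ->
  fsum n x y U - fsum m x y U = \sum_(m <= i < n) ip (U (x i)) (y i).
Proof.
move=> mn; rewrite /fsum -!(big_mkord xpredT (fun i => ip (U (x i)) (y i))).
by rewrite (@big_cat_nat _ _ _ m 0 n) //= addrAC subrr add0r.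
Qed.

Lemma fsum_cauchy x y : sqsum x -> sqsum y -> forall e : R, 0 < e ->
  exists N, forall U r m n, 0 <= r -> bd r U -> (N <= m)%N -> (m <= n)%N ->
  nr (fsum n x y U - fsum m x y U) <= e * r.
Proof.
move=> [c hc] [d hd] e e0; pose a i := nr (x i) * nr (y i).
have a0 i : 0 <= a i by rewrite mulr_ge0 ?nr_ge0.
have [|N hN] := @sum_tail a (c + d) a0 _ e e0.
  move=> n; apply: le_trans (lerD (hc n) (hd n)); rewrite -big_split /=.
  apply: ler_sum => i _; rewrite /a; have := sqr_ge0 (nr (x i) - nr (y i)).
  by have := a0 i; rewrite /a; nra.
exists N => U r m n r0 bU Nm mn; rewrite fsum_split //.
have nsum (s : seq nat) (F : nat -> C) : nr (\sum_(i <- s) F i) <= \sum_(i <- s) nr (F i).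
  elim: s => [|i s IH]; first by rewrite !big_nil nr0.
  by rewrite !big_cons; apply: le_trans (nrD _ _) _; rewrite lerD2l.
apply: le_trans (nsum _ _) _.
apply: (@le_trans _ _ (\sum_(m <= i < n) a i * r)).
  apply: ler_sum => i _; apply: le_trans (bd_ip bU _ _) _.
  by rewrite /a -mulrA mulrC.
rewrite -mulr_suml ler_wpM2r //; have := hN n.
rewrite -!(big_mkord xpredT a) (@big_cat_nat _ _ _ m 0 n) //= (@big_cat_nat _ _ _ N 0 m) //=.
have : 0 <= \sum_(N <= i < m) a i by rewrite sumr_ge0.
lra.
Qed.

(** The convergence is uniform on bounded sets of operators, because the tail of the sum of
    [nr (x i) * nr (y i)] does not involve [U]. This uniformity is what makes slices converge in
    operator norm. *)
Lemma normal_approx f : normal_fun H f -> exists x y, forall e : R, 0 < e ->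
  exists N, forall U r, 0 <= r -> bop H U -> bd r U -> nr (f U - fsum N x y U) <= e * r.
Proof.
move=> /normalP[x [y [hx hy h]]]; exists x, y => e e0.
have [N hN] := fsum_cauchy hx hy e0; exists N => U r r0 bU bUr.
apply/ler_addgt0Pr => d d0; have [M hM] := h U bU d d0.
pose n := maxn N M.
rewrite -[f U](subrK (fsum n x y U)) -addrA addrC; apply: le_trans (nrD _ _) _.
apply: lerD; first by apply: hN; rewrite ?leq_maxl.
by rewrite nrB hM ?leq_maxr.
Qed.

Lemma normal_series x y : sqsum x -> sqsum y ->
  exists2 f, normal_fun H f & represents x y f.
Proof.
move=> hx hy.
have ex U : exists z : C, bop H U -> forall e : R, 0 < e ->
    exists N, forall n, (N <= n)%N -> nr (fsum n x y U - z) <= e.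
  have [bU|] := pselect (bop H U); last by exists 0.
  have [|z hz] := @complex_complete R (fun n => fsum n x y U); last by exists z.
  move=> e e0; have /bopE[_ [r r0 br]] := bU.
  have q : 0 < r + 1 by lra.
  have [N hN] := fsum_cauchy hx hy (divr_gt0 e0 q).
  have hq : e / (r + 1) * r <= e by rewrite mulrAC ler_pdivrMr // ler_pM2l // lerDl.
  exists N => m n hm hn; apply: le_trans hq.
  case/orP: (leq_total m n) => mn; last exact: hN.
  by rewrite nrB; exact: hN.
have [f hf] := choice ex; exists f => //; apply/normalP; exists x, y; split=> //.
Qed.

(** [normal_fun] asks for infinite sequences; finite sums enter it by padding with zeros. *)
Definition cutoff n x : nat -> H := fun i => if (i < n)%N then x i else 0.

Lemma sqsum_cutoff n x : sqsum (cutoff n x).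
Proof.
exists (\sum_(i < n) nr (x i) ^+ 2) => N.
have c0 i : 0 <= nr (cutoff n x i) ^+ 2 by rewrite sqr_ge0.
have -> : \sum_(i < n) nr (x i) ^+ 2 = \sum_(i < n) nr (cutoff n x i) ^+ 2.
  by apply: eq_bigr => i _; rewrite /cutoff ltn_ord.
rewrite -!(big_mkord xpredT (fun i => nr (cutoff n x i) ^+ 2)).
case/orP: (leq_total N n) => Nn.
  by rewrite [leRHS](@big_cat_nat _ _ _ N) //= lerDl sumr_ge0.
have z : \sum_(n <= i < N) nr (cutoff n x i) ^+ 2 = 0.
  rewrite big_nat big1 // => i /andP[ni _].
  by rewrite /cutoff ltnNge ni nr0 expr0n.
by rewrite (@big_cat_nat _ _ _ n 0 N) //= z addr0.
Qed.

Lemma normal_fsum n x y : normal_fun H (fsum n x y).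
Proof.
apply/normalP; exists (cutoff n x), (cutoff n y); split; try exact: sqsum_cutoff.
move=> U bU e e0; exists n => m nm.
suff -> : fsum m (cutoff n x) (cutoff n y) U = fsum n x y U by rewrite subrr nr0 ltW.
rewrite /fsum -[LHS](big_mkord xpredT (fun i => ip (U (cutoff n x i)) (cutoff n y i))).
have z : \sum_(n <= i < m) ip (U (cutoff n x i)) (cutoff n y i) = 0.
  by rewrite big_nat big1 // => i /andP[ni _]; rewrite /cutoff ltnNge ni ip0r.
rewrite (@big_cat_nat _ _ _ n 0 m) //= z addr0.
by rewrite big_mkord; apply: eq_bigr => i _; rewrite /cutoff ltn_ord.
Qed.

Lemma normal_vfun (x y : H) : normal_fun H (vfun x y).
Proof.
have -> : vfun x y = fsum 1 (fun=> x) (fun=> y).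
  by apply/funext => U; rewrite /fsum big_ord_recl big_ord0 addr0.
exact: normal_fsum.
Qed.

Lemma fsum_lin n x y (a : C) U S : fsum n x y (a *: U + S) = a * fsum n x y U + fsum n x y S.
Proof.
rewrite /fsum mulr_sumr -big_split; apply: eq_bigr => i _ /=.
by rewrite -[(a *: U + S) _]/(a *: U (x i) + S (x i)) ipDl ipZl.
Qed.

Lemma fsum_bd n x y : exists2 c : R, 0 <= c & forall U r, bd r U -> nr (fsum n x y U) <= c * r.
Proof.
exists (\sum_(i < n) nr (x i) * nr (y i)); first by rewrite sumr_ge0 // => i _; rewrite mulr_ge0 ?nr_ge0.
move=> U r bU; rewrite /fsum mulr_suml.
elim/big_ind2: _ => [|a b c d h1 h2|i _]; first by rewrite nr0.
  by apply: le_trans (nrD _ _) _; exact: lerD.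
by apply: le_trans (bd_ip bU _ _) _; rewrite -mulrA mulrC.
Qed.

Lemma normal_lin f : normal_fun H f -> forall (a : C) U S, bop H U -> bop H S ->
  f (a *: U + S) = a * f U + f S.
Proof.
move=> /normal_approx[x [y h]] a U S bU bS.
have /bopE[_ [r r0 br]] := bU; have /bopE[_ [s s0 bs]] := bS.
apply/eqP; rewrite -subr_eq0; apply/eqP/nr_small => e e0.
pose M := nr a * r + s + nr a * r + s + 1.
have ar := mulr_ge0 (nr_ge0 a) r0.
have M0 : 0 < M by rewrite /M; lra.
have [N hN] := h _ (divr_gt0 e0 M0).
have k1 := hN _ _ r0 bU br; have k2 := hN _ _ s0 bS bs.
have k3 := hN _ (nr a * r + s) (addr_ge0 ar s0) (bop_lcomb a bU bS) (bd_lin a br bs).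
have -> : f (a *: U + S) - (a * f U + f S) =
    (f (a *: U + S) - fsum N x y (a *: U + S)) - (a * (f U - fsum N x y U) + (f S - fsum N x y S)).
  by rewrite fsum_lin; ring.
apply: le_trans (nrD _ _) _; rewrite nrN.
have k4 := nrD (a * (f U - fsum N x y U)) (f S - fsum N x y S); rewrite nrM in k4.
have k5 := ler_wpM2l (nr_ge0 a) k1.
have eM : e = e / M * M by rewrite divfK // gt_eqF.
have d0 : 0 < e / M by rewrite divr_gt0.
rewrite [leRHS]eM; move: k2 k3 k4 k5 d0; set q := e / M; rewrite /M => k2 k3 k4 k5 d0.
nra.
Qed.

Lemma normal_bd f : normal_fun H f ->
  exists2 c : R, 0 <= c & forall U r, 0 <= r -> bop H U -> bd r U -> nr (f U) <= c * r.
Proof.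
move=> /normal_approx[x [y h]]; have [N hN] := h _ ltr01.
have [c c0 hc] := fsum_bd N x y; exists (1 + c); first by lra.
move=> U r r0 bU br; rewrite -[f U](subrK (fsum N x y U)) mulrDl.
by apply: le_trans (nrD _ _) _; rewrite lerD ?hN ?hc.
Qed.

End OneSpace.

Section NormalSlice.
Context {T : tensor_choice R}.
Variables (H K : hilbert R).
Local Notation "H ** K" := (tspace (T H K)) (at level 40).
Local Notation tn := (tens (T _ _)).
Variable X : op (H ** K).
Hypothesis bX : bop _ X.

Lemma slice_r_normalE w : slice_r w X = op_of_form (fun a b => w (slice_l (vfun a b) X)).
Proof.
by rewrite /slice_r; congr op_of_form; apply/funext => a; apply/funext => b;
   rewrite slice_l_vfun.
Qed.

Lemma slice_l_sesql (a : C) x y b :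
  slice_l (vfun (a *: x + y) b) X = a *: slice_l (vfun x b) X + slice_l (vfun y b) X.
Proof.
apply: bop_ext => k l; rewrite -[(_ + _) k]/(a *: slice_l (vfun x b) X k + slice_l (vfun y b) X k).
by rewrite ipDl ipZl !slice_lE // tens_linear_l (bop_lin bX) ipDl ipZl.
Qed.

Lemma slice_l_sesqr (a : C) x y b :
  slice_l (vfun b (a *: x + y)) X = a^* *: slice_l (vfun b x) X + slice_l (vfun b y) X.
Proof.
apply: bop_ext => k l; rewrite -[(_ + _) k]/(a^* *: slice_l (vfun b x) X k + slice_l (vfun b y) X k).
by rewrite ipDl ipZl !slice_lE // tens_linear_l ipDr ipZr.
Qed.

Lemma slice_normal w : normal_fun K w ->
  bop H (slice_r w X) /\ forall a b, ip (slice_r w X a) b = w (slice_l (vfun a b) X).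
Proof.
move=> nw; have /bopE[_ [r r0 br]] := bX.
have [c c0 hc] := normal_bd nw; have lw := normal_lin nw.
have [||||bs _ hs] := @op_of_form_rep R H (fun a b => w (slice_l (vfun a b) X)) (c * r).
- exact: mulr_ge0.
- by move=> a x y b; rewrite slice_l_sesql lw //; exact: bop_slice_l.
- by move=> a x y b; rewrite slice_l_sesqr lw //; exact: bop_slice_l.
- move=> x k; rewrite -!mulrA; apply: hc.
  + by rewrite !mulr_ge0 ?nr_ge0.
  + exact: bop_slice_l.
  + by rewrite mulrA; exact: slice_l_bd.
by rewrite slice_r_normalE.
Qed.

Lemma slice_fsum n (x y : nat -> K) :
  slice_r (fsum n x y) X = \sum_(i < n) slice_r (vfun (x i) (y i)) X.
Proof.
have [bs hs] := slice_normal (normal_fsum n x y).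
apply: bop_ext => a b; rewrite hs /fsum.
have -> : (\sum_(i < n) slice_r (vfun (x i) (y i)) X) a = \sum_(i < n) slice_r (vfun (x i) (y i)) X a.
  by elim/big_rec2: _ => // i u v _ <-.
by rewrite ip_suml; apply: eq_bigr => i _; rewrite slice_lE // slice_rE.
Qed.

(** One [N] serves both the slices, in operator norm, and the functional; [lam_normal] compares the
    two. *)
Lemma slice_normal_approx w : normal_fun K w -> exists x y : nat -> K, forall e : R, 0 < e ->
  exists N, bd e (slice_r w X - \sum_(i < N) slice_r (vfun (x i) (y i)) X) /\
    forall U r, 0 <= r -> bop K U -> bd r U -> nr (w U - fsum N x y U) <= e * r.
Proof.
move=> nw; have [x [y h]] := normal_approx nw; exists x, y => e e0.
have /bopE[_ [r r0 br]] := bX.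
pose d := Num.min e (e / (r + 1)).
have q : 0 < r + 1 by lra.
have d0 : 0 < d by rewrite lt_min e0 divr_gt0.
have de : d <= e by rewrite ge_min lexx.
have dr : d * r <= e.
  apply: (@le_trans _ _ (d * (r + 1))); first by rewrite ler_wpM2l ?lerDl // ltW.
  by rewrite -ler_pdivlMr // ge_min lexx orbT.
have [N hN] := h _ d0; exists N; split; last first.
  by move=> U s s0 bU bs; apply: le_trans (hN _ _ s0 bU bs) _; rewrite ler_wpM2r.
have [bs hs] := slice_normal nw; have [bs' hs'] := slice_normal (normal_fsum N x y).
rewrite -slice_fsum; apply: ip_bd => [|a b]; first exact: ltW.
rewrite -[(_ - _) a]/(slice_r w X a - slice_r (fsum N x y) X a) ipBl hs hs'.
have br' := slice_l_bd bX a b r0 br.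
apply: le_trans (hN _ (r * nr a * nr b) _ (bop_slice_l bX a b) br') _.
  by rewrite !mulr_ge0 ?nr_ge0.
by rewrite !mulrA ler_wpM2r ?nr_ge0 // ler_wpM2r ?nr_ge0.
Qed.

End NormalSlice.

End Normal.

(** * The Hahn-Banach theorem *)

Section HahnBanach.
Variables (R : realType) (V : lmodType (cplx R)).
Local Notation rc t := (t%:C%C : cplx R).
Implicit Types (q : V -> R) (x y : V).

Definition sublin q := (forall x y, q (x + y) <= q x + q y) /\
  (forall t x, 0 <= t -> q (rc t *: x) <= t * q x).

Lemma rcscale_inv t x : t != 0 -> rc t^-1 *: (rc t *: x) = x.
Proof. by move=> t0; rewrite scalerA -rcM mulVf // scale1r. Qed.

Lemma sublin_scale q t x : sublin q -> 0 < t -> q (rc t *: x) = t * q x.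
Proof.
move=> [_ hq] t0; apply/eqP; rewrite eq_le (hq t x (ltW t0)) /=.
have := hq t^-1 (rc t *: x); rewrite rcscale_inv ?gt_eqF // invr_ge0 ltW // => /(_ isT).
by rewrite ler_pdivlMl.
Qed.

Lemma sublin0 q : sublin q -> q 0 = 0.
Proof.
move=> [h1 h2]; have := h2 0 0 (lexx _); rewrite scaler0 mul0r => k1.
by have := h1 0 0; rewrite addr0 => k2; apply/eqP; rewrite eq_le k1 /=; lra.
Qed.

Lemma sublinN q x : sublin q -> - q (- x) <= q x.
Proof. by move=> sq; have := sq.1 x (- x); rewrite subrr sublin0 // => ?; lra. Qed.

(** For fixed [y] the infimum over [t >= 0] of [q (z + t y) - t q y] is sublinear in [z] and below
    [q]. Minimality puts [q] below it, and the value at [t = 1] then gives additivity. *)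
Lemma sublin_minimal q : sublin q ->
  (forall q', sublin q' -> (forall x, q' x <= q x) -> forall x, q x <= q' x) ->
  (forall x y, q (x + y) = q x + q y) /\ forall t x, q (rc t *: x) = t * q x.
Proof.
move=> sq min.
have add x y : q (x + y) = q x + q y.
  apply/eqP; rewrite eq_le sq.1 /=.
  pose S z : set R := [set q (z + rc t *: y) - t * q y | t in [set t | 0 <= t]].
  have qt t : 0 <= t -> t * q y <= q (rc t *: y).
    rewrite le_eqVlt => /predU1P[<-|t0]; last by rewrite sublin_scale.
    by rewrite mul0r scale0r sublin0.
  have lbS z : lbound (S z) (- q (- z)).
    move=> _ [t t0 <-]; have := sq.1 (z + rc t *: y) (- z).
    by rewrite addrAC subrr add0r; have := qt t t0; lra.
  have hS z : has_inf (S z).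
    by split; [exists (q (z + rc 0 *: y) - 0 * q y), 0 => //=; exact: lexx | exists (- q (- z))].
  have le z t : 0 <= t -> inf (S z) <= q (z + rc t *: y) - t * q y.
    by move=> t0; apply: ge_inf; [case: (hS z) | exists t].
  have sS : sublin (fun z => inf (S z)).
    split=> [z z'|s z]; last first.
      rewrite le_eqVlt => /predU1P[<-|s0].
        by rewrite scale0r mul0r; have := le 0 0 (lexx _); rewrite scale0r addr0 sublin0 // mul0r subr0.
      rewrite mulrC -ler_pdivrMr //; apply: lb_le_inf; first by case: (hS z).
      move=> _ [t t0 <-]; rewrite ler_pdivrMr //.
      have := le (rc s *: z) (s * t) (mulr_ge0 (ltW s0) t0).
      by rewrite rcM -scalerA -scalerDr sublin_scale //; lra.
    apply/ler_addgt0Pr => e e0; have e1 : 0 < e / 2 by rewrite divr_gt0.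
    have [_ [t t0 <-] h1] := inf_adherent e1 (hS z).
    have [_ [t' t0' <-] h2] := inf_adherent e1 (hS z').
    have := le (z + z') (t + t') (addr_ge0 t0 t0').
    rewrite rcD scalerDl addrACA => h3.
    have := sq.1 (z + rc t *: y) (z' + rc t' *: y) => h4.
    move: h1 h2 h3 h4; lra.
  have h0 z : inf (S z) <= q z.
    by have := le z 0 (lexx _); rewrite scale0r addr0 mul0r subr0.
  have h1 := min _ sS h0 x; have := le x 1 ler01; rewrite scale1r mul1r.
  by move=> h2; have := le_trans h1 h2; lra.
split=> // t x; have qN z : q (- z) = - q z.
  by have := add z (- z); rewrite subrr sublin0 //; lra.
case: (ltgtP t 0) => [t0|t0|->]; last by rewrite scale0r mul0r sublin0.
  have -> : t = - (- t) by rewrite opprK.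
  rewrite [X in X *: _](_ : _ = - rc (- t)) ?scaleNr ?qN ?sublin_scale ?oppr_gt0 //; first by lra.
  by apply/eqP; rewrite -addr_eq0 -rcD addNr.
exact: sublin_scale.
Qed.

Lemma hahn_banach P : sublin P -> exists phi : V -> R,
  [/\ forall x y, phi (x + y) = phi x + phi y, forall t x, phi (rc t *: x) = t * phi x &
      forall x, phi x <= P x].
Proof.
move=> sP; pose Q := {q | sublin q /\ forall x, q x <= P x}.
pose rl (q q' : Q) : bool := `[< forall x, sval q' x <= sval q x >].
have [||| |q hq] := @Zorn Q rl.
- by move=> q; apply/asboolP.
- move=> a b c /asboolP h1 /asboolP h2; apply/asboolP => x.
  exact: le_trans (h2 x) (h1 x).
- move=> [a ha] [b hb] /asboolP /= h1 /asboolP /= h2.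
  have e : a = b by apply/funext => x; apply/eqP; rewrite eq_le h1 h2.
  by subst b; congr exist; exact: Prop_irrelevance.
- move=> A tA; have [[q0 Aq0]|nA] := pselect (exists q : Q, A q); last first.
    exists (exist _ P (conj sP (fun x => lexx _))) => s As.
    by exfalso; apply: nA; exists s.
  pose S x : set R := [set sval q x | q in A].
  have lb x : lbound (S x) (- P (- x)).
    move=> _ [[q [sq qP]] _ <-] /=; have := sublinN x sq; have := qP (- x); lra.
  have hS x : has_inf (S x) by split; [exists (sval q0 x), q0 | exists (- P (- x))].
  have le x (q : Q) : A q -> inf (S x) <= sval q x.
    by move=> Aq; apply: ge_inf; [case: (hS x)|exists q].
  have sS : sublin (fun x => inf (S x)).
    split=> [x y|t x t0].
      apply/ler_addgt0Pr => e e0; have e1 : 0 < e / 2 by rewrite divr_gt0.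
      have [_ [q1 A1 <-] h1] := inf_adherent e1 (hS x).
      have [_ [q2 A2 <-] h2] := inf_adherent e1 (hS y).
      have [q [Aq qq1 qq2]] : exists q : Q, [/\ A q, sval q x <= sval q1 x & sval q y <= sval q2 y].
        by case: (tA _ _ A1 A2) => /asboolP h; [exists q2 | exists q1].
      have := le (x + y) q Aq; have := (svalP q).1.1 x y.
      move: h1 h2; lra.
    move: t0; rewrite le_eqVlt => /predU1P[<-|t0].
      by rewrite scale0r mul0r; apply: le_trans (le 0 q0 Aq0) _; rewrite sublin0 //; case: (svalP q0).
    rewrite mulrC -ler_pdivrMr //; apply: lb_le_inf; first by case: (hS x).
    move=> _ [q Aq <-]; rewrite ler_pdivrMr //.
    by apply: le_trans (le _ q Aq) _; rewrite mulrC; case: (svalP q) => -[_ h] _; apply: h; exact: ltW.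
  have SP x : inf (S x) <= P x by apply: le_trans (le x q0 Aq0) _; case: (svalP q0).
  exists (exist (fun q => sublin q /\ forall x, q x <= P x) (fun x => inf (S x)) (conj sS SP)) => s As.
  by apply/asboolP => x /=; exact: le.
have [sq qP] := svalP q.
have [|ad sc] := sublin_minimal sq; last by exists (sval q).
move=> q' sq' q'q x.
have hP x' : q' x' <= P x' := le_trans (q'q x') (qP x').
have := hq (exist _ q' (conj sq' hP)); rewrite /rl asboolT // => /(_ isT) e.
by have <- : sval (exist (fun q => sublin q /\ forall x, q x <= P x) q' (conj sq' hP)) = sval q by rewrite e.
Qed.

End HahnBanach.

(** * States and the universal representation *)

Section States.
Variables (R : realType) (H : hilbert R).
Local Notation C := (cplx R).
Local Notation Re := (@complex.Re R).
Implicit Types (a b T : op H) (s : seq (op H)).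

Definition posf (phi : op H -> C) :=
  (forall (c : C) a b, bop H a -> bop H b -> phi (c *: a + b) = c * phi a + phi b) /\
  (forall a, pos_op a -> 0 <= phi a).

Section BopModule.
(** [hahn_banach] is stated for a full module, so the bounded operators are packed into one. *)
Definition bopb : {pred (H -> H)} := fun T => `[< bop H T >].
Record bops := Bops { bval : H -> H; bvalP : bval \in bopb }.
HB.instance Definition _ := [isSub for bval].
HB.instance Definition _ := gen_eqMixin bops.
HB.instance Definition _ := gen_choiceMixin bops.
Lemma bopb_closed : subsemimod_closed bopb.
Proof.
split; first by split=> [|f g /asboolP hf /asboolP hg]; apply/asboolP; [exact: bop0|exact: bopD].
by move=> c f /asboolP hf; apply/asboolP/bopZ.
Qed.
HB.instance Definition _ := GRing.SubChoice_isSubLmodule.Build C (H -> H) bopb bops bopb_closed.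
Lemma bop_val (T : bops) : bop H (bval T). Proof. exact/asboolP/bvalP. Qed.
End BopModule.

(* the supremum of the real part of the numerical range, cut off at 0 *)
Definition nrange T : R := sup [set Re (ip (T x) x) | x in [set x | nr x <= 1]].

Lemma nrange_sup T : bop H T -> has_sup [set Re (ip (T x) x) | x in [set x | nr x <= 1]].
Proof.
move=> /bopE[_ [r r0 br]]; split; first by exists (Re (ip (T 0) 0)), 0 => //=; rewrite nr0.
exists r => _ [x /= x1 <-]; apply: le_trans (Re_le_nr _) _.
apply: le_trans (bd_ip br _ _) _; rewrite -mulrA -[leRHS]mulr1 ler_wpM2l //.
by rewrite mulr_ile1 ?nr_ge0.
Qed.

Lemma nrange_ge T x : bop H T -> Re (ip (T x) x) <= nrange T * nr x ^+ 2.
Proof.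
move=> bT; have [->|x0] := eqVneq x 0; first by rewrite ip0r nr0 expr0n mulr0.
have n0 : 0 < nr x by rewrite lt_neqAle nr_ge0 eq_sym andbT; apply: contra x0 => /eqP/nr0_eq0->.
pose y := ((nr x)^-1)%:C%C *: x.
have y1 : nr y = 1 by rewrite nrZ nr_real ?invr_ge0 ?nr_ge0 // mulVf ?gt_eqF.
have : Re (ip (T y) y) <= nrange T.
  by apply: sup_upper_bound; [exact: nrange_sup | exists y => //=; rewrite y1].
rewrite /y (linZ (bop_lin bT)) ipZl ipZr cj_real !ReZ mulrA -invfM mulrC.
by rewrite ler_pdivrMr ?mulr_gt0 // -expr2.
Qed.

Lemma nrange_le T (c : R) : 0 <= c -> (forall x, Re (ip (T x) x) <= c * nr x ^+ 2) -> nrange T <= c.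
Proof.
move=> c0 h; apply: ge_sup; first by exists (Re (ip (T 0) 0)), 0 => //=; rewrite nr0.
move=> _ [x /= x1 <-]; apply: le_trans (h x) _.
by rewrite ler_piMr // expr_le1 ?nr_ge0.
Qed.

Lemma nrange_ge0 T : bop H T -> 0 <= nrange T.
Proof.
move=> bT; have -> : 0 = Re (ip (T 0) 0) by rewrite ip0r.
by apply: sup_upper_bound; [exact: nrange_sup | exists 0 => //=; rewrite nr0].
Qed.

Lemma nrangeD S T : bop H S -> bop H T -> nrange (S + T) <= nrange S + nrange T.
Proof.
move=> bS bT; apply: nrange_le; first by rewrite addr_ge0 ?nrange_ge0.
move=> x; rewrite -[(S + T) x]/(S x + T x) ipDl ReD mulrDl.
by apply: lerD; exact: nrange_ge.
Qed.

Lemma nrangeZ (t : R) T : 0 <= t -> bop H T -> nrange (t%:C%C *: T) <= t * nrange T.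
Proof.
move=> t0 bT; apply: nrange_le; first by rewrite mulr_ge0 ?nrange_ge0.
move=> x; rewrite -[(_ *: T) x]/(t%:C%C *: T x) ipZl ReZ -mulrA ler_wpM2l //.
exact: nrange_ge.
Qed.

Lemma sum_cs (I : Type) (s : seq I) (F G : I -> R) :
  (\sum_(i <- s) F i * G i) ^+ 2 <= (\sum_(i <- s) F i ^+ 2) * (\sum_(i <- s) G i ^+ 2).
Proof.
elim: s => [|i s IH]; first by rewrite !big_nil expr0n mulr0.
rewrite !big_cons; move: IH.
have : 0 <= \sum_(j <- s) F j ^+ 2 by rewrite sumr_ge0 // => j _; rewrite sqr_ge0.
have : 0 <= \sum_(j <- s) G j ^+ 2 by rewrite sumr_ge0 // => j _; rewrite sqr_ge0.
set A := \sum_(j <- s) F j ^+ 2; set B := \sum_(j <- s) G j ^+ 2.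
set S := \sum_(j <- s) _; set a := F i; set b := G i => B0 A0 IH.
suff h : 2 * (S * (a * b)) <= A * b ^+ 2 + B * a ^+ 2 by nra.
have q0 : 0 <= A * b ^+ 2 + B * a ^+ 2 by rewrite addr_ge0 // mulr_ge0 // sqr_ge0.
apply: le_trans (ler_norm _) _.
rewrite -(@ler_pXn2r _ 2) ?nnegrE // real_normK ?num_real //.
have h1 : (S * (a * b)) ^+ 2 <= A * B * (a * b) ^+ 2.
  by rewrite exprMn ler_wpM2r ?sqr_ge0.
have := sqr_ge0 (A * b ^+ 2 - B * a ^+ 2); nra.
Qed.

Definition sqs s : op H := \sum_(a <- s) (adj a \o a).
Definition allin (A : set (op H)) s := foldr (fun a P => A a /\ P) True s.

Lemma allin_cat A s t : allin A s -> allin A t -> allin A (s ++ t).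
Proof. by elim: s => //= a s IH [Aa /IH h] /h. Qed.

Lemma allin_scale (A : set (op H)) (c : C) s : (forall a, A a -> A (c *: a)) ->
  allin A s -> allin A [seq c *: a | a <- s].
Proof. by move=> h; elim: s => //= a s IH [/h Aa /IH]. Qed.

Section Dominate.
Variables (A : set (op H)) (g : op H -> C).
Hypotheses (A0 : A 0) (Al : lclosed A) (Ab : A `<=` bop H).
Hypothesis glin : forall (c : C) a b, A a -> A b -> g (c *: a + b) = c * g a + g b.
Hypothesis gbd : forall a (r : R), A a -> 0 <= r -> bd r a -> nr (g a) <= r.

Let AZ (c : C) a : A a -> A (c *: a).
Proof. by move=> Aa; rewrite -[_ *: _]addr0; exact: Al. Qed.

Let g0 : g 0 = 0.
Proof. by have := glin 1 A0 A0; rewrite scaler0 addr0 mul1r -[X in X = _]addr0 => /addrI. Qed.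

Let gZ (c : C) a : A a -> g (c *: a) = c * g a.
Proof. by move=> Aa; rewrite -[_ *: _]addr0 glin // g0 addr0. Qed.

Let nsq s : R := \sum_(a <- s) nr (g a) ^+ 2.

Lemma bop_sqs s : allin A s -> bop H (sqs s).
Proof.
rewrite /sqs; elim: s => [|a s IH] /=; first by rewrite big_nil => _; exact: bop0.
move=> [/Ab ba /IH bs]; rewrite big_cons; apply: bopD => //.
by apply: bop_comp => //; exact: bop_adj.
Qed.

Lemma sqs_ip s x : allin A s -> Re (ip (sqs s x) x) = \sum_(a <- s) nr (a x) ^+ 2.
Proof.
rewrite /sqs; elim: s => [|a s IH] /=; first by rewrite !big_nil ip0l.
move=> [/Ab ba /IH h]; rewrite !big_cons.
rewrite -[(_ + _) x]/(adj a (a x) + (\sum_(b <- s) (adj b \o b)) x).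
by rewrite ipDl ReD h adjE // nr_ip.
Qed.

(** Let [b] be the sum of [a] weighted by the conjugate of [g a]. Then [g b] is [M], while
    Cauchy-Schwarz bounds [b] by the square root of [M p], with [p] the numerical bound of [sqs s];
    contractivity of [g] gives [M^2 <= M p]. *)
Lemma nsq_le s : allin A s -> nsq s <= nrange (sqs s).
Proof.
move=> As; have bs := bop_sqs As; set M := nsq s; set p := nrange _.
have p0 : 0 <= p by exact: nrange_ge0.
have M0 : 0 <= M by rewrite /M /nsq sumr_ge0 // => a _; rewrite sqr_ge0.
pose b : op H := \sum_(a <- s) (g a)^* *: a.
have [Ab' gb] : A b /\ g b = \sum_(a <- s) (g a)^* * g a.
  rewrite /b; elim: (s) As => [|a s' IH] /=; first by rewrite !big_nil.
  by move=> [Aa /IH[As' gs']]; rewrite !big_cons glin // gs'; split=> //; exact: Al.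
have gbM : g b = M%:C%C.
  rewrite gb /M /nsq (big_morph (fun r : R => r%:C%C : C) (@rcD R) (erefl _)).
  by apply: eq_bigr => a _; rewrite rcX -nrE normCK mulrC.
have bb : bd (Num.sqrt (M * p)) b.
  move=> x; rewrite -(@ler_pXn2r _ 2) ?nnegrE ?mulr_ge0 ?nr_ge0 ?sqrtr_ge0 //.
  rewrite exprMn sqr_sqrtr ?mulr_ge0 // -mulrA.
  apply: (@le_trans _ _ (M * \sum_(a <- s) nr (a x) ^+ 2)); last first.
    by rewrite ler_wpM2l // -sqs_ip //; exact: nrange_ge.
  apply: le_trans (sum_cs _ _ _).
  rewrite ler_pXn2r ?nnegrE ?nr_ge0 //; last first.
    by rewrite sumr_ge0 // => a _; rewrite mulr_ge0 ?nr_ge0.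
  rewrite /b; elim: (s) => [|a s' IH]; first by rewrite !big_nil /= nr0.
  rewrite !big_cons -[(_ + _) x]/((g a)^* *: a x + (\sum_(j <- s') (g j)^* *: j) x).
  by apply: le_trans (nrD _ _) _; rewrite nrZ nr_conj lerD2l.
have := gbd Ab' (sqrtr_ge0 _) bb; rewrite gbM nr_real //.
rewrite -(@ler_pXn2r _ 2) ?nnegrE ?sqrtr_ge0 // sqr_sqrtr ?mulr_ge0 // expr2.
have [->|Mn] := eqVneq M 0; first by [].
by rewrite ler_pM2l // lt_neqAle eq_sym Mn.
Qed.

Lemma sqs_cat s t : sqs (s ++ t) = sqs s + sqs t. Proof. exact: big_cat. Qed.

Lemma sqs_scale (c : R) s : allin A s ->
  sqs [seq c%:C%C *: a | a <- s] = (c ^+ 2)%:C%C *: sqs s.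
Proof.
rewrite /sqs; elim: s => [|a s IH] /=; first by rewrite !big_nil scaler0.
move=> [/Ab ba /IH h]; rewrite !big_cons h scalerDr; congr (_ + _).
have -> : adj (c%:C%C *: a) = c%:C%C *: adj a.
  rewrite -[c%:C%C *: a]addr0 (adj_lcomb _ ba (@bop0 _ H)) adj0 cj_real.
  by rewrite -[(fun=> 0) : op H]/(0 : op H) addr0.
apply/funext => x; rewrite -[LHS]/(c%:C%C *: adj a (c%:C%C *: a x)).
by rewrite (linZ (bop_lin (bop_adj ba))) scalerA -rcM -expr2.
Qed.

Lemma nsq_scale (c : R) s : 0 <= c -> allin A s ->
  nsq [seq c%:C%C *: a | a <- s] = c ^+ 2 * nsq s.
Proof.
move=> c0; rewrite /nsq; elim: s => [|a s IH] /=; first by rewrite !big_nil mulr0.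
by move=> [Aa /IH h]; rewrite !big_cons h mulrDr gZ // nrM nr_real // exprMn.
Qed.

(* The sublinear functional
   [P T = inf (nrange (T + sum a^* a) - sum |g a|^2)], to which the
   Hahn-Banach theorem applies since [nsq_le] makes it finite. *)
Lemma state_dominate : exists phi, [/\ posf phi, Re (phi id) <= 1 &
  forall a, A a -> nr (g a) ^+ 2 <= Re (phi (adj a \o a))].
Proof.
pose S (T : bops) : set R := [set nrange (bval T + sqs s) - nsq s | s in allin A].
have lb (T : bops) : lbound (S T) (- nrange (- bval T)).
  move=> _ [s As <-]; have bs := bop_sqs As; have bT := bop_val T.
  have bT' : bop H (- bval T) by rewrite -scaleN1r; exact: bopZ.
  have := nrangeD (bopD bT bs) bT'; rewrite addrAC subrr add0r.
  have := nsq_le As; lra.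
have hS (T : bops) : has_inf (S T).
  by split; [exists (nrange (bval T + sqs [::]) - nsq [::]), [::] | exists (- nrange (- bval T))].
pose P (T : bops) := inf (S T).
have Ple (T : bops) s : allin A s -> P T <= nrange (bval T + sqs s) - nsq s.
  by move=> As; apply: ge_inf; [case: (hS T) | exists s].
have sqs0 : sqs [::] = 0 by rewrite /sqs big_nil.
have nsq0 : nsq [::] = 0 by rewrite /nsq big_nil.
have Ple0 (T : bops) : P T <= nrange (bval T).
  by have := @Ple T [::] I; rewrite sqs0 nsq0 addr0 subr0.
have n0 : nrange 0 = 0.
  apply/eqP; rewrite eq_le nrange_ge0 ?andbT; last exact: bop0.
  by apply: nrange_le => // x; rewrite ip0l mul0r.
have sP : sublin P.
  split=> [T T'|t T].
    apply/ler_addgt0Pr => e e0; have e1 : 0 < e / 2 by rewrite divr_gt0.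
    have [_ [s As <-] h1] := inf_adherent e1 (hS T).
    have [_ [s' As' <-] h2] := inf_adherent e1 (hS T').
    have := Ple (T + T') _ (allin_cat As As').
    rewrite sqs_cat /nsq big_cat /= -/(nsq s) -/(nsq s').
    rewrite [X in nrange X]addrACA.
    have := nrangeD (bopD (bop_val T) (bop_sqs As)) (bopD (bop_val T') (bop_sqs As')).
    rewrite -/(P T) in h1; rewrite -/(P T') in h2; move: h1 h2; lra.
  rewrite le_eqVlt => /predU1P[<-|t0].
    by rewrite mul0r; apply: le_trans (Ple0 _) _; rewrite scale0r n0.
  rewrite mulrC -ler_pdivrMr //; apply: lb_le_inf; first by case: (hS T).
  move=> _ [s As <-]; rewrite ler_pdivrMr //.
  pose r := Num.sqrt t; have r2 : r ^+ 2 = t by rewrite sqr_sqrtr // ltW.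
  have rs0 : 0 <= r by exact: sqrtr_ge0.
  have As' := @allin_scale A r%:C%C s (@AZ _) As.
  apply: le_trans (Ple _ _ As') _; rewrite sqs_scale // nsq_scale // r2.
  rewrite -[bval (_ *: T)]/(t%:C%C *: bval T) -scalerDr mulrBl ![_ * t]mulrC lerD2r.
  by apply: nrangeZ; [exact: ltW | apply: bopD; [exact: bop_val | exact: bop_sqs]].
have [psi [psiD psiZ psiP]] := hahn_banach sP.
pose mk (T : op H) (bT : bop H T) : bops := Bops (introT (asboolP _) bT).
have psi0 : psi 0 = 0 by have := psiZ 0 0; rewrite scaler0 mul0r.
have psiN (T : bops) : psi (- T) = - psi T by have := psiD T (- T); rewrite subrr psi0; lra.
have psi_pos (T : bops) : pos_op (bval T) -> 0 <= psi T.
  move=> [bT pT]; have := psiP (- T); rewrite psiN.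
  have : nrange (bval (- T)) <= 0.
    apply: nrange_le => // x; rewrite mul0r -[bval (- T) x]/(- bval T x) ipNl ReN oppr_le0.
    exact: Re_ge0.
  have := Ple0 (- T); lra.
have psi_i (T : bops) : pos_op (bval T) -> psi ('i%C *: T) = 0.
  move=> [bT pT].
  have h (c : C) : complex.Re c = 0 -> psi (c *: T) <= 0.
    move=> c0; apply: le_trans (psiP _) _; apply: le_trans (Ple0 _) _.
    apply: nrange_le => // x; rewrite mul0r -[bval (c *: T) x]/(c *: bval T x) ipZl.
    rewrite (ge0_Re (pT x)) mulrC ReZ c0 mulr0.
    by [].
  have := h 'i%C erefl; have := h (- 'i%C); rewrite scaleNr psiN ReN /= oppr0 => /(_ erefl).
  by move=> h1 h2; apply/eqP; rewrite eq_le h2 /=; lra.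
(* The complexification of the real-linear [psi]. On positive [T] its imaginary part vanishes,
   because [i T] and [- i T] have imaginary numerical range, where [nrange] is zero. *)
pose Psi (T : bops) : C := (psi T)%:C%C - 'i%C * (psi ('i%C *: T))%:C%C.
have ii : 'i%C * 'i%C = -1 :> C by rewrite -expr2 sqr_i.
have PsiD (S' T : bops) : Psi (S' + T) = Psi S' + Psi T.
  by rewrite /Psi scalerDr !psiD !rcD; ring.
have Psir (r : R) (T : bops) : Psi (r%:C%C *: T) = r%:C%C * Psi T.
  have e : 'i%C *: (r%:C%C *: T) = r%:C%C *: ('i%C *: T) by rewrite !scalerA mulrC.
  by rewrite /Psi e !psiZ !rcM; ring.
have Psii (T : bops) : Psi ('i%C *: T) = 'i%C * Psi T.
  rewrite /Psi scalerA ii scaleN1r psiN [in RHS]mulrBr mulrA ii (_ : (- psi T)%:C%C = - (psi T)%:C%C) ?rmorphN //.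
  by ring.
have PsiZ (c : C) (T : bops) : Psi (c *: T) = c * Psi T.
  have -> : c = (Re c)%:C%C + 'i%C * (complex.Im c)%:C%C by exact: complexE.
  by rewrite scalerDl PsiD -scalerA Psii !Psir; ring.
have PsiP (T : bops) : pos_op (bval T) -> Psi T = (psi T)%:C%C.
  by move=> pT; rewrite /Psi psi_i // mulr0 subr0.
pose phi (T : op H) : C := match pselect (bop H T) with left b => Psi (mk T b) | right _ => 0 end.
have phiE (T : op H) (bT : bop H T) : phi T = Psi (mk T bT).
  rewrite /phi; case: pselect => // b; congr Psi; exact: val_inj.
exists phi; split.
- split=> [c a b ba bb|a pa].
    rewrite (phiE _ (bop_lcomb c ba bb)) (phiE _ ba) (phiE _ bb).
    rewrite -PsiZ -PsiD; congr Psi; exact: val_inj.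
  have ba : bop H a by case: pa.
  by rewrite (phiE _ ba) PsiP // ler0c; exact: psi_pos.
- have bid := @bop_id _ H.
  have pid : pos_op (id : op H) by split=> // x; exact: ip_ge0.
  rewrite (phiE _ bid) PsiP //=; apply: le_trans (psiP _) _; apply: le_trans (Ple0 _) _.
  by apply: nrange_le => // x; rewrite /= mul1r -nr_ip.
move=> a Aa; have ba := Ab Aa.
have baa : bop H (adj a \o a) by apply: bop_comp => //; exact: bop_adj.
have paa : pos_op (adj a \o a) by split=> // x; rewrite /= adjE //; exact: ip_ge0.
rewrite (phiE _ baa) PsiP //=.
(* The list with the single entry [a] bounds [P] at minus [adj a \o a] by minus the square of
   [nr (g a)]; this is the source of the domination. *)
have := psiP (- mk _ baa); rewrite psiN.
have As : allin A [:: a] by [].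
have := @Ple (- mk _ baa) _ As.
rewrite /sqs big_seq1 -[bval _]/(- (adj a \o a)) addNr n0 /nsq big_seq1.
lra.
Qed.

End Dominate.

(** For self-adjoint [x] bounded by [r] the operator [r - x] is positive, so [phi x] is real; the
    general case follows from real and imaginary parts. *)
Lemma posf_adj phi a : posf phi -> bop H a -> phi (adj a) = (phi a)^*.
Proof.
move=> [pl pp] ba; have bb := bop_adj ba.
have pD x y : bop H x -> bop H y -> phi (x + y) = phi x + phi y.
  by move=> bx by_; rewrite -{1}[x]scale1r pl // mul1r.
have bz := @bop0 _ H.
have p0 : phi 0 = 0.
  by have := pl 1 _ _ bz bz; rewrite -[(fun=> 0) : op H]/(0 : op H) scaler0 addr0 mul1r -[X in X = _]addr0 => /addrI.
have pZ c x : bop H x -> phi (c *: x) = c * phi x.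
  by move=> bx; rewrite -[_ *: _]addr0 pl // p0 addr0.
have real x : bop H x -> adj x = x -> complex.Im (phi x) = 0.
  move=> bx sx; have /bopE[_ [r r0 br]] := bx.
  have bid := @bop_id _ H.
  have pr : 0 <= phi (r%:C%C *: id - x).
    apply: pp; split; first by apply: bopB => //; exact: bopZ.
    move=> z; rewrite -[(_ - x) z]/(r%:C%C *: z - x z) ipBl ipZl ip_nr -rcM.
    have h : ip (x z) z = (Re (ip (x z) z))%:C%C.
      have : ip (x z) z = (ip (x z) z)^* by rewrite -ipC -{1}sx adjE.
      by rewrite cjE; case: (ip _ _) => u v /= [/eqP]; rewrite -subr_eq0 opprK -mulr2n mulrn_eq0 /= => /eqP ->.
    rewrite h -rcB ler0c subr_ge0; apply: le_trans (Re_le_nr _) _.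
    by apply: le_trans (bd_ip br _ _) _; rewrite expr2 mulrA.
  have pid : 0 <= phi id by apply: pp; split=> // z; exact: ip_ge0.
  have : phi (r%:C%C *: id - x) = r%:C%C * phi id - phi x.
    have -> : r%:C%C *: id - x = (-1) *: x + r%:C%C *: id by rewrite scaleN1r addrC.
    have br' := bopZ r%:C%C bid.
    by rewrite (pl _ _ _ bx br') (pZ _ _ bid) mulN1r addrC.
  move=> e; move: pr; rewrite e (ge0_Re pid) -rcM.
  by case: (phi x) => u v; rewrite lecE /= sub0r oppr_eq0 eq_sym => /andP[/eqP].
have h1 : complex.Im (phi a + phi (adj a)) = 0.
  rewrite -pD //; apply: real; first exact: bopD.
  by rewrite -[a]scale1r adj_lcomb // ?adjK ?cj1 ?scale1r 1?addrC //; rewrite scale1r.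
have h2 : complex.Im ('i%C * phi a + - 'i%C * phi (adj a)) = 0.
  rewrite -!pZ // -pD; [|exact: bopZ..]; apply: real.
    by apply: bopD; exact: bopZ.
  rewrite adj_lcomb //; last exact: bopZ.
  have -> : adj (- 'i%C *: adj a) = (- 'i%C)^* *: a.
    rewrite -[_ *: adj a]addr0 (adj_lcomb _ bb bz) adjK // adj0.
    by rewrite -[(fun=> 0) : op H]/(0 : op H) addr0.
  by rewrite addrC cjN (_ : 'i%C^* = - 'i%C) ?opprK // cjE /=; congr Complex; rewrite oppr0.
move: h1 h2; rewrite cjE; case: (phi a) (phi (adj a)) => u v [u' v'] /= h1 h2.
by congr Complex; move: h1 h2; lra.
Qed.

End States.

(** * The direct sum of all GNS representations *)

Section UniversalRep.
Variables (R : realType) (H : hilbert R).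
Local Notation C := (cplx R).
Local Notation Re := (@complex.Re R).

(* [GnsVec phi a] stands for the class of [a] in the GNS space of [phi]; [gns_ker] is the
   kernel of the direct sum of all GNS spaces. *)
Record gns_vec := GnsVec { stf : op H -> C; sto : op H; stfP : posf stf; stoP : bop H sto }.

Definition gns_ker (x : gns_vec) (S : op H) (y : gns_vec) : C :=
  if stf x == stf y then stf x (adj (sto y) \o S \o sto x) else 0.

Lemma gns_ker_lin x (c : C) S S' y : bop H S -> bop H S' ->
  gns_ker x (c *: S + S') y = c * gns_ker x S y + gns_ker x S' y.
Proof.
move=> bS bS'; rewrite /gns_ker; case: eqP => _; last by rewrite mulr0 addr0.
have bx := stoP x; have bY := bop_adj (stoP y).
rewrite -(stfP x).1; try (by apply: bop_comp => //; apply: bop_comp).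
congr (stf x _); apply/funext => z.
rewrite -[LHS]/(adj (sto y) (c *: S (sto x z) + S' (sto x z))).
by rewrite (bop_lin bY).
Qed.

Lemma gns_ker0 x y : gns_ker x (fun=> 0) y = 0.
Proof.
have b0 := @bop0 _ H; have := gns_ker_lin x 1 y b0 b0.
rewrite -[(fun=> 0) : op H]/(0 : op H) scaler0 addr0 mul1r.
by rewrite -[X in X = _]addr0 => /addrI.
Qed.

Lemma gns_kerZ x (c : C) S y : bop H S -> gns_ker x (c *: S) y = c * gns_ker x S y.
Proof.
move=> bS; rewrite -[_ *: _]addr0 -[0 : op H]/(fun=> 0) gns_ker_lin ?gns_ker0 ?addr0 //.
exact: bop0.
Qed.

Lemma gns_ker_adj x S y : bop H S -> gns_ker y (adj S) x = (gns_ker x S y)^*.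
Proof.
move=> bS; rewrite /gns_ker eq_sym; case: eqP => [e|_]; last by rewrite rmorph0.
have bx := stoP x; have bY := stoP y.
rewrite -posf_adj; [|exact: stfP|]; last by apply: bop_comp => //; apply: bop_comp => //; exact: bop_adj.
rewrite e; congr (stf y _).
rewrite adj_comp //; last by apply: bop_comp => //; exact: bop_adj.
by rewrite adj_comp ?adjK //; exact: bop_adj.
Qed.

(* The kernel is block diagonal with respect to the states; each block is a
   positive functional applied to a positive operator. *)
Lemma gns_ker_pos (I : finType) (x : I -> gns_vec) (S : I -> I -> op H) :
  (forall i j, bop H (S i j)) ->
  (forall z : I -> H, 0 <= \sum_i \sum_j ip (S i j (z i)) (z j)) ->
  0 <= \sum_i \sum_j gns_ker (x i) (S i j) (x j).
Proof.
move=> bS pS.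
(* [rep i] is a chosen index with the same functional as [i]. So [chi k] selects the block of [k]
   when [k] is such a chosen index, and vanishes otherwise. *)
pose rep i : I := odflt i [pick j | stf (x j) == stf (x i)].
have repP i : stf (x (rep i)) = stf (x i).
  by rewrite /rep; case: pickP => [j /eqP //|/(_ i)]; rewrite eqxx.
have repE i j : (rep i == rep j) = (stf (x i) == stf (x j)).
  apply/eqP/eqP => [e|e]; first by rewrite -repP e repP.
  rewrite /rep e; case: pickP => [//|/(_ j)]; by rewrite eqxx.
pose chi k i : C := (rep i == k)%:R.
have -> : \sum_i \sum_j gns_ker (x i) (S i j) (x j) =
   \sum_k stf (x k) (\sum_i \sum_j
     (adj (chi k j *: sto (x j)) \o S i j \o (chi k i *: sto (x i)))).
  have bt k i j : bop H (adj (chi k j *: sto (x j)) \o S i j \o (chi k i *: sto (x i))).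
    have b1 := bopZ (chi k i) (stoP (x i)); have b2 := bopZ (chi k j) (stoP (x j)).
    by apply: bop_comp => //; apply: bop_comp => //; exact: bop_adj.
  have bsum (F : I -> op H) : (forall i, bop H (F i)) -> bop H (\sum_i F i).
    by move=> bF; elim/big_ind: _ => [|a b|i _]; [exact: bop0 | exact: bopD | exact: bF].
  have sD k a b : bop H a -> bop H b -> stf (x k) (a + b) = stf (x k) a + stf (x k) b.
    by move=> ba bb; rewrite -{1}[a]scale1r (stfP (x k)).1 // mul1r.
  have s0 k : stf (x k) 0 = 0.
    have b0 := @bop0 _ H; have := sD k _ _ b0 b0; rewrite -[(fun=> 0) : op H]/(0 : op H) addr0.
    by rewrite -[X in X = _]addr0 => /addrI.
  have ssum k (F : I -> op H) : (forall i, bop H (F i)) ->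
      stf (x k) (\sum_i F i) = \sum_i stf (x k) (F i).
    move=> bF; suff : bop H (\sum_i F i) /\ stf (x k) (\sum_i F i) = \sum_i stf (x k) (F i) by case.
    elim/big_ind2: _ => [|a u b v [ba ea] [bb eb]|i _]; first by split; [exact: bop0|exact: s0].
      by split; [exact: bopD|rewrite sD // ea eb].
    by split.
  transitivity (\sum_k \sum_i \sum_j
      stf (x k) (adj (chi k j *: sto (x j)) \o S i j \o (chi k i *: sto (x i)))); last first.
    apply: eq_bigr => k _; rewrite ssum; last by move=> i; apply: bsum.
    by apply: eq_bigr => i _; rewrite ssum.
  rewrite [RHS]exchange_big /=; apply: eq_bigr => i _.
  rewrite [RHS]exchange_big /=; apply: eq_bigr => j _.
  rewrite (bigD1 (rep i)) //= big1 ?addr0; last first.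
    move=> k ki; rewrite (_ : _ \o _ = 0) ?s0 //; apply/funext => z.
    rewrite -[LHS]/(adj (chi k j *: sto (x j)) (S i j (chi k i *: sto (x i) z))).
    rewrite (_ : chi k i = 0); last by rewrite /chi eq_sym (negbTE ki).
    rewrite scale0r (lin0 (bop_lin (bS _ _))).
    by rewrite lin0 //; apply/bop_lin/bop_adj/bopZ/stoP.
  rewrite /gns_ker -repE /chi eqxx scale1r repP.
  case: eqP => e.
    by rewrite e eqxx scale1r.
  rewrite (_ : rep j == rep i = false) ?scale0r; last by apply/eqP => e'; apply: e.
  rewrite -[0 : op H]/(fun=> 0) adj0.
  by rewrite -repP (_ : _ \o _ = 0) ?s0.
apply: sumr_ge0 => k _; apply: (stfP (x k)).2; split.
  elim/big_ind: _ => [|a b|i _]; [exact: bop0 | exact: bopD |].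
  elim/big_ind: _ => [|a b|j _]; [exact: bop0 | exact: bopD |].
  have b1 := bopZ (chi k i) (stoP (x i)); have b2 := bopZ (chi k j) (stoP (x j)).
  by apply: bop_comp => //; apply: bop_comp => //; exact: bop_adj.
move=> z; have := pS (fun i => chi k i *: sto (x i) z); congr (0 <= _).
have sE (F : I -> op H) : (\sum_i F i) z = \sum_i F i z.
  by elim/big_rec2: _ => // i u v _ <-.
rewrite sE ip_suml; apply: eq_bigr => i _; rewrite sE ip_suml; apply: eq_bigr => j _.
by rewrite /= adjE //; apply/bopZ/stoP.
Qed.

Lemma sum_tnth (I : Type) (V : zmodType) (s : seq I) (F : I -> V) :
  \sum_(i <- s) F i = \sum_(i < size s) F (tnth (in_tuple s) i).
Proof. by rewrite big_tnth. Qed.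

Lemma gns_ker_psd : psd (fun x y => gns_ker x id y).
Proof.
move=> s; have bid := @bop_id _ H.
rewrite sum_tnth; under eq_bigr do rewrite sum_tnth.
have -> : \sum_(i < size s) \sum_(j < size s)
   (tnth (in_tuple s) i).1 * ((tnth (in_tuple s) j).1)^* * gns_ker (tnth (in_tuple s) i).2 id (tnth (in_tuple s) j).2
 = \sum_i \sum_j gns_ker (tnth (in_tuple s) i).2 (((tnth (in_tuple s) i).1 * ((tnth (in_tuple s) j).1)^*) *: id)
     (tnth (in_tuple s) j).2.
  by apply: eq_bigr => i _; apply: eq_bigr => j _; rewrite gns_kerZ.
apply: gns_ker_pos => [i j|z]; first exact: bopZ.
rewrite (_ : \sum_i _ = ip (\sum_i (tnth (in_tuple s) i).1 *: z i) (\sum_i (tnth (in_tuple s) i).1 *: z i)).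
  exact: ip_ge0.
rewrite ip_suml; apply: eq_bigr => i _; rewrite ip_sumr; apply: eq_bigr => j _.
rewrite -[(_ *: id) (z i)]/(_ *: z i) !ipZl ipZr; ring.
Qed.

(* [gns_ker_pos] for the positive operators [c_i c_j^* (r^2 - b^* b)] *)
Lemma gns_ker_mul_bound (s : seq (C * gns_vec)) (b : op H) (r : R) : bop H b -> bd r b ->
  Re (\sum_(p <- s) \sum_(p' <- s) p.1 * p'.1^* * gns_ker p.2 (adj b \o b) p'.2) <=
  r ^+ 2 * Re (\sum_(p <- s) \sum_(p' <- s) p.1 * p'.1^* * gns_ker p.2 id p'.2).
Proof.
move=> bb br; have bid := @bop_id _ H.
have bbb : bop H (adj b \o b) by apply: bop_comp => //; exact: bop_adj.
rewrite -ReZ -subr_ge0 -ReB; apply: Re_ge0.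
rewrite mulr_sumr -sumrB sum_tnth.
under eq_bigr do rewrite mulr_sumr -sumrB sum_tnth.
set p := tnth _.
pose S i j : op H := ((p i).1 * ((p j).1)^*) *: ((r ^+ 2)%:C%C *: id + (-1) *: (adj b \o b)).
have bS i j : bop H (S i j) by apply/bopZ/bopD; exact: bopZ.
rewrite (_ : \sum_i _ = \sum_i \sum_j gns_ker (p i).2 (S i j) (p j).2); last first.
  apply: eq_bigr => i _; apply: eq_bigr => j _.
  rewrite /S gns_kerZ ?gns_ker_lin ?gns_kerZ //; try (by exact: bopZ); last by apply: bopD; exact: bopZ.
  ring.
apply: gns_ker_pos => // z; pose y := \sum_i (p i).1 *: z i.
rewrite (_ : \sum_i _ = (r ^+ 2)%:C%C * ip y y - ip (b y) (b y)).
  rewrite !ip_nr -rcM -rcB ler0c subr_ge0 -exprMn.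
  have [r0|r0] := leP 0 r; first by rewrite ler_pXn2r ?nnegrE ?mulr_ge0 ?nr_ge0.
  have := br y; have := nr_ge0 y; have := nr_ge0 (b y) => h1 h2 h3.
  have -> : nr y = 0 by apply/eqP; rewrite eq_le h2 andbT; nra.
  by have -> : nr (b y) = 0 by [apply/eqP; rewrite eq_le h1 andbT; nra]; rewrite mulr0.
rewrite -[ip (b y) (b y)]adjE //.
rewrite (_ : ip (adj b (b y)) y = \sum_i (p i).1 * ip (adj b (b (z i))) y); last first.
  rewrite -[adj b (b y)]/((adj b \o b) y) (lin_sum (bop_lin bbb)) ip_suml.
  by apply: eq_bigr => i _; rewrite (linZ (bop_lin bbb)) ipZl.
have -> : ip y y = \sum_i (p i).1 * ip (z i) y.
  by rewrite {1}/y ip_suml; apply: eq_bigr => i _; rewrite ipZl.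
rewrite mulr_sumr -sumrB; apply: eq_bigr => i _.
rewrite /y !ip_sumr !mulr_sumr -sumrB; apply: eq_bigr => j _.
rewrite -[S i j (z i)]/(_ *: ((r ^+ 2)%:C%C *: z i + (-1) *: adj b (b (z i)))).
by rewrite !ipZl ipDl !ipZl !ipZr; ring.
Qed.

Definition gns_act b (bb : bop H b) (x : gns_vec) : gns_vec := GnsVec (stfP x) (bop_comp bb (stoP x)).

(* The entries [[a, - t X], [- (t X)^*, 1]], weighted by vectors; for
   [a = |t|^2 r^2] this is positive when [X] has norm at most [r]. *)
Definition blockop (I J : Type) (c : I -> C) (d : J -> C) (g : I -> I -> C)
    (h : J -> J -> C) (a t : C) (X : I -> J -> op H) (u w : I + J) : op H :=
  match u, w with
  | inl i, inl i' => (a * (c i * (c i')^* * g i i')) *: id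
  | inr j, inr j' => (d j * (d j')^* * h j j') *: id
  | inl i, inr j => (- (t * (c i * (d j)^*))) *: X i j
  | inr j, inl i => (- (t * (c i * (d j)^*))^*) *: adj (X i j)
  end.

(** The entry map [q] is abstract because the computation is made twice: for the GNS kernel, and for
    vectors of [H] when the positivity asked by [gns_ker_pos] is checked. *)
Lemma block_sum (I J : finType) (q : I + J -> op H -> I + J -> C)
    (c : I -> C) (d : J -> C) (g : I -> I -> C) (h : J -> J -> C) (X : I -> J -> op H)
    (a t : C) :
  (forall i (e : C) S j, bop H S -> q i (e *: S) j = e * q i S j) ->
  (forall i S j, bop H S -> q j (adj S) i = (q i S j)^*) ->
  (forall i j, bop H (X i j)) ->
  let S := blockop c d g h a t X in
  let z := \sum_i \sum_j c i * (d j)^* * q (inl i) (X i j) (inr j) in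
  (forall u w, bop H (S u w)) /\
  \sum_u \sum_w q u (S u w) w =
    a * (\sum_i \sum_i' c i * (c i')^* * (g i i' * q (inl i) id (inl i'))) +
    \sum_j \sum_j' d j * (d j')^* * (h j j' * q (inr j) id (inr j')) -
    (t * z + (t * z)^*).
Proof.
move=> qZ qadj bX S z; have bid := @bop_id _ H; split.
  by move=> [i|j] [i'|j'] /=; apply: bopZ => //; exact: bop_adj.
rewrite big_sumType /=.
rewrite (eq_bigr (fun i => \sum_i' a * (c i * (c i')^* * (g i i' * q (inl i) id (inl i'))) -
    \sum_j t * (c i * (d j)^* * q (inl i) (X i j) (inr j)))); last first.
  move=> i _; rewrite big_sumType -sumrN; congr (_ + _); apply: eq_bigr => i' _.
    by rewrite qZ // !mulrA.
  by rewrite qZ // mulNr !mulrA.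
rewrite [X in _ + X = _](eq_bigr (fun j =>
    - (\sum_i (t * (c i * (d j)^* * q (inl i) (X i j) (inr j)))^*) +
    \sum_j' d j * (d j')^* * (h j j' * q (inr j) id (inr j')))); last first.
  move=> j _; rewrite big_sumType -sumrN; congr (_ + _); apply: eq_bigr => i' _.
    by rewrite qZ; [rewrite qadj // mulNr !cjM !mulrA | exact: bop_adj].
  by rewrite qZ // !mulrA.
rewrite !big_split /= !sumrN.
rewrite [in X in _ + (X + _)]exchange_big /=.
have -> : \sum_i \sum_j t * (c i * (d j)^* * q (inl i) (X i j) (inr j)) = t * z.
  by rewrite mulr_sumr; apply: eq_bigr => i _; rewrite mulr_sumr.
have -> : \sum_i \sum_j (t * (c i * (d j)^* * q (inl i) (X i j) (inr j)))^* = (t * z)^*.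
  by rewrite mulr_sumr cj_sum; apply: eq_bigr => i _; rewrite mulr_sumr cj_sum.
have -> : \sum_i \sum_i' a * (c i * (c i')^* * (g i i' * q (inl i) id (inl i'))) =
   a * (\sum_i \sum_i' c i * (c i')^* * (g i i' * q (inl i) id (inl i'))).
  by rewrite mulr_sumr; apply: eq_bigr => i _; rewrite mulr_sumr.
rewrite opprD; ring.
Qed.

Section Space.
Variables (E : hilbert R) (v : gns_vec -> E).
Hypotheses (gram_v : forall x y, ip (v x) (v y) = gns_ker x id y) (tot_v : total v).

Definition gns_rep (b : op H) : op E :=
  xget (fun=> 0) [set F | bop E F /\ forall x y, ip (F (v x)) (v y) = gns_ker x b y].

Lemma gns_rep_ex b r : bop H b -> 0 <= r -> bd r b ->
  exists F : op E, [/\ bop E F, bd r F & forall x y, ip (F (v x)) (v y) = gns_ker x b y].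
Proof.
move=> bb r0 br.
have [|F [lF bF hF]] := @ext_total _ _ _ _ v (fun x => v (gns_act bb x)) r tot_v r0.
  move=> s; rewrite -ler_sqr ?nnegrE ?mulr_ge0 ?nr_ge0 // exprMn !nr_ip.
  have := gns_ker_mul_bound s bb br; congr (_ <= _ * _); congr (Re _); rewrite ip_lcl.
    apply: eq_bigr => p _; rewrite ip_lcr mulr_sumr; apply: eq_bigr => p' _.
    rewrite gram_v mulrA /gns_ker /=; case: ifP => // _; congr (_ * stf _ _).
    by rewrite adj_comp //; exact: stoP.
  apply: eq_bigr => p _; rewrite ip_lcr mulr_sumr; apply: eq_bigr => p' _.
  by rewrite gram_v mulrA.
exists F; split=> //; first by apply/bopE; split=> //; exists r.
by move=> x y; rewrite hF gram_v.
Qed.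

Lemma gns_rep_uniq b F : bop E F -> (forall x y, ip (F (v x)) (v y) = gns_ker x b y) -> gns_rep b = F.
Proof.
move=> bF hF; apply: xget_unique => // G [bG hG].
apply: (bilin_total tot_v tot_v); try exact/bopE.
by move=> x y; rewrite hF hG.
Qed.

Lemma gns_repP b : bop H b -> [/\ bop E (gns_rep b),
  forall r, 0 <= r -> bd r b -> bd r (gns_rep b) & forall x y, ip (gns_rep b (v x)) (v y) = gns_ker x b y].
Proof.
move=> bb; have [_ [r r0 br]] := (bopE b).1 bb.
have [F [bF _ hF]] := gns_rep_ex bb r0 br.
rewrite (gns_rep_uniq bF hF); split=> // s s0 bs.
have [G [bG sG hG]] := gns_rep_ex bb s0 bs.
by rewrite -(gns_rep_uniq bF hF) (gns_rep_uniq bG hG).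
Qed.

Lemma gns_rep_bop b : bop H b -> bop E (gns_rep b). Proof. by case/gns_repP. Qed.

Lemma gns_rep_ip b x y : bop H b -> ip (gns_rep b (v x)) (v y) = gns_ker x b y.
Proof. by case/gns_repP. Qed.

Lemma gns_rep_vec b x (bb : bop H b) : gns_rep b (v x) = v (gns_act bb x).
Proof. by apply: (total_extl tot_v) => y; rewrite gns_rep_ip // gram_v. Qed.

Lemma gns_rep_id : gns_rep id = id.
Proof. by apply: gns_rep_uniq; [exact: bop_id | exact: gram_v]. Qed.

Lemma gns_rep_hom : star_hom (bop H) gns_rep.
Proof.
split; first exact: gns_rep_bop.
- move=> a x y bx bY; apply: gns_rep_uniq; first by apply: bop_lcomb; exact: gns_rep_bop.
  move=> z w; rewrite -[(_ + _) (v z)]/(a *: gns_rep x (v z) + gns_rep y (v z)).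
  by rewrite ipDl ipZl !gns_rep_ip // gns_ker_lin.
- move=> x y bx bY; apply: gns_rep_uniq; first by apply: bop_comp; exact: gns_rep_bop.
  by move=> z w /=; rewrite (gns_rep_vec z bY) gns_rep_ip.
move=> x bx; apply: gns_rep_uniq; first by apply/bop_adj/gns_rep_bop.
move=> z w; rewrite adjE; last exact: gns_rep_bop.
by rewrite ipC gns_rep_ip // gns_ker_adj.
Qed.

(** After scaling, [state_dominate] bounds [nr (f a)] by [r] times the norm of [gns_rep a xi], where
    [xi] is the cyclic vector of the dominating functional. So [f] factors boundedly through
    [a |-> gns_rep a xi], and Riesz gives [eta]. *)
Lemma gns_rep_fun (A : set (op H)) (f : op H -> C) (r : R) : A 0 -> lclosed A -> A `<=` bop H ->
  (forall (a : C) x y, A x -> A y -> f (a *: x + y) = a * f x + f y) -> 0 <= r ->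
  (forall x s, A x -> 0 <= s -> bd s x -> nr (f x) <= r * s) ->
  exists xi eta, [/\ nr xi <= 1, nr eta <= r & forall a, A a -> f a = ip (gns_rep a xi) eta].
Proof.
move=> A0 Al Ab fl r0 fb; have [re|rn] := eqVneq r 0.
  exists 0, 0; rewrite !nr0; split=> // a Aa; rewrite ip0r; apply: nr0_eq0.
  have [_ [s s0 bs]] := (bopE a).1 (Ab _ Aa).
  by apply/eqP; rewrite eq_le nr_ge0 andbT; have := fb a s Aa s0 bs; rewrite re mul0r.
have rp : 0 < r by rewrite lt_def rn.
pose g a : C := (r^-1)%:C%C * f a.
have [||phi [pphi phi1 dphi]] := @state_dominate R H A g A0 Al Ab.
- by move=> c a b Aa Ab'; rewrite /g fl // mulrDr mulrCA.
- move=> a s Aa s0 bs; rewrite /g nrM nr_real ?invr_ge0 // mulrC ler_pdivrMr // mulrC.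
  exact: fb.
pose xi := v (GnsVec pphi (@bop_id _ H)).
have PiE a : A a -> nr (gns_rep a xi) ^+ 2 = Re (phi (adj a \o a)).
  move=> Aa; rewrite nr_ip /xi (gns_rep_vec _ (Ab _ Aa)) gram_v /gns_ker eqxx /=.
  by rewrite adj_comp ?adj_id //; [exact: Ab | exact: bop_id].
have [|||||eta [neta _] heta] := @riesz_on R _ E A (fun a => gns_rep a xi) f r.
- exact: A0.
- by move=> a x y; exact: Al.
- move=> a x y Ax Ay; rewrite (star_hom_linear gns_rep_hom) //; exact: Ab.
- exact: fl.
- move=> a Aa; have := dphi a Aa; rewrite -PiE // ler_sqr ?nnegrE ?nr_ge0 //.
  by rewrite /g nrM nr_real ?invr_ge0 // mulrC ler_pdivrMr // mulrC.
exists xi, eta; split=> //.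
  rewrite -(ler_sqr _ _) ?nnegrE ?nr_ge0 // expr1n nr_ip gram_v /gns_ker eqxx /=.
  by rewrite adj_id.
by move: neta; rewrite max_l.
Qed.

Section Amplify.
Context {T : tensor_choice R}.
Variable K : hilbert R.
Local Notation "H ** K" := (tspace (T H K)) (at level 40).
Local Notation tn := (tens (T _ _)).

(** Complete boundedness of [gns_rep], which normality cannot provide here. In polarised form the
    bound is positivity of a block matrix under the GNS kernel; [gns_ker_pos] reduces it to vectors
    of [H], where it is Cauchy-Schwarz for [X]. *)
Lemma gns_rep_amp (X : op (H ** K)) (r : R) : bop _ X -> 0 <= r -> bd r X ->
  exists Y : op (E ** K), [/\ bop _ Y, bd r Y &
    forall k l, slice_r (vfun k l) Y = gns_rep (slice_r (vfun k l) X)].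
Proof.
move=> bX r0 rX.
pose w (p : gns_vec * K) : E ** K := tn (v p.1) p.2.
have tw : total w.
  by apply: (total_tn (w := id) tot_v) => // z h; apply: ip_eq0; apply: h.
pose q (p p' : gns_vec * K) := gns_ker p.1 (slice_r (vfun p.2 p'.2) X) p'.1.
have bS k l : bop H (slice_r (vfun k l) X) by exact: bop_slice_r.
have [|Y [lY bY hY]] := @ext_form _ _ _ _ _ w w q r tw tw r0.
  move=> s t; apply: nr_le_polar; rewrite ?mulr_ge0 ?nr_ge0 // => tau.
  pose ps := tnth (in_tuple s); pose pt := tnth (in_tuple t).
  pose xx (u : 'I_(size s) + 'I_(size t)) := match u with inl i => (ps i).2 | inr j => (pt j).2 end.
  have bS' i j : bop H (slice_r (vfun (ps i).2.2 (pt j).2.2) X) by [].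
  pose a := ((nr tau ^+ 2) * (r ^+ 2))%:C%C : C.
  have := block_sum (q := fun i S j => gns_ker (xx i).1 S (xx j).1)
    (fun i => (ps i).1) (fun j => (pt j).1)
    (fun i i' => ip (ps i).2.2 (ps i').2.2) (fun j j' => ip (pt j).2.2 (pt j').2.2) a tau.
  move=> /(_ _ (fun i e S j => @gns_kerZ _ e S _) (fun i S j => @gns_ker_adj _ S _) bS') [].
  set S := blockop _ _ _ _ _ _ _ => bSS eS.
  have pos : 0 <= \sum_u \sum_u' gns_ker (xx u).1 (S u u') (xx u').1.
    apply: gns_ker_pos => // z.
    have := block_sum (q := fun i S j => ip (S (z i)) (z j))
      (fun i => (ps i).1) (fun j => (pt j).1)
      (fun i i' => ip (ps i).2.2 (ps i').2.2) (fun j j' => ip (pt j).2.2 (pt j').2.2) a tau.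
    move=> /(_ (fun i j => slice_r (vfun (ps i).2.2 (pt j).2.2) X)).
    case=> [i e V j _|i V j bV|//|_ ->].
    - by rewrite -[(_ *: _) _]/(_ *: V (z i)) ipZl.
    - by rewrite adjE // ipC.
    pose u := \sum_i (ps i).1 *: tens (T H K) (z (inl i)) (ps i).2.2.
    pose u' := \sum_j (pt j).1 *: tens (T H K) (z (inr j)) (pt j).2.2.
    have lX := bop_lin bX.
    rewrite (_ : \sum_i \sum_i' _ = ip u u); last first.
      rewrite /u ip_suml; apply: eq_bigr => i _; rewrite ip_sumr; apply: eq_bigr => i' _.
      by rewrite ipZl ipZr tens_ip; ring.
    rewrite (_ : \sum_i \sum_i' _ = ip u' u'); last first.
      rewrite /u' ip_suml; apply: eq_bigr => i _; rewrite ip_sumr; apply: eq_bigr => i' _.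
      by rewrite ipZl ipZr tens_ip; ring.
    rewrite (_ : \sum_i \sum_j _ = ip (X u) u'); last first.
      rewrite /u (lin_sum lX) ip_suml; apply: eq_bigr => i _.
      rewrite /u' ip_sumr; apply: eq_bigr => j _.
      by rewrite (linZ lX) ipZl ipZr slice_rE //; ring.
    rewrite !ip_nr /a -rcM -rcD.
    have -> : tau * ip (X u) u' + (tau * ip (X u) u')^* = (2 * Re (tau * ip (X u) u'))%:C%C.
      by case: (tau * _) => p1 p2; rewrite cjE; apply/eqP; rewrite eq_complex /= subrr eqxx andbT; apply/eqP; ring.
    rewrite -rcB ler0c subr_ge0.
    have h1 := Re_le_nr (tau * ip (X u) u'); rewrite nrM in h1.
    have h2 : nr tau * nr (ip (X u) u') <= nr tau * (r * nr u * nr u').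
      by rewrite ler_wpM2l ?nr_ge0 // bd_ip.
    have h3 : 0 <= (nr tau * r * nr u - nr u') ^+ 2 by rewrite sqr_ge0.
    move: h1 h2 h3; move: (Re _) (nr (ip _ _)) (nr tau) (nr u) (nr u') => p1 p2 p3 p4 p5; nra.
  rewrite eS in pos.
  have -> : (r * nr (lc w s)) ^+ 2 = r ^+ 2 * Re (ip (lc w s) (lc w s)) by rewrite exprMn nr_ip.
  rewrite [nr (lc w t) ^+ 2]nr_ip.
  have gw p p' : ip (w p) (w p') = gns_ker p.1 id p'.1 * ip p.2 p'.2 by rewrite tens_ip gram_v.
  have es : ip (lc w s) (lc w s) = \sum_i \sum_i' (ps i).1 * ((ps i').1)^* *
      (ip (ps i).2.2 (ps i').2.2 * gns_ker (ps i).2.1 id (ps i').2.1).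
    rewrite ip_lcl sum_tnth; apply: eq_bigr => i _; rewrite ip_lcr sum_tnth mulr_sumr.
    by apply: eq_bigr => i' _; rewrite gw -/ps; ring.
  have et : ip (lc w t) (lc w t) = \sum_i \sum_i' (pt i).1 * ((pt i').1)^* *
      (ip (pt i).2.2 (pt i').2.2 * gns_ker (pt i).2.1 id (pt i').2.1).
    rewrite ip_lcl sum_tnth; apply: eq_bigr => i _; rewrite ip_lcr sum_tnth mulr_sumr.
    by apply: eq_bigr => i' _; rewrite gw -/pt; ring.
  have ez : \sum_(p <- s) \sum_(p' <- t) p.1 * (p'.1)^* * q p.2 p'.2 =
      \sum_i \sum_j (ps i).1 * ((pt j).1)^* * gns_ker (ps i).2.1 (slice_r (vfun (ps i).2.2 (pt j).2.2) X) (pt j).2.1.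
    by rewrite sum_tnth; apply: eq_bigr => i _; rewrite sum_tnth.
  rewrite -es -et -ez in pos.
  have := Re_ge0 pos; rewrite ReB !ReD Re_conj ReZ; lra.
exists Y; have bY' : bop _ Y by apply/bopE; split=> //; exists r.
split=> // k l; symmetry; apply: gns_rep_uniq; first exact: bop_slice_r.
by move=> x y; rewrite slice_rE // -/(w (x, k)) -/(w (y, l)) hY.
Qed.

End Amplify.
End Space.
End UniversalRep.

(** All that is used of the GNS construction. The field [univ_fun] speaks of arbitrary subspaces, so
    [p] can be fixed before the algebra; [univ_amp] supplies [p (x) id] on each [K]. *)
Record universal {R : realType} (T : tensor_choice R) (H E : hilbert R)
    (p : op H -> op E) : Prop := Universal {
  univ_hom : star_hom (bop H) p;
  univ_id : p id = id;
  univ_bd : forall b (r : R), bop H b -> 0 <= r -> bd r b -> bd r (p b);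
  univ_fun : forall (A : set (op H)) (f : op H -> cplx R) (r : R),
    A 0 -> lclosed A -> A `<=` bop H ->
    (forall (a : cplx R) x y, A x -> A y -> f (a *: x + y) = a * f x + f y) -> 0 <= r ->
    (forall x s, A x -> 0 <= s -> bd s x -> nr (f x) <= r * s) ->
    exists xi eta, [/\ nr xi <= 1, nr eta <= r & forall a, A a -> f a = ip (p a xi) eta];
  univ_amp : forall (K : hilbert R) (X : op (T H K)) (r : R),
    bop (T H K) X -> 0 <= r -> bd r X ->
    exists Y : op (T E K), [/\ bop (T E K) Y, bd r Y &
      forall k l, slice_r (vfun k l) Y = p (slice_r (vfun k l) X)] }.

Lemma universal_ex (R : realType) (T : tensor_choice R) (H : hilbert R) :
  exists (E : hilbert R) (p : op H -> op E), universal T p.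
Proof.
have [E [v [gram tot]]] := kolmogorov (@gns_ker_psd R H).
exists E, (gns_rep v); split.
- exact: gns_rep_hom.
- exact: gns_rep_id.
- by move=> b r bb; case: (gns_repP gram tot bb) => _ + _; apply.
- exact: gns_rep_fun.
- by move=> K X r; exact: gns_rep_amp.
Qed.

(** * Bicommutants *)

Section Commutants.
Context {R : realType} {T : tensor_choice R}.
Local Notation C := (cplx R).
Local Notation Re := (@complex.Re R).
Local Notation "H ** K" := (tspace (T H K)) (at level 40).
Local Notation tn := (tens (T _ _)).
Local Notation ot := (@otens R T _ _).

Lemma otens_comm_slice (H K : hilbert R) (X : op (H ** K)) (b : op H) :
  bop _ X -> bop H b ->
  (X \o ot b id = ot b id \o X <->
   forall k l, slice_r (vfun k l) X \o b = b \o slice_r (vfun k l) X).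
Proof.
move=> bX bb; have bid := @bop_id _ K; have bo := bop_otens (T := T) bb bid.
have bb' := bop_adj bb.
have e1 a k a' l : ip (X (ot b id (tn a k))) (tn a' l) = ip (slice_r (vfun k l) X (b a)) a'.
  by rewrite otensE // slice_rE.
have e2 a k a' l : ip (ot b id (X (tn a k))) (tn a' l) = ip (b (slice_r (vfun k l) X a)) a'.
  rewrite -[in LHS](adjK bo) adjE; last exact: bop_adj.
  rewrite otens_adj // adj_id otensE //.
  by rewrite -slice_rE // adjEr.
split=> [h k l|h].
  by apply: bop_ext => a a' /=; rewrite -e1 -e2 -[X _]/((X \o ot b id) _) h.
apply: op_tn_ext2; try exact: bop_comp.
by move=> a k a' l /=; rewrite e1 e2 -[LHS]/(ip ((slice_r (vfun k l) X \o b) a) a') h.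
Qed.

Lemma commutant_lin (H : hilbert R) (S : op H) : bop H S -> lclosed [set x : op H | S \o x = x \o S].
Proof.
move=> bS a x y /= hx hy; apply/funext => z /=.
rewrite -[(_ + _) z]/(a *: x z + y z) (bop_lin bS) -[(_ + _) (S z)]/(a *: x (S z) + y (S z)).
by rewrite -[S (x z)]/((S \o x) z) -[S (y z)]/((S \o y) z) hx hy.
Qed.

Lemma bop_rank_one (K : hilbert R) (k l : K) : bop K (rank_one k l).
Proof.
apply/bopE; split=> [a x y|]; first by rewrite /rank_one ipDl ipZl scalerDl scalerA.
exists (nr k * nr l); first by rewrite mulr_ge0 ?nr_ge0.
move=> x; rewrite /rank_one nrZ; have := cauchy_schwarz x l; have := nr_ge0 k.
move: (nr _) (nr (ip _ _)) (nr l) (nr x) => p1 p2 p3 p4; nra.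
Qed.

Lemma adj_rank_one (K : hilbert R) (k l : K) : adj (rank_one k l) = rank_one l k.
Proof.
apply: adj_uniq; first exact: bop_rank_one.
by move=> x y; rewrite /rank_one ipZl ipZr -ipC mulrC.
Qed.

(** The matrix unit from [k0] to [k] carries [a (x) k0] to a multiple of [a (x) k]. Commuting with
    it, [S] is determined along the whole second leg by its slice at [k0]. *)
Lemma commutant_tensor (H K : hilbert R) (S : op (H ** K)) : bop _ S ->
  (forall k l : K, S \o ot id (rank_one k l) = ot id (rank_one k l) \o S) ->
  exists s : op H, [/\ bop H s, S = ot s id &
    forall b, bop H b -> S \o ot b id = ot b id \o S -> s \o b = b \o s].
Proof.
move=> bS hS; have bid := @bop_id _ K; have bidH := @bop_id _ H.
have br := @bop_rank_one K.
(* If [K] is zero then so is [H (x) K], and [id] is a valid [s] that commutes with everything. *)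
have [[k0 hk0]|nk] := pselect (exists k : K, k <> 0); last first.
  exists id; split=> //; rewrite otens_id; apply: op_tn_ext => //; first exact: bop_id.
  move=> a b; have -> : b = 0 by apply: contrapT => h; apply: nk; exists b.
  by rewrite tn0r (lin0 (bop_lin bS)).
have n0 : ip k0 k0 != 0 by apply/eqP => /ip_eq0.
pose s := (ip k0 k0)^-1 *: slice_r (vfun k0 k0) S.
have bs : bop H s by apply/bopZ/bop_slice_r.
exists s; split=> //; last first.
  move=> b bb /otens_comm_slice /(_ k0 k0) h; apply/funext => x /=.
  rewrite -[s (b x)]/(_ *: slice_r (vfun k0 k0) S (b x)) -[s x]/(_ *: slice_r (vfun k0 k0) S x).
  rewrite (linZ (bop_lin bb)); congr (_ *: _).
  by rewrite -[LHS]/((slice_r (vfun k0 k0) S \o b) x) h.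
apply: op_tn_ext => //; first exact: bop_otens.
move=> a k; rewrite otensE //; apply: tn_ext => b l.
have E : tn a k = (ip k0 k0)^-1 *: ot id (rank_one k k0) (tn a k0).
  by rewrite otensE // /rank_one tnZr scalerA mulVf // scale1r.
rewrite {1}E (linZ (bop_lin bS)) -[S (ot _ _ _)]/((S \o ot id (rank_one k k0)) (tn a k0)) hS /=.
rewrite ipZl; set z := S _.
have bo := bop_otens (T := T) bidH (br k k0).
rewrite -adjEr //.
rewrite otens_adj // adj_id.
rewrite adj_rank_one otensE // /rank_one tnZr ipZr /z -slice_rE // /s.
rewrite -[(_ *: _) a]/(_ *: slice_r (vfun k0 k0) S a) tnZl ipZl tens_ip -ipC; ring.
Qed.

(** Its Kolmogorov space has an orthonormal basis indexed by [I]. It serves for finite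
    amplifications and, with one index, for the trivial corepresentation. *)
Lemma psd_delta (I : finType) : psd (fun i j : I => (i == j)%:R : C).
Proof.
move=> s.
have -> : \sum_(p <- s) \sum_(p' <- s) p.1 * p'.1^* * (p.2 == p'.2)%:R =
  \sum_k (\sum_(p <- s) p.1 * (p.2 == k)%:R) * (\sum_(p <- s) p.1 * (p.2 == k)%:R)^*.
  under [RHS]eq_bigr do rewrite mulr_suml.
  rewrite [RHS]exchange_big /=; apply: eq_bigr => p _.
  under [RHS]eq_bigr do rewrite cj_sum mulr_sumr.
  rewrite [RHS]exchange_big /=; apply: eq_bigr => p' _.
  rewrite (bigD1 p.2) //= big1 ?addr0; last first.
    by move=> k kp; rewrite [p.2 == k]eq_sym (negbTE kp) mulr0 mul0r.
  rewrite eqxx mulr1 cjM [p'.2 == _]eq_sym mulrA; congr (_ * _).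
  by case: (_ == _); rewrite ?rmorph0 ?rmorph1.
by apply: sumr_ge0 => k _; rewrite -normCK exprn_ge0.
Qed.

Section Bicommutant.
Variables (E : hilbert R) (B : set (op E)).
Hypotheses (Bb : B `<=` bop E) (Bl : lclosed B) (B1 : B id).
Hypotheses (Bm : forall x y, B x -> B y -> B (x \o y)) (Ba : forall x, B x -> B (adj x)).

(* The projection onto the closed span of [B] acting on the amplified vector
   commutes with the amplification of [B], hence with that of its bicommutant. *)
Lemma bicommutant_sum (I : finType) (x y : I -> E) m : commutant (commutant B) m ->
  (forall b, B b -> \sum_i ip (b (x i)) (y i) = 0) -> \sum_i ip (m (x i)) (y i) = 0.
Proof.
move=> [bm hm] hxy.
have [L [e [ge _]]] := kolmogorov (@psd_delta I).
have bid := @bop_id _ L; have bidE := @bop_id _ E.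
pose xi : E ** L := \sum_i tn (x i) (e i); pose eta : E ** L := \sum_i tn (y i) (e i).
have amp b : bop E b -> ip (ot b id xi) eta = \sum_i ip (b (x i)) (y i).
  move=> bb; rewrite (lin_sum (bop_lin (bop_otens bb bid))) ip_suml; apply: eq_bigr => i _.
  rewrite otensE // ip_sumr (bigD1 i) //= big1 ?addr0; last first.
    by move=> j ji; rewrite tens_ip ge eq_sym (negbTE ji) mulr0.
  by rewrite tens_ip ge eqxx mulr1.
rewrite -amp //.
(* [V] is the orthogonal complement of the orbit of [xi] under the amplified [B], and [W] the
   complement of [V]. The projection [Q] onto [W] comes from [riesz_on] with the orbit map as
   [L]. *)
pose V u := forall b, B b -> ip (ot b id xi) u = 0.
pose W w := forall u, V u -> ip w u = 0.
have B0 : B 0 by rewrite -[0](subrr (id : op E)) addrC -scaleN1r; exact: Bl.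
have proj z : exists w, [/\ nr w <= nr z, W w & V (z - w)].
  have [|||||w [nw cw] hw] := @riesz_on R _ (E ** L) B (fun b => ot b id xi)
    (fun b => ip (ot b id xi) z) (nr z) => //.
  - by move=> a b c Bx By; rewrite otens_lcomb_l //; exact: Bb.
  - by move=> a b c Bx By; rewrite otens_lcomb_l ?ipDl ?ipZl //; exact: Bb.
  - by move=> b Bx; rewrite mulrC; exact: cauchy_schwarz.
  exists w; split.
  - by move: nw; rewrite max_l ?nr_ge0.
  - move=> u hu; apply: nr_small => r r0.
    have r1 : 0 < r / (nr u + 1) by rewrite divr_gt0 // ltr_wpDl ?nr_ge0.
    have [b Bx hb] := cw _ r1.
    rewrite -[w](subrK (ot b id xi)) ipDl hu // addr0.
    apply: le_trans (cauchy_schwarz _ _) _.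
    apply: (@le_trans _ _ (r / (nr u + 1) * (nr u + 1))); last by rewrite divfK // gt_eqF // ltr_wpDl ?nr_ge0.
    by apply: ler_pM; rewrite ?nr_ge0 // lerDl.
  - by move=> b Bx; rewrite ipBr hw // subrr.
have [Q hQ] := choice proj.
have Vl a u u' : V u -> V u' -> V (a *: u + u').
  by move=> hu hu' b Bx; rewrite ipDr ipZr hu // hu' // mulr0 addr0.
have Wl a u u' : W u -> W u' -> W (a *: u + u').
  by move=> hu hu' b Bx; rewrite ipDl ipZl hu // hu' // mulr0 addr0.
have Qu z w : W w -> V (z - w) -> Q z = w.
  move=> Ww Vw; have [_ WQ VQ] := hQ z.
  apply/eqP; rewrite -subr_eq0; apply/eqP; apply: ip_eq0.
  have WD : W (Q z - w) by rewrite addrC -scaleN1r; exact: Wl.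
  apply: WD; have := Vl (-1) _ _ VQ Vw; rewrite scaleN1r opprB addrA subrK; apply.
have bQ : bop _ Q.
  apply/bopE; split=> [a u u'|]; last first.
    by exists 1 => // z; rewrite mul1r; case: (hQ z).
  have [_ W1 V1] := hQ u; have [_ W2 V2] := hQ u'.
  apply: Qu; first exact: Wl.
  by rewrite opprD addrACA -scalerBr; exact: Vl.
have Qxi : Q xi = xi.
  apply: Qu; last by move=> b _; rewrite subrr ip0r.
  by move=> u /(_ id B1); rewrite otens_id.
have act b : B b -> forall u, V u -> V (ot b id u).
  move=> Bx u hu c Bc; rewrite -adjE; last by apply: bop_otens => //; exact: Bb.
  rewrite otens_adj ?adj_id //; last exact: Bb.
  have := hu _ (Bm (Ba Bx) Bc); rewrite -[id in ot (_ \o _) id]/(id \o id) otens_comp //.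
    by apply/bop_adj/Bb.
  exact: Bb.
have Qcomm b : B b -> Q \o ot b id = ot b id \o Q.
  move=> Bx; have bb := Bb Bx; apply/funext => z /=; have [_ WQ VQ] := hQ z.
  have bo := bop_otens (T := T) bb bid.
  apply: Qu; last by rewrite -(linB (bop_lin bo)); exact: act.
  move=> u hu; rewrite -[ot b id](adjK bo) adjE; last exact: bop_adj.
  by apply: WQ; rewrite otens_adj // adj_id; apply: act => //; exact: Ba.
have Qm : Q \o ot m id = ot m id \o Q.
  apply/otens_comm_slice => // k l; apply: hm; split; first exact: bop_slice_r.
  by move=> b Bx; have /otens_comm_slice := Qcomm b Bx; move=> ->//; exact: Bb.
rewrite -Qxi -[ot m id _]/((ot m id \o Q) xi) -Qm /=.
by have [_ WQ _] := hQ (ot m id xi); apply: WQ => b Bx; rewrite amp ?hxy //; exact: Bb.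
Qed.

End Bicommutant.
End Commutants.

(** * The homomorphism [p (x) p] *)

Section Amplification.
Context {R : realType} {T : tensor_choice R}.
Local Notation C := (cplx R).
Local Notation Re := (@complex.Re R).
Local Notation "H ** K" := (tspace (T H K)) (at level 40).
Local Notation tn := (tens (T _ _)).
Local Notation ot := (@otens R T _ _).

Lemma ip_lcomb (H : hilbert R) (c : C) (F G : op H) z t :
  ip ((c *: F + G) z) t = c * ip (F z) t + ip (G z) t.
Proof. by rewrite -[(_ + _) z]/(c *: F z + G z) ipDl ipZl. Qed.

Lemma tn_total_ext2 (H K : hilbert R) (X Y : op (H ** K)) : bop _ X -> bop _ Y ->
  (forall k l, slice_r (vfun k l) X = slice_r (vfun k l) Y) -> X = Y.
Proof.
by move=> bX bY h; apply: op_tn_ext2 => // a k b l; rewrite -!slice_rE // h.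
Qed.

Lemma slice_r_lin (H K : hilbert R) (c : C) (X Y : op (H ** K)) k l : bop _ X -> bop _ Y ->
  slice_r (vfun k l) (c *: X + Y) = c *: slice_r (vfun k l) X + slice_r (vfun k l) Y.
Proof.
move=> bX bY; apply: bop_ext => a b; rewrite slice_rE; last exact: bop_lcomb.
rewrite -[(c *: X + Y) _]/(c *: X _ + Y _).
rewrite -[in RHS]/(c *: slice_r (vfun k l) X a + slice_r (vfun k l) Y a).
by rewrite !ipDl !ipZl !slice_rE.
Qed.

Lemma slice_l_lin (H K : hilbert R) (c : C) (X Y : op (H ** K)) a b : bop _ X -> bop _ Y ->
  slice_l (vfun a b) (c *: X + Y) = c *: slice_l (vfun a b) X + slice_l (vfun a b) Y.
Proof.
move=> bX bY; apply: bop_ext => k l; rewrite slice_lE; last exact: bop_lcomb.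
rewrite -[(c *: X + Y) _]/(c *: X _ + Y _).
rewrite -[in RHS]/(c *: slice_l (vfun a b) X k + slice_l (vfun a b) Y k).
by rewrite !ipDl !ipZl !slice_lE.
Qed.

Lemma slice_l_adj (H K : hilbert R) (X : op (H ** K)) a b : bop _ X ->
  slice_l (vfun a b) (adj X) = adj (slice_l (vfun b a) X).
Proof.
move=> bX; have bX' := bop_adj bX; apply: bop_ext => k l; rewrite slice_lE // adjE //.
rewrite adjE; last exact: bop_slice_l.
by rewrite ipC [RHS]ipC slice_lE.
Qed.

Lemma swap_ex (H K : hilbert R) (X : op (H ** K)) (r : R) : bop _ X -> 0 <= r -> bd r X ->
  exists Y : op (K ** H), [/\ bop _ Y, bd r Y &
    forall a k b l, ip (Y (tn k a)) (tn l b) = ip (X (tn a k)) (tn b l)].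
Proof.
move=> bX r0 rX; have [F [G [iF iG FG GF hF]]] := tflip_ex (T := T) H K.
have rY : bd r (F \o X \o G).
  move=> z /=; have := isometric_bd iF (X (G z)); rewrite mul1r => /le_trans; apply.
  apply: le_trans (rX _) _; rewrite ler_wpM2l //.
  by have := isometric_bd iG z; rewrite mul1r.
have hG k a : G (tn k a) = tn a k by rewrite -hF FG.
exists (F \o X \o G); split=> //.
  apply/bopE; split; last by exists r.
  by move=> c x y /=; rewrite iG.1 (bop_lin bX) iF.1.
by move=> a k b l /=; rewrite hG -hF iF.2.
Qed.

Variables (H E : hilbert R) (p : op H -> op E).
Hypothesis up : universal T p.

(* [lam X] is [(p (x) id)(X)]. *)
Definition lam (K : hilbert R) (X : op (H ** K)) : op (E ** K) :=
  xget (fun=> 0) [set Y | bop _ Y /\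
    forall k l, slice_r (vfun k l) Y = p (slice_r (vfun k l) X)].

Lemma lam_uniq K (X : op (H ** K)) Y : bop _ Y ->
  (forall k l, slice_r (vfun k l) Y = p (slice_r (vfun k l) X)) -> lam X = Y.
Proof.
move=> bY hY; apply: xget_unique => // Z [bZ hZ].
by apply: tn_total_ext2 => // k l; rewrite hY hZ.
Qed.

Lemma lamP K (X : op (H ** K)) : bop _ X -> [/\ bop _ (lam X),
  forall r, 0 <= r -> bd r X -> bd r (lam X) &
  forall k l, slice_r (vfun k l) (lam X) = p (slice_r (vfun k l) X)].
Proof.
move=> bX; have [_ [r r0 rX]] := (bopE X).1 bX.
have [Y [bY rY hY]] := univ_amp up bX r0 rX.
rewrite (lam_uniq bY hY); split=> // s s0 sX.
have [Z [bZ sZ hZ]] := univ_amp up bX s0 sX.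
by rewrite -(lam_uniq bY hY) (lam_uniq bZ hZ).
Qed.

Lemma lam_bop K (X : op (H ** K)) : bop _ X -> bop _ (lam X).
Proof. by case/lamP. Qed.

Lemma lam_slice K (X : op (H ** K)) k l : bop _ X ->
  slice_r (vfun k l) (lam X) = p (slice_r (vfun k l) X).
Proof. by case/lamP. Qed.

Lemma lam_lin K (c : C) (X Y : op (H ** K)) : bop _ X -> bop _ Y ->
  lam (c *: X + Y) = c *: lam X + lam Y.
Proof.
move=> bX bY; have bX' := lam_bop bX; have bY' := lam_bop bY.
apply: lam_uniq; first exact: bop_lcomb.
move=> k l; rewrite !slice_r_lin // !lam_slice //.
by rewrite (star_hom_linear (univ_hom up)) //; exact: bop_slice_r.
Qed.

Lemma lam_adj K (X : op (H ** K)) : bop _ X -> lam (adj X) = adj (lam X).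
Proof.
move=> bX; have bX' := lam_bop bX; apply: lam_uniq; first exact: bop_adj.
move=> k l; rewrite !slice_adj // lam_slice //.
by rewrite (star_hom_adj (univ_hom up)) //; exact: bop_slice_r.
Qed.

Lemma lam_normal K (X : op (H ** K)) w : bop _ X -> normal_fun K w ->
  slice_r w (lam X) = p (slice_r w X).
Proof.
move=> bX nw; have bY := lam_bop bX.
have [x [y hxy]] := slice_normal_approx bX nw.
have [bs sE] := slice_normal bY nw.
have [bsX _] := slice_normal bX nw.
have [_ [r r0 rY]] := (bopE _).1 bY.
apply: bop_ext => a b; apply/eqP; rewrite -subr_eq0; apply/eqP; apply: nr_small => e e0.
have ab0 : 0 <= nr a * nr b by rewrite mulr_ge0 ?nr_ge0.
pose D := r * nr a * nr b + nr a * nr b + 1.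
have rab : 0 <= r * nr a * nr b by rewrite !mulr_ge0 ?nr_ge0.
have D0 : 0 < D by rewrite /D; lra.
have d0 : 0 < e / D by rewrite divr_gt0.
have [N [hN1 hN2]] := hxy _ d0.
pose S := \sum_(i < N) slice_r (vfun (x i) (y i)) X.
have bS : bop H S.
  rewrite /S; elim/big_ind: _ => [|u v|i _]; [exact: bop0 | exact: bopD | exact: bop_slice_r].
have pS : p S = \sum_(i < N) slice_r (vfun (x i) (y i)) (lam X).
  have [_ pl _ _] := univ_hom up.
  suff : bop H S /\ p S = \sum_(i < N) slice_r (vfun (x i) (y i)) (lam X) by case.
  rewrite /S; elim/big_ind2: _ => [|u1 u2 v1 v2 [b1 e1] [b2 e2]|i _].
  - split; first exact: bop0.
    have := pl (-1) id id (@bop_id _ H) (@bop_id _ H); rewrite !scaleN1r !addNr.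
    by [].
  - split; first exact: bopD.
    by rewrite -[u2]scale1r pl // !scale1r e1 e2.
  - by split; [exact: bop_slice_r | rewrite lam_slice].
rewrite sE -[w _](subrK (fsum N x y (slice_l (vfun a b) (lam X)))) -addrA.
apply: le_trans (nrD _ _) _.
have h1 := hN2 _ _ rab (bop_slice_l bY a b) (slice_l_bd bY a b r0 rY).
have eF : fsum N x y (slice_l (vfun a b) (lam X)) = ip (p S a) b.
  rewrite pS /fsum; under eq_bigr do rewrite -ip_slice //.
  rewrite -ip_suml; congr (ip _ b).
  by elim/big_rec2: _ => // i u v _ ->.
rewrite eF in h1 *; rewrite -ipBl.
have -> : p S a - p (slice_r w X) a = - ((p (slice_r w X - S)) a).
  have [_ pl _ _] := univ_hom up.
  have := pl (-1) S (slice_r w X) bS bsX; rewrite scaleN1r addrC => ->.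
  by rewrite -[(_ + _) a]/(-1 *: p S a + p (slice_r w X) a) scaleN1r opprD opprK.
have h2 : nr (ip (- (p (slice_r w X - S)) a) b) <= e / D * (nr a * nr b).
  rewrite ipNl nrN mulrA; apply: bd_ip.
  by apply: (univ_bd up) => //; [exact: bopB | exact: ltW].
apply: (@le_trans _ _ (e / D * D)); last by rewrite divfK // gt_eqF.
apply: le_trans (lerD h1 h2) _; rewrite -mulrDr ler_wpM2l ?(ltW d0) // /D; lra.
Qed.

(* [bil X] is [(p (x) p)(X)]. *)
Definition bil (X : op (H ** H)) : op (E ** E) :=
  xget (fun=> 0) [set Z | bop _ Z /\ forall x y x' y',
    ip (Z (tn x y)) (tn x' y') = ip (p (slice_l (vfun x x') (lam X)) y) y'].

Lemma bil_uniq X Z : bop _ Z -> (forall x y x' y',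
  ip (Z (tn x y)) (tn x' y') = ip (p (slice_l (vfun x x') (lam X)) y) y') -> bil X = Z.
Proof.
move=> bZ hZ; apply: xget_unique => // Z' [bZ' hZ'].
by apply: op_tn_ext2 => // *; rewrite hZ hZ'.
Qed.

Lemma bilP X : bop _ X -> [/\ bop _ (bil X), forall r, 0 <= r -> bd r X -> bd r (bil X) &
  forall x y x' y', ip (bil X (tn x y)) (tn x' y') = ip (p (slice_l (vfun x x') (lam X)) y) y'].
Proof.
move=> bX; have ex r : 0 <= r -> bd r X -> exists Z, [/\ bop _ Z, bd r Z & forall x y x' y',
    ip (Z (tn x y)) (tn x' y') = ip (p (slice_l (vfun x x') (lam X)) y) y'].
  (* [lam] acts on the first leg only: amplify, swap the legs, amplify again, swap back. *)
  move=> r0 rX; have [bY /(_ r r0 rX) rY _] := lamP bX.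
  have [Y' [bY' rY' hY']] := swap_ex bY r0 rY.
  have [bZ /(_ r r0 rY') rZ hZ] := lamP bY'.
  have [Z [bZ' rZ' hZ']] := swap_ex bZ r0 rZ.
  exists Z; split=> // x y x' y'; rewrite hZ' -slice_rE // hZ.
  congr (ip (p _ _) _); apply: bop_ext => a b.
  by rewrite slice_rE // hY' slice_lE.
have [_ [r r0 rX]] := (bopE _).1 bX.
have [Z [bZ rZ hZ]] := ex r r0 rX; rewrite (bil_uniq bZ hZ); split=> // s s0 sX.
have [Z' [bZ' rZ' hZ']] := ex s s0 sX.
by rewrite -(bil_uniq bZ hZ) (bil_uniq bZ' hZ').
Qed.

Lemma bil_bop X : bop _ X -> bop _ (bil X). Proof. by case/bilP. Qed.

Lemma bil_ip X x y x' y' : bop _ X ->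
  ip (bil X (tn x y)) (tn x' y') = ip (p (slice_l (vfun x x') (lam X)) y) y'.
Proof. by case/bilP. Qed.

Lemma bil_lin (c : C) X Y : bop _ X -> bop _ Y -> bil (c *: X + Y) = c *: bil X + bil Y.
Proof.
move=> bX bY; have bX' := bil_bop bX; have bY' := bil_bop bY.
apply: bil_uniq; first exact: bop_lcomb.
move=> x y x' y'; rewrite lam_lin // slice_l_lin //; try exact: lam_bop.
rewrite (star_hom_linear (univ_hom up)); try by apply/bop_slice_l/lam_bop.
rewrite (ip_lcomb c (bil X) (bil Y)) ip_lcomb.
by congr (c * _ + _); exact: bil_ip.
Qed.

Lemma bil_adj X : bop _ X -> bil (adj X) = adj (bil X).
Proof.
move=> bX; have bX' := bil_bop bX; apply: bil_uniq; first exact: bop_adj.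
move=> x y x' y'; rewrite lam_adj // slice_l_adj; last exact: lam_bop.
rewrite (star_hom_adj (univ_hom up)); last by apply/bop_slice_l/lam_bop.
rewrite adjE // ipC bil_ip // adjE -?ipC //.
by apply: (star_hom_bop (univ_hom up)); apply/bop_slice_l/lam_bop.
Qed.

Lemma bil_id : bil id = id.
Proof.
have bid := @bop_id _ H; have bid2 := @bop_id _ (H ** H).
apply: bil_uniq; first exact: bop_id.
move=> x y x' y'; have [pb pl _ _] := univ_hom up.
have pZ (c : C) : p (c *: id) = c *: id.
  have := pl (c - 1) id id bid bid; rewrite (univ_id up) scalerBl scale1r subrK => ->.
  by rewrite scalerBl scale1r subrK.
have sid (L : hilbert R) (k l : H) : slice_r (vfun k l) (id : op (L ** H)) = ip k l *: id.
  apply: bop_ext => a b; rewrite -[(_ *: _) a]/(_ *: a) ipZl mulrC -(tens_ip (T _ _)).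
  exact/slice_rE/bop_id.
have lid : lam (id : op (H ** H)) = id.
  by apply: lam_uniq => [|k l]; [exact: bop_id | rewrite !sid pZ].
rewrite lid (_ : slice_l (vfun x x') id = ip x x' *: id); last first.
  apply: bop_ext => a b; rewrite -[(_ *: _) a]/(_ *: a) ipZl -(tens_ip (T _ _)).
  exact/slice_lE/bop_id.
by rewrite pZ /= tens_ip -[(_ *: _) y]/(_ *: y) ipZl.
Qed.

(* The pairing identity characterising [X = D(U_kl)] for a corepresentation [U]
   is preserved by the amplification. *)
Lemma bil_coef K (U : op (H ** K)) (X : op (H ** H)) k l : bop _ U -> bop _ X ->
  (forall a b a' b', ip (X (tn a b)) (tn a' b') =
     ip (slice_l (vfun a a') U (slice_l (vfun b b') U k)) l) ->
  bil X = slice_r (vfun k l) (leg13 (lam U) \o leg23 (lam U)).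
Proof.
move=> bU bX hX; have bP := lam_bop bU.
have b13 := bop_leg13 bP; have b23 := bop_leg23 bP; have bc := bop_comp b13 b23.
apply: bil_uniq; first exact: bop_slice_r.
move=> x y x' y'; rewrite slice_rE // [LHS]/= leg_formula //.
pose l' := adj (slice_l (vfun x x') (lam U)) l.
have sl : slice_l (vfun x x') (lam X) = slice_r (vfun k l') U.
  apply: bop_ext => b b'; rewrite slice_lE; last exact: lam_bop.
  rewrite -slice_rE; last exact: lam_bop.
  rewrite lam_slice // (_ : slice_r (vfun b b') X = slice_r (vfun (slice_l (vfun b b') U k) l) U).
    rewrite -lam_slice // slice_rE // -slice_lE // /l' -adjEr; last exact: bop_slice_l.
    by rewrite slice_rE // slice_lE.
  by apply: bop_ext => a a'; rewrite slice_rE // hX slice_rE // slice_lE.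
rewrite sl -lam_slice // slice_rE // -slice_lE // /l' adjEr //.
exact: bop_slice_l.
Qed.

End Amplification.

(** * Bounded functionals on operator algebras, with real bounds *)

Section BoundedFunctionals.
Variables (R : realType).
Local Notation C := (cplx R).
Local Notation Re := (@complex.Re R).

Definition dualr (H : hilbert R) (A : set (op H)) (f : op H -> C) :=
  (forall (a : C) x y, A x -> A y -> f (a *: x + y) = a * f x + f y) /\
  exists2 c : R, 0 <= c & forall x r, A x -> 0 <= r -> bd r x -> nr (f x) <= c * r.

Lemma dualP (H : hilbert R) (A : set (op H)) f : dual A f <-> dualr A f.
Proof.
split=> [[fl [c hc]]|[fl [c c0 hc]]]; split=> //.
  exists (Num.max (Re c) 0) => [|x r Ax r0 rx]; first by rewrite le_max lexx orbT.
  have h := hc x r%:C%C Ax; rewrite ler0c in h.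
  have := h r0 (bd_opbound rx) => /Re_le; rewrite -/(nr (f x)) mulrC ReZ mulrC => /le_trans; apply.
  by rewrite ler_wpM2r // le_max lexx.
exists c%:C%C => x m Ax m0 mx.
rewrite (ge0_Re m0) -rcM -nr_le; apply: hc => //; first exact: Re_ge0.
exact: opbound_bd.
Qed.

Lemma dualr_ext (H : hilbert R) (A : set (op H)) f g : dualr A f -> dualr A g ->
  forall S : set (op H), S `<=` A -> A 0 -> lclosed A -> A `<=` norm_closure (lspan S) ->
  (forall s, S s -> f s = g s) -> forall a, A a -> f a = g a.
Proof.
move=> [fl [c c0 hf]] [gl [d d0 hg]] S SA A0 Al Ad hS a Aa.
have SLA : lspan S `<=` A by apply: lspan_ind.
have E s : lspan S s -> f s = g s.
  move=> Ss; suff : A s /\ f s = g s by case.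
  apply: (lspan_ind (P := [set s | A s /\ f s = g s])) Ss => [|e x y [Ax hx] [Ay hy]|x Sx].
  - split=> //; have := fl 1 0 0 A0 A0; rewrite scale1r mul1r addr0 -[X in X = _]addr0 => /addrI <-.
    by have := gl 1 0 0 A0 A0; rewrite scale1r mul1r addr0 -[X in X = _]addr0 => /addrI <-.
  - by split; [exact: Al | rewrite fl // gl // hx hy].
  - by split; [exact: SA | exact: hS].
apply/eqP; rewrite -subr_eq0; apply/eqP; apply: nr_small => e e0.
have /ncP[_ /(_ (e / (c + d + 1)))] := Ad _ Aa.
have cd0 : 0 < c + d + 1 by lra.
case=> [|s Ss hs]; first by rewrite divr_gt0.
have As := SLA _ Ss; have AD : A (a - s) by rewrite addrC -scaleN1r; exact: Al.
have fD : f a = f s + f (a - s).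
  by rewrite -{1}[a](subrK s) -[_ - s]scale1r fl // mul1r addrC scale1r.
have gD : g a = f s + g (a - s).
  by rewrite E // -{1}[a](subrK s) -[_ - s]scale1r gl // mul1r addrC scale1r.
rewrite fD gD opprD addrACA subrr add0r.
have q0 : 0 <= e / (c + d + 1) by rewrite divr_ge0 ?ltW.
apply: le_trans (nrD _ _) _; rewrite nrN.
apply: (@le_trans _ _ (e / (c + d + 1) * (c + d + 1))); last by rewrite divfK // gt_eqF.
apply: le_trans (lerD (hf _ _ AD q0 hs) (hg _ _ AD q0 hs)) _.
by rewrite -mulrDl mulrC ler_wpM2l // lerDl.
Qed.

Lemma dualr_ip (H K : hilbert R) (A : set (op H)) (F : op H -> op K) (c : R) u v :
  (forall (a : C) x y, A x -> A y -> F (a *: x + y) = a *: F x + F y) -> 0 <= c ->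
  (forall x r, A x -> 0 <= r -> bd r x -> bd (c * r) (F x)) ->
  dualr A (fun x => ip (F x u) v).
Proof.
move=> Fl c0 Fb; split=> [a x y Ax Ay|]; first by rewrite Fl // ip_lcomb.
exists (c * nr u * nr v) => [|x r Ax r0 rx]; first by rewrite !mulr_ge0 ?nr_ge0.
apply: le_trans (bd_ip (Fb x r Ax r0 rx) _ _) _.
by rewrite -!mulrA [r * _]mulrC !mulrA.
Qed.

Lemma star_hom_id_bd (H K : hilbert R) (A : set (op H)) (F : op H -> op K) :
  cstar_algebra A -> A id -> star_hom A F ->
  forall a r, A a -> 0 <= r -> bd r a -> bd r (F a).
Proof. by move=> cA A1 hF a r; apply: (star_hom_contractive cA hF A1). Qed.

End BoundedFunctionals.

(** * Commutants as algebras *)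

Section CommutantAlgebra.
Variables (R : realType) (H : hilbert R) (S : set (op H)).
Local Notation C := (cplx R).

Lemma commutant_lclosed : S `<=` bop H -> lclosed (commutant S).
Proof.
move=> Sb a x y [bx hx] [bY hy]; split=> [|s Ss]; first exact: bop_lcomb.
by apply: (commutant_lin (Sb _ Ss)); [exact: hx | exact: hy].
Qed.

Lemma commutant_mul x y : commutant S x -> commutant S y -> commutant S (x \o y).
Proof.
move=> [bx hx] [bY hy]; split=> [|s Ss]; first exact: bop_comp.
apply/funext => z /=; rewrite -[s (x (y z))]/((s \o x) (y z)) hx //=.
by rewrite -[s (y z)]/((s \o y) z) hy.
Qed.

Lemma commutant_adj : S `<=` bop H -> (forall s, S s -> S (adj s)) ->
  forall x, commutant S x -> commutant S (adj x).
Proof.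
move=> Sb Sa x [bx hx]; split=> [|s Ss]; first exact: bop_adj.
have bs := Sb _ Ss; rewrite -[s in LHS](adjK bs) -[s in RHS](adjK bs).
by rewrite -!adj_comp ?hx //; [exact: Sa | exact: bop_adj | exact: bop_adj].
Qed.

Lemma commutant2_sub : S `<=` bop H -> S `<=` commutant (commutant S).
Proof. by move=> Sb s Ss; split=> [|t [_ ht]]; [exact: Sb | rewrite ht]. Qed.

End CommutantAlgebra.

(** * Coefficients of operators on a tensor product *)

Section Coefficients.
Context {R : realType} {T : tensor_choice R}.
Local Notation C := (cplx R).
Local Notation "H ** K" := (tspace (T H K)) (at level 40).

Definition coefs (H K : hilbert R) (U : op (H ** K)) : set (op H) :=
  [set z | exists k l, z = slice_r (vfun k l) U].

Lemma coefs_dense (H K : hilbert R) (U : op (H ** K)) : bop _ U ->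
  norm_closure [set slice_r w U | w in normal_fun K] `<=` norm_closure (lspan (coefs U)).
Proof.
move=> bU; apply: subset_trans (@nc_idem _ _ _); apply: nc_mono => _ [w nw <-].
have [bs _] := slice_normal bU nw; apply/ncP; split=> // e e0.
have [x [y /(_ e e0)[N [hN _]]]] := slice_normal_approx bU nw.
exists (\sum_(i < N) slice_r (vfun (x i) (y i)) U) => //.
elim/big_ind: _ => [|a b ha hb|i _]; first exact: lspan0.
  by rewrite -[a]scale1r; exact: lspan_lin.
by apply: lspan_in; exists (x i), (y i).
Qed.

Lemma coefs_sub (H K : hilbert R) (U : op (H ** K)) : bop _ U ->
  coefs U `<=` norm_closure [set slice_r w U | w in normal_fun K].
Proof.
move=> bU _ [k [l ->]]; apply: nc_sub; last by exists (vfun k l) => //; exact: normal_vfun.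
by move=> _ [w nw <-]; case: (slice_normal bU nw).
Qed.

End Coefficients.

(** * The Eberlein algebra generated by a corepresentation *)

Section EberleinConstruction.
Context {R : realType} {T : tensor_choice R}.
Local Notation C := (cplx R).
Local Notation Re := (@complex.Re R).
Local Notation "H ** K" := (tspace (T H K)) (at level 40).
Local Notation tn := (tens (T _ _)).
Local Notation ot := (@otens R T _ _).

(* [D(U_kl)] is paired with product vectors as [U_13 U_23] prescribes. *)
Definition coef_comult (H K : hilbert R) (D : op H -> op (H ** H)) (U : op (H ** K)) :=
  forall k l a b a' b', ip (D (slice_r (vfun k l) U) (tn a b)) (tn a' b') =
    ip (slice_l (vfun a a') U (slice_l (vfun b b') U k)) l.

Lemma ftens_vfun (H K : hilbert R) (Z : op (H ** K)) x y x' y' : bop _ Z ->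
  ftens (vfun x y) (vfun x' y') Z = ip (Z (tn x x')) (tn y y').
Proof. by move=> bZ; rewrite /ftens /vfun slice_rE. Qed.

(** Produces the vectors hidden in the choice made by [normal_ext]. They are not unique, so later
    identities are proved for whichever vectors come. *)
Lemma normal_extP (H E : hilbert R) (A : set (op H)) (p : op H -> op E) f :
  universal_rep A p -> dual A f ->
  exists x y, normal_ext A p f = vfun x y /\ forall a, A a -> f a = ip (p a x) y.
Proof.
move=> [_ _ hp] df; have [x0 [y0 h0]] := hp f df.
have : [set g | exists x y, g = vfun x y /\ forall a, A a -> f a = g (p a)] (normal_ext A p f).
  by rewrite /normal_ext; apply: xgetPex; exists (vfun x0 y0); exists x0, y0.
by move=> [x [y [e h]]]; exists x, y; split=> // a Aa; rewrite h // e.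
Qed.

Lemma dualr_eq (H : hilbert R) (A : set (op H)) f g : lclosed A -> dualr A f ->
  (forall a, A a -> g a = f a) -> dualr A g.
Proof.
move=> Al [fl [c c0 fb]] h; split=> [e x y Ax Ay|]; first by rewrite !h ?fl //; exact: Al.
by exists c => // x r Ax r0 rx; rewrite h //; exact: fb.
Qed.

Lemma dualr_vfun (H : hilbert R) (A : set (op H)) x y : dualr A (vfun x y).
Proof.
apply: (dualr_ip (F := id) (c := 1)) => // z r _ _ rz; by rewrite mul1r.
Qed.

Lemma slice_r_normal_bop (H K : hilbert R) (X : op (H ** K)) w : bop _ X -> normal_fun K w ->
  bop H (slice_r w X).
Proof. by move=> bX nw; case: (slice_normal bX nw). Qed.

Variables (H E K : hilbert R) (p : op H -> op E).
Hypothesis up : universal T p.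
Variables (D : op H -> op (H ** H)) (M : set (op H)).
Hypotheses (cM : cstar_algebra M) (M1 : M id) (hD : star_hom M D) (D1 : D id = id).
Variable U : op (H ** K).
Hypotheses (bU : bop _ U) (U1 : bd 1 U) (cfU : coef_comult D U).
Local Notation A := (norm_closure [set slice_r w U | w in normal_fun K]).
Hypotheses (cA : cstar_algebra A) (AM : A `<=` M) (A1 : A id).
(* [U2] is the tensor square of [U]: it turns products of coefficients of [U]
   into coefficients. *)
Variable U2 : op (H ** (K ** K)).
Hypotheses (bU2 : bop _ U2) (cfU2 : coef_comult D U2).
Hypothesis U2E : forall k k' l l', slice_r (vfun (tn k k') (tn l l')) U2 =
  slice_r (vfun k l) U \o slice_r (vfun k' l') U.

Local Notation P := (lam p U).
Definition ebPhi (a : op H) : op (E ** E) := bil p (D a).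
Local Notation Phi := ebPhi.
Local Notation M2 := (bidual A p).

Let Ab : A `<=` bop H. Proof. exact: cstar_bop cA. Qed.
Let Al : lclosed A. Proof. exact: cstar_linear cA. Qed.
Let A0 : A 0. Proof. exact: cstar0 cA. Qed.
Let bP : bop _ P. Proof. exact: lam_bop. Qed.

Lemma eb_coef k l : A (slice_r (vfun k l) U).
Proof. by apply: coefs_sub => //; exists k, l. Qed.

Lemma eb_slice k l : slice_r (vfun k l) P = p (slice_r (vfun k l) U).
Proof. exact: lam_slice. Qed.

Lemma eb_ext f g : dualr A f -> dualr A g ->
  (forall k l, f (slice_r (vfun k l) U) = g (slice_r (vfun k l) U)) -> forall a, A a -> f a = g a.
Proof.
move=> hf hg h; apply: (dualr_ext hf hg (S := coefs U)) => //.
- exact: coefs_sub.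
- exact: coefs_dense.
- by move=> _ [k [l ->]].
Qed.

Lemma ebD_bop a : A a -> bop _ (D a).
Proof. by move=> Aa; apply: (star_hom_bop hD); exact: AM. Qed.

Lemma ebD_bd a (r : R) : A a -> 0 <= r -> bd r a -> bd r (D a).
Proof. by move=> Aa r0 ra; apply: (star_hom_id_bd cM M1 hD) => //; exact: AM. Qed.

Lemma ebPhi_bop a : A a -> bop _ (Phi a).
Proof. by move=> Aa; apply: bil_bop => //; exact: ebD_bop. Qed.

Lemma ebPhi_bd a (r : R) : A a -> 0 <= r -> bd r a -> bd r (Phi a).
Proof.
by move=> Aa r0 ra; have [_ h _] := bilP up (ebD_bop Aa); apply: h => //; exact: ebD_bd.
Qed.

Lemma ebPhi_lin (c : C) a b : A a -> A b -> Phi (c *: a + b) = c *: Phi a + Phi b.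
Proof.
move=> Aa Ab'; rewrite /Phi (star_hom_linear hD); [|exact: AM|exact: AM].
by apply: bil_lin => //; exact: ebD_bop.
Qed.

Lemma ebPhi_adj a : A a -> Phi (adj a) = adj (Phi a).
Proof.
move=> Aa; rewrite /Phi (star_hom_adj hD); last exact: AM.
by apply: bil_adj => //; exact: ebD_bop.
Qed.

Lemma ebPhi_id : Phi id = id.
Proof. by rewrite /Phi D1 bil_id. Qed.

Lemma ebPhi_coef k l : Phi (slice_r (vfun k l) U) = slice_r (vfun k l) (leg13 P \o leg23 P).
Proof. by apply: bil_coef => //; exact: ebD_bop (eb_coef k l). Qed.

Lemma ebPhi_dual u v : dualr A (fun a => ip (Phi a u) v).
Proof.
apply: (dualr_ip (c := 1)) => //; first exact: ebPhi_lin.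
by move=> x r Ax r0 rx; rewrite mul1r; exact: ebPhi_bd.
Qed.

Lemma ebPhi_mul a b : A a -> A b -> Phi (a \o b) = Phi a \o Phi b.
Proof.
have b13 := bop_leg13 bP; have b23 := bop_leg23 bP; have bc := bop_comp b13 b23.
have base k l k' l' : Phi (slice_r (vfun k l) U \o slice_r (vfun k' l') U) =
    Phi (slice_r (vfun k l) U) \o Phi (slice_r (vfun k' l') U).
  rewrite -U2E !ebPhi_coef -(leg_slice_mul (S := lam p U2)) //; last first.
    move=> k1 k2 l1 l2; rewrite lam_slice // U2E (star_hom_mul (univ_hom up)) ?eb_slice //; exact: bop_slice_r.
    exact: lam_bop.
  apply: bil_coef => //; rewrite U2E; apply/ebD_bop/(cstar_mul cA); exact: eb_coef.
(* Density is used in one factor at a time: first for an arbitrary left factor against a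
   coefficient, then for the right factor. *)
have step1 k l c : A c -> Phi (c \o slice_r (vfun k l) U) = Phi c \o Phi (slice_r (vfun k l) U).
  move=> Ac; set d := slice_r _ _; have Ad : A d by exact: eb_coef.
  apply: bop_ext => u v; move: c Ac; apply: eb_ext.
  - have [_ [r r0 rb]] := (bopE d).1 (Ab Ad).
    apply: (dualr_ip (F := fun c => Phi (c \o d)) (c := r)) => // [e x y Ax Ay|x s Ax s0 sx].
      by rewrite -ebPhi_lin //; exact: (cstar_mul cA).
    rewrite mulrC; apply: ebPhi_bd; [exact: (cstar_mul cA) | exact: mulr_ge0 | exact: bd_comp].
  - exact: ebPhi_dual.
  - by move=> k' l'; rewrite /d base.
move=> Aa Ab'; apply: bop_ext => u v; move: b Ab'; apply: eb_ext.
- have [_ [r r0 ra]] := (bopE a).1 (Ab Aa).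
  apply: (dualr_ip (F := fun c => Phi (a \o c)) (c := r)) => // [e x y Ax Ay|x s Ax s0 sx].
    rewrite -ebPhi_lin; try exact: (cstar_mul cA).
    congr (Phi _); apply/funext => z /=.
    by rewrite -[(_ + _) z]/(e *: x z + y z) (bop_lin (Ab Aa)).
  apply: ebPhi_bd; [exact: (cstar_mul cA) | exact: mulr_ge0 | exact: bd_comp].
- have [fl fb] := ebPhi_dual u (adj (Phi a) v).
  have e x : ip (Phi x u) (adj (Phi a) v) = ip ((Phi a \o Phi x) u) v.
    by rewrite adjEr //; exact: ebPhi_bop.
  rewrite -(_ : (fun x => ip (Phi x u) (adj (Phi a) v)) = (fun x => ip ((Phi a \o Phi x) u) v)).
    exact: ebPhi_dual.
  by apply/funext.
- by move=> k l; rewrite step1.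
Qed.

Lemma ebPhi_hom : star_hom A Phi.
Proof. by split; [exact: ebPhi_bop | exact: ebPhi_lin | exact: ebPhi_mul | exact: ebPhi_adj]. Qed.

Let B := p @` A.

Lemma eb_pb : B `<=` bop E.
Proof. by move=> _ [a Aa <-]; apply: (star_hom_bop (univ_hom up)); exact: Ab. Qed.

Lemma eb_pl : lclosed B.
Proof.
move=> c _ _ [a Aa <-] [b Ab' <-]; exists (c *: a + b); first exact: Al.
by rewrite (star_hom_linear (univ_hom up)) //; exact: Ab.
Qed.

Lemma eb_pm x y : B x -> B y -> B (x \o y).
Proof.
move=> [a Aa <-] [b Ab' <-]; exists (a \o b); first exact: (cstar_mul cA).
by rewrite (star_hom_mul (univ_hom up)) //; exact: Ab.
Qed.

Lemma eb_pa x : B x -> B (adj x).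
Proof.
move=> [a Aa <-]; exists (adj a); first exact: (cstar_adj cA).
by rewrite (star_hom_adj (univ_hom up)) //; exact: Ab.
Qed.

Lemma eb_p1 : B id.
Proof. by exists id => //; exact: univ_id up. Qed.

Lemma eb_comm_bop : commutant B `<=` bop E. Proof. by move=> x []. Qed.

Lemma eb_M2lin : lclosed M2. Proof. exact: commutant_lclosed eb_comm_bop. Qed.

Lemma eb_M2mul x y : M2 x -> M2 y -> M2 (x \o y). Proof. exact: commutant_mul. Qed.

Lemma eb_M2adj x : M2 x -> M2 (adj x).
Proof.
by apply: commutant_adj; [exact: eb_comm_bop | exact: commutant_adj eb_pb eb_pa].
Qed.

Lemma eb_M2p a : A a -> M2 (p a).
Proof. by move=> Aa; apply: (commutant2_sub eb_pb); exists a. Qed.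

Lemma eb_M2bop x : M2 x -> bop E x. Proof. by case. Qed.

(* Vector functionals representing [a |-> <Phi(a) z, z'>]; they extend to A**. *)
Definition ebrep (z z' : E ** E) (w : E * E) :=
  forall a, A a -> ip (Phi a z) z' = ip (p a w.1) w.2.

(** The norm bounds matter: they give the bound of [ebPsi] and the square summability in
    [ebPsi_normal]. *)
Lemma ebrep_ex z z' : exists w, [/\ nr w.1 <= 1, nr w.2 <= nr z * nr z' & ebrep z z' w].
Proof.
have [||x [y [nx ny hxy]]] := @univ_fun _ _ _ _ _ up _ (fun a => ip (Phi a z) z') (nr z * nr z')
  A0 Al Ab (ebPhi_dual z z').1.
- by rewrite mulr_ge0 ?nr_ge0.
- move=> a s Aa s0 sa; apply: le_trans (bd_ip (ebPhi_bd Aa s0 sa) _ _) _.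
  by rewrite [leRHS]mulrC mulrA.
by exists (x, y); split.
Qed.

(** Linear relations between vector functionals pass from the image of [A] to its bicommutant. Three
    terms are what sesquilinearity of the form in [ebPsiP] requires. *)
Lemma eb_key3 (c1 c2 c3 : C) (w1 w2 w3 : E * E) m : M2 m ->
  (forall a, A a -> c1 * ip (p a w1.1) w1.2 + c2 * ip (p a w2.1) w2.2 + c3 * ip (p a w3.1) w3.2 = 0) ->
  c1 * ip (m w1.1) w1.2 + c2 * ip (m w2.1) w2.2 + c3 * ip (m w3.1) w3.2 = 0.
Proof.
move=> Mm h.
pose x (i : 'I_3) := nth 0 [:: c1 *: w1.1; c2 *: w2.1; c3 *: w3.1] i.
pose y (i : 'I_3) := nth 0 [:: w1.2; w2.2; w3.2] i.
have sE b : lin b -> \sum_i ip (b (x i)) (y i) =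
   c1 * ip (b w1.1) w1.2 + c2 * ip (b w2.1) w2.2 + c3 * ip (b w3.1) w3.2.
  move=> lb; rewrite !big_ord_recl big_ord0 /x /y /= !(linZ lb) !ipZl addr0 addrA //.
rewrite -sE; last exact/bop_lin/eb_M2bop.
apply: (bicommutant_sum eb_pb eb_pl eb_p1 eb_pm eb_pa) => // _ [a Aa <-].
by rewrite sE ?h //; apply/bop_lin/eb_pb; exists a.
Qed.

Lemma eb_key w w' m : M2 m -> (forall a, A a -> ip (p a w.1) w.2 = ip (p a w'.1) w'.2) ->
  ip (m w.1) w.2 = ip (m w'.1) w'.2.
Proof.
move=> Mm h; have := @eb_key3 1 (-1) 0 w w' w m Mm.
rewrite !mul1r !mulN1r !mul0r !addr0 => e; apply/eqP; rewrite -subr_eq0; apply/eqP/e => a Aa.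
by rewrite mul1r mulN1r mul0r addr0 h // subrr.
Qed.

(** The normal extension of [Phi], obtained by transposition: the functional [a |-> <Phi(a) z, z'>]
    is a vector functional of [p], and as such it can be evaluated at [m] in the bidual. *)
Definition ebPsi (m : op E) : op (E ** E) :=
  xget (fun=> 0) [set Z | bop _ Z /\ forall z z' w, ebrep z z' w -> ip (Z z) z' = ip (m w.1) w.2].

Lemma ebPsiP m : M2 m -> [/\ bop _ (ebPsi m), forall r, 0 <= r -> bd r m -> bd r (ebPsi m) &
  forall z z' w, ebrep z z' w -> ip (ebPsi m z) z' = ip (m w.1) w.2].
Proof.
move=> Mm.
have [f hf] := choice (fun z : (E ** E) * (E ** E) => ebrep_ex z.1 z.2).
pose q z z' := ip (m (f (z, z')).1) (f (z, z')).2.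
have qE z z' w : ebrep z z' w -> q z z' = ip (m w.1) w.2.
  by move=> hw; apply: eb_key => // a Aa; rewrite -hw //; case: (hf (z, z')) => _ _ <-.
have ex r : 0 <= r -> bd r m -> exists Z, [/\ bop _ Z, bd r Z & forall z z' w, ebrep z z' w -> ip (Z z) z' = ip (m w.1) w.2].
  move=> r0 rm; have [|||bZ rZ hZ] := @op_of_form_rep _ _ q r r0.
  - move=> c x y z; rewrite /q; have := @eb_key3 (-1) c 1 (f (c *: x + y, z)) (f (x, z)) (f (y, z)) m Mm.
    rewrite !mul1r !mulN1r => e; apply/eqP; rewrite eq_sym -subr_eq0 addrC addrA; apply/eqP/e => a Aa.
    have [_ _ <- //] := hf (c *: x + y, z); have [_ _ <- //] := hf (x, z); have [_ _ <- //] := hf (y, z).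
    by rewrite mul1r mulN1r /= (linD (bop_lin (ebPhi_bop Aa))) (linZ (bop_lin (ebPhi_bop Aa))) ipDl ipZl; ring.
  - move=> c x y z; rewrite /q; have := @eb_key3 (-1) c^* 1 (f (x, c *: y + z)) (f (x, y)) (f (x, z)) m Mm.
    rewrite !mul1r !mulN1r => e; apply/eqP; rewrite eq_sym -subr_eq0 addrC addrA; apply/eqP/e => a Aa.
    have [_ _ <- //] := hf (x, c *: y + z); have [_ _ <- //] := hf (x, y); have [_ _ <- //] := hf (x, z).
    by rewrite mul1r mulN1r /= ipDr ipZr; ring.
  - move=> x y; rewrite /q; have [n1 n2 _] := hf (x, y).
    apply: le_trans (bd_ip rm _ _) _; rewrite -!mulrA ler_wpM2l //.
    have := nr_ge0 (f (x, y)).1; have := nr_ge0 (f (x, y)).2; rewrite /= in n2.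
    move: n1 n2; move: (nr _) (nr _ * nr _) (nr _) => p1 p2 p3; nra.
  by exists (op_of_form q); split=> // z z' w hw; rewrite hZ; exact: qE.
have [_ [r r0 rm]] := (bopE m).1 (eb_M2bop Mm).
have uniq Z : bop _ Z -> (forall z z' w, ebrep z z' w -> ip (Z z) z' = ip (m w.1) w.2) -> ebPsi m = Z.
  move=> bZ hZ; apply: xget_unique => // Y [bY hY]; apply: bop_ext => z z'.
  by have [w [_ _ hw]] := ebrep_ex z z'; rewrite (hY _ _ _ hw) (hZ _ _ _ hw).
have [Z [bZ rZ hZ]] := ex r r0 rm; rewrite (uniq Z bZ hZ); split=> // s s0 sm.
by have [Y [bY sY hY]] := ex s s0 sm; rewrite -(uniq Z bZ hZ) (uniq Y bY hY).
Qed.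

Lemma ebPsi_bop m : M2 m -> bop _ (ebPsi m). Proof. by case/ebPsiP. Qed.

Lemma ebPsi_ip m z z' w : M2 m -> ebrep z z' w -> ip (ebPsi m z) z' = ip (m w.1) w.2.
Proof. by case/ebPsiP => _ _; apply. Qed.

Lemma ebPsi_ext (Z Z' : op (E ** E)) :
  (forall z z' w, ebrep z z' w -> ip (Z z) z' = ip (Z' z) z') -> Z = Z'.
Proof.
move=> h; apply: bop_ext => z z'; have [w [_ _ hw]] := ebrep_ex z z'; exact: (h _ _ _ hw).
Qed.

Lemma ebPsi_p a : A a -> ebPsi (p a) = Phi a.
Proof.
move=> Aa; apply: ebPsi_ext => z z' w hw.
by rewrite (ebPsi_ip (eb_M2p Aa) hw) hw.
Qed.

Lemma ebPsi_id : ebPsi id = id.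
Proof. by rewrite -(univ_id up) ebPsi_p // ebPhi_id. Qed.

Lemma ebPsi_hom : star_hom M2 ebPsi.
Proof.
split; first exact: ebPsi_bop.
- move=> c m n Mm Mn; apply: ebPsi_ext => z z' w hw.
  by rewrite ip_lcomb !(ebPsi_ip _ hw) ?ip_lcomb //; exact: eb_M2lin.
(* The right factor is first taken in the image of [A]: multiplying by [p a] on the right only
   changes the representing vector [w.1]. A general right factor follows by changing [w.2] to
   [adj m w.2]. *)
- have half m a z z' : M2 m -> A a -> ip (ebPsi (m \o p a) z) z' = ip (ebPsi m (Phi a z)) z'.
    move=> Mm Aa; have [w [_ _ hw]] := ebrep_ex z z'.
    rewrite (ebPsi_ip (eb_M2mul Mm (eb_M2p Aa)) hw).
    rewrite (@ebPsi_ip m (Phi a z) z' (p a w.1, w.2)) // => b Ab'.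
    rewrite -[Phi b _]/((Phi b \o Phi a) z) -ebPhi_mul // hw; last exact: (cstar_mul cA).
    by rewrite (star_hom_mul (univ_hom up)) //; exact: Ab.
  move=> m n Mm Mn; apply: ebPsi_ext => z z' w hw.
  rewrite (ebPsi_ip (eb_M2mul Mm Mn) hw) /=.
  have bm := eb_M2bop Mm; have bPm := ebPsi_bop Mm.
  rewrite -[RHS]adjEr // -[LHS]adjEr //.
  rewrite (@ebPsi_ip n z (adj (ebPsi m) z') (w.1, adj m w.2)) // => a Aa.
  rewrite adjEr // -half // (ebPsi_ip (eb_M2mul Mm (eb_M2p Aa)) hw) /=.
  by rewrite adjEr.
- move=> m Mm; apply: ebPsi_ext => z z' w hw.
  rewrite (ebPsi_ip (eb_M2adj Mm) hw) (adjE (ebPsi_bop Mm)) (adjE (eb_M2bop Mm)).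
  rewrite ipC [RHS]ipC; congr (_^*); symmetry; apply: (@ebPsi_ip m z' z (w.2, w.1)) => // a Aa.
  have Aa' := cstar_adj cA Aa; have ba := Ab Aa.
  rewrite -[a](adjK ba) ebPhi_adj // adjE; last exact: ebPhi_bop.
  have baa := Ab Aa'; have bpa := star_hom_bop (univ_hom up) baa.
  rewrite (star_hom_adj (univ_hom up) baa) adjE // ipC hw //.
  by rewrite -ipC.
Qed.

Lemma eb_universal : universal_rep A p.
Proof.
have [pb pl pm pa] := univ_hom up; split.
- split=> [a Aa|c a b Aa Ab'|a b Aa Ab'|a Aa].
  + exact/pb/Ab.
  + by rewrite pl //; exact: Ab.
  + by rewrite pm //; exact: Ab.
  + by rewrite pa //; exact: Ab.
- apply/seteqP; split=> // z _; apply: subset_closure; apply: lspan_in.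
  by exists id, z; split=> //; rewrite (univ_id up).
- move=> f /dualP[fl [c c0 fb]].
  by have [x [y [_ _ h]]] := univ_fun up A0 Al Ab fl c0 fb; exists x, y.
Qed.

(** An [S] in the commutant commutes, slice by slice, with both legs of [P], hence with [Phi] on
    coefficients and by density on [A]. A pair representing [z] against [adj S z'] then also
    represents [S z] against [z'], which gives commutation with [ebPsi m]. *)
Lemma ebPsi_vn m : M2 m -> vn_tensor M2 M2 (ebPsi m).
Proof.
move=> Mm; split=> [|S [bS hS]]; first exact: ebPsi_bop.
have bid := @bop_id _ E; have bidK := @bop_id _ K.
have b13 := bop_leg13 bP; have b23 := bop_leg23 bP; have bc := bop_comp b13 b23.
have M21 : M2 id by rewrite -(univ_id up); exact: eb_M2p.
have Mp k l : M2 (slice_r (vfun k l) P) by rewrite eb_slice; apply/eb_M2p/eb_coef.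
have c13 : leg13 P \o ot S id = ot S id \o leg13 P.
  apply/otens_comm_slice => // k l; rewrite (_ : slice_r _ _ = ot (slice_r (vfun k l) P) id).
    by apply: hS; exists (slice_r (vfun k l) P), id.
  by apply: bop_ext => z z'; rewrite slice_rE // leg13_slice.
have c23 : leg23 P \o ot S id = ot S id \o leg23 P.
  apply/otens_comm_slice => // k l; rewrite (_ : slice_r _ _ = ot id (slice_r (vfun k l) P)).
    by apply: hS; exists id, (slice_r (vfun k l) P).
  by apply: bop_ext => z z'; rewrite slice_rE // leg23_slice.
have cc : (leg13 P \o leg23 P) \o ot S id = ot S id \o (leg13 P \o leg23 P).
  apply/funext => z /=; rewrite -[leg23 P (ot S id z)]/((leg23 P \o ot S id) z) c23 /=.
  by rewrite -[LHS]/((leg13 P \o ot S id) (leg23 P z)) c13.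
have cPhi a : A a -> S \o Phi a = Phi a \o S.
  move=> Aa; apply: bop_ext => u v; move: a Aa; apply: eb_ext.
  - rewrite (_ : (fun a => _) = (fun a => ip (Phi a u) (adj S v))); first exact: ebPhi_dual.
    by apply/funext => a; rewrite adjEr.
  - exact: ebPhi_dual.
  - move=> k l; have /otens_comm_slice h := cc.
    by rewrite ebPhi_coef -h.
apply: bop_ext => z z' /=; have [w [_ _ hw]] := ebrep_ex z (adj S z').
rewrite -adjEr // (ebPsi_ip Mm hw); symmetry; apply: ebPsi_ip => // a Aa.
by rewrite -hw // adjEr // -[LHS]/(ip ((Phi a \o S) z) z') -cPhi.
Qed.

Lemma ebPsi_normal : normal_map M2 ebPsi.
Proof.
move=> f /normalP[zs [zs' [[c1 sz] [c2 sz'] hf]]].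
have [w hw] := choice (fun n : nat => ebrep_ex (zs n) (zs' n)).
(* [ebrep_ex] puts the whole norm on [w.2]; rescaling by [nr (zs n)] makes both sequences square
   summable. For [zs n = 0] the inverse is 0 by convention, and [w.2] vanishes by its bound. *)
pose x n : E := (nr (zs n))%:C%C *: (w n).1.
pose y n : E := ((nr (zs n))^-1)%:C%C *: (w n).2.
have nx n : nr (x n) <= nr (zs n).
  rewrite nrZ nr_real ?nr_ge0 //; case: (hw n) => h _ _.
  by rewrite -[leRHS]mulr1 ler_wpM2l ?nr_ge0.
have ny n : nr (y n) <= nr (zs' n).
  rewrite nrZ nr_real ?invr_ge0 ?nr_ge0 //; case: (hw n) => _ h _.
  have [z0|zn] := eqVneq (nr (zs n)) 0; first by rewrite z0 invr0 mul0r nr_ge0.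
  by rewrite ler_pdivrMl // lt_def zn nr_ge0.
have sx : sqsum x.
  by exists c1 => N; apply: le_trans (sz N); apply: ler_sum => i _; rewrite ler_sqr ?nnegrE ?nr_ge0.
have sy : sqsum y.
  by exists c2 => N; apply: le_trans (sz' N); apply: ler_sum => i _; rewrite ler_sqr ?nnegrE ?nr_ge0.
have [g ng hg] := normal_series sx sy; exists g => // m Mm.
have bm := eb_M2bop Mm; have bPm := ebPsi_bop Mm.
have e n : ip (m (x n)) (y n) = ip (ebPsi m (zs n)) (zs' n).
  have [h1 h2 hr] := hw n; rewrite (ebPsi_ip Mm hr) /x /y (linZ (bop_lin bm)) ipZl ipZr cj_real.
  have [z0|zn] := eqVneq (nr (zs n)) 0; last by rewrite mulrA -rcM divff // mul1r.
  rewrite z0 mul0r; rewrite z0 mul0r in h2.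
  have -> : (w n).2 = 0 by apply: nr0_eq0; apply/eqP; rewrite eq_le h2 nr_ge0.
  by rewrite ip0r.
apply/eqP; rewrite -subr_eq0; apply/eqP; apply: nr_small => d d0.
have d2 : 0 < d / 2 by lra.
have [N1 h1] := hf _ bPm _ d2; have [N2 h2] := hg _ bm _ d2.
pose N := maxn N1 N2; have := h1 N (leq_maxl _ _); have := h2 N (leq_maxr _ _).
have -> : fsum N x y m = fsum N zs zs' (ebPsi m) by apply: eq_bigr => i _; rewrite e.
move=> q1 q2; rewrite -(subrK (fsum N zs zs' (ebPsi m)) (f _)) -addrA.
apply: le_trans (nrD _ _) _; rewrite nrB; lra.
Qed.

Lemma eb_comult : eberlein_comult A p Phi.
Proof.
split; first exact: ebPhi_hom.
  by move=> _ [a Aa <-]; rewrite -ebPsi_p //; exact/ebPsi_vn/eb_M2p.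
exists ebPsi; split.
- exact: ebPsi_hom.
- by move=> _ [m Mm <-]; exact: ebPsi_vn.
- exact: ebPsi_normal.
- exact: ebPsi_id.
- exact: ebPsi_p.
Qed.

(** An [S] in the commutant commutes with every [1 (x) rank_one k l], so it is some [s (x) 1]. Then
    [s] commutes with the slices of [P], which lie in the bidual, and so [S] commutes with [P]. *)
Lemma eb_V : vn_tensor M2 (bop K) P /\ opbound 1 P.
Proof.
split; last first.
  by have := (@bd_opbound _ _ 1 P); apply; have [_ h _] := lamP up bU; apply: h.
have bid := @bop_id _ E; have bidK := @bop_id _ K.
have M21 : M2 id by rewrite -(univ_id up); exact: eb_M2p.
split=> // S [bS hS].
have [|s [bs eS hs]] := commutant_tensor bS.
  by move=> k l; rewrite hS //; exists id, (rank_one k l); split=> //; exact: bop_rank_one.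
rewrite eS; symmetry; apply/otens_comm_slice => // k l.
have Mp : M2 (slice_r (vfun k l) P) by rewrite eb_slice; apply/eb_M2p/eb_coef.
symmetry; apply: hs; first exact: bop_slice_r.
by rewrite hS //; exists (slice_r (vfun k l) P), id.
Qed.

Lemma eb_convP f g : dual A f -> dual A g ->
  [/\ dual A (conv A p Phi f g),
     forall k l, conv A p Phi f g (slice_r (vfun k l) U) =
       ip (slice_l (normal_ext A p f) P (slice_l (normal_ext A p g) P k)) l &
     forall x y x' y', normal_ext A p f = vfun x y -> normal_ext A p g = vfun x' y' ->
       forall a, A a -> conv A p Phi f g a = ip (Phi a (tn x x')) (tn y y')].
Proof.
move=> df dg; have [x [y [ef _]]] := normal_extP eb_universal df.
have [x' [y' [eg _]]] := normal_extP eb_universal dg.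
have cE a : A a -> conv A p Phi f g a = ip (Phi a (tn x x')) (tn y y').
  by move=> Aa; rewrite /conv ef eg ftens_vfun //; exact: ebPhi_bop.
split.
- by apply/dualP; apply: dualr_eq cE => //; exact: ebPhi_dual.
- move=> k l; rewrite cE; last exact: eb_coef.
  have b13 := bop_leg13 bP; have b23 := bop_leg23 bP; have bc := bop_comp b13 b23.
  by rewrite ebPhi_coef slice_rE // [LHS]/= leg_formula // ef eg.
- move=> x1 y1 x2 y2 e1 e2 a Aa.
  by rewrite /conv e1 e2 ftens_vfun //; exact: ebPhi_bop.
Qed.

Lemma eb_slice_ext f : dual A f -> bop K (slice_l (normal_ext A p f) P) /\
  forall k l, ip (slice_l (normal_ext A p f) P k) l = f (slice_r (vfun k l) U).
Proof.
move=> df; have [x [y [ef hf]]] := normal_extP eb_universal df.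
rewrite ef; split=> [|k l]; first exact: bop_slice_l.
by rewrite hf ?eb_slice; [rewrite -eb_slice -ip_slice | exact: eb_coef].
Qed.

Lemma eb_slice_conv f g : dual A f -> dual A g ->
  slice_l (normal_ext A p (conv A p Phi f g)) P =
  slice_l (normal_ext A p f) P \o slice_l (normal_ext A p g) P.
Proof.
move=> df dg; have [dc hc _] := eb_convP df dg.
by apply: bop_ext => k l; rewrite (eb_slice_ext dc).2 hc.
Qed.

(** The product formula of condition (4) for any [V] with coefficients in [A]. It computes the
    product of [A] on the coefficients of a smaller embedded algebra, whose corepresentation is
    unrelated to [U]. *)
Lemma eb_conv_corep (L : hilbert R) (V : op (H ** L)) f g (Q S : op L) : bop _ V ->
  coef_comult D V -> (forall k l, A (slice_r (vfun k l) V)) -> dual A f -> dual A g ->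
  (forall k l, ip (Q k) l = f (slice_r (vfun k l) V)) ->
  (forall k l, ip (S k) l = g (slice_r (vfun k l) V)) ->
  forall k l, conv A p Phi f g (slice_r (vfun k l) V) = ip (Q (S k)) l.
Proof.
move=> bV cV AV df dg hQ hS k l.
have [x [y [ef hf]]] := normal_extP eb_universal df.
have [x' [y' [eg hg]]] := normal_extP eb_universal dg.
have [_ _ cE] := eb_convP df dg; rewrite (cE _ _ _ _ ef eg) //.
have bL : bop _ (lam p V) by exact: lam_bop.
have b13 := bop_leg13 bL; have b23 := bop_leg23 bL; have bc := bop_comp b13 b23.
rewrite /Phi (bil_coef up bV (ebD_bop (AV k l)) (cV k l)).
rewrite slice_rE // [LHS]/= leg_formula //.
have -> : slice_l (vfun x y) (lam p V) = Q.
  by apply: bop_ext => k' l'; rewrite hQ hf // slice_lE // -slice_rE // lam_slice.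
have -> : slice_l (vfun x' y') (lam p V) = S.
  by apply: bop_ext => k' l'; rewrite hS hg // slice_lE // -slice_rE // lam_slice.
by [].
Qed.

Lemma eb_dual_ext f g : dual A f -> dual A g ->
  (forall k l, f (slice_r (vfun k l) U) = g (slice_r (vfun k l) U)) -> forall a, A a -> f a = g a.
Proof. by move=> /dualP df /dualP dg; exact: eb_ext. Qed.

Lemma eb_eberlein : eberlein A p Phi P.
Proof.
split.
- exact: cA.
- exact: eb_universal.
- exact: eb_comult.
- exact: eb_V.
- move=> w nw; exists (slice_r w U); last exact: lam_normal.
  by apply: nc_sub => [_ [v nv <-]|]; [exact: slice_r_normal_bop | exists w].
- move=> _ [a Aa <-]; apply/ncP; split; first by apply: (star_hom_bop (univ_hom up)); exact: Ab.
  move=> e e0; have /ncP[ba h] := Aa; have [_ [w nw <-] hw] := h e e0.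
  exists (slice_r w P); first by exists w.
  have bs := slice_r_normal_bop bU nw.
  have := univ_bd up (bopB ba bs) (ltW e0) hw; rewrite lam_normal //.
  have [_ pl _ _] := univ_hom up.
  by have := pl (-1) _ _ bs ba; rewrite !scaleN1r ![- _ + _]addrC => ->.
(* Both bracketings are compositions of the same three slices of [P]. *)
- move=> f g h df dg dh; have [dfg _ _] := eb_convP df dg; have [dgh _ _] := eb_convP dg dh.
  have [d1 h1 _] := eb_convP dfg dh; have [d2 h2 _] := eb_convP df dgh.
  by apply: eb_dual_ext => // k l; rewrite h1 h2 !eb_slice_conv.
- exact: eb_slice_conv.
Qed.

(** On vector functionals of [H] the amplification by [p] cancels and [D] itself appears.
    Functionals on [C_0^u(G)] are of this kind, which leads to the restriction property. *)
Lemma eb_conv_vfun (x y x' y' : H) a : A a ->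
  conv A p Phi (vfun x y) (vfun x' y') a = ip (D a (tn x x')) (tn y y').
Proof.
have d1 : dual A (vfun x y) by apply/dualP; exact: dualr_vfun.
have d2 : dual A (vfun x' y') by apply/dualP; exact: dualr_vfun.
have [dc hc _] := eb_convP d1 d2; have /dualP dc' := dc.
have sl u v : dual A (vfun u v) -> slice_l (normal_ext A p (vfun u v)) P = slice_l (vfun u v) U.
  by move=> d; apply: bop_ext => k l; rewrite (eb_slice_ext d).2 /vfun ip_slice.
move: a; apply: eb_ext => //.
  apply: (dualr_ip (c := 1)) => // [c a b Aa Ab'|a r Aa r0 ra].
    by rewrite (star_hom_linear hD) //; exact: AM.
  by rewrite mul1r; exact: ebD_bd.
by move=> k l; rewrite hc !sl // cfU.
Qed.

End EberleinConstruction.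

(** * Multipliers of [A (x) K(H)] *)

Section TotalDense.
Context {R : realType}.
Local Notation C := (cplx R).
Local Notation Re := (@complex.Re R).

Lemma total_dense (H : hilbert R) (X : Type) (v : X -> H) : total v ->
  forall z (e : R), 0 < e -> exists s, nr (z - lc v s) <= e.
Proof.
move=> tv z e e0.
have [|||||w [_ cw] hw] := @riesz_on R H H [set u | exists s, u = lc v s] id
  (fun u => ip u z) (nr z).
- by exists [::]; rewrite /lc big_nil.
- by move=> a _ _ [s ->] [t ->]; exists ([seq (a * p.1, p.2) | p <- s] ++ t); rewrite lc_cat lc_scale.
- by [].
- by move=> a x y _ _; rewrite ipDl ipZl.
- by move=> x _; rewrite mulrC; exact: cauchy_schwarz.
have -> : z = w by apply: (total_ext tv) => x; rewrite hw //; exists [:: (1, x)]; rewrite lc1.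
by have [_ [s ->] hs] := cw e e0; exists s.
Qed.

Lemma total_tn_vec {T : tensor_choice R} (H K : hilbert R) (X : Type) (v : X -> K) : total v ->
  total (fun p : H * X => tens (T H K) p.1 (v p.2)).
Proof. by move=> tv; apply: (total_tn (v := id)) => // z h; apply: ip_eq0; apply: h. Qed.

End TotalDense.

Lemma lspan_elim (R : realType) (V : lmodType (cplx R)) (S : set V) (P : V -> Prop) :
  P 0 -> (forall a x y, P x -> P y -> P (a *: x + y)) -> (forall s, S s -> P s) ->
  forall s, lspan S s -> P s.
Proof. by move=> P0 Pl PS; exact: (lspan_ind (P := [set s | P s])). Qed.

Section Columns.
Context {R : realType} {T : tensor_choice R}.
Local Notation C := (cplx R).
Local Notation Re := (@complex.Re R).
Local Notation "H ** K" := (tspace (T H K)) (at level 40).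
Local Notation tn := (tens (T _ _)).
Local Notation ot := (@otens R T _ _).
Variables (H : hilbert R) (A : set (op H)).
Hypothesis cA : cstar_algebra A.

Let Ab : A `<=` bop H. Proof. exact: cstar_bop cA. Qed.

Lemma fsubE (V W : hilbert R) (F G : V -> W) z : (F - G) z = F z - G z.
Proof. by []. Qed.

(* Columns with entries in [A]: the norm closure of [A (x) K] in B(H, H (x) K). *)
Definition colgen (K : hilbert R) : set (H -> H ** K) :=
  [set F | exists c k, A c /\ F = fun x => tens (T H K) (c x) k].

Definition col (K : hilbert R) : set (H -> H ** K) :=
  [set F | forall e : R, 0 < e -> exists2 s, lspan (@colgen K) s & bd e (F - s)].

Lemma col_gen (K : hilbert R) c k : A c -> col (fun x => tens (T H K) (c x) k).
Proof.
move=> Ac e e0; exists (fun x => tn (c x) k); first by apply: lspan_in; exists c, k.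
by move=> x; rewrite fsubE subrr nr0 mulr_ge0 ?nr_ge0 ?ltW.
Qed.

Lemma col_close (K : hilbert R) (F : H -> H ** K) :
  (forall e : R, 0 < e -> exists2 G, col G & bd e (F - G)) -> col F.
Proof.
move=> h e e0; have e2 : 0 < e / 2 by lra.
have [G cG bG] := h _ e2; have [s ls bs] := cG _ e2; exists s => // x.
rewrite (_ : (F - s) x = (F - G) x + (G - s) x); last by rewrite !fsubE addrA subrK.
apply: le_trans (nrD _ _) _; have := bG x; have := bs x; lra.
Qed.

Lemma col_lin (K : hilbert R) : lclosed (@col K).
Proof.
move=> a F G cF cG e e0; have na := nr_ge0 a.
have d0 : 0 < e / (nr a + 1) by rewrite divr_gt0 // ltr_wpDl.
have [s ls bs] := cF _ (divr_gt0 d0 (ltr0Sn _ 1)); have [t lt bt] := cG _ (divr_gt0 d0 (ltr0Sn _ 1)).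
exists (a *: s + t); first exact: lspan_lin.
move=> x; rewrite (_ : (a *: F + G - (a *: s + t)) x = a *: (F - s) x + (G - t) x); last first.
  rewrite !fsubE -![(_ *: _ + _) x]/(_ *: _ x + _ x) scalerBr opprD addrACA //.
apply: le_trans (nrD _ _) _; rewrite nrZ.
have h1 := bs x; have h2 := bt x; have nx := nr_ge0 x.
have -> : e * nr x = (nr a + 1) * (e / (nr a + 1)) * nr x.
  by rewrite [_ * (e / _)]mulrC divfK // gt_eqF // ltr_wpDl.
move: h1 h2 d0; move: (nr ((F - s) x)) (nr ((G - t) x)) (e / _) => p q d.
move: na nx; move: (nr a) (nr x) => na nx na0 nx0 h1' h2' d0'.
have h3 : na * p <= na * (d / 2 * nx) by rewrite ler_wpM2l.
have h4 : 0 <= na * (d * nx) by rewrite !mulr_ge0 // ltW.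
have h5 : 0 <= d * nx by rewrite mulr_ge0 // ltW.
by rewrite (_ : (na + 1) * d * nx = na * (d * nx) + d * nx); [lra | ring].
Qed.

Lemma col_map (K K' : hilbert R) (L : H ** K -> H ** K') : blin L ->
  (forall c k, A c -> col (fun x => L (tn (c x) k))) -> forall F, col F -> col (L \o F).
Proof.
move=> [lL [r r0 rL]] hL F cF; apply: col_close => e e0.
have r1 : 0 < r + 1 by lra.
have [s ls bs] := cF _ (divr_gt0 e0 r1).
exists (L \o s); last first.
  move=> x; rewrite fsubE /= -(linB lL); apply: le_trans (rL _) _.
  have := bs x; rewrite fsubE => h.
  apply: (@le_trans _ _ (r * (e / (r + 1) * nr x))); first by rewrite ler_wpM2l.
  rewrite mulrA ler_wpM2r ?nr_ge0 // mulrCA -[leRHS]mulr1 ler_wpM2l ?(ltW e0) //.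
  by rewrite ler_pdivrMr // mul1r; lra.
move: s ls {bs}; apply: lspan_elim => [|a u v hu hv|_ [c [k [Ac ->]]]].
- move=> e1 e10; exists 0; first exact: lspan0.
  by move=> x; rewrite fsubE /= -[(0 : H -> _) x]/0 (lin0 lL) subrr nr0 mulr_ge0 ?nr_ge0 ?ltW.
- rewrite /= (_ : L \o _ = a *: (L \o u) + (L \o v)); first exact: col_lin.
  by apply/funext => x; rewrite /= -[(_ + _) x]/(a *: u x + v x) lL.
- exact: hL.
Qed.

(** For [U] and [adj U] together this is the multiplier condition for [A] tensored with the
    compacts, by [colmult_multipliers] and [multipliers_colmult]. It can be checked on a total
    family of vectors [k], which suits tensor products and direct sums. *)
Definition colmult (K : hilbert R) (U : op (H ** K)) :=
  forall c k, A c -> col (fun x => U (tens (T H K) (c x) k)).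

Lemma colmult_id (K : hilbert R) : colmult (id : op (H ** K)).
Proof. by move=> c k; exact: col_gen. Qed.

Lemma colmult_comp (K : hilbert R) (U V : op (H ** K)) : bop _ U -> colmult U -> colmult V -> colmult (U \o V).
Proof.
move=> /bopE bU mU mV c k Ac.
by apply: (col_map bU mU (F := fun x => V (tn (c x) k))); exact: mV.
Qed.

Lemma colmult_total (K : hilbert R) (X : Type) (v : X -> K) (U : op (H ** K)) : bop _ U -> total v ->
  (forall c x, A c -> col (fun y => U (tn (c y) (v x)))) -> colmult U.
Proof.
move=> bU tv h c k Ac; have [lU [r r0 rU]] := (bopE U).1 bU.
have [_ [q q0 qc]] := (bopE c).1 (Ab Ac).
apply: col_close => e e0.
have d0 : 0 < e / (r * q + 1) by rewrite divr_gt0 // ltr_wpDl // mulr_ge0.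
have [s hs] := total_dense tv k d0.
exists (fun y => U (tn (c y) (lc v s))).
  rewrite (_ : (fun y => _) = \sum_(p <- s) p.1 *: (fun y => U (tn (c y) (v p.2)))).
    elim: s {hs} => [|p s IH]; last by rewrite big_cons; apply: col_lin => //; exact: h.
    rewrite big_nil => e1 e10; exists 0; first exact: lspan0.
    by move=> x; rewrite fsubE subrr nr0 mulr_ge0 ?nr_ge0 ?ltW.
  apply/funext => y; rewrite /lc; elim: (s) => [|p t IH].
    by rewrite !big_nil tn0r (lin0 lU).
  rewrite !big_cons tnDr tnZr (linD lU) (linZ lU) IH.
  by rewrite -[(_ + _) y in RHS]/(_ y + _ y).
move=> y; rewrite fsubE -(linB lU) (_ : _ - _ = tn (c y) (k - lc v s)); last first.
  by rewrite -(linB (proj1 (@blin_tnr R T H K (c y)))).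
apply: le_trans (rU _) _; rewrite tn_nr.
have h1 := qc y; have ny := nr_ge0 y.
have -> : e * nr y = (r * q + 1) * (e / (r * q + 1)) * nr y.
  by rewrite [_ * (e / _)]mulrC divfK // gt_eqF // ltr_wpDl // mulr_ge0.
have n1 := nr_ge0 (c y); have n2 := nr_ge0 (k - lc v s).
have h2 : nr (c y) * nr (k - lc v s) <= q * nr y * (e / (r * q + 1)) by exact: ler_pM.
have h3 : r * (nr (c y) * nr (k - lc v s)) <= r * (q * nr y * (e / (r * q + 1))) by rewrite ler_wpM2l.
apply: le_trans h3 _; move: ny d0; move: (nr y) (e / _) => ny d ny0 d0'.
have : 0 <= d * ny by rewrite mulr_ge0 // ltW.
by rewrite (_ : r * (q * ny * d) = r * q * d * ny); [nra | ring].
Qed.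

Lemma col_contr (K : hilbert R) (F : H -> H ** K) l : bop H (contr_r l \o F) -> col F -> A (contr_r l \o F).
Proof.
move=> bF cF; apply: (cstar_closed cA); apply/ncP; split=> // e e0.
have n1 : 0 < nr l + 1 by rewrite ltr_wpDl ?nr_ge0.
have [s ls bs] := cF _ (divr_gt0 e0 n1); have [lC _] := @blin_contr_r R T H K l.
exists (contr_r l \o s); last first.
  move=> x; rewrite fsubE /= -(linB lC); apply: le_trans (contr_r_bd _ _) _.
  have := bs x; rewrite fsubE => h.
  apply: (@le_trans _ _ (nr l * (e / (nr l + 1) * nr x))); first by rewrite ler_wpM2l ?nr_ge0.
  rewrite mulrA ler_wpM2r ?nr_ge0 // mulrCA -[leRHS]mulr1 ler_wpM2l ?(ltW e0) //.
  by rewrite ler_pdivrMr // mul1r; lra.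
move: s ls {bs}; apply: lspan_elim => [|a u v hu hv|_ [c [k [Ac ->]]]] /=.
- rewrite (_ : _ \o _ = fun=> 0); first exact: (cstar0 cA).
  by apply/funext => x /=; rewrite -[(0 : H -> _) x]/0 (lin0 lC).
- rewrite (_ : contr_r l \o _ = a *: (contr_r l \o u) + (contr_r l \o v)); first exact: (cstar_linear cA).
  by apply/funext => x; rewrite /= -[(_ + _) x]/(a *: u x + v x) lC.
- rewrite (_ : _ \o _ = ip k l *: c + (fun=> 0)); first by apply: (cstar_linear cA) => //; exact: (cstar0 cA).
  by apply/funext => x /=; rewrite contr_r_tn -[(_ + _) x]/(ip k l *: c x + 0) addr0.
Qed.

Lemma colmult_coef (K : hilbert R) (U : op (H ** K)) : bop _ U -> colmult U -> colmult (adj U) ->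
  forall k l, multipliers A (slice_r (vfun k l) U).
Proof.
move=> bU mU mU' k l; have bs := bop_slice_r bU k l; split=> // c Ac.
have half V k' l' c' : bop _ V -> colmult V -> A c' -> A (slice_r (vfun k' l') V \o c').
  move=> bV mV Ac'; have e : slice_r (vfun k' l') V \o c' = contr_r l' \o (fun x => V (tn (c' x) k')).
    by apply/funext => x /=; rewrite contr_r_slice.
  have bc := bop_comp (bop_slice_r bV k' l') (Ab Ac').
  by rewrite e in bc *; apply: col_contr => //; exact: mV.
split; first exact: half.
have bc := Ab Ac; rewrite -[c](adjK bc) -[slice_r _ _](adjK bs) -adj_comp; try exact: bop_adj.
rewrite -slice_adj //; apply: (cstar_adj cA); apply: half => //; first exact: bop_adj.
exact: (cstar_adj cA).
Qed.

Lemma otens_lcomb_r (K : hilbert R) (a : C) x (u w : op K) : bop H x -> bop K u -> bop K w ->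
  ot x (a *: u + w) = a *: ot x u + ot x w.
Proof.
move=> bx bu bw; have b1 := bop_otens (T := T) bx bu; have b2 := bop_otens (T := T) bx bw.
apply: op_tn_ext; [by apply: bop_otens => //; exact: bop_lcomb | exact: bop_lcomb |].
move=> c d; rewrite otensE //; last exact: bop_lcomb.
rewrite -[(_ + ot x w) _]/(a *: ot x u _ + ot x w _) !otensE //.
by rewrite -[(_ + w) d]/(a *: u d + w d) tnDr tnZr.
Qed.

Local Notation mt K := (@min_tensor R T H K A (compact_ops K)).

Lemma compact_bop (K : hilbert R) : compact_ops K `<=` bop K. Proof. by move=> x []. Qed.

Lemma elem_bop (K : hilbert R) : elementary A (compact_ops K) `<=` bop (H ** K).
Proof. by move=> _ [x [u [Ax Cu ->]]]; apply: bop_otens; [exact: Ab | exact: compact_bop]. Qed.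

Lemma lspan_bop (K : hilbert R) (S : set (op K)) : S `<=` bop K -> lspan S `<=` bop K.
Proof.
move=> Sb; apply: lspan_ind => //; first exact: bop0.
by move=> a x y; exact: bop_lcomb.
Qed.

Lemma mt_lin (K : hilbert R) : lclosed (mt K).
Proof. exact/nc_lin/lspan_lin. Qed.

Lemma mt_elem (K : hilbert R) c u : A c -> compact_ops K u -> mt K (ot c u).
Proof.
move=> Ac cu; apply: nc_sub; first exact/lspan_bop/elem_bop.
by apply: lspan_in; exists c, u.
Qed.

Lemma rank_one_compact (K : hilbert R) (k l : K) : compact_ops K (rank_one k l).
Proof.
apply: nc_sub; last by apply: lspan_in; exists k, l.
by apply: lspan_bop => _ [x [y ->]]; exact: bop_rank_one.
Qed.

Lemma lspan_adj (K : hilbert R) (S : set (op K)) : S `<=` bop K -> (forall s, S s -> lspan S (adj s)) ->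
  forall s, lspan S s -> lspan S (adj s).
Proof.
move=> Sb Sa s ls; suff : bop K s /\ lspan S (adj s) by case.
apply: (lspan_ind (P := [set s | bop K s /\ lspan S (adj s)])) ls => [|a x y [bx hx] [bY hy]|x Sx] /=.
- split; first exact: bop0.
  by rewrite -[(0 : op K)]/(fun=> 0) adj0 -[(fun=> 0) : op K]/(0 : op K); exact: lspan0.
- by split; [exact: bop_lcomb | rewrite adj_lcomb //; exact: lspan_lin].
- by split; [exact: Sb | exact: Sa].
Qed.

Lemma compact_adj (K : hilbert R) u : compact_ops K u -> compact_ops K (adj u).
Proof.
have rb : [set Q : op K | exists x y, Q = rank_one x y] `<=` bop K.
  by move=> _ [x [y ->]]; exact: bop_rank_one.
apply: nc_adj; first exact: lspan_bop.
move=> x lx; apply: nc_sub; first exact: lspan_bop.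
by apply: lspan_adj lx => // _ [k [l ->]]; rewrite adj_rank_one; apply: lspan_in; exists l, k.
Qed.

Lemma mt_adj (K : hilbert R) t : mt K t -> mt K (adj t).
Proof.
apply: nc_adj; first exact/lspan_bop/elem_bop.
move=> x lx; apply: nc_sub; first exact/lspan_bop/elem_bop.
apply: lspan_adj lx; first exact: elem_bop.
move=> _ [c [u [Ac cu ->]]]; rewrite otens_adj; [|exact: Ab|exact: compact_bop].
by apply: lspan_in; exists (adj c), (adj u); split=> //; [exact: (cstar_adj cA) | exact: compact_adj].
Qed.

Lemma colmult_mt (K : hilbert R) (U : op (H ** K)) : bop _ U -> colmult U -> forall t, mt K t -> mt K (U \o t).
Proof.
move=> bU mU; have [lU [r r0 rU]] := (bopE U).1 bU.
have r1 : 0 < r + 1 by lra.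
have close (V W : op (H ** K)) e : 0 <= e -> bd (e / (r + 1)) (V - W) -> bd e ((U \o V) - (U \o W)).
  move=> e0 h x; rewrite fsubE /= -(linB lU); apply: le_trans (rU _) _.
  apply: (@le_trans _ _ (r * (e / (r + 1) * nr x))).
    by rewrite ler_wpM2l //; have := h x; rewrite fsubE.
  rewrite mulrA ler_wpM2r ?nr_ge0 // mulrCA -[leRHS]mulr1 ler_wpM2l //.
  by rewrite ler_pdivrMr // mul1r; lra.
have Ulin (a : C) (V W : op (H ** K)) : U \o (a *: V + W) = a *: (U \o V) + (U \o W).
  by apply/funext => x; rewrite /= -[(_ + W) x]/(a *: V x + W x) lU.
have U0 : U \o (0 : op (H ** K)) = 0 by apply/funext => x; rewrite /= -[(0 : op _) x]/0 (lin0 lU).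
have mt0 : mt K 0 by apply: nc_sub; [exact/lspan_bop/elem_bop | exact: lspan0].
(* For a rank-one second factor, [c (x) rank_one k l] is the column of [c] and [k] after contraction
   with [l]; spans and limits do the rest. *)
have rank c k l : A c -> mt K (U \o ot c (rank_one k l)).
  move=> Ac; have bo := bop_otens (T := T) (Ab Ac) (bop_rank_one k l).
  apply: nc_close; first exact: bop_comp.
  move=> e e0; have n1 : 0 < nr l + 1 by rewrite ltr_wpDl ?nr_ge0.
  have [s ls bs] := mU c k Ac _ (divr_gt0 e0 n1); have [lC _] := @blin_contr_r R T H K l.
  have cE c' k' : A c' -> ot c' (rank_one k' l) = (fun x => tn (c' x) k') \o contr_r l.
    move=> Ac'; have := lin_total_ext (@tn_total _ T H K) => h; apply: h.
    - by apply/bopE/bop_otens; [exact: Ab | exact: bop_rank_one].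
    - apply: blin_comp; last exact: blin_contr_r.
      exact: (@blin_comp _ _ _ _ (fun x => tn x k') c' (@blin_tnl R T H K k') ((bopE c').1 (Ab Ac'))).
    - move=> [a m] /=; rewrite otensE ?contr_r_tn; [|exact: Ab|exact: bop_rank_one].
      by rewrite /rank_one tnZr (linZ (bop_lin (Ab Ac'))) tnZl.
  exists (s \o contr_r l).
    move: s ls {bs}; apply: lspan_elim => [|a u v hu hv|_ [c' [k' [Ac' ->]]]] /=.
    - exact: mt0.
    - by rewrite (_ : _ \o _ = a *: (u \o contr_r l) + (v \o contr_r l)) //; exact: mt_lin.
    - by rewrite -cE //; apply: mt_elem => //; exact: rank_one_compact.
  move=> x; rewrite fsubE cE //=.
  have := bs (contr_r l x); rewrite fsubE => /le_trans; apply.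
  apply: (@le_trans _ _ (e / (nr l + 1) * (nr l * nr x))).
    by rewrite ler_wpM2l ?contr_r_bd // divr_ge0 ?ltW.
  rewrite mulrA ler_wpM2r ?nr_ge0 // -mulrA -[leRHS]mulr1 ler_wpM2l ?(ltW e0) //.
  by rewrite mulrC ler_pdivrMr // mul1r; lra.
have elem c u : A c -> compact_ops K u -> mt K (U \o ot c u).
  move=> Ac cu; have bc := Ab Ac; have [_ [q q0 qc]] := (bopE c).1 bc.
  apply: nc_close; first by apply: bop_comp => //; apply: bop_otens => //; exact: compact_bop.
  move=> e e0; have /ncP[bu hu] := cu; have q1 : 0 < q + 1 by lra.
  have e1 : 0 < e / (r + 1) by rewrite divr_gt0.
  have [s ls bs] := hu _ (divr_gt0 e1 q1).
  have sb : bop K s by apply: lspan_bop ls => _ [x [y ->]]; exact: bop_rank_one.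
  exists (U \o ot c s); last first.
    apply: close; first exact: ltW.
    rewrite (_ : ot c u - ot c s = ot c (u - s)); last first.
      rewrite [u - s]addrC [ot c u - _]addrC -[- s]scaleN1r -[- ot c s]scaleN1r.
      exact/esym/otens_lcomb_r.
    apply: bd_le (otens_bd (T := T) bc (bopB bu sb) q0 _ qc bs); last by rewrite divr_ge0 ?ltW.
    by rewrite mulrCA -[leRHS]mulr1 ler_wpM2l ?(ltW e1) // ler_pdivrMr // mul1r; lra.
  suff : bop K s /\ mt K (U \o ot c s) by case.
  move: s ls {bs sb}; apply: lspan_elim => [|a x y [bx hx] [bY hy]|_ [x [y ->]]] /=.
  - split; first exact: bop0.
    rewrite (_ : ot c 0 = 0) ?U0 //; apply: op_tn_ext => [||a b].
    + by apply: bop_otens => //; exact: bop0.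
    + exact: bop0.
    + by rewrite otensE ?tn0r //; exact: bop0.
  - by split; [exact: bop_lcomb | rewrite otens_lcomb_r // Ulin; exact: mt_lin].
  - by split; [exact: bop_rank_one | exact: rank].
move=> t /ncP[bt ht]; apply: nc_close; first exact: bop_comp.
move=> e e0; have [s ls bs] := ht _ (divr_gt0 e0 r1); exists (U \o s); last by apply: close => //; exact: ltW.
move: s ls {bs}; apply: lspan_elim => [|a x y hx hy|_ [c [u [Ac cu ->]]]] /=.
- by rewrite U0.
- by rewrite Ulin; exact: mt_lin.
- exact: elem.
Qed.

Lemma colmult_multipliers (K : hilbert R) (U : op (H ** K)) : bop _ U -> colmult U -> colmult (adj U) ->
  multipliers (mt K) U.
Proof.
move=> bU mU mU'; split=> // t ht; split; first exact: colmult_mt.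
have bt := nc_bop ht; rewrite -[t \o U]adjK; last exact: bop_comp.
by rewrite adj_comp //; apply/mt_adj/colmult_mt => //; [exact: bop_adj | exact: mt_adj].
Qed.

Lemma multipliers_colmult (K : hilbert R) (U : op (H ** K)) : multipliers (mt K) U -> colmult U /\ colmult (adj U).
Proof.
have colt t l : mt K t -> col (fun x => t (tn x l)).
  move=> /ncP[bt ht]; apply: col_close => e e0; have n1 : 0 < nr l + 1 by rewrite ltr_wpDl ?nr_ge0.
  have [s ls bs] := ht _ (divr_gt0 e0 n1); exists (fun x => s (tn x l)); last first.
    move=> x; rewrite fsubE; have := bs (tn x l); rewrite fsubE => /le_trans; apply.
    rewrite tn_nr [nr x * _]mulrC mulrA ler_wpM2r ?nr_ge0 // -mulrA -[leRHS]mulr1 ler_wpM2l ?(ltW e0) //.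
    by rewrite mulrC ler_pdivrMr // mul1r; lra.
  move: s ls {bs}; apply: lspan_elim => [|a u v hu hv|_ [c [u [Ac cu ->]]]] /=.
  - move=> d d0; exists 0; first exact: lspan0.
    by move=> x; rewrite fsubE -[(0 : op (H ** K)) _]/0 subrr nr0 mulr_ge0 ?nr_ge0 ?ltW.
  - exact: (col_lin a hu hv).
  - rewrite (_ : (fun x => _) = fun x => tn (c x) (u l)); first exact: col_gen.
    by apply/funext => x; rewrite otensE //; [exact: Ab | exact: compact_bop].
have half V : bop _ V -> (forall t, mt K t -> mt K (V \o t)) -> colmult V.
  move=> bV hV c k Ac.
  have [k0|kn] := pselect (k = 0).
    move=> e e0; exists 0; first exact: lspan0.
    by move=> x; rewrite fsubE k0 tn0r (lin0 (bop_lin bV)) subrr nr0 mulr_ge0 ?nr_ge0 ?ltW.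
  have n0 : ip k k != 0 by apply/eqP => /ip_eq0.
  (* This rank-one operator is the projection onto the line of [k]; it fixes [k], so evaluating at
     [k] returns the column. *)
  have := colt _ k (hV _ (mt_elem Ac (rank_one_compact ((ip k k)^-1 *: k) k))).
  congr col; apply/funext => x /=; rewrite otensE; [|exact: Ab|exact: bop_rank_one].
  by rewrite /rank_one scalerA divff // scale1r.
move=> [bU hU]; split; first by apply: half => // t /hU[].
apply: half; first exact: bop_adj.
move=> t ht; have bt := nc_bop ht; rewrite -[_ \o t]adjK; last by apply: bop_comp => //; exact: bop_adj.
rewrite adj_comp // ?adjK //; last exact: bop_adj.
by apply: mt_adj; case: (hU _ (mt_adj ht)).
Qed.

End Columns.

(** * Direct sums and strict continuity *)

Section DirectSum.
Context {R : realType}.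
Local Notation C := (cplx R).
Local Notation Re := (@complex.Re R).
Variables (I : eqType) (Ks : I -> hilbert R).

Definition dproj (i : I) (u : {i & Ks i}) : Ks i :=
  tagged_as (Tagged (fun i => hspace (Ks i)) (0 : Ks i)) u.

Lemma dprojE i (x : Ks i) : dproj i (Tagged (fun i => hspace (Ks i)) x) = x.
Proof. by rewrite /dproj /tagged_as /=; case: eqP => // e; rewrite (eq_irrelevance e erefl). Qed.

Lemma dproj0 i u : i != tag u -> dproj i u = 0.
Proof. by rewrite /dproj /tagged_as /=; case: eqP. Qed.

(** The double sum is grouped by index: [r] lists the indices that occur, each contributing the
    squared norm of its component. *)
Lemma dsum_psd : psd (fun u v : {i & Ks i} => ip (tagged u) (dproj (tag u) v)).
Proof.
move=> s; rewrite sum_tnth; under eq_bigr do rewrite sum_tnth.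
set p := tnth _; pose r := undup [seq tag (p k).2 | k <- enum 'I_(size s)].
rewrite (_ : \sum_i _ = \sum_(i <- r) ip (\sum_k (p k).1 *: dproj i (p k).2) (\sum_k (p k).1 *: dproj i (p k).2)).
  by apply: sumr_ge0 => i _; exact: ip_ge0.
under [RHS]eq_bigr do rewrite ip_suml.
rewrite [RHS]exchange_big /=; apply: eq_bigr => k _.
under [RHS]eq_bigr do rewrite ip_sumr.
rewrite [RHS]exchange_big /=; apply: eq_bigr => l _.
rewrite (bigD1_seq (tag (p k).2)) ?undup_uniq ?mem_undup //=; last first.
  by apply/mapP; exists k => //; rewrite mem_enum.
rewrite big1 ?addr0; last by move=> i ik; rewrite (dproj0 ik) scaler0 ip0l.
rewrite ipZl ipZr mulrA; congr (_ * _ * _).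
by case: (p k) => c [i x] /=; rewrite dprojE.
Qed.

Lemma dsum_ex : exists (K : hilbert R) (j : forall i, Ks i -> K),
  [/\ forall i, isometric (j i),
      forall i i' x y, i != i' -> ip (j i x) (j i' y) = 0 &
      total (fun u : {i & Ks i} => j (tag u) (tagged u))].
Proof.
have [K [v [gv tv]]] := kolmogorov dsum_psd.
pose j i (x : Ks i) := v (Tagged (fun i => hspace (Ks i)) x).
have jj i (x y : Ks i) : ip (j i x) (j i y) = ip x y by rewrite gv /= dprojE.
have jo i i' x y : i != i' -> ip (j i x) (j i' y) = 0.
  by move=> ii; rewrite gv /= dproj0 ?ip0r.
exists K, j; split=> //; last first.
  by move=> z h; apply: tv => -[i x]; have := h (existT _ i x).
move=> i; split=> // a x y; apply: (total_extl tv) => -[i' z].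
rewrite -/(j i' z) ipDl ipZl.
have [e|ne] := eqVneq i i'; last by rewrite !jo // mulr0 addr0.
by case: i' / e z => z; rewrite !jj ipDl ipZl.
Qed.

End DirectSum.

Section Unitaries.
Context {R : realType}.

Lemma isometric_unitary (H : hilbert R) (F G : op H) : isometric F -> isometric G ->
  cancel F G -> cancel G F -> unitary F.
Proof.
move=> iF iG FG GF; have bF := (bopE F).2 (isometric_blin iF).
have aF : adj F = G.
  apply: adj_uniq; first exact/bopE/isometric_blin.
  by move=> x y; rewrite -iF.2 GF.
by split=> //; rewrite aF; apply/funext => x /=; [exact: FG | exact: GF].
Qed.

Lemma unitary_ip (H : hilbert R) (U : op H) : unitary U -> forall x y, ip (U x) (U y) = ip x y.
Proof. by move=> [bU h _] x y; rewrite -adjE // -[adj U (U x)]/((adj U \o U) x) h. Qed.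

Lemma unitary_bd (H : hilbert R) (U : op H) : unitary U -> bd 1 U.
Proof. by move=> uU; apply: isometric_bd; split; [case: uU => -[] | exact: unitary_ip]. Qed.

Lemma unitary_comp (H : hilbert R) (U V : op H) : unitary U -> unitary V -> unitary (U \o V).
Proof.
move=> [bU h1 h2] [bV h3 h4]; split; first exact: bop_comp.
  rewrite adj_comp //; apply/funext => x /=.
  by rewrite -[adj U (U (V x))]/((adj U \o U) (V x)) h1 -[LHS]/((adj V \o V) x) h3.
rewrite adj_comp //; apply/funext => x /=.
by rewrite -[V (adj V _)]/((V \o adj V) (adj U x)) h4 -[LHS]/((U \o adj U) x) h2.
Qed.

Lemma unitary_id (H : hilbert R) : unitary (id : op H).
Proof. by split; rewrite ?adj_id //; exact: bop_id. Qed.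

End Unitaries.

Section DirectSumOperator.
Context {R : realType} {T : tensor_choice R}.
Local Notation C := (cplx R).
Local Notation "H ** K" := (tspace (T H K)) (at level 40).
Local Notation tn := (tens (T _ _)).
Lemma dsum_unitary (I : eqType) (Ks : I -> hilbert R) (K : hilbert R)
    (j : forall i, Ks i -> K) (H : hilbert R) (Us : forall i, op (H ** Ks i)) :
  (forall i, isometric (j i)) ->
  (forall i i' x y, i != i' -> ip (j i x) (j i' y) = 0) ->
  total (fun u : {i & Ks i} => j (tag u) (tagged u)) ->
  (forall i, unitary (Us i)) ->
  exists (U : op (H ** K)) (M : forall i, H ** Ks i -> H ** K),
  [/\ unitary U, forall i, isometric (M i), forall i a x, M i (tn a x) = tn a (j i x),
      forall i s, U (M i s) = M i (Us i s) &
      forall i s, adj U (M i s) = M i (adj (Us i) s)].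
Proof.
move=> ij oj tj uU; have exM i : exists M : H ** Ks i -> H ** K, blin M /\ forall a x, M (tn a x) = tn a (j i x).
  have [M bM hM] := tmap_blin (T := T) (@blin_id _ H) (isometric_blin (ij i)).
  by exists M.
pose M i := projT1 (cid (exM i)).
have bM i : blin (M i) by case: (projT2 (cid (exM i))).
have hM i a x : M i (tn a x) = tn a (j i x) by case: (projT2 (cid (exM i))) => _ h; exact: h.
have iM i : isometric (M i).
  split; first by case: (bM i).
  have bi := @blin_id _ (H ** Ks i).
  apply: (ip_tn_ext (F' := id) (G' := id) (bM i) (bM i) bi bi) => a k a' k'.
  by rewrite !hM !tens_ip (ij i).2.
have b0 i : blin (fun _ : H ** Ks i => 0 : H ** K).
  split=> [a x y|]; first by rewrite scaler0 addr0.
  by exists 0 => // x; rewrite nr0 mul0r.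
have oM i i' s t : i != i' -> ip (M i s) (M i' t) = 0.
  move=> ii; have := ip_tn_ext (bM i) (bM i') (b0 i) (b0 i') _ s t; rewrite ip0l; apply.
  by move=> a k a' k'; rewrite !hM tens_ip oj // mulr0.
pose w (p : H * {i & Ks i}) : H ** K := tn p.1 (j (tag p.2) (tagged p.2)).
pose w' (p : H * {i & Ks i}) : H ** K := M (tag p.2) (Us (tag p.2) (tn p.1 (tagged p.2))).
have tw : total w by exact: (total_tn_vec tj).
(* Totality of the images is surjectivity of each [Us i], used as [Us i \o adj (Us i) = id]. *)
have tw' : total w'.
  move=> z hz; apply: tw => -[a [i x]]; rewrite /w /= -hM.
  have [_ Ql Qr] := madjP (bM i); have [bi h1 h2] := uU i; rewrite -Qr.
  suff -> : madj (M i) z = 0 by rewrite ip0r.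
  rewrite -[madj _ z]/(id (madj (M i) z)) -h2 /=.
  suff -> : adj (Us i) (madj (M i) z) = 0 by rewrite (lin0 (bop_lin bi)).
  apply: (@tn_total _ T H (Ks i)) => -[b y] /=; rewrite adjEr // Qr.
  by have := hz (b, existT _ i y).
have gram p q : ip (w' p) (w' q) = ip (w p) (w q).
  case: p q => [a [i x]] [b [i' y]]; rewrite /w /w' /=.
  have [e|ne] := eqVneq i i'; last by rewrite oM // tens_ip oj // mulr0.
  by case: i' / e y => y; rewrite (iM i).2 unitary_ip // !tens_ip (ij i).2.
have [U [G [iU iG UG GU hU]]] := gram_unitary tw tw' gram.
have unU := isometric_unitary iU iG UG GU; have [bU h1 h2] := unU.
have UM i s : U (M i s) = M i (Us i s).
  have bi : bop _ (Us i) by case: (uU i).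
  have := @lin_total_ext _ _ _ _ _ (U \o M i) (M i \o Us i) (@tn_total _ T H (Ks i)).
  move=> h; rewrite -[LHS]/((U \o M i) s) h //.
  - exact: (blin_comp (isometric_blin iU) (bM i)).
  - by apply: (blin_comp (bM i)); exact/bopE.
  - by move=> [a x] /=; rewrite hM; have := hU (a, existT _ i x).
exists U, M; split=> // i s; have [bi g1 g2] := uU i.
rewrite -{1}[s]/(id s) -g2 /= -UM -[LHS]/((adj U \o U) (M i (adj (Us i) s))) h1 //.
Qed.

End DirectSumOperator.

Section Strict.
Context {R : realType} {T : tensor_choice R}.
Local Notation C := (cplx R).
Local Notation Re := (@complex.Re R).
Local Notation "H ** K" := (tspace (T H K)) (at level 40).
Variables (H Z : hilbert R) (A : set (op H)) (D : op H -> op Z).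
Hypotheses (cA : cstar_algebra A) (hD : star_hom (multipliers A) D).
Hypothesis ndA : forall z : H, (forall c x, A c -> ip (c x) z = 0) -> z = 0.
Hypothesis ndD : forall z : Z, (forall c x, A c -> ip (D c x) z = 0) -> z = 0.

Let Ab : A `<=` bop H. Proof. exact: cstar_bop cA. Qed.

Lemma multipliers_sub : A `<=` multipliers A.
Proof. by move=> c Ac; split=> [|d Ad]; [exact: Ab | split; exact: (cstar_mul cA)]. Qed.

(* A vector is in the closure of the orbit [{c v | c in A}] of a non-degenerate
   representation; apply this to [x + z] in the direct sum of the identity
   representation and [D]. *)
Lemma strict_unit (x : H) (z : Z) (e : R) : 0 < e ->
  exists2 c, A c & nr (x - c x) <= e /\ nr (z - D c z) <= e.
Proof.
pose Ks (b : bool) : hilbert R := if b then H else Z.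
have [K [j [ij oj tj]]] := @dsum_ex R bool Ks.
pose j1 : H -> K := j true; pose j2 : Z -> K := j false.
have i1 : isometric j1 := ij true; have i2 : isometric j2 := ij false.
have o12 a b : ip (j1 a) (j2 b) = 0 by exact: (oj true false).
have o21 a b : ip (j2 a) (j1 b) = 0 by exact: (oj false true).
have [[l1 _] P1l P1r] := madjP (isometric_blin i1).
have [[l2 _] P2l P2r] := madjP (isometric_blin i2).
set P1 := madj j1 in l1 P1l P1r; set P2 := madj j2 in l2 P2l P2r.
have DA c : A c -> bop Z (D c) by move=> Ac; exact/(star_hom_bop hD)/multipliers_sub.
have Dadj c : A c -> D (adj c) = adj (D c) by move=> Ac; exact/(star_hom_adj hD)/multipliers_sub.
have Dmul c d : A c -> A d -> D (c \o d) = D c \o D d.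
  by move=> Ac Ad; apply: (star_hom_mul hD); exact: multipliers_sub.
pose L c := j1 (c x) + j2 (D c z).
pose V u := forall c, A c -> ip (L c) u = 0.
pose rho c u := j1 (c (P1 u)) + j2 (D c (P2 u)).
have rhoB c u w : A c -> rho c (u - w) = rho c u - rho c w.
  move=> Ac; rewrite /rho (linB l1) (linB l2) (linB (bop_lin (Ab Ac))) (linB (bop_lin (DA c Ac))).
  by rewrite (linB i1.1) (linB i2.1) opprD addrACA.
have ipL c u : ip (L c) u = ip (c x) (P1 u) + ip (D c z) (P2 u) by rewrite ipDl -P1r -P2r.
have P1r' c u : P1 (rho c u) = c (P1 u).
  by apply: ip_extr => a; rewrite P1l /rho ipDl i1.2 o21 addr0.
have P2r' c u : P2 (rho c u) = D c (P2 u).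
  by apply: ip_extr => a; rewrite P2l /rho ipDl i2.2 o12 add0r.
have rhoadj c u w : A c -> ip (rho c u) w = ip u (rho (adj c) w).
  move=> Ac; rewrite /rho ipDl ipDr -!P1r -!P2r -P1l -P2l Dadj //.
  by rewrite adjEr ?adjEr //; [exact: DA | exact: Ab].
have Vrho c u : A c -> V u -> V (rho c u).
  move=> Ac Vu d Ad; rewrite ipL P1r' P2r'.
  have := Vu (adj c \o d) (cstar_mul cA (cstar_adj cA Ac) Ad); rewrite ipL Dmul //; last exact: (cstar_adj cA).
  by rewrite Dadj //= !adjE //; [exact: DA | exact: Ab].
pose zeta := j1 x + j2 z.
have P1z : P1 zeta = x by apply: ip_extr => a; rewrite P1l /zeta ipDl i1.2 o21 addr0.
have P2z : P2 zeta = z by apply: ip_extr => a; rewrite P2l /zeta ipDl i2.2 o12 add0r.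
have rhoz c : rho c zeta = L c by rewrite /rho P1z P2z.
have Llin a c d : A c -> A d -> L (a *: c + d) = a *: L c + L d.
  move=> Ac Ad; rewrite /L (star_hom_linear hD); try exact: multipliers_sub.
  rewrite -[(_ + d) x]/(a *: c x + d x) -[(_ + D d) z]/(a *: D c z + D d z).
  by rewrite i1.1 i2.1 scalerDr addrACA.
have [|||||w [_ cw] hw] := @riesz_on R _ K A L (fun c => ip (L c) zeta) (nr zeta).
- exact: (cstar0 cA).
- by move=> a c d; exact: (cstar_linear cA).
- exact: Llin.
- by move=> a c d Ac Ad; rewrite Llin // ipDl ipZl.
- by move=> c Ac; rewrite mulrC; exact: cauchy_schwarz.
have Ww u : V u -> ip w u = 0.
  move=> Vu; apply: nr_small => r r0; have n1 : 0 < nr u + 1 by rewrite ltr_wpDl ?nr_ge0.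
  have [c Ac hc] := cw _ (divr_gt0 r0 n1).
  rewrite -[w](subrK (L c)) ipDl Vu // addr0; apply: le_trans (cauchy_schwarz _ _) _.
  apply: (@le_trans _ _ (r / (nr u + 1) * (nr u + 1))); last by rewrite divfK // gt_eqF.
  by apply: ler_pM; rewrite ?nr_ge0 // lerDl.
have Vu : V (zeta - w) by move=> c Ac; rewrite ipBr hw // subrr.
(* [rho c (zeta - w)] lies in [V], while [L c] and [w] are orthogonal to [V], so its squared norm is
   zero. Non-degeneracy of both summands then gives [zeta = w]. *)
have r0 c : A c -> rho c (zeta - w) = 0.
  move=> Ac; apply: ip_eq0; have VV := Vrho _ _ Ac Vu.
  rewrite {1}rhoB // ipBl rhoz VV // rhoadj // Ww ?subrr //.
  by apply: Vrho => //; exact: (cstar_adj cA).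
have p1 : P1 (zeta - w) = 0.
  apply: ndA => c a Ac; have Ac' := cstar_adj cA Ac.
  by rewrite -adjEr -?P1r' ?r0 ?(lin0 l1) ?ip0r //; exact: Ab.
have p2 : P2 (zeta - w) = 0.
  apply: ndD => c a Ac; have Ac' := cstar_adj cA Ac.
  by rewrite -adjEr -?Dadj -?P2r' ?r0 ?(lin0 l2) ?ip0r //; exact: DA.
have zw : zeta = w.
  apply/eqP; rewrite -subr_eq0; apply/eqP; apply: tj => -[[] a] /=.
    by rewrite -/(j1 a) -P1r p1 ip0r.
  by rewrite -/(j2 a) -P2r p2 ip0r.
move=> e0; have [c Ac hc] := cw e e0; rewrite -zw in hc; exists c => //.
have Pbd (W : hilbert R) (k : W -> K) (P : K -> W) : isometric k -> (forall u a, ip (P u) a = ip u (k a)) ->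
    forall u, nr (P u) <= nr u.
  move=> ik hP u; apply: nr_le_ip; first exact: nr_ge0.
  move=> a; rewrite hP; apply: le_trans (cauchy_schwarz _ _) _.
  by have := isometric_bd ik a; rewrite mul1r => h; rewrite ler_wpM2l ?nr_ge0.
split; apply: le_trans hc.
  have := Pbd _ _ _ i1 P1l (zeta - L c); congr (nr _ <= _).
  by rewrite (linB l1) P1z -rhoz P1r' P1z.
have := Pbd _ _ _ i2 P2l (zeta - L c); congr (nr _ <= _).
by rewrite (linB l2) P2z -rhoz P2r' P2z.
Qed.

(** One [c] with [c x] near [x] and [D c z] near [z] reduces [b] to [b \o c], which is in [A]. In
    the application [x] and [y] represent the product of two functionals, and [z] and [t] are
    tensors of vectors representing the factors. *)
Lemma strict_ext_unique (x y : H) (z t : Z) :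
  (forall c, A c -> ip (c x) y = ip (D c z) t) ->
  forall b, multipliers A b -> ip (b x) y = ip (D b z) t.
Proof.
move=> h b Mb; have [bb hb] := Mb; have bDb := star_hom_bop hD Mb.
have [_ [r r0 rb]] := (bopE _).1 bb; have [_ [s s0 sb]] := (bopE _).1 bDb.
apply/eqP; rewrite -subr_eq0; apply/eqP; apply: nr_small => e e0.
have q0 : 0 <= r * nr y + s * nr t by rewrite addr_ge0 ?mulr_ge0 ?nr_ge0.
have q1 : 0 < r * nr y + s * nr t + 1 by rewrite ltr_wpDl.
have [c Ac [h1 h2]] := strict_unit x z (divr_gt0 e0 q1).
have d0 : 0 <= e / (r * nr y + s * nr t + 1) by rewrite divr_ge0 ?ltW.
have := h _ (hb c Ac).1; rewrite (star_hom_mul hD) //=; last exact: multipliers_sub.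
move=> E; rewrite (_ : _ - _ = ip (b (x - c x)) y - ip (D b (z - D c z)) t); last first.
  by rewrite (linB (bop_lin bb)) (linB (bop_lin bDb)) !ipBl E opprB addrA subrK.
apply: le_trans (nrD _ _) _; rewrite nrN.
apply: (@le_trans _ _ (e / (r * nr y + s * nr t + 1) * (r * nr y + s * nr t + 1))); last by rewrite divfK // gt_eqF.
have k1 := bd_ip rb (x - c x) y; have k2 := bd_ip sb (z - D c z) t.
have m1 : r * nr (x - c x) * nr y <= r * (e / (r * nr y + s * nr t + 1)) * nr y.
  by rewrite ler_wpM2r ?nr_ge0 // ler_wpM2l.
have m2 : s * nr (z - D c z) * nr t <= s * (e / (r * nr y + s * nr t + 1)) * nr t.
  by rewrite ler_wpM2r ?nr_ge0 // ler_wpM2l.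
move: m1 m2 d0; move: (e / _) => d m1 m2 d0.
apply: le_trans (lerD (le_trans k1 m1) (le_trans k2 m2)) _.
by rewrite (_ : d * _ = r * d * nr y + s * d * nr t + d); [rewrite lerDl | ring].
Qed.

End Strict.

(** * Corepresentations with coefficients in a given algebra *)

Section Corepresentations.
Context {R : realType} {T : tensor_choice R}.
Local Notation C := (cplx R).
Local Notation Re := (@complex.Re R).
Local Notation "H ** K" := (tspace (T H K)) (at level 40).
Local Notation tn := (tens (T _ _)).
Local Notation ot := (@otens R T _ _).

Lemma slice_r_sesql (H K : hilbert R) (U : op (H ** K)) (a : C) k k' l : bop _ U ->
  slice_r (vfun (a *: k + k') l) U = a *: slice_r (vfun k l) U + slice_r (vfun k' l) U.
Proof.
move=> bU; apply: bop_ext => x y; rewrite ip_lcomb !slice_rE //.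
by rewrite tnDr tnZr (bop_lin bU) ipDl ipZl.
Qed.

Lemma slice_r_sesqr (H K : hilbert R) (U : op (H ** K)) (a : C) k l l' : bop _ U ->
  slice_r (vfun k (a *: l + l')) U = a^* *: slice_r (vfun k l) U + slice_r (vfun k l') U.
Proof.
move=> bU; apply: bop_ext => x y; rewrite ip_lcomb !slice_rE //.
by rewrite tnDr tnZr ipDr ipZr.
Qed.

(** The twist [phi] covers both variables of a coefficient: the identity for the first, conjugation
    for the second. *)
Lemma closed_total (H K : hilbert R) (X : Type) (v : X -> K) (S : set (op H)) (F : K -> op H)
    (phi : C -> C) (r : R) : total v -> S 0 -> lclosed S -> norm_closure S `<=` S -> 0 <= r ->
  (forall a k l, F (a *: k + l) = phi a *: F k + F l) ->
  (forall k, bop H (F k)) -> (forall k, bd (r * nr k) (F k)) ->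
  (forall x, S (F (v x))) -> forall k, S (F k).
Proof.
move=> tv S0 Sl Sc r0 Fl Fb Fr FS k; apply: Sc; apply/ncP; split=> // e e0.
have r1 : 0 < r + 1 by lra.
have [s hs] := total_dense tv k (divr_gt0 e0 r1).
have F0 : F 0 = 0.
  have n0 := Fr 0; apply/funext => x; apply: nr0_eq0; apply/eqP; rewrite eq_le nr_ge0 andbT.
  by have := n0 x; rewrite nr0 mulr0 mul0r.
exists (F (lc v s)).
  elim: s {hs} => [|p s IH]; first by rewrite /lc big_nil F0.
  by rewrite /lc big_cons Fl; exact: Sl.
have -> : F k - F (lc v s) = F (k - lc v s).
  have := Fl 1 (k - lc v s) (lc v s); have p1 : phi 1 *: F k = F k.
    by have := Fl 1 k 0; rewrite F0 !addr0 scale1r.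
  have p1' : phi 1 *: F (k - lc v s) = F (k - lc v s).
    by have := Fl 1 (k - lc v s) 0; rewrite F0 !addr0 scale1r.
  by rewrite p1' scale1r subrK => ->; rewrite addrK.
apply: bd_le (Fr _); apply: (@le_trans _ _ (r * (e / (r + 1)))); first by rewrite ler_wpM2l.
by rewrite mulrCA -[leRHS]mulr1 ler_wpM2l ?(ltW e0) // ler_pdivrMr // mul1r; lra.
Qed.

Lemma coefs_total (H K : hilbert R) (X : Type) (v : X -> K) (S : set (op H)) (U : op (H ** K)) :
  bop _ U -> total v -> S 0 -> lclosed S -> norm_closure S `<=` S ->
  (forall x y, S (slice_r (vfun (v x) (v y)) U)) -> forall k l, S (slice_r (vfun k l) U).
Proof.
move=> bU tv S0 Sl Sc h k l; have [_ [r r0 rU]] := (bopE _).1 bU.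
apply: (closed_total (F := fun l => slice_r (vfun k l) U) (phi := fun a => a^*) (r := r * nr k) tv) => //.
- by rewrite mulr_ge0 ?nr_ge0.
- by move=> a x y; exact: slice_r_sesqr.
- by move=> x; exact: bop_slice_r.
- by move=> x; exact: slice_r_bd.
move=> y; apply: (closed_total (F := fun k => slice_r (vfun k (v y)) U) (phi := id) (r := r * nr (v y)) tv) => //.
- by rewrite mulr_ge0 ?nr_ge0.
- by move=> a x z; exact: slice_r_sesql.
- by move=> x; exact: bop_slice_r.
- by move=> x; rewrite mulrAC; exact: slice_r_bd.
Qed.

Variables (H : hilbert R) (A : set (op H)) (D : op H -> op (H ** H)).
Hypothesis cA : cstar_algebra A.
Local Notation M := (multipliers A).
Hypotheses (cM : cstar_algebra M) (hD : star_hom M D) (D1 : D id = id).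

Lemma mult_id : M id.
Proof. by split=> [|a Aa]; [exact: bop_id | split]. Qed.

Lemma mult_bd x (r : R) : M x -> 0 <= r -> bd r x -> bd r (D x).
Proof. by move=> Mx r0 rx; apply: (star_hom_id_bd cM mult_id hD). Qed.

(** Both sides are bounded sesquilinear forms in [k] and [l], the left one by contractivity of [D],
    so a total family decides. *)
Lemma coef_comult_total (K : hilbert R) (X : Type) (v : X -> K) (U : op (H ** K)) :
  bop _ U -> (forall k l, M (slice_r (vfun k l) U)) -> total v ->
  (forall k l a b a' b', ip (D (slice_r (vfun (v k) (v l)) U) (tn a b)) (tn a' b') =
    ip (slice_l (vfun a a') U (slice_l (vfun b b') U (v k))) (v l)) -> coef_comult D U.
Proof.
move=> bU MU tv h k l a b a' b'; have [_ [r r0 rU]] := (bopE _).1 bU.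
have [||||bQ _ hQ] := @op_of_form_rep _ _ (fun k l => ip (D (slice_r (vfun k l) U) (tn a b)) (tn a' b'))
  (r * nr (tens (T H H) a b) * nr (tens (T H H) a' b')).
- by rewrite !mulr_ge0 ?nr_ge0.
- move=> c x y z; rewrite slice_r_sesql // (star_hom_linear hD) ?ip_lcomb //.
- move=> c x y z; rewrite slice_r_sesqr // (star_hom_linear hD) ?ip_lcomb //.
- move=> x y; have rxy : 0 <= r * nr x * nr y by rewrite !mulr_ge0 ?nr_ge0.
  apply: le_trans (bd_ip (mult_bd (MU x y) rxy (slice_r_bd bU x y r0 rU)) _ _) _.
  by rewrite le_eqVlt; apply/orP; left; apply/eqP; ring.
rewrite -hQ -[RHS]/(ip ((slice_l (vfun a a') U \o slice_l (vfun b b') U) k) l).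
congr (ip (_ k) l); apply: (bilin_total tv tv); first exact/bopE.
- by apply/bopE/bop_comp; exact: bop_slice_l.
- by move=> x y; rewrite hQ h.
Qed.

Lemma coef_comult_slice (K : hilbert R) (U : op (H ** K)) k l : bop _ U ->
  (forall k l, M (slice_r (vfun k l) U)) -> coef_comult D U ->
  D (slice_r (vfun k l) U) = slice_r (vfun k l) (leg13 U \o leg23 U).
Proof.
move=> bU MU cU; have b13 := bop_leg13 bU; have b23 := bop_leg23 bU; have bc := bop_comp b13 b23.
apply: op_tn_ext2; [exact/(star_hom_bop hD) | exact: bop_slice_r |].
by move=> a b a' b'; rewrite cU slice_rE // [RHS]/= leg_formula.
Qed.

Lemma coef_comult_ip (K : hilbert R) (U : op (H ** K)) k l x y : bop _ U ->
  (forall k l, M (slice_r (vfun k l) U)) -> coef_comult D U ->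
  ip (D (slice_r (vfun k l) U) x) y = ip (leg13 U (leg23 U (tn x k))) (tn y l).
Proof.
move=> bU MU cU; have b13 := bop_leg13 bU; have b23 := bop_leg23 bU; have bc := bop_comp b13 b23.
by rewrite coef_comult_slice // slice_rE.
Qed.

Lemma coef_comult_corep (K : hilbert R) (U : op (H ** K)) : unitary U ->
  (forall k l, M (slice_r (vfun k l) U)) -> coef_comult D U -> corepresentation D U.
Proof.
move=> uU MU cU; split=> //; have [bU _ _] := uU.
have b13 := bop_leg13 bU; have b23 := bop_leg23 bU; have bc := bop_comp b13 b23.
apply: xget_unique => [|Z [bZ hZ]].
  by split=> // x k y l; rewrite coef_comult_ip.
apply: tn_total_ext2 => // k l; apply: bop_ext => x y; rewrite !slice_rE //.
by rewrite hZ coef_comult_ip.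
Qed.

(* [amplify D U] is [0] when the operator it should denote does not exist; but
   then [leg13 U \o leg23 U = 0] for a unitary [U], and the spaces are trivial. *)
Lemma corep_coef_comult (K : hilbert R) (U : op (H ** K)) :
  (forall k l, M (slice_r (vfun k l) U)) -> corepresentation D U -> coef_comult D U.
Proof.
move=> MU [uU aU] k l a b a' b'; have [bU u1 u2] := uU.
have b13 := bop_leg13 bU; have b23 := bop_leg23 bU; have bc := bop_comp b13 b23.
rewrite -leg_formula //; pose PZ := [set Z | bop _ Z /\ forall x k y l,
  ip (Z (tens (T (H ** H) K) x k)) (tn y l) = ip (D (slice_r (vfun k l) U) x) y].
have [[Z hZ]|nZ] := pselect (exists Z, PZ Z).
  have [_ h] : PZ (amplify D U) by apply: xgetPex; exists Z.
  by rewrite -h aU.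
have a0 : amplify D U = fun=> 0.
  by apply: xgetPN => Z hZ; apply: nZ; exists Z.
have z0 (x y : H) (m : K) : tens (T (H ** H) K) (tn x y) m = 0.
  have [J1 [bJ1 hJ1 h1]] := @leg13_ex R T H K; have [J2 [bJ2 hJ2 h2]] := @leg23_ex R T H K.
  have [_ g1 g2 _] := h1 U bU; have [_ f1 f2 _] := h2 U bU.
  have [_ g3 _ _] := h1 _ (bop_adj bU).
  have : leg13 U (leg23 U (J2 x (adj U (tn y m)))) = 0.
    by rewrite -[LHS]/((leg13 U \o leg23 U) _) -aU a0.
  rewrite f1 -[U (adj U _)]/((U \o adj U) (tn y m)) u2 /= hJ2 -hJ1 g1 => e.
  rewrite -[tn x m]/(id (tn x m)) -u1 /= -g3 e.
  by rewrite (lin0 (bop_lin (bop_leg13 (bop_adj bU)))).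
rewrite -[leg13 U _]/((leg13 U \o leg23 U) _) -aU a0 ip0l.
have [ab0|abn] := pselect (tens (T H H) a b = 0).
  by rewrite ab0 (lin0 (bop_lin (star_hom_bop hD (MU k l)))) ip0l.
have k0 : k = 0.
  apply: nr0_eq0; have : nr (tens (T (H ** H) K) (tn a b) k) = 0 by rewrite z0 nr0.
  rewrite tn_nr => /eqP.
  by rewrite mulf_eq0 => /orP[/eqP/nr0_eq0//|/eqP].
have -> : slice_r (vfun k l) U = 0.
  by apply: bop_ext => x y; rewrite slice_rE // k0 tn0r (lin0 (bop_lin bU)) -[(0 : op H) x]/0 !ip0l.
have D0 : D 0 = 0.
  have := star_hom_linear hD (-1) mult_id mult_id; rewrite !scaleN1r !addNr //.
by rewrite D0 -[(0 : op _) _]/0 ip0l.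
Qed.

(** The multiplier property in column form and the corepresentation identity in paired form pass
    easily to tensor products and direct sums; [colmult_multipliers] and [coef_comult_corep] return
    to the forms of the definitions. *)
Record corep_in (S : set (op H)) (K : hilbert R) (U : op (H ** K)) : Prop := CorepIn {
  corep_in_unitary : unitary U;
  corep_in_col : colmult A U;
  corep_in_col' : colmult A (adj U);
  corep_in_comult : coef_comult D U;
  corep_in_coef : forall k l, S (slice_r (vfun k l) U) }.

Variable S : set (op H).
Hypotheses (Sl : lclosed S) (Sc : norm_closure S `<=` S) (S1 : S id).
Hypothesis Sm : forall x y, S x -> S y -> S (x \o y).

Let S0 : S 0.
Proof. by rewrite -[0](subrr (id : op H)) addrC -scaleN1r; exact: Sl. Qed.

Lemma corep_in_bop (K : hilbert R) (U : op (H ** K)) : corep_in S U -> bop _ U.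
Proof. by case=> -[]. Qed.

Lemma corep_in_mult (K : hilbert R) (U : op (H ** K)) : corep_in S U ->
  forall k l, M (slice_r (vfun k l) U).
Proof. by move=> g; apply: colmult_coef => //; [exact: corep_in_bop g | case: g | case: g]. Qed.

(** Supplies [id] as a coefficient, and a default value in [universal_corep]. *)
Lemma trivial_corep : exists (K : hilbert R) (U : op (H ** K)), corep_in S U /\
  exists k l, slice_r (vfun k l) U = id.
Proof.
have [K [v [gv _]]] := kolmogorov (@psd_delta R unit).
have sid (k l : K) : slice_r (vfun k l) (id : op (H ** K)) = ip k l *: id.
  apply: bop_ext => a b; rewrite -[(_ *: _) a]/(_ *: a) ipZl mulrC -(tens_ip (T _ _)).
  exact/slice_rE/bop_id.
have bid := @bop_id _ H; have bid2 := @bop_id _ (H ** H).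
exists K, id; split; last first.
  exists (v tt), (v tt); rewrite sid gv eqxx scale1r //.
split.
- exact: unitary_id.
- exact: colmult_id.
- by rewrite adj_id; exact: colmult_id.
- have DZ c : D (c *: id) = c *: id.
    have := star_hom_linear hD (c - 1) mult_id mult_id; rewrite D1 scalerBl scale1r subrK => ->.
    by rewrite scalerBl scale1r subrK.
  move=> k l a b a' b'; rewrite sid DZ -[(_ *: _) _]/(_ *: tn a b) ipZl tens_ip.
  have sl (x y : H) : slice_l (vfun x y) (id : op (H ** K)) = ip x y *: id.
    apply: bop_ext => k' l'; rewrite -[(_ *: _) k']/(_ *: k') ipZl -(tens_ip (T _ _)).
    exact/slice_lE/bop_id.
  by rewrite !sl -[(_ *: id) _]/(_ *: (ip b b' *: k)) !ipZl; ring.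
- by move=> k l; rewrite sid -[_ *: _]addr0; exact: Sl.
Qed.

(** [W] is [U_12 V_13]. At elementary tensors its coefficients are products, and [leg_slice_mul]
    turns multiplicativity of [D] into the corepresentation identity; totality of elementary tensors
    covers the other coefficients. *)
Lemma tensor_corep (K K' : hilbert R) (U : op (H ** K)) (V : op (H ** K')) : corep_in S U -> corep_in S V ->
  exists2 W : op (H ** (K ** K')), corep_in S W &
  forall k k' l l', slice_r (vfun (tn k k') (tn l l')) W =
    slice_r (vfun k l) U \o slice_r (vfun k' l') V.
Proof.
move=> gU gV; have bU := corep_in_bop gU; have bV := corep_in_bop gV.
have [A1 [J1 [bJ1 hJ1 bA1 A1J [A1id [A1m A1a]]]]] := @leg12_ex R T H K K'.
have [A2 [J2 [bJ2 hJ2 bA2 A2J [A2id [A2m A2a]]]]] := @leg13r_ex R T H K K'.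
have bAU := bA1 _ bU; have bAV := bA2 _ bV.
have uni1 P : unitary P -> unitary (A1 P).
  move=> [bP h1 h2]; split; first exact: bA1.
    by rewrite A1a // -A1m // ?h1 //; exact: bop_adj.
  by rewrite A1a // -A1m // ?h2 //; exact: bop_adj.
have uni2 P : unitary P -> unitary (A2 P).
  move=> [bP h1 h2]; split; first exact: bA2.
    by rewrite A2a // -A2m // ?h1 //; exact: bop_adj.
  by rewrite A2a // -A2m // ?h2 //; exact: bop_adj.
have c1 P : bop _ P -> colmult A P -> colmult A (A1 P).
  move=> bP cP; apply: (colmult_total cA (v := fun p : K * K' => tens (T K K') p.1 p.2)).
  - exact: bA1.
  - exact: tn_total.
  move=> c [k k'] Ac /=.
  rewrite (_ : (fun y => _) = J1 k' \o (fun y => P (tn (c y) k))); last first.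
    by apply/funext => y /=; rewrite -hJ1 A1J.
  apply: (col_map (bJ1 k') _ (cP c k Ac)) => d m Ad.
  rewrite (_ : (fun x => _) = fun x => tn (d x) (tens (T K K') m k')); first exact: col_gen.
  by apply/funext => x; rewrite hJ1.
have c2 P : bop _ P -> colmult A P -> colmult A (A2 P).
  move=> bP cP; apply: (colmult_total cA (v := fun p : K * K' => tens (T K K') p.1 p.2)).
  - exact: bA2.
  - exact: tn_total.
  move=> c [k k'] Ac /=.
  rewrite (_ : (fun y => _) = J2 k \o (fun y => P (tn (c y) k'))); last first.
    by apply/funext => y /=; rewrite -hJ2 A2J.
  apply: (col_map (bJ2 k) _ (cP c k' Ac)) => d m Ad.
  rewrite (_ : (fun x => _) = fun x => tn (d x) (tens (T K K') k m)); first exact: col_gen.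
  by apply/funext => x; rewrite hJ2.
pose W := A1 U \o A2 V; have bW : bop _ W by exact: bop_comp.
have J1ip m s b l l' : ip (J1 m s) (tn b (tens (T K K') l l')) = ip m l' * ip s (tn b l).
  rewrite -ipZl; apply: (ip_tn_ext1 (F' := fun s => ip m l' *: s) (bJ1 m)).
    by apply/bopE; exact: (bopZ (ip m l') (@bop_id _ _)).
  by move=> a k; rewrite hJ1 !tens_ip ipZl tens_ip; ring.
have J2ip k l l' b s : ip (A1 U (J2 k s)) (tn b (tens (T K K') l l')) =
    ip (ot (slice_r (vfun k l) U) id s) (tn b l').
  have bid := @bop_id _ K'; have bs := bop_slice_r bU k l.
  apply: (ip_tn_ext1 (F := A1 U \o J2 k)).
  - by apply: (blin_comp _ (bJ2 k)); exact/bopE.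
  - exact/bopE/bop_otens.
  - by move=> a m /=; rewrite hJ2 -hJ1 A1J // J1ip otensE // tens_ip slice_rE //; ring.
have WE k k' l l' : slice_r (vfun (tn k k') (tn l l')) W =
    slice_r (vfun k l) U \o slice_r (vfun k' l') V.
  have bid := @bop_id _ K'; have bs := bop_slice_r bU k l.
  apply: bop_ext => a b; rewrite slice_rE // /W /= -hJ2 A2J // J2ip -[LHS]adjEr; last exact: bop_otens.
  rewrite otens_adj // adj_id otensE //; last exact: bop_adj.
  by rewrite -slice_rE // adjEr.
have uW : unitary W by apply: unitary_comp; [apply: uni1; case: gU | apply: uni2; case: gV].
have cW : colmult A W.
  by apply: colmult_comp => //; [apply: c1 => //; case: gU | apply: c2 => //; case: gV].
have cW' : colmult A (adj W).
  rewrite adj_comp // A1a // A2a //; have bU' := bop_adj bU; have bV' := bop_adj bV.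
  by apply: colmult_comp; [exact: bA2 | apply: c2 => //; case: gV | apply: c1 => //; case: gU].
have MW : forall k l, M (slice_r (vfun k l) W) by exact: colmult_coef.
exists W => //; split=> //.
  apply: (coef_comult_total bW MW (@tn_total _ T K K')) => -[k k'] [l l'] a b a' b' /=.
  have bc : bop _ (leg13 W \o leg23 W) by apply: bop_comp; [exact: bop_leg13 | exact: bop_leg23].
  rewrite -leg_formula // -[leg13 W _]/((leg13 W \o leg23 W) _) -[RHS]slice_rE //.
  rewrite (leg_slice_mul bU bV bW WE) WE (star_hom_mul hD); try exact: corep_in_mult.
  by rewrite !coef_comult_slice //; try exact: corep_in_mult; [case: gV | case: gU].
apply: (coefs_total bW (@tn_total _ T K K')) => // -[k k'] [l l'] /=.
by rewrite WE; apply: Sm; [case: gU | case: gV].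
Qed.

(** Coefficients between different summands vanish, so each property is checked on one summand at a
    time. *)
Lemma dsum_corep (I : eqType) (Ks : I -> hilbert R) (Us : forall i, op (H ** Ks i)) :
  (forall i, corep_in S (Us i)) ->
  exists (K : hilbert R) (U : op (H ** K)), corep_in S U /\
    forall i k l, exists k' l', slice_r (vfun k' l') U = slice_r (vfun k l) (Us i).
Proof.
move=> gU; have [K [j [ij oj tj]]] := dsum_ex Ks.
have uU i := corep_in_unitary (gU i); have bUs i : bop _ (Us i) by case: (uU i).
have [U [N [unU iN hN UN UN']]] := dsum_unitary ij oj tj uU.
have [bU _ _] := unU; have bU' := bop_adj bU.
have oN i i' s b y : i != i' -> ip (N i s) (tn b (j i' y)) = 0.
  move=> ii; have b0 : blin (fun _ : H ** Ks i => 0 : H ** K).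
    split=> [a x z|]; first by rewrite scaler0 addr0.
    by exists 0 => // x; rewrite nr0 mul0r.
  have := ip_tn_ext1 (y := tn b (j i' y)) (y' := 0) (isometric_blin (iN i)) b0 _ s; rewrite ip0l; apply.
  by move=> a k; rewrite hN tens_ip oj // mulr0.
have sE i k l : slice_r (vfun (j i k) (j i l)) U = slice_r (vfun k l) (Us i).
  by apply: bop_ext => a b; rewrite !slice_rE // -!hN UN (iN i).2.
have sO i i' k l : i != i' -> slice_r (vfun (j i k) (j i' l)) U = 0.
  by move=> ii; apply: bop_ext => a b; rewrite slice_rE // -hN UN oN // -[(0 : op H) a]/0 ip0l.
have lE i a a' k : slice_l (vfun a a') U (j i k) = j i (slice_l (vfun a a') (Us i) k).
  apply: (total_extl tj) => -[i' l] /=; rewrite slice_lE //.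
  have [e|ne] := eqVneq i i'; last by rewrite oj // -hN UN oN.
  by case: i' / e l => l; rewrite (ij i).2 -!hN UN (iN i).2 slice_lE.
have cgen (V : op (H ** K)) (Vs : forall i, op (H ** Ks i)) : bop _ V ->
    (forall i s, V (N i s) = N i (Vs i s)) -> (forall i, colmult A (Vs i)) -> colmult A V.
  move=> bV hV cV; apply: (colmult_total cA bV tj) => c [i x] Ac /=.
  rewrite (_ : (fun y => _) = N i \o (fun y => Vs i (tn (c y) x))); last first.
    by apply/funext => y /=; rewrite -hN hV.
  apply: (col_map (isometric_blin (iN i)) _ (cV i c x Ac)) => d m Ad.
  rewrite (_ : (fun y => _) = fun y => tn (d y) (j i m)); first exact: col_gen.
  by apply/funext => y; rewrite hN.
have cU : colmult A U by apply: (cgen _ Us) => // i; case: (gU i).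
have cU' : colmult A (adj U) by apply: (cgen _ (fun i => adj (Us i))) => // i; case: (gU i).
have MU : forall k l, M (slice_r (vfun k l) U) by exact: colmult_coef.
exists K, U; split; last by move=> i k l; exists (j i k), (j i l).
split=> //.
  apply: (coef_comult_total bU MU tj) => -[i k] [i' l] a b a' b' /=.
  have [e|ne] := eqVneq i i'.
    by case: i' / e l => l; rewrite sE !lE (ij i).2; case: (gU i).
  rewrite sO // !lE oj //.
  have := star_hom_linear hD (-1) mult_id mult_id; rewrite !scaleN1r !addNr // => ->.
  by rewrite -[(0 : op _) _]/0 ip0l.
apply: (coefs_total bU tj) => // -[i k] [i' l] /=.
have [e|ne] := eqVneq i i'; last by rewrite sO.
by case: i' / e l => l; rewrite sE; case: (gU i).
Qed.

End Corepresentations.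

(** * The greatest unital embedded algebra *)

Section Nondegeneracy.
Context {R : realType} {T : tensor_choice R}.
Local Notation C := (cplx R).
Local Notation Re := (@complex.Re R).
Local Notation "H ** K" := (tspace (T H K)) (at level 40).
Local Notation tn := (tens (T _ _)).

Lemma nc_ip0 (H : hilbert R) (S : set (op H)) w z : (forall s, S s -> ip (s w) z = 0) ->
  forall t, norm_closure (lspan S) t -> ip (t w) z = 0.
Proof.
move=> h t /ncP[bt ht]; apply: nr_small => e e0.
have q1 : 0 < nr w * nr z + 1 by rewrite ltr_wpDl ?mulr_ge0 ?nr_ge0.
have [s ls bs] := ht _ (divr_gt0 e0 q1).
have s0 : ip (s w) z = 0.
  move: s ls {bs}; apply: lspan_elim => [|a x y hx hy|//]; first by rewrite -[(0 : op H) w]/0 ip0l.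
  by rewrite ip_lcomb hx hy mulr0 addr0.
have -> : ip (t w) z = ip ((t - s) w) z by rewrite fsubE ipBl s0 subr0.
apply: le_trans (bd_ip bs w z) _; rewrite -mulrA -[leRHS](divfK (lt0r_neq0 q1)).
rewrite ler_wpM2l ?lerDl //; exact/ltW/divr_gt0.
Qed.

Lemma multipliers_cstar (H : hilbert R) (A : set (op H)) :
  cstar_algebra A -> cstar_algebra (multipliers A).
Proof.
move=> cA; have Ab := cstar_bop cA; split.
- by move=> x [].
- split; first exact: bop0.
  move=> a Aa; split; first exact: (cstar0 cA).
  rewrite (_ : _ \o _ = fun=> 0); first exact: (cstar0 cA).
  by apply/funext => x /=; rewrite (lin0 (bop_lin (Ab _ Aa))).
- move=> c x y [bx hx] [bY hy]; split=> [|a Aa]; first exact: bop_lcomb.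
  have [x1 x2] := hx a Aa; have [y1 y2] := hy a Aa; split; first exact: (cstar_linear cA c x1 y1).
  have := cstar_linear cA c x2 y2; congr A; apply/funext => z /=.
  by rewrite -[(_ + y) z]/(c *: x z + y z) (bop_lin (Ab _ Aa)).
- move=> x y [bx hx] [bY hy]; split=> [|a Aa]; first exact: bop_comp.
  by split; [exact: (hx _ (hy _ Aa).1).1 | exact: (hy _ (hx _ Aa).2).2].
- move=> x [bx hx]; have bx' := bop_adj bx; split=> // a Aa; have ba := Ab _ Aa.
  have [h1 h2] := hx _ (cstar_adj cA Aa).
  rewrite -[a](adjK ba) -!adj_comp //; try exact: bop_adj.
  by split; exact: (cstar_adj cA).
- move=> x /ncP[bx hx]; split=> // a Aa; have ba := Ab _ Aa; have [_ [q q0 qa]] := (bopE _).1 ba.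
  have q1 : 0 < q + 1 by lra.
  have le1 (e : R) : 0 < e -> e / (q + 1) * q <= e.
    by move=> e0; rewrite mulrAC -mulrA -[leRHS]mulr1 ler_wpM2l ?(ltW e0) // ler_pdivrMr // mul1r; lra.
  split; apply: (cstar_closed cA); apply/ncP; split; try exact: bop_comp.
    move=> e e0; have [s [bs hs] xs] := hx _ (divr_gt0 e0 q1); exists (s \o a); first exact: (hs _ Aa).1.
    have d0 : 0 <= e / (q + 1) by rewrite divr_ge0 ?ltW.
    exact: bd_le (le1 _ e0) (bd_comp d0 xs qa).
  move=> e e0; have [s [bs hs] xs] := hx _ (divr_gt0 e0 q1); exists (a \o s); first exact: (hs _ Aa).2.
  have := bd_comp q0 qa xs; rewrite mulrC => h.
  have -> : (a \o x) - (a \o s) = a \o (x - s).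
    by apply/funext => z; rewrite fsubE /= -(linB (bop_lin ba)).
  exact: bd_le (le1 _ e0) h.
Qed.

Lemma min_tensor_total (H : hilbert R) (A : set (op H)) : A `<=` bop H ->
  (forall z : H, (forall c x, A c -> ip (c x) z = 0) -> z = 0) ->
  forall z : H ** H, (forall t w, min_tensor A A t -> ip (t w) z = 0) -> z = 0.
Proof.
move=> Ab nd z hz; pose X := {p : op H * H | A p.1}.
have tv : total (fun p : X => (sval p).1 (sval p).2).
  by move=> y hy; apply: nd => c x Ac; exact: (hy (exist _ (c, x) Ac)).
apply: (total_tn tv tv) => -[[[c x] /= Ac] [[d y] /= Ad]].
rewrite -(otensE (T := T) (Ab _ Ac) (Ab _ Ad)); apply: hz; apply: nc_sub.
  by apply: lspan_bop => _ [x' [y' [Ax Ay ->]]]; apply: bop_otens; exact: Ab.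
by apply: lspan_in; exists c, d.
Qed.

End Nondegeneracy.

Section Main.
Context {R : realType} {T : tensor_choice R} {G : lcqg T}.
Variable Cu : universal_lcqg G.
Local Notation C := (cplx R).
Local Notation Re := (@complex.Re R).
Local Notation "H ** K" := (tspace (T H K)) (at level 40).
Local Notation tn := (tens (T _ _)).
Local Notation Hu := (univ_space Cu).
Local Notation C0 := (@C0u R T G Cu).
Local Notation D := (@univ_comult R T G Cu).
Local Notation M := (multipliers C0).

Let cC0 : cstar_algebra C0 := C0u_cstar Cu.
Let cM : cstar_algebra M := multipliers_cstar cC0.
Let hD : star_hom M D := univ_comult_hom Cu.
Let M1 : M id := mult_id C0.

Lemma C0u_nondegenerate (z : Hu) : (forall c x, C0 c -> ip (c x) z = 0) -> z = 0.
Proof.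
move=> h; have [_ nd _] := C0u_universal Cu.
by apply: (closure_total nd) => _ [x [y [Ax ->]]]; exact: h.
Qed.

Lemma univ_comult_total (z : Hu ** Hu) :
  (forall c w, C0 c -> ip (D c w) z = 0) -> z = 0.
Proof.
move=> h; apply: (min_tensor_total (cstar_bop cC0) C0u_nondegenerate) => t w.
rewrite -univ_comult_nondeg; apply: nc_ip0 => _ [a [x [Aa _ ->]]] /=; exact: h.
Qed.

(** [D id] is self-adjoint and fixes every [D c w]; these vectors are total by non-degeneracy of
    [D]. *)
Lemma univ_comult_id : D id = id.
Proof.
apply/funext => z; apply/eqP; rewrite eq_sym -subr_eq0; apply/eqP; apply: univ_comult_total => c w Ac.
have Mc : M c by exact: multipliers_sub.
have aD : adj (D id) = D id by rewrite -(star_hom_adj hD M1) adj_id.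
have bD := star_hom_bop hD M1.
rewrite ipBr -[in X in _ - X]aD adjEr // -[D id (D c w)]/((D id \o D c) w) -(star_hom_mul hD) //.
by rewrite subrr.
Qed.

Local Notation corep_in S U := (corep_in C0 D S U).

Section EmbeddedFacts.
Variable B : embedded Cu.
Local Notation U := (@em_U R T G Cu B).

Lemma em_bop : bop _ U. Proof. by case: (em_U_mult B). Qed.

Lemma em_coef_mult k l : M (slice_r (vfun k l) U).
Proof.
have [c1 c2] := multipliers_colmult cC0 (em_U_mult B).
exact: (colmult_coef cC0 em_bop c1 c2).
Qed.

Lemma em_coef k l : em_alg B (slice_r (vfun k l) U).
Proof. by rewrite em_algE; apply: coefs_sub em_bop _ _; exists k, l. Qed.

Lemma em_dense : em_alg B `<=` norm_closure (lspan (coefs U)).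
Proof. by rewrite em_algE; exact: coefs_dense em_bop. Qed.

Lemma em_mult : em_alg B `<=` M.
Proof.
apply: subset_trans em_dense _; apply: subset_trans _ (cstar_closed cM); apply: nc_mono.
apply: lspan_ind => [||_ [k [l ->]]]; [exact: (cstar0 cM) | exact: (cstar_linear cM) | exact: em_coef_mult].
Qed.

Lemma em_good (S : set (op Hu)) : em_alg B `<=` S -> corep_in S U.
Proof.
move=> BS; have [c1 c2] := multipliers_colmult cC0 (em_U_mult B); split=> //.
- by case: (em_U_corep B).
- exact: (corep_coef_comult hD em_coef_mult (em_U_corep B)).
- by move=> k l; apply/BS/em_coef.
Qed.

Lemma em_cstar : cstar_algebra (em_alg B). Proof. exact: eberlein_cstar (em_eberlein B). Qed.

Hypothesis uB : unital B.

(** [Q] and [S] are the slices of [em_U'] by [f] and [g]. Their matrix entries do not involve the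
    representation realising the bidual, so products of different embedded algebras can be compared.
    Unitality bounds the coproduct through [star_hom_contractive]. *)
Lemma em_conv_coef f g : em_dual B f -> em_dual B g -> em_dual B (em_conv B f g) /\
  exists Q S : op (em_K B), [/\ forall k l, ip (Q k) l = f (slice_r (vfun k l) U),
    forall k l, ip (S k) l = g (slice_r (vfun k l) U) &
    forall k l, em_conv B f g (slice_r (vfun k l) U) = ip (Q (S k)) l].
Proof.
move=> df dg; have eB := em_eberlein B; have cB := em_cstar.
have uR := eberlein_bidual eB; have [hP _ _] := eberlein_Phi eB.
have [[bU' _] _] := eberlein_V eB.
have sl h : em_dual B h ->
    forall k l, ip (slice_l (normal_ext (em_alg B) (@em_rep R T G Cu B) h) (@em_U' R T G Cu B) k) l = h (slice_r (vfun k l) U).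
  move=> dh k l; have [x [y [-> hh]]] := normal_extP uR dh.
  rewrite -ip_slice // em_U'E ?hh //; [exact: em_coef | exact: normal_vfun].
have dc : em_dual B (em_conv B f g).
  have [x [y [ef _]]] := normal_extP uR df; have [x' [y' [eg _]]] := normal_extP uR dg.
  apply/dualP; apply: (dualr_eq (f := fun a => ip (@em_Phi R T G Cu B a (tn x x')) (tn y y'))).
  - exact: (cstar_linear cB).
  - have [e [Be he]] := uB.
    apply: (dualr_ip (c := 1)) => // [c a b|a r Ba r0 ra]; first exact: (star_hom_linear hP).
    by rewrite mul1r; exact: (star_hom_contractive cB hP Be he).
  - by move=> a Ba; rewrite /em_conv /conv ef eg ftens_vfun //; exact: (star_hom_bop hP).
split=> //; exists (slice_l (normal_ext (em_alg B) (@em_rep R T G Cu B) f) (@em_U' R T G Cu B)),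
  (slice_l (normal_ext (em_alg B) (@em_rep R T G Cu B) g) (@em_U' R T G Cu B)).
split; [exact: sl | exact: sl | move=> k l].
by rewrite -(sl _ dc) (eberlein_hom eB df dg).
Qed.

End EmbeddedFacts.

Definition closed_algebra (S : set (op Hu)) :=
  [/\ S `<=` bop Hu, lclosed S, forall x y, S x -> S y -> S (x \o y) & norm_closure S `<=` S].

Definition contains_unital (S : set (op Hu)) := S id /\ forall B : embedded Cu, unital B -> em_alg B `<=` S.

Definition gen_alg : set (op Hu) := [set x | forall S, closed_algebra S -> contains_unital S -> S x].

Lemma gen_alg_min S : closed_algebra S -> contains_unital S -> gen_alg `<=` S.
Proof. by move=> cS lS x; apply. Qed.

Lemma gen_alg_large : contains_unital gen_alg.
Proof. by split=> [S _ []//|B uB b Bb S _ [_ h]]; exact: (h B uB). Qed.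

Lemma gen_alg_mult : gen_alg `<=` M.
Proof.
apply: gen_alg_min; last by split=> // B _; exact: em_mult.
by split; [exact: (cstar_bop cM) | exact: (cstar_linear cM) | exact: (cstar_mul cM) | exact: (cstar_closed cM)].
Qed.

Lemma gen_alg_closed : closed_algebra gen_alg.
Proof.
split.
- by move=> x /gen_alg_mult[].
- by move=> a x y hx hy S cS lS; have [_ h _ _] := cS; apply: h; [exact: hx | exact: hy].
- by move=> x y hx hy S cS lS; have [_ _ h _] := cS; apply: h; [exact: hx | exact: hy].
- move=> x hx S cS lS; have [_ _ _ h] := cS; apply: h; move: hx; apply: nc_mono.
  exact: gen_alg_min.
Qed.

(** The bounded operators whose adjoint is in [gen_alg] form a closed algebra that contains the
    generators, as each embedded algebra is self-adjoint; minimality does the rest. *)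
Lemma gen_alg_cstar : cstar_algebra gen_alg.
Proof.
have [Ab Al Am Ac] := gen_alg_closed; have [A1 AB] := gen_alg_large.
have A00 : gen_alg (0 : op Hu) by rewrite -[0](subrr (id : op Hu)) addrC -scaleN1r; exact: Al.
split=> //.
suff : gen_alg `<=` [set x | bop Hu x /\ gen_alg (adj x)] by move=> h x /h[].
apply: gen_alg_min.
  split.
  - by move=> x [].
  - by move=> a x y [bx hx] [bY hy]; split; [exact: bop_lcomb | rewrite adj_lcomb //; exact: Al].
  - by move=> x y [bx hx] [bY hy]; split; [exact: bop_comp | rewrite adj_comp //; exact: Am].
  - move=> x hx; split; first exact: nc_bop hx.
    apply: Ac; apply: (nc_adj (S := [set x | bop Hu x /\ gen_alg (adj x)])) hx => [y []//|y [bY hy]].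
    by apply: nc_sub.
split; first by split; [exact: bop_id | rewrite adj_id].
move=> B uB b Bb; split; first exact: Ab (AB B uB _ Bb).
apply: (AB B uB); exact: (cstar_adj (em_cstar B)).
Qed.

(** Summands are indexed by sets of operators on the fixed space [Hu]: the corepresentations
    themselves range over all Hilbert spaces and are too many to index a direct sum. *)
Lemma universal_corep : exists (K : hilbert R) (U : op (Hu ** K)), corep_in gen_alg U /\
  forall (K' : hilbert R) (V : op (Hu ** K')), corep_in gen_alg V -> coefs V `<=` coefs U.
Proof.
have [Ab Al Am Ac] := gen_alg_closed; have [A1 _] := gen_alg_large.
pose crep := {K : hilbert R & op (Hu ** K)}.
(* A set that is not a set of coefficients receives the trivial corepresentation, which is harmless
   as its coefficients are in [gen_alg]. *)
have ex (s : set (op Hu)) : exists c : crep, corep_in gen_alg (projT2 c) /\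
    ((exists c' : crep, corep_in gen_alg (projT2 c') /\ coefs (projT2 c') = s) -> coefs (projT2 c) = s).
  have [[c' [g e]]|n] := pselect (exists c' : crep, corep_in gen_alg (projT2 c') /\ coefs (projT2 c') = s).
    by exists c'.
  have [K [U [g _]]] := trivial_corep hD univ_comult_id Al A1.
  by exists (existT _ K U).
have [f hf] := choice ex.
have [K [U [gU hU]]] := dsum_corep cC0 cM hD Al Ac A1 (fun s => (hf s).1).
exists K, U; split=> // K' V gV _ [k [l ->]].
have e : coefs (projT2 (f (coefs V))) = coefs V.
  by apply: (hf _).2; exists (existT _ K' V).
have : coefs V (slice_r (vfun k l) V) by exists k, l.
rewrite -{1}e => -[k1 [l1 ->]].
by have [k2 [l2 <-]] := hU (coefs V) k1 l1; exists k2, l2.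
Qed.

(** A finite combination of coefficients is a single slice by a finite-sum functional. Families over
    ['I_n] become sequences through [insub], with 0 from [n] on. *)
Lemma lspan_coefs (K : hilbert R) (U : op (Hu ** K)) : bop _ U ->
  lspan (coefs U) `<=` [set slice_r w U | w in normal_fun K].
Proof.
move=> bU _ [n [a [s [hs ->]]]].
have [k hk] := choice hs; have [l hl] := choice hk.
pose x (m : nat) : K := if insub m is Some i then a i *: k i else 0.
pose y (m : nat) : K := if insub m is Some i then l i else 0.
exists (fsum n x y); first exact: normal_fsum.
rewrite slice_fsum //; apply: eq_bigr => i _; rewrite /x /y valK hl.
by rewrite -[a i *: k i]addr0 slice_r_sesql // (_ : slice_r (vfun 0 (l i)) U = 0) ?addr0 //;
  apply: bop_ext => u v; rewrite slice_rE // tn0r (lin0 (bop_lin bU)) -[(0 : op Hu) u]/0 !ip0l.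
Qed.

Lemma coefs_algebra (K : hilbert R) (U : op (Hu ** K)) : corep_in gen_alg U ->
  (forall (K' : hilbert R) (V : op (Hu ** K')), corep_in gen_alg V -> coefs V `<=` coefs U) ->
  norm_closure [set slice_r w U | w in normal_fun K] = gen_alg.
Proof.
move=> gU maxU; have [Ab Al Am Ac] := gen_alg_closed; have [A1 AB] := gen_alg_large.
have bU := corep_in_bop gU.
have cb : coefs U `<=` bop Hu by move=> _ [k [l ->]]; exact: bop_slice_r.
have lb := lspan_bop cb.
have -> : norm_closure [set slice_r w U | w in normal_fun K] = norm_closure (lspan (coefs U)).
  apply/seteqP; split; first exact: coefs_dense.
  by apply: nc_mono; exact: lspan_coefs.
apply/seteqP; split.
  apply: subset_trans _ Ac; apply: nc_mono; apply: lspan_ind => //.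
    by rewrite -[0](subrr (id : op Hu)) addrC -scaleN1r; exact: Al.
  by move=> _ [k [l ->]]; case: gU.
apply: gen_alg_min.
  split; [by move=> x [] | exact/nc_lin/lspan_lin | | exact: nc_idem].
  apply: nc_mul => // [|x y lx ly]; first exact: lspan_lin.
  apply: nc_sub => //; move: x lx; apply: lspan_elim => [|a x1 x2 h1 h2|_ [k [l ->]]].
  - exact: lspan0.
  - by rewrite (_ : _ \o _ = a *: (x1 \o y) + (x2 \o y)) //; exact: lspan_lin.
  - move: y ly; apply: lspan_elim => [|a y1 y2 h1 h2|_ [k' [l' ->]]].
    + rewrite (_ : _ \o _ = 0); first exact: lspan0.
      apply/funext => z /=; rewrite -[(0 : op Hu) z]/0.
      by rewrite (lin0 (bop_lin (bop_slice_r bU k l))).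
    + rewrite (_ : _ \o _ = a *: (slice_r (vfun k l) U \o y1) + (slice_r (vfun k l) U \o y2)).
        exact: lspan_lin.
      apply/funext => z /=; rewrite -[(_ + y2) z]/(a *: y1 z + y2 z).
      by rewrite (bop_lin (bop_slice_r bU k l)).
    (* A product of coefficients is a coefficient of the tensor square, which maximality of [U]
       turns into a coefficient of [U] itself. *)
    + have [W gW hW] := tensor_corep cC0 cM hD Al Ac A1 Am gU gU.
      by rewrite -hW; apply: lspan_in; apply: (maxU _ _ gW); exists (tn k k'), (tn l l').
split.
  have [K0 [U0 [g0 [k [l e]]]]] := trivial_corep hD univ_comult_id Al A1.
  by apply: nc_sub => //; apply: lspan_in; apply: (maxU _ _ g0); exists k, l.
move=> B uB; apply: subset_trans (@em_dense B) _; apply: nc_mono.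
apply: lspan_ind => [||s hs]; [exact: lspan0 | exact: lspan_lin | apply: lspan_in].
by move: hs; apply: maxU; apply: em_good; exact: AB.
Qed.

Lemma greatest_ex : exists A : embedded Cu, greatest_unital A.
Proof.
have [K [U [gU maxU]]] := universal_corep; have eA := coefs_algebra gU maxU.
have [Ab Al Am Ac] := gen_alg_closed; have [A1 AB] := gen_alg_large.
have bU := corep_in_bop gU; have U1 := unitary_bd (corep_in_unitary gU).
have cfU := corep_in_comult gU.
have [U2 gU2 U2E] := tensor_corep cC0 cM hD Al Ac A1 Am gU gU.
have bU2 := corep_in_bop gU2; have cfU2 := corep_in_comult gU2.
have [E [p up]] := universal_ex T Hu.
set A := norm_closure _ in eA.
have cA : cstar_algebra A by rewrite eA; exact: gen_alg_cstar.
have AM : A `<=` M by rewrite eA; exact: gen_alg_mult.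
have Aid : A id by rewrite eA.
have D1 := univ_comult_id.
have eb := eb_eberlein up cM M1 hD D1 bU U1 cfU cA AM Aid bU2 cfU2 U2E.
have bDc c : M c -> bop _ (D c) by exact: (star_hom_bop hD).
have restr f g : dual C0 f -> dual C0 g -> forall b, A b ->
    strict_ext (univ_conv f g) b = conv A p (ebPhi p D) (strict_ext f) (strict_ext g) b.
  move=> df dg b Ab'; have uR := C0u_universal Cu.
  have [x [y [ef _]]] := normal_extP uR df; have [x' [y' [eg _]]] := normal_extP uR dg.
  have cE c : M c -> univ_conv f g c = ip (D c (tn x x')) (tn y y').
    by move=> Mc; rewrite /univ_conv /conv ef eg ftens_vfun //; exact: bDc.
  have dc : dual C0 (univ_conv f g).
    apply/dualP; apply: (dualr_eq (f := fun c => ip (D c (tn x x')) (tn y y'))).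
    - exact: (cstar_linear cC0).
    - apply: (dualr_ip (c := 1)) => // [a c d Cc Cd|c r Cc r0 rc].
        by apply: (star_hom_linear hD); exact: multipliers_sub.
      by rewrite mul1r; apply: (mult_bd cM hD) => //; exact: multipliers_sub.
    - by move=> c Cc; rewrite cE //; exact: multipliers_sub.
  have [x2 [y2 [ec hc]]] := normal_extP uR dc.
  (* Both sides become vector functionals, of the identity representation on the left and of [D] on
     the right. They agree on [C_0^u(G)], and strict continuity carries this to multipliers. *)
  rewrite /strict_ext ec ef eg (eb_conv_vfun up cM M1 hD bU cfU cA AM Aid) //.
  apply: (strict_ext_unique cC0 hD C0u_nondegenerate univ_comult_total); last exact: AM.
  by move=> c Cc; rewrite -hc // cE //; exact: multipliers_sub.
have mU : multipliers (min_tensor C0 (compact_ops K)) U.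
  by apply: colmult_multipliers => //; [exact: corep_in_col gU | exact: corep_in_col' gU].
have cU : corepresentation D U.
  apply: (coef_comult_corep hD (corep_in_unitary gU)) => //.
  by move=> k l; apply/gen_alg_mult; exact: corep_in_coef gU k l.
pose AA := @Embedded R T G Cu K U A E p (ebPhi p D) (lam p U) mU cU erefl
  (fun w nw => lam_normal up bU nw) eb restr.
exists AA; split; first by exists id; split.
move=> B uB; have BA : em_alg B `<=` A by rewrite eA; exact: AB.
split=> // f g df dg b Bb.
have dB h : em_dual AA h -> em_dual B h.
  move=> /dualP[hl [c c0 hb]]; apply/dualP; split=> [a x y Bx By|]; first by apply: hl; exact: BA.
  by exists c => // x r Bx; apply: hb; exact: BA.
have [dc [Q [S [hQ hS hc]]]] := em_conv_coef uB (dB _ df) (dB _ dg).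
have [dA _ _] := eb_convP up cM M1 hD bU cfU cA AM Aid df dg.
have cB := em_cstar B.
have h1 : dualr (em_alg B) (em_conv AA f g) by exact/dualP/(dB _ dA).
have h2 : dualr (em_alg B) (em_conv B f g) by exact/dualP.
apply: (dualr_ext h1 h2 (S := coefs (@em_U R T G Cu B))) Bb.
- by move=> _ [k [l ->]]; exact: em_coef.
- exact: (cstar0 cB).
- exact: (cstar_linear cB).
- exact: em_dense.
(* On a coefficient of [B] both products are expressed by [Q] and [S], on the side of [A] through
   [eb_conv_corep]. *)
move=> _ [k [l ->]]; rewrite hc.
have AB' k' l' : A (slice_r (vfun k' l') (@em_U R T G Cu B)) by exact/BA/em_coef.
exact: (eb_conv_corep up cM M1 hD bU cfU cA AM Aid (em_bop B) (corep_in_comult (em_good BA)) AB' df dg hQ hS).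
Qed.

(** Two greatest algebras contain each other, and for equal algebras the morphism property of the
    inclusion is equality of the products. *)
Lemma greatest_unique (A A' : embedded Cu) : greatest_unital A -> greatest_unital A' ->
  em_alg A = em_alg A' /\ same_coproduct A A'.
Proof.
move=> [uA gA] [uA' gA']; have [AA' mA] := gA' A uA; have [A'A _] := gA A' uA'.
have e : em_alg A = em_alg A' by apply/seteqP; split.
split=> // a f g Aa df dg; symmetry; apply: mA => //; by rewrite /em_dual -e.
Qed.

End Main.

Theorem theorem5p1 (R : realType) (T : tensor_choice R) (G : lcqg T)
    (Cu : universal_lcqg G) :
  (exists A : embedded Cu, greatest_unital A) /\
  (forall A A' : embedded Cu, greatest_unital A -> greatest_unital A' ->
     em_alg A = em_alg A' /\ same_coproduct A A').
Proof.
by split; [exact: greatest_ex | exact: greatest_unique].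
Qed.
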